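(* Let $\xi$ be any Borel probability measure on $[0,\pi]$ other than the Dirac mass $\delta_0$ at $0$. Define $\sigma(\theta)=\sin\frac{\theta}{2}$ and $\xi(\sigma^2)=\int_{[0,\pi]}\sigma^2(\theta)\,d\xi(\theta)$. Then there exists a function $f:\mathbb{R}\to[0,1]$ with $\lim_{|c|\to\infty}f(c)=0$ such that, for every integer $n\ge 1$ and every real $c$ for which $$t=\frac{n(\log n+c)}{2\,\xi(\sigma^2)}$$ is a non-negative integer, the uniform plane Kac walk $P_\xi$ on $SO(2n+1)$ started at the identity satisfies $$\Bigl|\,\bigl\|\delta_{\mathrm{Id}}\cdot P_\xi^t-\nu\bigr\|_{\mathrm{TV}}-\mathbf{1}(c<0)\Bigr|\le f(c).$$ (The function $f$ does not depend on $n$.)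
   Context: $\nu$ denotes the Haar probability measure on $SO(2n+1)$. For $\theta\in[0,\pi]$, $R(1,2;\theta)\in SO(2n+1)$ is the block diagonal matrix with upper left $2\times 2$ block $\begin{pmatrix}\cos\theta&-\sin\theta\\ \sin\theta&\cos\theta\end{pmatrix}$ and lower right block $I_{2n-1}$. The transition kernel is $$P_\xi f(X)=\int_{[0,\pi]}\int_{SO(2n+1)}f\bigl(U R(1,2;\theta)U^{-1}X\bigr)\,d\nu(U)\,d\xi(\theta).$$ $\delta_{\mathrm{Id}}\cdot P_\xi^t$ is the law of the corresponding Markov chain after $t$ steps started at the identity, i.e. the $t$-fold convolution power of the law of $UR(1,2;\theta)U^{-1}$ with $U\sim\nu$, $\theta\sim\xi$ independent. The total variation distance between Borel probability measures is $\|\mu-\nu\|_{\mathrm{TV}}=\sup_{B}(\mu(B)-\nu(B))$, the supremum over Borel sets $B$. $\mathbf 1(c<0)$ is $1$ if $c<0$ and $0$ otherwise. *)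

(* Defs.v *)
From HB Require Import structures.
From mathcomp Require Import all_boot all_order all_algebra.
From mathcomp Require Import all_classical all_reals all_analysis.
Set Implicit Arguments.
Unset Strict Implicit.
Unset Printing Implicit Defensive.
Import Order.TTheory GRing.Theory Num.Theory.
Import numFieldNormedType.Exports.
Local Open Scope classical_set_scope.
Local Open Scope ring_scope.

Definition special_orthogonal (R : realType) (m : nat) : pred 'M[R]_m :=
  fun A => (A *m A^T == 1%:M) && (\det A == 1).

Record SO (R : realType) (m : nat) : Type := MkSO {
  SO_mx :> 'M[R]_m ;
  SO_mxP : special_orthogonal SO_mx }.

HB.instance Definition _ (R : realType) (m : nat) := [isSub for @SO_mx R m].
HB.instance Definition _ (R : realType) (m : nat) := [Choice of SO R m by <:].

Section SO_group.
Context (R : realType) (m : nat).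
Implicit Types A B C : SO R m.

Lemma special_orthogonal1 : special_orthogonal (1%:M : 'M[R]_m).
Proof. by rewrite /special_orthogonal trmx1 mulmx1 det1 !eqxx. Qed.

Lemma special_orthogonalM A B : special_orthogonal (A *m B).
Proof.
case: A B => [A /andP[/eqP AA /eqP dA]] [B /andP[/eqP BB /eqP dB]] /=.
rewrite /special_orthogonal trmx_mul mulmxA -(mulmxA A B) BB mulmx1 AA.
by rewrite det_mulmx dA dB mulr1 !eqxx.
Qed.

Lemma special_orthogonalV A : special_orthogonal A^T.
Proof.
case: A => [A /andP[/eqP AA /eqP dA]] /=.
by rewrite /special_orthogonal trmxK det_tr dA (mulmx1C AA) !eqxx.
Qed.

Definition SO_one : SO R m := MkSO special_orthogonal1.
Definition SO_mul A B : SO R m := MkSO (special_orthogonalM A B).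
Definition SO_inv A : SO R m := MkSO (special_orthogonalV A).

Lemma SO_mulA : associative SO_mul.
Proof. by move=> A B C; apply: val_inj => /=; rewrite mulmxA. Qed.

Lemma SO_mul1 : left_id SO_one SO_mul.
Proof. by move=> A; apply: val_inj => /=; rewrite mul1mx. Qed.

Lemma SO_mulr1 : right_id SO_one SO_mul.
Proof. by move=> A; apply: val_inj => /=; rewrite mulmx1. Qed.

Lemma SO_mulV : left_inverse SO_one SO_inv SO_mul.
Proof.
move=> A; apply: val_inj => /=; apply: mulmx1C.
by case: A => A /= /andP[/eqP].
Qed.

Lemma SO_mulrV : right_inverse SO_one SO_inv SO_mul.
Proof. by move=> A; apply: val_inj => /=; case: A => A /= /andP[/eqP]. Qed.

HB.instance Definition _ := isGroup.Build (SO R m)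
  SO_mulA SO_mul1 SO_mulr1 SO_mulV SO_mulrV.

(* subspace topology inherited from the matrices *)
HB.instance Definition _ := isPointed.Build (SO R m) SO_one.
HB.instance Definition _ :=
  Topological.copy (SO R m) (initial_topology (@SO_mx R m)).
HB.instance Definition _ := Measurable.copy (SO R m)
  (g_sigma_algebraType (@open (SO R m))).

End SO_group.

Section uniform_plane_Kac_walk.
Context (R : realType).

(* On a compact group a left-invariant Borel probability measure is unique,
   and is also right-invariant. *)
Definition is_haar (m : nat) (nu : probability (SO R m) R) : Prop :=
  forall (g : SO R m) (B : set (SO R m)), measurable B ->
    nu [set (g * x)%g | x in B] = nu B.

Definition rot2 (theta : R) : 'M[R]_2 :=
  \matrix_(i < 2, j < 2)
    if i == j then cos theta
    else if (i < j)%N then - sin theta else sin theta.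

Definition rot12_mx (k : nat) (theta : R) : 'M[R]_(2 + k) :=
  block_mx (rot2 theta) 0 0 1%:M.

Lemma rot2_orthogonal theta : rot2 theta *m (rot2 theta)^T = 1%:M.
Proof.
apply/matrixP => i j; rewrite !mxE !big_ord_recl big_ord0 !mxE.
case: i => [[|[|//]] ?]; case: j => [[|[|//]] ?]; rewrite /= /bump /= ?addr0.
- by rewrite mulrNN -!expr2 cos2Dsin2.
- by rewrite [X in _ + X]mulrC mulrN mulrC addrN.
- by rewrite mulrN [X in _ - X]mulrC addrN.
- by rewrite -!expr2 addrC cos2Dsin2.
Qed.

Lemma rot12_special_orthogonal k theta : special_orthogonal (rot12_mx k theta).
Proof.
rewrite /special_orthogonal /rot12_mx tr_block_mx mulmx_block !trmx0 trmx1.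
rewrite !mul0mx !mulmx0 !mulmx1 !addr0 !add0r rot2_orthogonal -scalar_mx_block.
rewrite eqxx /= det_ublock det1 mulr1 (expand_det_row _ ord0) !big_ord_recl big_ord0.
rewrite /cofactor !det_mx11 !mxE /= addr0 expr0 expr1 mul1r mulN1r mulrNN.
by rewrite -!expr2 cos2Dsin2.
Qed.

(* R(1,2;theta) in SO(2n+1).  SO(1) is trivial, so n = 0 gets the identity;
   for n = k.+1 the dimension 2n+1 is convertible to 2 + (2k+1). *)
Definition rot12 (n : nat) (theta : R) : SO R n.*2.+1 :=
  match n return SO R n.*2.+1 with
  | 0 => SO_one R 1
  | k.+1 => @MkSO R k.+1.*2.+1 (rot12_mx k.*2.+1 theta)
              (rot12_special_orthogonal k.*2.+1 theta)
  end.

Local Open Scope ereal_scope.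

Definition kac_kernel (n : nat) (nu : probability (SO R n.*2.+1) R)
    (xi : probability (measurableTypeR R) R)
    (f : SO R n.*2.+1 -> \bar R) (X : SO R n.*2.+1) : \bar R :=
  \int[xi]_(theta in `[0%R, pi])
    \int[nu]_U f (U * rot12 n theta * U^-1 * X)%g.

(* (delta_Id . P^t)(B) = (P^t 1_B)(Id) *)
Definition kac_law (n : nat) (nu : probability (SO R n.*2.+1) R)
    (xi : probability (measurableTypeR R) R) (t : nat)
    (B : set (SO R n.*2.+1)) : \bar R :=
  iter t (kac_kernel nu xi) (EFin \o \1_B) 1%g.

Definition tv_distance (d : measure_display) (T : measurableType d)
    (mu nu : set T -> \bar R) : \bar R :=
  ereal_sup [set mu B - nu B | B in measurable].

Definition xi_sigma2 (xi : probability (measurableTypeR R) R) : R :=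
  (\int[xi]_(theta in `[0%R, pi]) (sin (theta / 2) ^+ 2))%R.

End uniform_plane_Kac_walk.

(* Main.v *)
Require Import Defs.
From HB Require Import structures.
From mathcomp Require Import all_boot all_order all_algebra fingroup perm.
From mathcomp Require Import all_classical all_reals all_analysis.
From mathcomp Require Import measurable_realfun ring lra zify complex.
Set Implicit Arguments.
Unset Strict Implicit.
Unset Printing Implicit Defensive.
Import Order.TTheory GRing.Theory Num.Theory.
Import numFieldNormedType.Exports.
Local Open Scope classical_set_scope.
Local Open Scope ring_scope.

(** Upper bound. The elementary symmetric functions of the eigenvalues span the polynomial class
    functions; ordering their monomials by top torus weight makes every convolution operator [h]
    triangular, with diagonal entry [phi m h] the mean of a product of principal minors. For a
    rotation by [t], |phi m| <= lap m ^ sin(t/2)^2, where [lap m = E exp(-2 sum_h m_h X_h)] involves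
    two columns of a Haar matrix. The degree of the representation of highest weight [m] is bounded
    by counting minors and permanents, and a comparison with [lap m] gives
    ln (degree) <= (ln n + C) (n/2) (- ln (lap m)); summing over [m] yields an L2 bound, exponentially
    small in the excess of the sum of the sin(t_i/2)^2 over (n/2) ln n, for every product of
    conjugacy classes. Indicators are L2 limits of polynomials, which turns this into a total
    variation bound, and the angles are integrated out through their Laplace transform.
    Lower bound. The trace is an eigenfunction of the walk and its second moment stays bounded by
    its squared mean plus a constant, so Chebyshev's inequality separates the two laws. *)

(** * Expectations of bounded measurable functions *)

(** The coefficient of [ln n] leaves no room. A box of the diagram of [m] costs about [ln n] in the
    logarithm of the degree and gains about 1 in [g = (n/2) (- ln (lap m))], so the comparison is
    tight to leading order; only errors of order [g], free of [ln n], are affordable. A crude bound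
    [g >= const * n * Gam m], where [Gam m] is the sum of [ln (1 + l_i / n)] over the row lengths,
    absorbs all costs of order [n * Gam m]. Where [ln n] is really paid the gain has to be nearly
    sharp: either the whole diagram is small and two moments of the gain suffice, or the expensive
    boxes lie in columns of moderate height, where they cost at most 2/3 of [ln n] and gain 7/10
    each. The dependence between the entries of a Haar matrix is handled by Stein identities, which
    bound Laplace transforms of its columns by Gaussian ones. The degree enters through an
    inequality between the trace and the Hilbert-Schmidt norm of a kernel of finite rank, so it is
    enough to count a spanning family. The L2 bound sees the angles only through the sum of
    [sin(t/2)^2], which is why they can be integrated out last. *)

Section bounded_measurable.
Context {d} {T : measurableType d} {R : realType}.
Implicit Types (f g : T -> R) (P : probability T R).

Definition bm f := measurable_fun setT f /\ exists M : R, forall x, `|f x| <= M.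

Definition Ex P f : R := Rintegral P setT f.

Lemma bm_cst (c : R) : bm (fun=> c).
Proof. by split; [exact: measurable_cst | exists `|c|]. Qed.

Lemma bmD f g : bm f -> bm g -> bm (fun x => f x + g x).
Proof.
move=> [mf [M fM]] [mg [L gL]]; split; first exact: measurable_funD.
by exists (M + L) => x; rewrite (le_trans (ler_normD _ _))// lerD.
Qed.

Lemma bmM f g : bm f -> bm g -> bm (fun x => f x * g x).
Proof.
move=> [mf [M fM]] [mg [L gL]]; split; first exact: measurable_funM.
by exists (M * L) => x; rewrite normrM ler_pM.
Qed.

Lemma bmN f : bm f -> bm (fun x => - f x).
Proof.
move=> bf; have := bmM (bm_cst (-1)) bf.
by under eq_fun do rewrite mulN1r.
Qed.

Lemma bmB f g : bm f -> bm g -> bm (fun x => f x - g x).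
Proof. by move=> bf bg; exact: bmD bf (bmN bg). Qed.

Lemma bm_sum (I : Type) (r : seq I) (p : pred I) (F : I -> T -> R) :
  (forall i, p i -> bm (F i)) -> bm (fun x => \sum_(i <- r | p i) F i x).
Proof.
move=> bF; elim: r => [|i r IH].
  by under eq_fun do rewrite big_nil; exact: bm_cst.
under eq_fun do rewrite big_cons.
by case pi : (p i) => //; apply: bmD => //; exact: bF.
Qed.

Lemma bm_prod (I : Type) (r : seq I) (p : pred I) (F : I -> T -> R) :
  (forall i, p i -> bm (F i)) -> bm (fun x => \prod_(i <- r | p i) F i x).
Proof.
move=> bF; elim: r => [|i r IH].
  by under eq_fun do rewrite big_nil; exact: bm_cst.
under eq_fun do rewrite big_cons.
by case pi : (p i) => //; apply: bmM => //; exact: bF.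
Qed.

Lemma bmX f n : bm f -> bm (fun x => f x ^+ n).
Proof.
move=> bf; have := @bm_prod nat (index_iota 0 n) predT (fun=> f) (fun _ _ => bf).
by under eq_fun do rewrite prodr_const_nat subn0.
Qed.

Lemma bm_indic (A : set T) : measurable A -> bm (\1_A : T -> R).
Proof.
move=> mA; split; first exact: measurable_indic.
by exists 1 => x; rewrite indicE; case: (_ \in _); rewrite ?normr0 ?normr1.
Qed.

Lemma bm_integrable P f : bm f -> P.-integrable setT (EFin \o f).
Proof.
move=> [mf [M fM]]; apply: measurable_bounded_integrable => //.
  by apply: le_lt_trans (ltry 1); rewrite -(probability_setT P).
by exists M; split; [exact: num_real | move=> y My x _; exact: le_trans (fM x) (ltW My)].
Qed.

Lemma Ex_EFin P f : bm f -> (\int[P]_x (f x)%:E)%E = (Ex P f)%:E.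
Proof.
by move=> bf; rewrite /Ex /Rintegral fineK//; exact: integrable_fin_num (bm_integrable P bf).
Qed.

Lemma Ex_cst P (c : R) : Ex P (fun=> c) = c.
Proof. rewrite /Ex Rintegral_cst//; transitivity (c * fine (1 : \bar R)); last by rewrite mulr1.
by congr (_ * fine _); exact: probability_setT. Qed.

Lemma ExD P f g : bm f -> bm g -> Ex P (fun x => f x + g x) = Ex P f + Ex P g.
Proof. by move=> bf bg; apply: RintegralD => //; exact: bm_integrable. Qed.

Lemma ExZ P (c : R) f : bm f -> Ex P (fun x => c * f x) = c * Ex P f.
Proof. by move=> bf; apply: RintegralZl => //; exact: bm_integrable. Qed.

Lemma ExN P f : bm f -> Ex P (fun x => - f x) = - Ex P f.
Proof.
by move=> bf; rewrite -mulN1r -ExZ//; congr Ex; apply/funext => x; rewrite mulN1r.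
Qed.

Lemma ExB P f g : bm f -> bm g -> Ex P (fun x => f x - g x) = Ex P f - Ex P g.
Proof. by move=> bf bg; rewrite ExD ?ExN//; exact: bmN. Qed.

Lemma Ex_sum P (I : Type) (r : seq I) (p : pred I) (F : I -> T -> R) :
  (forall i, p i -> bm (F i)) ->
  Ex P (fun x => \sum_(i <- r | p i) F i x) = \sum_(i <- r | p i) Ex P (F i).
Proof.
move=> bF; elim: r => [|i r IH].
  by under eq_fun do rewrite big_nil; rewrite Ex_cst big_nil.
under eq_fun do rewrite big_cons; rewrite big_cons.
case pi : (p i) => //; rewrite ExD ?IH//; first exact: bF.
exact: bm_sum.
Qed.

Lemma Ex_ge0 P f : (forall x, 0 <= f x) -> 0 <= Ex P f.
Proof. by move=> f0; apply: Rintegral_ge0. Qed.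

Lemma Ex_le P f g : bm f -> bm g -> (forall x, f x <= g x) -> Ex P f <= Ex P g.
Proof.
move=> bf bg fg; rewrite -subr_ge0 -ExB//; apply: Ex_ge0 => x.
by rewrite subr_ge0.
Qed.

Lemma bm_norm f : bm f -> bm (fun x => `|f x|).
Proof.
move=> [mf [M fM]]; split; first exact: measurableT_comp.
by exists M => x; rewrite normr_id.
Qed.

Lemma Ex_norm P f : bm f -> `|Ex P f| <= Ex P (fun x => `|f x|).
Proof.
move=> bf; rewrite ler_norml; apply/andP; split.
  rewrite -ExN; last exact: bm_norm.
  apply: Ex_le => //; first exact: bmN (bm_norm bf).
  by move=> x; rewrite lerNl -normrN; exact: ler_norm.
by apply: Ex_le => //; [exact: bm_norm | move=> x; exact: ler_norm].
Qed.

Lemma Ex_indic P (A : set T) : measurable A -> Ex P (\1_A) = fine (P A).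
Proof. by move=> mA; rewrite /Ex /Rintegral integral_indic// setIT. Qed.

Lemma Ex_cvg P (F : nat -> T -> R) f (M : R) :
  (forall n, measurable_fun setT (F n)) ->
  (forall n x, `|F n x| <= M) ->
  (forall x, F n x @[n --> \oo] --> f x) ->
  [/\ bm f & Ex P (F n) @[n --> \oo] --> Ex P f].
Proof.
move=> mF FM Ff.
have mf : measurable_fun setT f.
  by apply: (measurable_fun_cvg (h := F)) => // x _; exact: Ff.
have bf : bm f.
  split => //; exists M => x.
  have Fx := cvg_norm (Ff x); rewrite -(cvg_lim _ (Fx _))//.
  apply: limr_le; first by apply/cvg_ex; exists (`|f x|); exact: Fx.
  by apply: nearW => n; exact: FM.
split => //.
have [|||||_ _] := @dominated_convergence _ T R P setT measurableT
  (fun n => EFin \o F n) (EFin \o f) (fun=> M%:E).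
- by move=> n; exact/measurable_EFinP.
- exact/measurable_EFinP.
- by apply: aeW => x _; apply: cvg_EFin; [exact: nearW|exact: Ff].
- exact: bm_integrable (bm_cst M).
- by apply: aeW => x n _ /=; rewrite lee_fin.
rewrite Ex_EFin// => /fine_cvg h; apply: cvg_trans h; apply: near_eq_cvg.
by apply: nearW => n.
Qed.

(** Cauchy-Schwarz by the discriminant: the quadratic form in [s], [t] given by the mean of
    [(s f + t g)^2] is nonnegative. *)
Lemma Ex_sqr_le P f g : bm f -> bm g ->
  (Ex P (fun x => f x * g x)) ^+ 2 <= Ex P (fun x => f x ^+ 2) * Ex P (fun x => g x ^+ 2).
Proof.
move=> bf bg; set b := Ex P _; set a := Ex P _; set c := Ex P _.
have H (s t : R) : 0 <= s ^+ 2 * a + 2 * s * t * b + t ^+ 2 * c.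
  have -> : s ^+ 2 * a + 2 * s * t * b + t ^+ 2 * c =
     Ex P (fun x => (s * f x + t * g x) ^+ 2).
    rewrite (_ : (fun x => _) = (fun x => s ^+ 2 * f x ^+ 2 +
        (2 * s * t * (f x * g x) + t ^+ 2 * g x ^+ 2))); last first.
      by apply/funext => x; ring.
    have bff := bmX 2 bf; have bgg := bmX 2 bg; have bfg := bmM bf bg.
    have bZ (k : R) h : bm h -> bm (fun x => k * h x) by move=> bh; apply: bmM => //; exact: bm_cst.
    rewrite ExD ?ExZ//; [|exact: bZ|by apply: bmD; exact: bZ].
    by rewrite ExD ?ExZ// ?addrA//; exact: bZ.
  by apply: Ex_ge0 => x; exact: sqr_ge0.
have a0 : 0 <= a by apply: Ex_ge0 => x; exact: sqr_ge0.
have c0 : 0 <= c by apply: Ex_ge0 => x; exact: sqr_ge0.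
have [a_eq0|a_neq0] := eqVneq a 0.
  rewrite a_eq0 mul0r leNgt; apply/negP => b2p.
  (* With [a = 0] the form is affine in [s]; this choice of [s] gives it the negative value
     [- c - 2]. *)
  have := H ((c + 1) / b) (-1); rewrite a_eq0 mulr0 add0r.
  have b0 : b != 0 by apply: contraTneq b2p => ->; rewrite expr0n ltxx.
  have -> : 2 * ((c + 1) / b) * -1 * b + (-1) ^+ 2 * c = - c - 2 by field.
  by move=> ?; lra.
have apos : 0 < a by rewrite lt_def a_neq0.
have := H b (- a).
have -> : b ^+ 2 * a + 2 * b * - a * b + (- a) ^+ 2 * c = a * (a * c - b ^+ 2) by ring.
by rewrite pmulr_rge0// subr_ge0.
Qed.

End bounded_measurable.

Section fubini_bm.
Context {d1 d2} {T1 : measurableType d1} {T2 : measurableType d2} {R : realType}.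
Variables (P : probability T1 R) (Q : probability T2 R).

Lemma prod_integrable (F : T1 * T2 -> R) : bm F ->
  (P \x Q)%E.-integrable setT (EFin \o F).
Proof.
move=> [mF [M FM]]; apply: measurable_bounded_integrable => //.
  have := product_measure1E P Q measurableT measurableT; rewrite setXTT => h.
  apply: (@le_lt_trans _ _ (1 * 1)%E); last by rewrite mule1 ltry.
  by rewrite [leLHS]h; apply: lee_pmul => //; exact: probability_le1.
by exists M; split; [exact: num_real | move=> y My x _; exact: le_trans (FM x) (ltW My)].
Qed.

Lemma bm_pair1 (F : T1 * T2 -> R) x : bm F -> bm (fun y => F (x, y)).
Proof.
move=> [mF [M FM]]; split; last by exists M => y; exact: FM.
exact: measurableT_comp mF (measurable_pair1 x).
Qed.

Lemma bm_pair2 (F : T1 * T2 -> R) y : bm F -> bm (fun x => F (x, y)).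
Proof.
move=> [mF [M FM]]; split; last by exists M => x; exact: FM.
exact: measurableT_comp mF (measurable_pair2 y).
Qed.

Lemma Ex_bound d (T : measurableType d) (P0 : probability T R) (f : T -> R) M :
  bm f -> (forall x, `|f x| <= M) -> `|Ex P0 f| <= M.
Proof.
move=> bf fM; apply: (le_trans (Ex_norm P0 bf)).
rewrite -[leRHS](Ex_cst P0); apply: Ex_le => //; [exact: bm_norm|exact: bm_cst].
Qed.

Lemma bm_Ex1 (F : T1 * T2 -> R) : bm F -> bm (fun x => Ex Q (fun y => F (x, y))).
Proof.
move=> bF; split; last first.
  have [_ [M FM]] := bF; exists M => x; apply: Ex_bound => //; exact: bm_pair1.
have := measurable_fubini_F (prod_integrable bF); rewrite /fubini_F => h.
apply/measurable_EFinP; apply: eq_measurable_fun h => x _ /=.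
by rewrite Ex_EFin//; exact: bm_pair1.
Qed.

Lemma bm_Ex2 (F : T1 * T2 -> R) : bm F -> bm (fun y => Ex P (fun x => F (x, y))).
Proof.
move=> bF; split; last first.
  have [_ [M FM]] := bF; exists M => x; apply: Ex_bound => //; exact: bm_pair2.
have := measurable_fubini_G (prod_integrable bF); rewrite /fubini_G => h.
apply/measurable_EFinP; apply: eq_measurable_fun h => x _ /=.
by rewrite Ex_EFin//; exact: bm_pair2.
Qed.

Lemma Ex_swap (F : T1 * T2 -> R) : bm F ->
  Ex P (fun x => Ex Q (fun y => F (x, y))) = Ex Q (fun y => Ex P (fun x => F (x, y))).
Proof.
move=> bF; have := Fubini (prod_integrable bF).
have e1 x : (\int[Q]_y (EFin \o F) (x, y) = (Ex Q (fun y => F (x, y)))%:E)%E.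
  by rewrite -Ex_EFin//; exact: bm_pair1.
have e2 y : (\int[P]_x (EFin \o F) (x, y) = (Ex P (fun x => F (x, y)))%:E)%E.
  by rewrite -(Ex_EFin _ (bm_pair2 y bF)).
under eq_integral do rewrite e1.
under [in X in _ = X -> _]eq_integral do rewrite e2.
by rewrite !Ex_EFin//; [case|exact: bm_Ex2|exact: bm_Ex1].
Qed.

End fubini_bm.

(** * Borel structure of SO(m) and invariance of Haar expectations *)

Section SO_measurable.
Context {R : realType} {m : nat}.
Local Notation G := (SO R m).

Lemma measurable_entry i j : measurable_fun setT (fun U : G => SO_mx U i j).
Proof.
apply: (measurability _ (RGenOInfty.measurableE R)) => //.
move=> _ [_ [a ->] <-]; rewrite setTI; apply: sub_sigma_algebra.
have : continuous (fun U : G => SO_mx U i j).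
  move=> U; apply: (@continuous_comp _ _ _ (@SO_mx R m) (fun M : 'M[R]_m => M i j)).
    exact: initial_continuous.
  exact: coord_continuous.
by move=> /continuousP; apply; exact: interval_open.
Qed.

Lemma bm_entry i j : bm (fun U : G => SO_mx U i j).
Proof.
split; first exact: measurable_entry.
exists 1 => U; case: U => U /= /andP[/eqP UU _].
have /matrixP/(_ i i) := UU; rewrite !mxE eqxx => rU.
rewrite -(@ler_pXn2r _ 2)// ?nnegrE// expr1n real_normK ?num_real//.
rewrite -[leRHS]rU (bigD1 j)//= mxE -expr2 lerDl sumr_ge0// => k _.
by rewrite mxE -expr2 sqr_ge0.
Qed.

(** An open set of matrices is the union of the boxes with rational centre and radius that it
    contains, a countable union; the preimage of a box is a finite intersection of conditions on
    entries. *)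
Lemma measurable_SO d (T : measurableType d) (F : T -> G) :
  (forall i j, measurable_fun setT (fun t => SO_mx (F t) i j)) ->
  measurable_fun setT F.
Proof.
move=> mF; apply: (measurability _ (erefl : @measurable _ G = <<s @open G >>)).
move=> _ [V [W oW <-] <-]; rewrite setTI.
pose box (p : 'M[rat]_m * rat) : set 'M[R]_m :=
  [set A | forall i j, `|A i j - ratr (p.1 i j)| < ratr p.2].
have -> : F @^-1` ((@SO_mx R m) @^-1` W) =
    \bigcup_(p in [set p | box p `<=` W]) (F @^-1` ((@SO_mx R m) @^-1` box p)).
  apply/seteqP; split=> [t Ot|t [p pW] bt]; last exact: pW.
  have /nbhs_ballP[e /= e0 eW] := open_nbhs_nbhs (conj oW Ot).
  have [r r0 re] : exists2 r : rat, 0 < ratr r :> R & ratr r < e / 2.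
    by have [|q /itvP qe] := @rat_in_itvoo R 0 (e / 2); [lra|exists q; rewrite qe].
  pose q i j := xget 0 [set q : rat | `|SO_mx (F t) i j - ratr q| < ratr r].
  have qP i j : `|SO_mx (F t) i j - ratr (q i j)| < ratr r.
    apply: (@xgetPex _ 0 [set q : rat | `|SO_mx (F t) i j - ratr q| < ratr r]).
    have [|s /itvP se] := @rat_in_itvoo R (SO_mx (F t) i j - ratr r) (SO_mx (F t) i j + ratr r).
      lra.
    by exists s => /=; rewrite distrC ltr_distl se//= se.
  exists (\matrix_(i, j) q i j, r); last by move=> i j /=; rewrite mxE.
  move=> A /= bA; apply: eW; split => // i j.
  rewrite /ball /=; have := qP i j; have := bA i j; rewrite mxE => h1 h2.
  rewrite (_ : _ - _ = (SO_mx (F t) i j - ratr (q i j)) - (A i j - ratr (q i j))); last by ring.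
  by rewrite (le_lt_trans (ler_normB _ _))//; lra.
(* Rewrites a union over a set of rational boxes as a union over the whole countable type, with
   empty terms outside the set. *)
have -> : forall (S : set ('M[rat]_m * rat)) (H : 'M[rat]_m * rat -> set T), \bigcup_(p in S) H p =
    \bigcup_p (if p \in S then H p else set0).
  move=> S H; apply/seteqP; split=> [t [p Sp Hp]|t [p _]].
    by exists p => //; rewrite mem_set.
  by case: ifPn => // pS Hp; exists p => //; rewrite inE in pS.
apply: countable_bigcupT_measurable => [|p].
  exact: countableP.
case: ifP => // _.
rewrite (_ : _ @^-1` _ = \bigcap_(ij in [set: 'I_m * 'I_m])
   [set t | `|SO_mx (F t) ij.1 ij.2 - ratr (p.1 ij.1 ij.2)| < ratr p.2]); last first.
  apply/seteqP; split=> [t bt ij _|t bt i j]; first exact: bt.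
  exact: (bt (i, j)).
apply: fin_bigcap_measurable => // ij _.
have mh : measurable_fun setT (fun t => `|SO_mx (F t) ij.1 ij.2 - ratr (p.1 ij.1 ij.2)|).
  by apply: measurableT_comp => //; apply: measurable_funB; [exact: mF|exact: measurable_cst].
rewrite (_ : [set t | _] = setT `&` (fun t => `|SO_mx (F t) ij.1 ij.2 - ratr (p.1 ij.1 ij.2)|)
   @^-1` [set` `]-oo, ratr p.2[]); last first.
  by rewrite setTI; apply/seteqP; split=> t /=; rewrite in_itv.
exact: mh.
Qed.

End SO_measurable.

Section haar.
Context {R : realType} {m : nat}.
Local Notation G := (SO R m).

Lemma SO_mxM (a b : G) : SO_mx (a * b)%g = SO_mx a *m SO_mx b.
Proof. by []. Qed.

Lemma SO_mxV (a : G) : SO_mx a^-1%g = (SO_mx a)^T.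
Proof. by []. Qed.

Lemma measurable_mul d (T : measurableType d) (F H : T -> G) :
  measurable_fun setT F -> measurable_fun setT H ->
  measurable_fun setT (fun t => F t * H t)%g.
Proof.
move=> mF mH; apply: measurable_SO => i j.
under eq_fun do rewrite SO_mxM mxE.
apply: measurable_sum => k; apply: measurable_funM.
  exact: (measurableT_comp (measurable_entry i k)).
exact: (measurableT_comp (measurable_entry k j)).
Qed.

Lemma measurable_inv d (T : measurableType d) (F : T -> G) :
  measurable_fun setT F -> measurable_fun setT (fun t => (F t)^-1)%g.
Proof.
move=> mF; apply: measurable_SO => i j.
under eq_fun do rewrite SO_mxV mxE.
exact: (measurableT_comp (measurable_entry j i)).
Qed.

Lemma bm_comp d (T : measurableType d) d' (T' : measurableType d') (f : T' -> R) (F : T -> T') :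
  bm f -> measurable_fun setT F -> bm (fun t => f (F t)).
Proof.
move=> [mf [M fM]] mF; split; first exact: measurableT_comp.
by exists M.
Qed.

Context (nu : probability G R) (nuH : is_haar nu).

Lemma Ex_mull g f : bm f -> Ex nu (fun U => f (g * U)%g) = Ex nu f.
Proof.
move=> bf; pose phi (U : G) : G := (g * U)%g.
have mphi : measurable_fun setT phi.
  by apply: measurable_mul; [exact: measurable_cst|exact: measurable_id].
rewrite /Ex /Rintegral; congr fine.
transitivity (\int[pushforward nu phi]_x (f x)%:E)%E.
  rewrite integral_pushforward ?setTI//; last exact: bm_integrable (bm_comp bf mphi).
  by apply/measurable_EFinP; case: bf.
apply: eq_measure_integral => A mA _.
rewrite /pushforward /= -[RHS](nuH g^-1%g mA); congr (nu _).
apply/seteqP; split=> [x Ax|_ [x Ax <-]].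
  by exists (phi x) => //; rewrite /phi mulKg.
by rewrite /preimage /= /phi mulgA mulgV mul1g.
Qed.

Lemma measurable_fst_mul_snd : measurable_fun setT (fun p : G * G => p.1^-1 * p.2)%g.
Proof. by apply: measurable_mul => //; exact: measurable_inv. Qed.

(** The mean of [f (x^-1 y)] over two independent Haar elements is computed in both orders:
    averaging [y] first gives the mean of [f], averaging [x] first gives the mean of [f (x^-1)].
    Right invariance then follows from left invariance. *)
Lemma Ex_inv f : bm f -> Ex nu (fun U => f U^-1%g) = Ex nu f.
Proof.
move=> bf; pose F (p : G * G) := f (p.1^-1 * p.2)%g.
have bF : bm F by exact: bm_comp bf measurable_fst_mul_snd.
have := Ex_swap nu nu bF; rewrite /F /=.
under [in LHS]eq_fun do rewrite Ex_mull//.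
rewrite Ex_cst => ->; rewrite -[LHS](Ex_cst nu); congr Ex; apply/funext => y.
have bfi : bm (fun U : G => f U^-1%g) by apply: (bm_comp bf); exact: measurable_inv.
rewrite -(@Ex_mull y^-1%g _ bfi); congr Ex; apply/funext => x.
by rewrite invgM invgK.
Qed.

Lemma Ex_mulr g f : bm f -> Ex nu (fun U => f (U * g)%g) = Ex nu f.
Proof.
move=> bf; rewrite -Ex_inv; last first.
  by apply: (bm_comp bf); apply: measurable_mul; [exact: measurable_id|exact: measurable_cst].
have bfi : bm (fun U : G => f U^-1%g) by apply: (bm_comp bf); exact: measurable_inv.
rewrite -[RHS]Ex_inv// -(@Ex_mull g^-1%g _ bfi); congr Ex; apply/funext => x.
by rewrite invgM invgK.
Qed.

End haar.

(** * Expectations of complex functions, taken on real and imaginary parts *)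

Section complex_expectation.
Context {d} {T : measurableType d} {R : realType}.
Local Notation C := R[i].
Implicit Types (f g : T -> C) (P : probability T R).
Local Notation re := (@complex.Re R).
Local Notation im := (@complex.Im R).

Definition bmc f := bm (fun x => re (f x)) /\ bm (fun x => im (f x)).

Definition Ec P f : C := (Ex P (fun x => re (f x)) +i* Ex P (fun x => im (f x)))%C.

Lemma bmc_cst (c : C) : bmc (fun=> c).
Proof. by split; exact: bm_cst. Qed.

Lemma bmc_real (f : T -> R) : bm f -> bmc (fun x => (f x)%:C%C).
Proof. by move=> bf; split => //=; exact: bm_cst. Qed.

Lemma bmcD f g : bmc f -> bmc g -> bmc (fun x => f x + g x).
Proof.
move=> [f1 f2] [g1 g2]; split.
  by under eq_fun do rewrite raddfD; exact: bmD.
by under eq_fun do rewrite raddfD; exact: bmD.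
Qed.

Lemma reM (x y : C) : re (x * y) = re x * re y - im x * im y.
Proof. by case: x y => [a b] [c e]. Qed.

Lemma imM (x y : C) : im (x * y) = re x * im y + im x * re y.
Proof. by case: x y => [a b] [c e]. Qed.

Lemma bmcM f g : bmc f -> bmc g -> bmc (fun x => f x * g x).
Proof.
move=> [f1 f2] [g1 g2]; split.
  by under eq_fun do rewrite reM; apply: bmB; exact: bmM.
by under eq_fun do rewrite imM; apply: bmD; exact: bmM.
Qed.

Lemma bmc_sum (I : Type) (r : seq I) (p : pred I) (F : I -> T -> C) :
  (forall i, p i -> bmc (F i)) -> bmc (fun x => \sum_(i <- r | p i) F i x).
Proof.
move=> bF; elim: r => [|i r IH].
  by under eq_fun do rewrite big_nil; exact: bmc_cst.
under eq_fun do rewrite big_cons.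
by case pi : (p i) => //; apply: bmcD => //; exact: bF.
Qed.

Lemma complex_ext (x y : C) : re x = re y -> im x = im y -> x = y.
Proof. by case: x y => [a b] [c e] /= -> ->. Qed.

Lemma Ec_cst P (c : C) : Ec P (fun=> c) = c.
Proof. by apply: complex_ext; rewrite /= Ex_cst. Qed.

Lemma EcD P f g : bmc f -> bmc g -> Ec P (fun x => f x + g x) = Ec P f + Ec P g.
Proof.
move=> [f1 f2] [g1 g2]; apply: complex_ext; rewrite raddfD /=.
  by under eq_fun do rewrite raddfD; exact: ExD.
by under eq_fun do rewrite raddfD; exact: ExD.
Qed.

Lemma EcZ P (c : C) f : bmc f -> Ec P (fun x => c * f x) = c * Ec P f.
Proof.
have bZ (k : R) h : bm h -> bm (fun x : T => k * h x) by move=> bh; apply: bmM => //; exact: bm_cst.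
move=> [f1 f2]; apply: complex_ext; rewrite ?reM ?imM /=.
  by under eq_fun do rewrite reM; rewrite ExB ?ExZ//; exact: bZ.
by under eq_fun do rewrite imM; rewrite ExD ?ExZ//; exact: bZ.
Qed.

Lemma Ec_real P (f : T -> R) : bm f -> Ec P (fun x => (f x)%:C%C) = (Ex P f)%:C%C.
Proof. by move=> bf; rewrite /Ec /= Ex_cst. Qed.

Lemma Ec_sum P (I : Type) (r : seq I) (p : pred I) (F : I -> T -> C) :
  (forall i, p i -> bmc (F i)) ->
  Ec P (fun x => \sum_(i <- r | p i) F i x) = \sum_(i <- r | p i) Ec P (F i).
Proof.
move=> bF; elim: r => [|i r IH].
  by under eq_fun do rewrite big_nil; rewrite Ec_cst big_nil.
under eq_fun do rewrite big_cons; rewrite big_cons.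
case pi : (p i) => //; rewrite EcD ?IH//; first exact: bF.
exact: bmc_sum.
Qed.

End complex_expectation.

Lemma bmc_comp (R : realType) d (T : measurableType d) d' (T' : measurableType d')
    (f : T -> R[i]) (F : T' -> T) :
  bmc f -> measurable_fun setT F -> bmc (fun t => f (F t)).
Proof. by move=> [f1 f2] mF; split; [exact: (bm_comp f1)|exact: (bm_comp f2)]. Qed.

(** * Polynomial functions on SO(N) *)

Section polynomial_functions.
Context {R : realType} {m : nat}.
Local Notation C := R[i].
Local Notation G := (SO R m).
Implicit Types (f : G -> C) (k l : nat).

(** The index is an upper bound of the degree, so that [pol k] increases with [k]. Coefficients are
    complex because the torus is diagonalised over the complex numbers. *)
Inductive pol : nat -> (G -> C) -> Prop :=
| pol_cst k (c : C) : pol k (fun=> c)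
| pol_entry k i j : (0 < k)%N -> pol k (fun U => (SO_mx U i j)%:C%C)
| polD k f (g : G -> C) : pol k f -> pol k g -> pol k (fun U => f U + g U)
| polM k l f (g : G -> C) : pol k f -> pol l g -> pol (k + l) (fun U => f U * g U).

Lemma pol_le k l f : (k <= l)%N -> pol k f -> pol l f.
Proof.
move=> kl pf; have := polM pf (pol_cst (l - k) 1).
rewrite subnKC//; congr pol; apply/funext => U; exact: mulr1.
Qed.

Lemma polZ k c f : pol k f -> pol k (fun U => c * f U).
Proof. by move=> pf; rewrite -[k]add0n; exact: polM (pol_cst 0 c) pf. Qed.

Lemma pol_sum k (I : Type) (r : seq I) (p : pred I) (F : I -> G -> C) :
  (forall i, p i -> pol k (F i)) -> pol k (fun x => \sum_(i <- r | p i) F i x).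
Proof.
move=> bF; elim: r => [|i r IH].
  by under eq_fun do rewrite big_nil; exact: pol_cst.
under eq_fun do rewrite big_cons.
by case pi : (p i) => //; apply: polD => //; exact: bF.
Qed.

Lemma pol_prod (I : Type) (r : seq I) (p : pred I) (k : I -> nat) (F : I -> G -> C) :
  (forall i, p i -> pol (k i) (F i)) ->
  pol (\sum_(i <- r | p i) k i) (fun x => \prod_(i <- r | p i) F i x).
Proof.
move=> bF; elim: r => [|i r IH].
  by rewrite big_nil; under eq_fun do rewrite big_nil; exact: pol_cst.
rewrite big_cons (_ : (fun x => _) = fun x => if p i then F i x * \prod_(j <- r | p j) F j x
    else \prod_(j <- r | p j) F j x); last by apply/funext => x; rewrite big_cons.
by case pi : (p i) => //; apply: polM => //; exact: bF.
Qed.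

Lemma pol_bmc k f : pol k f -> bmc f.
Proof.
elim=> [*|*|*|*]; [exact: bmc_cst|exact/bmc_real/bm_entry|exact: bmcD|exact: bmcM].
Qed.

(** Matrix entries of a product of three factors are sums of products of entries, and this passes to
    polynomials. Every averaging operator below thereby acts on the single variable left free and
    keeps the degree. *)
Lemma pol_sep k f : pol k f -> exists (I : finType) (a b c : I -> G -> C),
  (forall i, [/\ pol k (a i), pol k (b i) & pol k (c i)]) /\
  forall x z y : G, f (x * z * y)%g = \sum_i a i x * b i z * c i y.
Proof.
elim=> {k f}[k c|k i j k0|k f g _ [I1 [a1 [b1 [c1 [P1 E1]]]]] _ [I2 [a2 [b2 [c2 [P2 E2]]]]]
  |k l f g _ [I1 [a1 [b1 [c1 [P1 E1]]]]] _ [I2 [a2 [b2 [c2 [P2 E2]]]]]].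
- exists unit, (fun _ _ => c), (fun _ _ => 1), (fun _ _ => 1); split=> [_|x g y].
    by split; exact: pol_cst.
  by rewrite big_const card_unit /= addr0 !mulr1.
- exists ('I_m * 'I_m)%type, (fun pq U => (SO_mx U i pq.1)%:C%C),
    (fun pq U => (SO_mx U pq.1 pq.2)%:C%C), (fun pq U => (SO_mx U pq.2 j)%:C%C).
  split=> [[p q]|x g y]; first by split; exact: pol_entry.
  rewrite -(pair_bigA _ (fun p q => (SO_mx x i p)%:C%C * (SO_mx g p q)%:C%C * (SO_mx y q j)%:C%C)) /=.
  rewrite exchange_big /= mxE rmorph_sum /=; apply: eq_bigr => q _.
  by rewrite mxE rmorphM rmorph_sum mulr_suml /=; apply: eq_bigr => p _; rewrite rmorphM.
- exists (I1 + I2)%type, (fun s => match s with inl i => a1 i | inr i => a2 i end),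
    (fun s => match s with inl i => b1 i | inr i => b2 i end),
    (fun s => match s with inl i => c1 i | inr i => c2 i end).
  split=> [[i|i]|x h y]; [exact: P1|exact: P2|].
  by rewrite big_sumType /= E1 E2.
- exists (I1 * I2)%type, (fun s U => a1 s.1 U * a2 s.2 U),
    (fun s U => b1 s.1 U * b2 s.2 U), (fun s U => c1 s.1 U * c2 s.2 U).
  split=> [[i j]|x h y] /=.
    by have [? ? ?] := P1 i; have [? ? ?] := P2 j; split; exact: polM.
  rewrite E1 E2 big_distrl /= -(pair_bigA _ (fun i j => (a1 i x * a2 j x) * (b1 i h * b2 j h) * (c1 i y * c2 j y))) /=.
  apply: eq_bigr => p _.
  by rewrite big_distrr /=; apply: eq_bigr => q _; ring.
Qed.

Lemma pol_mull k f x : pol k f -> pol k (fun g => f (x * g)%g).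
Proof.
move=> /pol_sep[I [a [b [c [P E]]]]].
rewrite (_ : (fun g => _) = fun g => \sum_i (a i x * c i 1%g) * b i g); last first.
  apply/funext => g; rewrite -[(x * g)%g]mulg1 E; apply: eq_bigr => i _; ring.
by apply: pol_sum => i _; apply: polZ; have [] := P i.
Qed.

Context (nu : probability G R).

Lemma pol_conj_avg k f : pol k f -> pol k (fun g => Ec nu (fun U => f (U * g * U^-1)%g)).
Proof.
move=> /pol_sep[I [a [b [c [P E]]]]].
have mV : measurable_fun setT (fun U : G => U^-1%g) by exact: measurable_inv.
rewrite (_ : (fun g => _) = fun g => \sum_i (Ec nu (fun U => a i U * c i U^-1%g)) * b i g); last first.
  apply/funext => g; under eq_fun do rewrite E.
  rewrite Ec_sum => [|i _].
    apply: eq_bigr => i _; rewrite [RHS]mulrC -EcZ.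
      by congr Ec; apply/funext => U; ring.
    have [/pol_bmc p1 _ /pol_bmc p3] := P i; apply: bmcM => //; exact: (bmc_comp p3).
  have [/pol_bmc p1 _ /pol_bmc p3] := P i; apply: bmcM; last exact: (bmc_comp p3).
  by apply: bmcM => //; exact: bmc_cst.
by apply: pol_sum => i _; apply: polZ; have [] := P i.
Qed.

Definition class_op (h : G) (f : G -> C) : G -> C :=
  fun g => Ec nu (fun U => f (g * (U * h * U^-1))%g).

Lemma bmc_conj f (h : G) : bmc f -> bmc (fun U : G => f (U * h * U^-1)%g).
Proof.
move=> bf; apply: (bmc_comp bf); apply: measurable_mul; last exact: measurable_inv.
by apply: measurable_mul => //; exact: measurable_cst.
Qed.

Lemma class_op_pol k f h : pol k f -> pol k (class_op h f).
Proof.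
move=> /pol_sep[I [a [b [c [P E]]]]].
rewrite (_ : class_op h f = fun g => \sum_i (Ec nu (fun U => b i (U * h * U^-1)%g) * c i 1%g) * a i g); last first.
  have bb i : bmc (fun U : G => b i (U * h * U^-1)%g) by apply: bmc_conj; have [_ /pol_bmc] := P i.
  apply/funext => g; rewrite /class_op.
  under eq_fun do rewrite -[(g * _)%g]mulg1 E.
  rewrite Ec_sum => [|i _].
    apply: eq_bigr => i _; rewrite -mulrA [RHS]mulrC -EcZ//.
    by congr Ec; apply/funext => U; ring.
  by apply: bmcM; [apply: bmcM|]; rewrite //; exact: bmc_cst.
by apply: pol_sum => i _; apply: polZ; have [] := P i.
Qed.

End polynomial_functions.

(** * Principal minors and symmetric functions of the eigenvalues *)

Section principal_minors.
Context {K : comNzRingType} {N : nat}.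
Implicit Types (A : 'M[K]_N) (I : {set 'I_N}).

Definition pminor A I : K :=
  \sum_(s : {perm 'I_N} | perm_on I s) (-1) ^+ s * \prod_(i in I) A i (s i).

(** The elementary symmetric function of degree [h] of the eigenvalues, that is the trace on the
    exterior power of order [h]. *)
Definition eigsym h A : K := \sum_(I : {set 'I_N} | #|I| == h) pminor A I.

Lemma pminor_det A I :
  pminor A I = \det (\matrix_(i, j) if i \in I then A i j else (i == j)%:R).
Proof.
rewrite /determinant (bigID (fun s : {perm 'I_N} => perm_on I s)) /= [X in _ + X]big1 ?addr0.
  apply: eq_bigr => s sI; congr (_ * _); rewrite [RHS](bigID [in I]) /= [X in _ * X]big1 ?mulr1.
    by apply: eq_bigr => i iI; rewrite mxE iI.
  by move=> i /negbTE iI; rewrite mxE iI (out_perm sI) ?iI// eqxx.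
move=> s /subsetPn[i si iI]; rewrite (bigD1 i)//= mxE (negbTE iI).
by rewrite inE eq_sym in si; rewrite (negbTE si) mul0r mulr0.
Qed.

(** In the form [1 + D (A - 1)], with [D] a coordinate projection, Sylvester's identity shrinks the
    determinant to the size of [I]. *)
Lemma pminor_det1D A I :
  pminor A I = \det (1%:M + diag_mx (\row_i (i \in I)%:R) *m (A - 1%:M)).
Proof.
rewrite pminor_det; congr determinant; apply/matrixP => i j.
rewrite mul_diag_mx !mxE; case: ifP => _; rewrite ?mul1r ?mul0r ?addr0//.
by rewrite addrC subrK.
Qed.

Lemma pminor_diag (d : 'rV[K]_N) A I :
  pminor (diag_mx d *m A) I = (\prod_(i in I) d 0 i) * pminor A I.
Proof.
rewrite /pminor mulr_sumr; apply: eq_bigr => s _; rewrite mulrCA; congr (_ * _).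
by rewrite -big_split /=; apply: eq_bigr => i _; rewrite mul_diag_mx mxE.
Qed.

Lemma det1D_pminor (y : K) A :
  \det (1%:M + y *: A) = \sum_(I : {set 'I_N}) y ^+ #|I| * pminor A I.
Proof.
rewrite /determinant; under eq_bigr => s _.
  rewrite (eq_bigr (fun i => y * A i (s i) + (i == s i)%:R)); last first.
    by move=> i _; rewrite !mxE addrC.
  rewrite bigA_distr mulr_sumr; over.
rewrite exchange_big /=; apply: eq_bigr => I _; rewrite mulr_sumr.
rewrite (bigID (fun s : {perm 'I_N} => perm_on I s)) /= [X in _ + X]big1 ?addr0.
  apply: eq_bigr => s sI; rewrite [RHS]mulrCA; congr (_ * _).
  rewrite (bigID [in I]) /= [X in _ * X]big1 ?mulr1.
    rewrite (eq_bigr (fun i => y * A i (s i))) ?big_split ?prodr_const//=.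
    by move=> i ->.
  by move=> i /negbTE iI; rewrite iI (out_perm sI) ?iI// eqxx.
move=> s /subsetPn[i si iI]; rewrite (bigD1 i)//= (negbTE iI).
by rewrite inE eq_sym in si; rewrite (negbTE si) mul0r mulr0.
Qed.

End principal_minors.

Section eigsym_conj.
Context {K : comNzRingType} {N : nat}.

Lemma pminor_map (L : comNzRingType) (f : {rmorphism K -> L}) (A : 'M[K]_N) I :
  pminor (map_mx f A) I = f (pminor A I).
Proof.
rewrite /pminor rmorph_sum; apply: eq_bigr => s _.
rewrite rmorphM rmorph_sign rmorph_prod; congr (_ * _).
by apply: eq_bigr => i _; rewrite mxE.
Qed.

Lemma eigsym_map (L : comNzRingType) (f : {rmorphism K -> L}) (A : 'M[K]_N) h :
  eigsym h (map_mx f A) = f (eigsym h A).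
Proof. by rewrite /eigsym rmorph_sum; apply: eq_bigr => I _; exact: pminor_map. Qed.

(** The generating function of the [eigsym h A] is a determinant over polynomials, from which
    invariance under conjugation is read off. *)
Lemma eigsym_coef h (A : 'M[K]_N) :
  eigsym h A = (\det (1%:M + 'X *: map_mx polyC A))`_h.
Proof.
rewrite det1D_pminor coef_sum /eigsym big_mkcond /=; apply: eq_bigr => I _.
rewrite pminor_map mulrC coefCM coefXn eq_sym.
by case: eqP => _; rewrite ?mulr1 ?mulr0.
Qed.

Lemma eigsym_conj h (V W A : 'M[K]_N) : V *m W = 1%:M -> eigsym h (V *m A *m W) = eigsym h A.
Proof.
move=> VW; rewrite !eigsym_coef; congr (_ `_ h).
pose pV := map_mx polyC V; pose pW := map_mx polyC W.
have pVW : pV *m pW = 1%:M by rewrite -map_mxM VW map_scalar_mx.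
have -> : 1%:M + 'X *: map_mx polyC (V *m A *m W) = pV *m (1%:M + 'X *: map_mx polyC A) *m pW.
  by rewrite mulmxDr mulmxDl mulmx1 pVW !map_mxM -scalemxAr -scalemxAl.
rewrite !det_mulmx mulrC mulrA -det_mulmx; have /mulmx1C -> := pVW.
by rewrite det1 mul1r.
Qed.

(** Sylvester's identity. One block matrix, multiplied by a unipotent one on the right or on the
    left, becomes block triangular; the two determinants are the two sides. *)
Lemma det1D_mulC p (X : 'M[K]_(N, p)) (Y : 'M[K]_(p, N)) :
  \det (1%:M + X *m Y) = \det (1%:M + Y *m X).
Proof.
have := congr1 determinant (mulmx_block 1%:M (- X) Y 1%:M 1%:M X 0 1%:M).
have := congr1 determinant (mulmx_block 1%:M X 0 1%:M 1%:M (- X) Y 1%:M).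
rewrite !mul1mx !mulmx1 !mulmx0 !mul0mx !addr0 !add0r subrr addNr.
rewrite !det_mulmx !det_ublock !det_lblock !det1 !mulr1 !mul1r.
by move=> <- ->; rewrite addrC.
Qed.

End eigsym_conj.

(** * Trigonometric polynomials on the maximal torus *)

Section cis.
Context {R : realType}.
Local Notation C := R[i].

Definition cis (t : R) : C := (cos t +i* sin t)%C.

Lemma cisD s t : cis (s + t) = cis s * cis t.
Proof. by apply: complex_ext; rewrite ?reM ?imM /= ?cosD ?sinD // addrC. Qed.

Lemma cis0 : cis 0 = 1.
Proof. by apply: complex_ext; rewrite /= ?cos0 ?sin0. Qed.

Lemma cis_sum (I : Type) (r : seq I) (p : pred I) (F : I -> R) :
  cis (\sum_(i <- r | p i) F i) = \prod_(i <- r | p i) cis (F i).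
Proof. exact: (big_morph cis cisD cis0). Qed.

Lemma cisX t k : cis (t *+ k) = cis t ^+ k.
Proof. by elim: k => [|k IH]; rewrite ?mulr0n ?cis0// mulrS exprS cisD IH. Qed.

Lemma cis_2pi : cis (pi *+ 2) = 1.
Proof. by apply: complex_ext; rewrite /= ?cos2pi ?sin2pi. Qed.

Lemma cis_neq1 t : 0 < t < pi *+ 2 -> cis t != 1.
Proof.
move=> /andP[t0 t2]; apply/negP => /eqP /(congr1 (@complex.Re R)) /= ct.
have := cos2Dsin2 (t / 2); have : cos t = 1 - sin (t / 2) ^+ 2 *+ 2.
  rewrite [in LHS](_ : t = (t / 2) *+ 2); [rewrite cos_mulr2n; have := cos2Dsin2 (t / 2); lra|lra].
have s0 : 0 < sin (t / 2) by apply: sin_gt0_pi; lra.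
by rewrite ct; have := exprn_gt0 2 s0; lra.
Qed.

End cis.

Section torus.
Context {R : realType}.
Local Notation C := R[i].
Local Notation toC := (map_mx (fun x : R => x%:C%C)).

(** The angles form a sequence indexed by [nat], of which the first [n] terms count, so that the
    recursion peels off a block by a shift. *)
Fixpoint torus_mx n (x : nat -> R) : 'M[R]_(n.*2.+1) :=
  match n with
  | 0 => 1%:M
  | k.+1 => block_mx (rot2 (x 0%N)) 0 0 (torus_mx k (fun i => x i.+1)) : 'M[_]_(2 + k.*2.+1)
  end.

Lemma det_rot2 (t : R) : \det (rot2 t) = 1.
Proof.
rewrite (expand_det_row _ ord0) !big_ord_recl big_ord0.
rewrite /cofactor !det_mx11 !mxE /= addr0 expr0 expr1 mul1r mulN1r mulrNN.
by rewrite -!expr2 cos2Dsin2.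
Qed.

Lemma torus_special n x : special_orthogonal (torus_mx n x).
Proof.
elim: n x => [|k IH] x; first exact: special_orthogonal1.
have /andP[/eqP TT /eqP dT] := IH (fun i => x i.+1).
change (@special_orthogonal R (2 + k.*2.+1) (block_mx (rot2 (x 0%N)) 0 0 (torus_mx k (fun i => x i.+1)))).
rewrite /special_orthogonal tr_block_mx mulmx_block !trmx0.
rewrite !mul0mx !mulmx0 !addr0 !add0r rot2_orthogonal TT -scalar_mx_block.
by rewrite eqxx det_ublock det_rot2 dT mulr1 eqxx.
Qed.

Definition torus n x : SO R n.*2.+1 := MkSO (torus_special n x).

(* Columns: the eigenvectors of plane rotations. *)
Definition frame2 : 'M[C]_2 := \matrix_(i, j) if i == 0 then 1 else if j == 0 then (0 -i* 1)%C else (0 +i* 1)%C.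
Definition frameV2 : 'M[C]_2 := 2^-1 *: \matrix_(i, j) if j == 0 then 1 else if i == 0 then (0 +i* 1)%C else (0 -i* 1)%C.

Fixpoint frame n : 'M[C]_(n.*2.+1) :=
  match n with
  | 0 => 1%:M
  | k.+1 => block_mx frame2 0 0 (frame k) : 'M[_]_(2 + k.*2.+1)
  end.

Fixpoint frameV n : 'M[C]_(n.*2.+1) :=
  match n with
  | 0 => 1%:M
  | k.+1 => block_mx frameV2 0 0 (frameV k) : 'M[_]_(2 + k.*2.+1)
  end.

Lemma frame2K : frameV2 *m frame2 = 1%:M.
Proof.
apply/matrixP => i j; rewrite !mxE !big_ord_recl big_ord0 !mxE.
have i2 : (0 +i* 1 : C)%C * (0 -i* 1)%C = 1 by apply: complex_ext; rewrite ?reM ?imM /=; ring.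
have i3 : (0 +i* 1 : C)%C * (0 +i* 1)%C = -1 by apply: complex_ext; rewrite ?reM ?imM /=; ring.
have i4 : (0 -i* 1 : C)%C * (0 -i* 1)%C = -1 by apply: complex_ext; rewrite ?reM ?imM /=; ring.
case: i => [[|[|//]] ?]; case: j => [[|[|//]] ?]; rewrite /= ?mulr1 ?addr0 -!mulrA ?i2 ?i3 ?i4 ?mulr1 ?mulrN1 ?subrr//.
  by field.
by rewrite [_ * 'i%C]mulrC i2; field.
Qed.

Lemma frameK n : frameV n *m frame n = 1%:M.
Proof.
elim: n => [|k IH] /=; first by rewrite mulmx1.
change ((block_mx frameV2 0 0 (frameV k) : 'M[C]_(2 + k.*2.+1)) *m block_mx frame2 0 0 (frame k) = 1%:M).
by rewrite mulmx_block !mulmx0 !mul0mx !addr0 !add0r frame2K IH -scalar_mx_block.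
Qed.

Fixpoint ang n (x : nat -> R) (j : nat) : R :=
  match n with
  | 0 => 0
  | k.+1 => match j with 0 => x 0%N | 1 => - x 0%N | j'.+2 => ang k (fun i => x i.+1) j' end
  end.

Lemma rot2_diag t : frameV2 *m toC (rot2 t) *m frame2 = diag_mx (\row_j cis (if j == 0 then t else - t)).
Proof.
apply/matrixP => i j; rewrite !mxE !big_ord_recl big_ord0 !mxE !big_ord_recl !big_ord0 !mxE.
apply: complex_ext; case: i => [[|[|//]] ?]; case: j => [[|[|//]] ?];
  rewrite /= ?raddfD ?raddfMn ?reM ?imM /= ?reM ?imM /= ?cosN ?sinN ?mulr0n ?mulr1n /=; try by field.
all: by field.
Qed.

Lemma torus_diag n x :
  frameV n *m toC (torus_mx n x) *m frame n = diag_mx (\row_j cis (ang n x j)).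
Proof.
elim: n x => [|k IH] x /=.
  by rewrite mulmx1 mul1mx map_mx1; apply/matrixP => i j; rewrite !mxE cis0.
change ((block_mx frameV2 0 0 (frameV k) : 'M[C]_(2 + k.*2.+1)) *m
  toC (block_mx (rot2 (x 0%N)) 0 0 (torus_mx k (fun i => x i.+1)) : 'M[R]_(2 + k.*2.+1)) *m
  block_mx frame2 0 0 (frame k) = diag_mx (\row_(j < 2 + k.*2.+1) cis (ang k.+1 x j))).
rewrite (map_block_mx (fun x : R => x%:C%C)) !map_mx0 !mulmx_block !mulmx0 !mul0mx !addr0 !add0r.
rewrite !mul0mx IH rot2_diag.
rewrite [RHS](_ : _ = diag_mx (row_mx (\row_(j < 2) cis (if j == 0 then x 0%N else - x 0%N))
     (\row_(j < k.*2.+1) cis (ang k (fun i => x i.+1) j)))).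
  by rewrite diag_mx_row.
congr diag_mx; apply/rowP => j; rewrite mxE.
rewrite -[j](splitK (j : 'I_(2 + k.*2.+1))); case: (fintype.split _) => a /=.
  by rewrite row_mxEl mxE; case: a => [[|[|a]] ha].
by rewrite row_mxEr mxE.
Qed.

End torus.

Section trigonometric_polynomials.
Context {R : realType} {n : nat}.
Local Notation C := R[i].
Local Notation wt := ('I_n -> int).
Implicit Types (w v : wt) (x : nat -> R).

Definition chr w x : C := cis (\sum_(i < n) (w i)%:~R * x i).
(** Pairing with a regular dominant coweight: with [e_i] the coordinate weights, the positive roots
    [e_i - e_j] ([i < j]), [e_i + e_j] and [e_i] all have positive level, so a Weyl reflection
    towards the dominant chamber raises the level. *)
Definition lev w : int := \sum_(i < n) (n - i)%:Z * w i.
Definition nrm w : nat := \sum_(i < n) absz (w i).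

Lemma chrD w v x : chr (fun i => w i + v i) x = chr w x * chr v x.
Proof.
rewrite /chr -cisD -big_split; congr cis; apply: eq_bigr => i _.
by rewrite intrD mulrDl.
Qed.

Lemma levD w v : lev (fun i => w i + v i) = lev w + lev v.
Proof. by rewrite /lev -big_split; apply: eq_bigr => i _; rewrite mulrDr. Qed.

Lemma nrmD w v : (nrm (fun i => w i + v i)%R <= nrm w + nrm v)%N.
Proof. rewrite /nrm -big_split /=; apply: leq_sum => i _; by move: (w i) (v i) => a b; lia. Qed.

Definition tpol (S : wt -> Prop) (F : (nat -> R) -> C) := exists (J : finType) (w : J -> wt) (c : J -> C),
  (forall j, S (w j)) /\ forall x, F x = \sum_j c j * chr (w j) x.

Lemma tpol_sub (S S' : wt -> Prop) F : (forall w, S w -> S' w) -> tpol S F -> tpol S' F.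
Proof. by move=> SS [J [w [c [Sw E]]]]; exists J, w, c; split => // j; exact: SS. Qed.

Lemma tpol_chr (S : wt -> Prop) w c : S w -> tpol S (fun x => c * chr w x).
Proof.
move=> Sw; exists unit, (fun=> w), (fun=> c); split => // x.
by rewrite big_const card_unit /= addr0.
Qed.

Lemma tpol0 S : tpol S (fun=> 0).
Proof.
by exists void, (of_void _), (fun=> 0); split => [[]|x]; rewrite big1//; case.
Qed.

Lemma tpolD S F H : tpol S F -> tpol S H -> tpol S (fun x => F x + H x).
Proof.
move=> [J [w [c [Sw E]]]] [J' [w' [c' [Sw' E']]]].
exists (J + J')%type, (fun s => match s with inl i => w i | inr i => w' i end),
    (fun s => match s with inl i => c i | inr i => c' i end).
by split=> [[j|j]|x]; rewrite ?big_sumType /= ?E ?E'.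
Qed.

Lemma tpol_sum S (I : Type) (r : seq I) (p : pred I) (F : I -> (nat -> R) -> C) :
  (forall i, p i -> tpol S (F i)) -> tpol S (fun x => \sum_(i <- r | p i) F i x).
Proof.
move=> bF; elim: r => [|i r IH].
  by under eq_fun do rewrite big_nil; exact: tpol0.
under eq_fun do rewrite big_cons.
by case pi : (p i) => //; apply: tpolD => //; exact: bF.
Qed.

Lemma tpolM (S1 S2 S : wt -> Prop) F H :
  (forall w v, S1 w -> S2 v -> S (fun i => w i + v i)) ->
  tpol S1 F -> tpol S2 H -> tpol S (fun x => F x * H x).
Proof.
move=> SS [J [w [c [Sw E]]]] [J' [w' [c' [Sw' E']]]].
exists (J * J')%type, (fun s i => w s.1 i + w' s.2 i), (fun s => c s.1 * c' s.2).
split=> [[j j']|x]; first exact: SS.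
rewrite E E' big_distrl -(pair_bigA _ (fun j j' => c j * c' j' * chr (fun i => w j i + w' j' i) x)) /=.
apply: eq_bigr => j _; rewrite big_distrr /=; apply: eq_bigr => j' _.
by rewrite chrD; ring.
Qed.

(* [chr l] is the term of highest level, with coefficient [a] *)
Definition leading k l a F := (nrm l <= k)%N /\ exists2 F',
  tpol (fun w => lev w < lev l /\ (nrm w <= k)%N) F' & forall x, F x = a * chr l x + F' x.

Lemma leadingM k k' l l' a a' F F' : leading k l a F -> leading k' l' a' F' ->
  leading (k + k') (fun i => l i + l' i) (a * a') (fun x => F x * F' x).
Proof.
move=> [lk [H tH E]] [lk' [H' tH' E']]; split.
  by rewrite (leq_trans (nrmD _ _))// leq_add.
exists (fun x => a * chr l x * H' x + H x * (a' * chr l' x) + H x * H' x); last first.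
  by move=> x; rewrite E E' chrD; ring.
apply: tpolD; [apply: tpolD|].
- apply: tpolM (tpol_chr (S := eq l) a erefl) tH' => w v <- [lv nv].
  by rewrite !levD; split; [lia|rewrite (leq_trans (nrmD _ _))// leq_add].
- apply: tpolM tH (tpol_chr (S := eq l') a' erefl) => w v [lw nw] <-.
  by rewrite !levD; split; [lia|rewrite (leq_trans (nrmD _ _))// leq_add].
- apply: tpolM tH tH' => w v [lw nw] [lv nv].
  by rewrite !levD; split; [lia|rewrite (leq_trans (nrmD _ _))// leq_add].
Qed.

Section coefficients.
Variable K : nat.
Local Notation M := (K.*2.+1).
Local Notation box := {ffun 'I_n -> 'I_M}.

Definition grid (s : box) : nat -> R :=
  fun i => if insub i is Some j then pi *+ 2 * (s j)%:R / M%:R else 0.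

(** A Fourier coefficient taken as an average over a finite grid with [2 K + 1] points per angle.
    Weights with entries between [-K] and [K] are pairwise distinct modulo [2 K + 1], so the grid
    separates them exactly. *)
Definition fcoef (F : (nat -> R) -> C) (v : wt) : C :=
  (M%:R ^+ n)^-1 * \sum_(s : box) F (grid s) * chr (fun i => - v i) (grid s).

Definition wbox (b : box) : wt := fun i => (b i)%:Z - K%:Z.

Definition inbox v := forall i, (absz (v i) <= K)%N.

Lemma geom_cis (d : int) : (absz d < M)%N ->
  \sum_(s < M) cis (d%:~R * (pi *+ 2 * s%:R / M%:R)) = (if d == 0 then M%:R else 0) :> C.
Proof.
move=> dM; case: eqP => [->|/eqP d0].
  under eq_bigr do rewrite mul0r cis0.
  by rewrite sumr_const card_ord.
pose t : R := d%:~R * (pi *+ 2) / M%:R; pose z : C := cis t.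
have M0 : 0 < M%:R :> R by rewrite ltr0n.
rewrite (eq_bigr (fun s : 'I_M => z ^+ s)); last first.
  move=> s _; rewrite /z -cisX; congr cis; rewrite /t -[RHS]mulr_natr.
  by field; rewrite gt_eqF.
have zM : z ^+ M = 1.
  rewrite /z -cisX /t -[X in cis X]mulr_natr mulfVK ?gt_eqF//.
  case: (d) => k; first by rewrite -[k%:~R]/(k%:R) mulr_natl cisX cis_2pi expr1n.
  rewrite NegzE mulrNz mulNr -[_%:~R]/(k.+1%:R) mulr_natl -[RHS](expr1n _ k.+1) -cis_2pi -cisX.
  have := cisD (pi *+ 2 *+ k.+1 : R) (- (pi *+ 2 *+ k.+1)); rewrite subrr cis0.
  by rewrite cisX cis_2pi expr1n mul1r => <-.
have z1 : z != 1.
  have main (e : nat) : (0 < e < M)%N -> cis (e%:R * (pi *+ 2) / M%:R : R) != 1.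
    move=> /andP[e0 eM]; apply: cis_neq1; have pi0 := pi_gt0 R.
    have e0' : 0 < e%:R :> R by rewrite ltr0n.
    have pi2 : 0 < pi *+ 2 :> R by rewrite pmulrn_lgt0.
    apply/andP; split; first by apply: divr_gt0 => //; apply: mulr_gt0.
    by rewrite ltr_pdivrMr// mulrC ltr_pM2l// ltr_nat.
  rewrite /z /t; case: (d) d0 dM => k d0 dM; first by apply: main; lia.
  rewrite NegzE mulrNz !mulNr; apply/negP => /eqP h.
  have := main k.+1; rewrite /= => /(_ _)/negP; apply; first by move: dM; rewrite /=; lia.
  have := cisD ((k.+1)%:R * (pi *+ 2) / M%:R : R) (- (k.+1%:R * (pi *+ 2) / M%:R)).
  by rewrite subrr cis0 h mulr1 => <-.
have := subrX1 z M; rewrite zM subrr => /esym/eqP; rewrite mulf_eq0 subr_eq0 (negbTE z1) /=.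
by move=> /eqP.
Qed.

Lemma fcoef_chr w v : (forall i, (absz (w i - v i) < M)%N) ->
  fcoef (chr w) v = (if [forall i, w i == v i] then 1 else 0).
Proof.
move=> wv; rewrite /fcoef.
have E (s : box) : chr w (grid s) * chr (fun i => - v i) (grid s) =
    \prod_(i < n) cis ((w i - v i)%:~R * (pi *+ 2 * (s i)%:R / M%:R)).
  rewrite -chrD /chr cis_sum; apply: eq_bigr => i _; congr (cis (_ * _)).
  by rewrite /grid; case: insubP => [j _ /val_inj ->//|]; rewrite ltn_ord.
under eq_bigr do rewrite E.
rewrite -(bigA_distr_bigA (fun i (k : 'I_M) => cis ((w i - v i)%:~R * (pi *+ 2 * k%:R / M%:R)))) /=.
rewrite (eq_bigr (fun i => if w i == v i then M%:R else 0 : C)); last first.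
  by move=> i _; rewrite geom_cis// subr_eq0.
case: ifPn => [/forallP wvE|/forallPn[i /negbTE wvi]].
  rewrite (eq_bigr (fun=> M%:R)) => [|i _]; last by rewrite wvE.
  by rewrite prodr_const card_ord mulVf// expf_neq0// pnatr_eq0.
by rewrite (bigD1 i)//= wvi mul0r mulr0.
Qed.

Lemma fcoef_sum (J : finType) (w : J -> wt) (c : J -> C) F v :
  (forall j, inbox (w j)) -> inbox v ->
  (forall x, F x = \sum_j c j * chr (w j) x) ->
  fcoef F v = \sum_(j | [forall i, w j i == v i]) c j.
Proof.
move=> wK vK E; rewrite /fcoef; under eq_bigr do rewrite E big_distrl /=.
rewrite exchange_big /= big_distrr /= [RHS]big_mkcond; apply: eq_bigr => j _.
rewrite (_ : (if _ then c j else 0) = c j * (if [forall i, w j i == v i] then 1 else 0)); last first.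
  by case: ifP; rewrite ?mulr1 ?mulr0.
rewrite -fcoef_chr => [|i]; last by have := wK j i; have := vK i; lia.
rewrite /fcoef mulrCA; congr (_ * _); rewrite big_distrr /=.
by apply: eq_bigr => s _; rewrite mulrA.
Qed.

Lemma fcoef_tpol0 S F v : tpol S F -> (forall w, S w -> inbox w) -> inbox v ->
  (forall w, S w -> [forall i, w i == v i] -> False) -> fcoef F v = 0.
Proof.
move=> [J [w [c [Sw E]]]] SK vK Sv.
rewrite (fcoef_sum _ vK E) => [|j]; last exact: SK.
by rewrite big1// => j /(Sv _ (Sw j)).
Qed.

Lemma wbox_in (b : box) : inbox (wbox b).
Proof. by move=> i; rewrite /wbox; have := ltn_ord (b i); lia. Qed.

Lemma inbox_wbox v : inbox v -> exists b : box, v =1 wbox b.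
Proof.
move=> vK; exists [ffun i => inord (absz (v i + K%:Z))] => i.
by rewrite /wbox ffunE inordK; have := vK i; lia.
Qed.

Lemma tpol_fcoef S F : tpol S F -> (forall w, S w -> inbox w) ->
  forall x, F x = \sum_(b : box) fcoef F (wbox b) * chr (wbox b) x.
Proof.
move=> [J [w [c [Sw E]]]] SK x.
have SK' j := SK _ (Sw j).
have /choice[g gP] : forall j, exists b : box, w j =1 wbox b by move=> j; exact: inbox_wbox.
rewrite E (partition_big g predT)//=; apply: eq_bigr => b _.
rewrite (fcoef_sum SK' (wbox_in b) E) big_distrl /=; apply: eq_big => j.
  apply/eqP/forallP => [<- i|h]; first by rewrite gP.
  apply/ffunP => i; apply: val_inj => /=.
  by have := h i; rewrite gP /wbox => /eqP; lia.
move=> /eqP <-; congr (_ * cis _); apply: eq_bigr => i _; by rewrite gP.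
Qed.

Lemma fcoefD F H v : fcoef (fun x => F x + H x) v = fcoef F v + fcoef H v.
Proof. by rewrite /fcoef -mulrDr -big_split; congr (_ * _); apply: eq_bigr => s _; rewrite mulrDl. Qed.

Lemma fcoefZ a F v : fcoef (fun x => a * F x) v = a * fcoef F v.
Proof.
by rewrite /fcoef mulrCA; congr (_ * _); rewrite big_distrr /=; apply: eq_bigr => s _; rewrite mulrA.
Qed.

(** All terms but the leading one have level below that of [l], hence below that of [v]. *)
Lemma fcoef_leading k l a F v : leading k l a F -> (k <= K)%N -> inbox v ->
  (lev l <= lev v)%R -> fcoef F v = (if [forall i, l i == v i] then a else 0).
Proof.
move=> [lk [H tH E]] kK vK lv.
have nK w : (nrm w <= k)%N -> inbox w.
  move=> wk i; rewrite (leq_trans _ (leq_trans wk kK))//.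
  by rewrite /nrm (bigD1 i)//= leq_addr.
rewrite (_ : F = fun x => a * chr l x + H x); last exact/funext.
rewrite fcoefD fcoefZ fcoef_chr => [|i]; last first.
  by have := nK _ lk i; have := vK i; lia.
rewrite (fcoef_tpol0 tH) ?addr0//; first by case: ifP => _; rewrite ?mulr1 ?mulr0.
  by move=> w [_]; exact: nK.
move=> w [lw _] /forallP wv; suff : lev w = lev v by lia.
by apply: eq_bigr => i _; rewrite (eqP (wv i)).
Qed.

End coefficients.
End trigonometric_polynomials.

Section torus_weights.
Context {R : realType}.
Local Notation C := R[i].
Local Notation toC := (map_mx (fun x : R => x%:C%C)).

(** The weight of the eigenvalue of index [l]: [e_i] for [l = 2 i], [- e_i] for [l = 2 i + 1], and
    zero for the last index [2 n]. *)
Definition wtl n (l : nat) : 'I_n -> int := fun i => (l == i.*2)%:Z - (l == i.*2.+1)%:Z.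
Arguments wtl : clear implicits.

Lemma ang_wtl n x l : ang n x l = \sum_(i < n) (wtl n l i)%:~R * x i :> R.
Proof.
elim: n x l => [|n IH] x l /=; first by rewrite big_ord0.
rewrite big_ord_recl; case: l => [|[|l]] /=.
- rewrite big1 ?addr0 => [|i _]; first by rewrite /wtl /= subr0 mul1r.
  by rewrite /wtl /= !subrr ?mul0r.
- rewrite big1 ?addr0 => [|i _]; first by rewrite /wtl /= sub0r mulN1r.
  by rewrite /wtl /= /bump /= subrr mul0r.
- rewrite IH [X in _ = X + _](_ : _ = 0) ?add0r; last by rewrite /wtl /= subrr mul0r.
  by apply: eq_bigr => i _; congr (_%:~R * _).
Qed.

Lemma wtl_even n i (j : 'I_n) : wtl n i.*2 j = (i == j :> nat)%:Z.
Proof. by rewrite /wtl (inj_eq double_inj) (_ : (i.*2 == j.*2.+1) = false) ?subr0//; apply/eqP; lia. Qed.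

Lemma wtl_odd n i (j : 'I_n) : wtl n i.*2.+1 j = - (i == j :> nat)%:Z.
Proof.
by rewrite /wtl eqSS (inj_eq double_inj) (_ : (i.*2.+1 == j.*2) = false) ?sub0r//; apply/eqP; lia.
Qed.

Lemma sum_ord_eq (V : zmodType) n i (F : nat -> V) :
  \sum_(j < n) F j *+ (i == j :> nat) = F i *+ (i < n)%N.
Proof.
case: ltnP => i_n.
  rewrite (bigD1 (Ordinal i_n))//= eqxx big1 ?addr0// => j ij.
  by rewrite (_ : (i == j) = false) ?mulr0n//; apply/eqP => e; case/eqP: ij; exact/val_inj.
by rewrite big1 ?mulr0n// => j _; rewrite (_ : (i == j) = false) ?mulr0n//; have := ltn_ord j; lia.
Qed.

Lemma lev_wtl n l : (l <= n.*2)%N ->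
  lev (wtl n l) = if odd l then - (n - l./2)%:Z else (n - l./2)%:Z.
Proof.
move=> ln; rewrite /lev; rewrite -[in wtl n l](odd_double_half l); case: ifP => ol; rewrite ?add1n ?add0n.
  rewrite (eq_bigr (fun j : 'I_n => - ((n - j)%:Z *+ (l./2 == j :> nat)))) => [|j _].
    by rewrite sumrN (sum_ord_eq n l./2 (fun j => (n - j)%:Z)); case: ltnP => h; lia.
  by rewrite wtl_odd mulrN; case: eqP; rewrite ?mulr0 ?mulr1 ?mulr1n ?mulr0n.
rewrite (eq_bigr (fun j : 'I_n => ((n - j)%:Z *+ (l./2 == j :> nat)))) => [|j _].
  by rewrite (sum_ord_eq n l./2 (fun j => (n - j)%:Z)); case: ltnP => h; lia.
by rewrite wtl_even; case: eqP; rewrite ?mulr0 ?mulr1 ?mulr1n ?mulr0n.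
Qed.

Lemma nrm_wtl n l : (nrm (wtl n l) <= 1)%N.
Proof.
rewrite /nrm -[in wtl n l](odd_double_half l).
have main : (\sum_(i < n) (l./2 == i :> nat) <= 1)%N.
  case: (ltnP l./2 n) => i_n.
    rewrite (bigD1 (Ordinal i_n))//= eqxx big1// => j ij.
    by rewrite (_ : (_ == _) = false)//; apply/eqP => e; case/eqP: ij; exact/val_inj.
  by rewrite big1// => j _; rewrite (_ : (_ == _) = false)//; have := ltn_ord j; lia.
apply: leq_trans main; apply: leq_sum => j _.
by case: (odd l); rewrite ?add1n ?add0n ?wtl_odd ?wtl_even; case: eqP.
Qed.

Definition wI n (I : {set 'I_(n.*2.+1)}) : 'I_n -> int := fun i => \sum_(l in I) wtl n l i.

(** The eigenvalues of weights [e_0, ..., e_(h-1)], the choice of [h] eigenvalues whose product has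
    the highest level. *)
Definition top n h : {set 'I_(n.*2.+1)} := [set l : 'I_(n.*2.+1) | ~~ odd l & (l < h.*2)%N].

Lemma chr_wI n (I : {set 'I_(n.*2.+1)}) x :
  chr (wI I) x = \prod_(l in I) cis (ang n x l) :> C.
Proof.
rewrite /chr -cis_sum; congr cis.
under [RHS]eq_bigr do rewrite ang_wtl.
rewrite [RHS]exchange_big /=; apply: eq_bigr => i _.
by rewrite /wI rmorph_sum /= big_distrl.
Qed.

Lemma lev_wI n (I : {set 'I_(n.*2.+1)}) : lev (wI I) = \sum_(l in I) lev (wtl n l).
Proof. by rewrite [RHS]exchange_big /=; apply: eq_bigr => i _; rewrite /wI big_distrr. Qed.

Lemma nrm_wI n (I : {set 'I_(n.*2.+1)}) : (nrm (wI I) <= #|I|)%N.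
Proof.
rewrite -sum1_card; apply: leq_trans (leq_sum _ (fun l (_ : l \in I) => nrm_wtl n l)).
rewrite [leqRHS]exchange_big /=; apply: leq_sum => i _; rewrite /wI.
elim/big_rec2: _ => [//|l a b _ h]; apply: leq_trans (_ : absz (wtl n l i) + absz b <= _)%N; last by rewrite leq_add2l.
by move: (wtl n l i) h => c h; lia.
Qed.

Lemma wI_top n h : wI (top n h) = fun i : 'I_n => (i < h)%N%:Z.
Proof.
apply/funext => i; have i2 : (i.*2 < n.*2.+1)%N by have := ltn_ord i; lia.
rewrite /wI; case: ltnP => ih.
  rewrite (bigD1 (Ordinal i2)) /=; last by rewrite inE /= odd_double; lia.
  rewrite wtl_even eqxx big1 ?addr0// => l /andP[]; rewrite inE => /andP[ol lh] li.
  rewrite -[in wtl n l](odd_double_half l) (negbTE ol) add0n wtl_even.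
  rewrite (_ : (_ == _) = false)//; apply/eqP => e; case/eqP: li; apply: val_inj => /=.
  by rewrite -e -[LHS](odd_double_half l) (negbTE ol).
rewrite big1// => l; rewrite inE => /andP[ol lh].
rewrite -[in wtl n l](odd_double_half l) (negbTE ol) add0n wtl_even.
by rewrite (_ : (_ == _) = false)//; apply/eqP; lia.
Qed.

Lemma card_top n h : (h <= n)%N -> #|top n h| = h.
Proof.
move=> hn; pose f (i : 'I_h) : 'I_(n.*2.+1) := inord i.*2.
have fE (i : 'I_h) : f i = i.*2 :> nat by rewrite /f inordK//; have := ltn_ord i; lia.
rewrite (_ : top n h = [set f i | i : 'I_h]%SET).
  rewrite card_imset ?card_ord// => i j /(congr1 (@nat_of_ord _)).
  by rewrite !fE => /double_inj e; exact: val_inj.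
apply/setP => l; rewrite inE; apply/andP/imsetP => [[ol lh]|[i _ ->]].
  have l2 : (l./2 < h)%N by lia.
  by exists (Ordinal l2) => //; apply: ord_inj; rewrite fE /=; lia.
by rewrite fE odd_double; have := ltn_ord i; split=> //; lia.
Qed.

(** Subtract the threshold [n - h] from the level of each eigenvalue: what remains is positive
    exactly on [top n h], so exchanging a member of it for an outsider lowers the sum strictly. *)
Lemma lev_top n h (I : {set 'I_(n.*2.+1)}) : (h <= n)%N -> #|I| = h -> I != top n h ->
  lev (wI I) < lev (wI (top n h)).
Proof.
move=> hn Ih IT; pose g (l : 'I_(n.*2.+1)) : int := lev (wtl n l) - (n - h)%:Z.
have E (J : {set 'I_(n.*2.+1)}) : #|J| = h -> lev (wI J) = \sum_(l in J) g l + h%:Z * (n - h)%:Z.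
  move=> Jh; rewrite lev_wI /g big_split /= sumrN sumr_const Jh.
  by rewrite -mulr_natl natz subrK.
rewrite !E ?card_top// ltrD2r.
have gT l : l \in top n h -> 0 < g l.
  rewrite inE => /andP[ol lh]; rewrite /g lev_wtl; last by have := ltn_ord l; lia.
  by rewrite (negbTE ol); lia.
have gF l : l \notin top n h -> g l <= 0.
  rewrite inE negb_and negbK /g lev_wtl; last by have := ltn_ord l; lia.
  by case: ifP => /= [ol _|ol lh]; have := ltn_ord l; lia.
rewrite (big_setID (top n h)) /= finset.setIC [ltRHS](big_setID I) /=.
have : \sum_(l in I :\: top n h) g l <= 0.
  by apply: sumr_le0 => l; rewrite inE => /andP[/gF].
suff : 0 < \sum_(l in top n h :\: I) g l by rewrite ltrD2l => h1 h2; exact: le_lt_trans h2 h1.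
have /set0Pn[l lT] : top n h :\: I != finset.set0.
  apply: contra IT; rewrite finset.setD_eq0 => TI; rewrite eq_sym eqEcard TI /=.
  by rewrite card_top// Ih.
rewrite (bigD1 l)//=; apply: ltr_wpDr; first apply: sumr_ge0 => j.
  by rewrite inE => /andP[/andP[_ /gT /ltW]].
by apply: gT; move: lT; rewrite inE => /andP[].
Qed.

Definition adj n (M : 'M[R]_n.*2.+1) := frameV n *m toC M *m frame n.

(** In the basis [frame] the torus element is diagonal and multiplies the principal minor on [I] by
    the product of the eigenvalues in [I]. *)
Lemma eigsym_torus n h x (M : 'M[R]_n.*2.+1) :
  (eigsym h (torus_mx n x *m M))%:C%C =
  \sum_(I : {set 'I_(n.*2.+1)} | #|I| == h) pminor (adj M) I * chr (wI I) x :> C.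
Proof.
have toCM (A B : 'M[R]_n.*2.+1) : toC (A *m B) = toC A *m toC B.
  by rewrite (map_mxM (real_complex R)).
rewrite -[LHS](eigsym_map (real_complex R)) toCM -(eigsym_conj _ _ (frameK n)).
rewrite (_ : _ *m _ *m frame n = diag_mx (\row_j cis (ang n x j)) *m adj M); last first.
  rewrite -torus_diag /adj !mulmxA -(mulmxA _ (frame n) (frameV n)).
  by rewrite (mulmx1C (frameK n)) mulmx1.
apply: eq_bigr => I _; rewrite pminor_diag chr_wI mulrC; congr (_ * _).
by apply: eq_bigr => l _; rewrite mxE.
Qed.

(** The source of triangularity: the leading weight is the same for every [M], which enters the
    leading term through a scalar factor. *)
Lemma eigsym_leading n h (M : 'M[R]_n.*2.+1) : (h <= n)%N ->
  leading h (fun i : 'I_n => (i < h)%N%:Z) (pminor (adj M) (top n h))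
    (fun x => (eigsym h (torus_mx n x *m M))%:C%C).
Proof.
move=> hn; split; first by rewrite -wI_top (leq_trans (nrm_wI _))// card_top.
exists (fun x => \sum_(I : {set 'I_(n.*2.+1)} | (#|I| == h) && (I != top n h))
    pminor (adj M) I * chr (wI I) x); last first.
  by move=> x; rewrite eigsym_torus (bigD1 (top n h)) ?card_top//= wI_top.
apply: tpol_sum => I /andP[/eqP Ih IT]; apply: tpol_chr.
by rewrite -wI_top lev_top// -Ih nrm_wI.
Qed.

Lemma leading1 n : leading 0 (fun _ : 'I_n => 0) (1 : C) (fun=> 1).
Proof.
split; first by rewrite /nrm big1.
exists (fun=> 0); first exact: tpol0.
by move=> x; rewrite /chr big1 ?cis0 ?mulr1 ?addr0// => i _; rewrite mul0r.
Qed.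

Lemma leading_eq n k l k' l' (a a' : C) F F' : k = k' -> l =1 l' -> a = a' -> F =1 F' ->
  @leading R n k l a F -> leading k' l' a' F'.
Proof. by move=> -> /funext -> -> /funext ->. Qed.

Lemma leadingX n k (l : 'I_n -> int) (a : C) F e : leading k l a F ->
  leading (e * k) (fun i => e%:Z * l i) (a ^+ e) (fun x => F x ^+ e).
Proof.
move=> H; elim: e => [|e IH].
  by apply: leading_eq (leading1 n) => // i; rewrite mul0r.
apply: leading_eq (leadingM H IH) => [||//|x]; rewrite ?mulSn ?exprS// => i.
by rewrite intS mulrDl mul1r.
Qed.

Lemma leading_prod n (J : Type) (r : seq J) (k : J -> nat) (l : J -> 'I_n -> int) (a : J -> C) F :
  (forall j, leading (k j) (l j) (a j) (F j)) ->
  leading (\sum_(j <- r) k j) (fun i => \sum_(j <- r) l j i) (\prod_(j <- r) a j)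
    (fun x => \prod_(j <- r) F j x).
Proof.
move=> H; elim: r => [|j r IH].
  by apply: leading_eq (leading1 n) => // [|i||x]; rewrite big_nil.
by apply: leading_eq (leadingM (H j) IH) => // [|i||x]; rewrite big_cons.
Qed.

Definition em n (m : 'I_n -> nat) (A : 'M[R]_n.*2.+1) : R := \prod_(i < n) eigsym i.+1 A ^+ m i.
Definition Delta n h (M : 'M[R]_n.*2.+1) : C := pminor (adj M) (top n h).
(* [Phi m] is a highest weight function of weight [lam m], as a function on matrices. *)
Definition Phi n (m : 'I_n -> nat) (M : 'M[R]_n.*2.+1) : C := \prod_(i < n) Delta i.+1 M ^+ m i.
(** In the Young diagram attached to [m], the number of columns of height [i + 1] is [m i]; [degm]
    counts its boxes and [lam] lists its row lengths. *)
Definition degm n (m : 'I_n -> nat) : nat := \sum_(i < n) m i * i.+1.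
Definition lam n (m : 'I_n -> nat) : 'I_n -> int := fun j => \sum_(i < n) (m i)%:Z * (j < i.+1)%N%:Z.

Lemma em_leading n (m : 'I_n -> nat) (M : 'M[R]_n.*2.+1) :
  leading (degm m) (lam m) (Phi m M) (fun x => (em m (torus_mx n x *m M))%:C%C).
Proof.
have H (i : 'I_n) := leadingX (m i) (eigsym_leading M (ltn_ord i)).
apply: leading_eq (leading_prod _ H) => // x.
by rewrite /em [RHS](rmorph_prod (real_complex R)); apply: eq_bigr => i _; rewrite rmorphXn.
Qed.

End torus_weights.
Arguments wtl : clear implicits.

Section polynomials_on_the_torus.
Context {R : realType} {n : nat}.
Local Notation C := R[i].
Local Notation G := (SO R n.*2.+1).

Lemma entry_torus (x : nat -> R) i j : (torus_mx n x i j)%:C%C =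
  \sum_(l < n.*2.+1) frame n i l * frameV n l j * chr (wtl n l) x :> C.
Proof.
have := torus_diag n x; set D := diag_mx _ => DE.
have : frame n *m D *m frameV n = map_mx (fun x : R => x%:C%C) (torus_mx n x).
  by rewrite -DE -!mulmxA (mulmx1C (frameK n)) mulmx1 !mulmxA (mulmx1C (frameK n)) mul1mx.
move=> /matrixP/(_ i j); rewrite [RHS]mxE => <-; rewrite mxE; apply: eq_bigr => l _.
by rewrite /D mul_mx_diag !mxE mulrAC ang_wtl.
Qed.

Lemma pol_tpol k (f : G -> C) : pol k f ->
  tpol (fun w : 'I_n -> int => (nrm w <= k)%N) (fun x => f (torus n x)).
Proof.
elim=> {k f}[k c|k i j k0|k f g _ IHf _ IHg|k l f g _ IHf _ IHg].
- apply: (tpol_sub (S := fun w => w = fun=> 0)); last first.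
    have := @tpol_chr R n (fun w => w = fun=> 0) (fun=> 0) c erefl.
    congr tpol; apply/funext => x; rewrite /chr big1 ?cis0 ?mulr1// => i _.
    by rewrite mul0r.
  by move=> w ->; rewrite /nrm big1.
- rewrite [X in tpol _ X](funext (fun x => entry_torus x i j)).
  by apply: tpol_sum => l _; apply: tpol_chr; exact: leq_trans (nrm_wtl _ _) k0.
- exact: tpolD.
- apply: tpolM IHf IHg => w v wk vl; exact: leq_trans (nrmD _ _) (leq_add wk vl).
Qed.

Lemma eigsym_pol h : pol h (fun g : G => (eigsym h (SO_mx g))%:C%C).
Proof.
under eq_fun do rewrite /eigsym rmorph_sum /=.
apply: pol_sum => I /eqP Ih; under eq_fun do rewrite /pminor rmorph_sum /=.
apply: pol_sum => s _; under eq_fun do rewrite rmorphM rmorph_prod /=.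
apply: polZ; have := @pol_prod _ _ _ (index_enum 'I_n.*2.+1) (mem I) (fun=> 1%N)
    (fun i (x : G) => (SO_mx x i (s i))%:C%C : C) (fun i _ => pol_entry i (s i) (ltn0Sn 0)).
by rewrite sum1_card Ih.
Qed.

Lemma em_pol (m : 'I_n -> nat) : pol (degm m) (fun g : G => (em m (SO_mx g))%:C%C).
Proof.
under eq_fun do rewrite /em rmorph_prod /=.
apply: pol_prod => i _; under eq_fun do rewrite rmorphXn /=.
elim: (m i) => [|e IH]; first by under eq_fun do rewrite expr0; exact: pol_cst.
under eq_fun do rewrite exprS.
by rewrite mulSn; apply: polM IH; exact: eigsym_pol.
Qed.

Lemma em_conj (m : 'I_n -> nat) (V W A : 'M[R]_n.*2.+1) : V *m W = 1%:M -> em m (V *m A *m W) = em m A.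
Proof. by move=> VW; apply: eq_bigr => i _; rewrite eigsym_conj. Qed.

End polynomials_on_the_torus.

(** * Normal form of orthogonal matrices *)

Section orthogonal_matrices.
Context {R : realType}.

Definition orth n (V : 'M[R]_n) := V *m V^T = 1%:M.

Lemma orthC n (V : 'M[R]_n) : orth V -> V^T *m V = 1%:M.
Proof. exact: mulmx1C. Qed.

Lemma orthT n (V : 'M[R]_n) : orth V -> orth V^T.
Proof. by move=> oV; rewrite /orth trmxK orthC. Qed.

Lemma orthM n (V W : 'M[R]_n) : orth V -> orth W -> orth (V *m W).
Proof. by move=> oV oW; rewrite /orth trmx_mul mulmxA -(mulmxA V) oW mulmx1. Qed.

Lemma orth1 n : orth (1%:M : 'M[R]_n).
Proof. by rewrite /orth trmx1 mulmx1. Qed.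

Lemma orthN n (V : 'M[R]_n) : orth V -> orth (- V).
Proof. by move=> oV; rewrite /orth linearN /= mulmxN mulNmx opprK. Qed.

Lemma orth_det n (V : 'M[R]_n) : orth V -> \det V = 1 \/ \det V = -1.
Proof.
move=> /(congr1 determinant); rewrite det_mulmx det_tr det1 => /eqP.
by rewrite -expr2 sqrf_eq1 => /orP[] /eqP; [left|right].
Qed.

Lemma orth_block p m (A : 'M[R]_p) (B : 'M[R]_m) :
  orth A -> orth B -> orth (block_mx A 0 0 B : 'M[R]_(p + m)).
Proof.
move=> oA oB; rewrite /orth tr_block_mx mulmx_block !trmx0 !mul0mx !mulmx0 !addr0 !add0r.
by rewrite oA oB -scalar_mx_block.
Qed.

Lemma orth_dl0 p m (A : 'M[R]_(p + m)) : orth A -> dlsubmx A = 0 ->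
  [/\ A = block_mx (ulsubmx A) 0 0 (drsubmx A), orth (ulsubmx A) & orth (drsubmx A)].
Proof.
move=> oA dl; have oA' := orthC oA; have E := esym (submxK A); rewrite dl in E.
move: oA'; rewrite {1 2}E tr_block_mx mulmx_block trmx0 !mul0mx !mulmx0 !addr0 scalar_mx_block.
move=> /eq_block_mx[uu ur _ _].
have ur0 : ursubmx A = 0.
  by rewrite -[ursubmx A]mul1mx -(mulmx1C uu) -mulmxA ur mulmx0.
split; [by rewrite {1}E ur0|exact: mulmx1C|].
move: oA; rewrite {1 2}/orth E ur0 tr_block_mx mulmx_block !trmx0 !mul0mx !mulmx0 !add0r scalar_mx_block.
by move=> /eq_block_mx[_ _ _]; rewrite block_mxKdr.
Qed.

Definition sqn n (u : 'cV[R]_n) : R := (u^T *m u) 0 0.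

Lemma sqnE n (u : 'cV[R]_n) : u^T *m u = (sqn u)%:M.
Proof. exact: mx11_scalar. Qed.

Lemma sqn_sum n (u : 'cV[R]_n) : sqn u = \sum_i u i 0 ^+ 2.
Proof. by rewrite /sqn mxE; apply: eq_bigr => i _; rewrite mxE expr2. Qed.

Lemma sqn_gt0 n (u : 'cV[R]_n) : (0 < sqn u) = (u != 0).
Proof.
have h i : true -> 0 <= u i 0 ^+ 2 by rewrite sqr_ge0.
rewrite lt_def sqn_sum sumr_ge0 ?andbT//; congr (~~ _); apply/eqP/eqP => [/psumr_eq0P|-> ].
  by move=> H; apply/colP => i; rewrite mxE; apply/eqP; rewrite -sqrf_eq0 H.
by rewrite big1// => i _; rewrite mxE expr0n.
Qed.

Lemma unit_scale n (u : 'cV[R]_n) : u != 0 -> exists2 k : R, k != 0 & sqn (k *: u) = 1.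
Proof.
rewrite -sqn_gt0 => u0; exists (Num.sqrt (sqn u))^-1; first by rewrite invr_eq0 sqrtr_eq0 -ltNge.
rewrite sqn_sum; under eq_bigr do rewrite mxE exprMn.
by rewrite -big_distrr /= -sqn_sum exprVn sqr_sqrtr ?ltW// mulVf// gt_eqF.
Qed.

(** The reflection along the difference of [u] and the first basis vector; when they coincide the
    identity serves. *)
Lemma householder m (u : 'cV[R]_(1 + m)) : sqn u = 1 ->
  exists2 H : 'M[R]_(1 + m), orth H & H *m col_mx 1%:M 0 = u.
Proof.
move=> u1; pose e : 'cV[R]_(1 + m) := col_mx 1%:M 0.
have [->|ue] := eqVneq u e; first by exists 1%:M; rewrite ?mul1mx//; exact: orth1.
pose w := u - e; pose c := u 0 0; have w0 : w != 0 by rewrite subr_eq0.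
have et : e^T = row_mx 1%:M 0 by rewrite tr_col_mx trmx1 trmx0.
have eu : e^T *m u = c%:M.
  by rewrite et -[u]vsubmxK mul_row_col mul1mx mul0mx addr0 [LHS]mx11_scalar mxE lshift0.
have ue' : u^T *m e = c%:M by rewrite -[LHS]trmxK trmx_mul trmxK eu tr_scalar_mx.
have ee : e^T *m e = 1%:M by rewrite et mul_row_col mulmx1 mulmx0 addr0.
have wT : w^T = u^T - e^T by rewrite /w linearB.
have ww : w^T *m w = (2 - 2 * c)%:M.
  rewrite wT /w mulmxBl !mulmxBr eu ue' ee sqnE u1 -!raddfB /=; congr _%:M; ring.
have c1 : 2 - 2 * c != 0 by move: w0; rewrite -sqn_gt0 /sqn ww mxE eqxx mulr1n lt_def => /andP[].
have we : w^T *m e = (c - 1)%:M by rewrite wT mulmxBl ue' ee -raddfB.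
pose H := 1%:M - (2 / (2 - 2 * c)) *: (w *m w^T).
have HT : H^T = H by rewrite /H linearB /= linearZ /= trmx_mul trmxK trmx1.
exists H.
  rewrite /orth HT {1}/H mulmxBl mul1mx {1}/H -scalemxAl mulmxBr mulmx1.
  rewrite -scalemxAr !mulmxA -(mulmxA w w^T w) ww mul_mx_scalar -scalemxAl scalerA.
  by move: (w *m w^T) => Z; apply/matrixP => i j; rewrite !mxE; field.
rewrite -/e /H mulmxBl mul1mx -scalemxAl -mulmxA we mul_mx_scalar scalerA.
rewrite (_ : _ * (c - 1) = -1); last by field.
by rewrite scaleN1r opprK /w addrC subrK.
Qed.

(** Two reflections: one carries the first basis vector to the first column of [W], the other acts
    on the orthogonal complement. *)
Lemma complete_plane m (W : 'M[R]_(2 + m, 2)) : W^T *m W = 1%:M ->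
  exists2 V : 'M[R]_(2 + m), orth V & V *m col_mx 1%:M 0 = W.
Proof.
rewrite -[W](@hsubmxK _ _ 1 1); set u := lsubmx _; set v := rsubmx _ => /=.
have e1 : (1%:M : 'M[R]_2) = block_mx (1%:M : 'M[R]_1) 0 0 (1%:M : 'M[R]_1) := @scalar_mx_block _ 1 1 1.
move=> WW; rewrite e1 (@tr_row_mx _ _ 1 1) (@mul_col_row _ 1 1 _ 1 1) in WW.
move: WW => /(@eq_block_mx _ 1 1 1 1)[uu uv _ vv].
have sq1 k (z : 'cV[R]_k) : z^T *m z = 1%:M -> sqn z = 1 by rewrite /sqn => ->; rewrite mxE.
have [V1 oV1 V1u] := @householder m.+1 u (sq1 _ _ uu).
pose v' := V1^T *m (v : 'cV[R]_(1 + m.+1)).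
have v'0 : usubmx v' = 0.
  have : (col_mx 1%:M 0)^T *m v' = 0 by rewrite /v' mulmxA -trmx_mul V1u uv.
  by rewrite -{1}[v']vsubmxK tr_col_mx trmx1 trmx0 mul_row_col mul1mx mul0mx addr0.
have v'E : v' = col_mx 0 (dsubmx v') by rewrite -v'0 vsubmxK.
have v'1 : sqn (dsubmx v') = 1.
  apply: sq1; have : v'^T *m v' = 1%:M.
    by rewrite /v' trmx_mul trmxK -mulmxA (mulmxA V1) oV1 mul1mx vv.
  by rewrite {1 2}v'E tr_col_mx mul_row_col trmx0 mul0mx add0r.
have [V2 oV2 V2v] := @householder m (dsubmx v') v'1.
exists (V1 *m block_mx (1%:M : 'M[R]_1) 0 0 V2); first exact: orthM oV1 (orth_block (orth1 1) oV2).
(* The same matrix cut into [2 + m] rows on the left and into [1 + (1 + m)] rows on the right. *)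
have -> : (col_mx 1%:M 0 : 'M[R]_(2 + m, 2)) =
    row_mx (col_mx (1%:M : 'M[R]_1) (0 : 'M[R]_(1 + m, 1)))
      (col_mx (0 : 'M[R]_1) (col_mx (1%:M : 'M[R]_1) (0 : 'M[R]_(m, 1)))) :> 'M[R]_(1 + (1 + m), 1 + 1).
  apply/matrixP => i j; rewrite !mxE.
  have nb (b b' : bool) : b = b' -> b%:R = b'%:R :> R by move=> ->.
  have nb0 (b : bool) : b = false -> b%:R = 0 :> R by move=> ->.
  have F k (a b : 'I_k) : (a == b) = (a == b :> nat) by [].
  case: (@fintype.splitP 2 m i) => i1 Hi; case: (@fintype.splitP 1 1 j) => j1 Hj;
    rewrite !mxE; case: (@fintype.splitP 1 (1 + m) i) => i2 Hi2; rewrite !mxE;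
    try (case: (@fintype.splitP 1 m i2) => i3 Hi3; rewrite !mxE);
    have := ltn_ord j1; have := ltn_ord i1; have := ltn_ord i2 => l2 l1 lj;
    have Hj' : nat_of_ord (j : 'I_2) = _ := Hj; have Hi' : nat_of_ord (i : 'I_(2 + m)) = _ := Hi2;
    rewrite ?F ?F; try done; first [apply: nb|apply: nb0|apply/esym/nb0]; lia.
rewrite (@mul_mx_row _ _ _ 1 1) -!mulmxA.
rewrite [X in V1 *m X](_ : _ = col_mx 1%:M 0); last first.
  by rewrite (@mul_block_col R 1 (1 + m) 1 (1 + m) 1) mul1mx !mulmx0 addr0 mul0mx addr0.
rewrite V1u [X in V1 *m X](_ : _ = v') ?/v' ?mulmxA ?oV1 ?mul1mx//.
by rewrite (@mul_block_col R 1 (1 + m) 1 (1 + m) 1) !mul0mx mulmx0 !add0r V2v -v'E.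
Qed.

(** A complex eigenvector of [g^T] with eigenvalue [l] is one of [g + g^T] with eigenvalue
    [l + 1/l]. Symmetry makes the latter real, and then the real part or the imaginary part of the
    vector, whichever is nonzero, does the job. *)
Lemma symmetric_part_eigen m (g : 'M[R]_(m.+1)) : orth g ->
  exists (u : 'cV[R]_m.+1) (c : R), sqn u = 1 /\ g *m u + g^T *m u = (2 * c) *: u.
Proof.
move=> og; pose toC k (A : 'M[R]_k) := map_mx (fun x : R => x%:C%C) A.
have [l /eigenvalueP[v vl v0]] := eigenvalue_closed (toC _ g^T) (ltn0Sn m).
have toCM k (A B : 'M[R]_k) : toC k (A *m B) = toC k A *m toC k B by rewrite /toC (map_mxM (real_complex R)).
have gg : toC _ g^T *m toC _ g = 1%:M by rewrite -toCM orthC// [LHS](map_scalar_mx (real_complex R)).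
have vg : v = l *: (v *m toC _ g) by rewrite scalemxAl -vl -mulmxA gg mulmx1.
have l0 : l != 0 by apply: contra v0 => /eqP l0; rewrite vg l0 scale0r.
pose mu := l + l^-1; have vS : v *m toC _ (g + g^T) = mu *: v.
  rewrite [toC _ _](map_mxD (real_complex R)) mulmxDr vl [in LHS]addrC /mu scalerDl; congr (_ + _).
  by rewrite [in RHS]vg scalerA mulVf// scale1r.
pose a := map_mx (@complex.Re R) v; pose b := map_mx (@complex.Im R) v.
pose p := complex.Re mu; pose q := complex.Im mu.
have aS : a *m (g + g^T) = p *: a - q *: b.
  apply/rowP => i; have /rowP/(_ i)/(congr1 (@complex.Re R)) := vS.
  rewrite !mxE raddf_sum /= reM => <-; apply: eq_bigr => j _.
  by rewrite !mxE reM /= mulr0 subr0.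
have bS : b *m (g + g^T) = p *: b + q *: a.
  apply/rowP => i; have /rowP/(_ i)/(congr1 (@complex.Im R)) := vS.
  rewrite !mxE raddf_sum /= imM => <-; apply: eq_bigr => j _.
  by rewrite !mxE imM /= mulr0 add0r.
have ST : (g + g^T)^T = g + g^T by rewrite linearD /= trmxK addrC.
(* Symmetry of [g + g^T] evaluated on the real and imaginary parts yields
   [q (|a|^2 + |b|^2) = 0]. *)
have q0 : q = 0.
  have : a *m (g + g^T) *m b^T = (b *m (g + g^T) *m a^T)^T by rewrite !trmx_mul trmxK ST mulmxA.
  rewrite aS bS mulmxBl mulmxDl -!scalemxAl linearD /= !linearZ /= !trmx_mul !trmxK.
  have sa : sqn a^T = (a *m a^T) 0 0 by rewrite /sqn trmxK.
  have sb : sqn b^T = (b *m b^T) 0 0 by rewrite /sqn trmxK.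
  move: (a *m b^T) (a *m a^T) (b *m b^T) sa sb => X Y Z sa sb /matrixP/(_ 0 0).
  rewrite !mxE -sa -sb => H; have {H}/eqP : q * (sqn a^T + sqn b^T) = 0 by lra.
  rewrite mulf_eq0 => /orP[/eqP//|/eqP].
  have a_ge n (z : 'cV[R]_n) : 0 <= sqn z by rewrite sqn_sum sumr_ge0// => i _; exact: sqr_ge0.
  move=> ab0; have a0 : ~~ (0 < sqn a^T) by have := a_ge _ b^T; lra.
  have b0 : ~~ (0 < sqn b^T) by have := a_ge _ a^T; lra.
  exfalso; move: v0; rewrite sqn_gt0 negbK in a0; rewrite sqn_gt0 negbK in b0.
  case/negP; apply/eqP/rowP => i; rewrite mxE; apply: complex_ext => /=.
    by have /eqP/colP/(_ i) := a0; rewrite !mxE.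
  by have /eqP/colP/(_ i) := b0; rewrite !mxE.
have fin (z : 'rV[R]_m.+1) : z != 0 -> z *m (g + g^T) = p *: z ->
    exists (u : 'cV[R]_m.+1) (c : R), sqn u = 1 /\ g *m u + g^T *m u = (2 * c) *: u.
  move=> z0 zS; have zt0 : z^T != 0 by rewrite trmx_eq0.
  have [k k0 ku] := unit_scale zt0; exists (k *: z^T), (p / 2); split => //.
  rewrite -mulmxDl -scalemxAr -{1}ST -trmx_mul zS linearZ /= !scalerA; congr (_ *: _); by field.
have [a0|/fin] := eqVneq a 0; last by apply; rewrite aS q0 scale0r subr0.
have [b0|/fin] := eqVneq b 0; last by apply; rewrite bS q0 scale0r addr0.
case/negP: v0; apply/eqP/rowP => i; rewrite mxE; apply: complex_ext => /=.
  by move/rowP/(_ i): a0; rewrite !mxE.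
by move/rowP/(_ i): b0; rewrite !mxE.
Qed.

Definition has_plane N (g : 'M[R]_N) := exists (W : 'M[R]_(N, 2)) t,
  W^T *m W = 1%:M /\ g *m W = W *m rot2 t.

(** The relation [g u + g^T u = 2 c u] gives [g (g u) = 2 c (g u) - u], so [u] and [g u] span an
    invariant subspace: a plane rotated by [acos c], or a line on which [g] is a sign. *)
Lemma plane_or_fixed m (g : 'M[R]_m.+1) : orth g ->
  has_plane g \/ exists (u : 'cV[R]_m.+1) (e : bool), sqn u = 1 /\ g *m u = (-1) ^+ e *: u.
Proof.
move=> og; have [u [c [u1 gu]]] := symmetric_part_eigen og.
have uu : u^T *m u = 1%:M by rewrite sqnE u1.
have ugu : u^T *m (g *m u) = c%:M.
  have := congr1 (mulmx u^T) gu; rewrite mulmxDr -scalemxAr uu.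
  have -> : u^T *m (g^T *m u) = u^T *m (g *m u).
    by rewrite [LHS]mx11_scalar -tr_scalar_mx -mx11_scalar !trmx_mul !trmxK mulmxA.
  move=> /matrixP/(_ 0 0) H; rewrite [LHS]mx11_scalar; congr _%:M.
  by move: H; rewrite !mxE eqxx mulr1n; lra.
have ugTu : (g *m u)^T *m u = c%:M by rewrite -[LHS]trmxK trmx_mul trmxK ugu tr_scalar_mx.
have gugu : (g *m u)^T *m (g *m u) = 1%:M by rewrite trmx_mul -mulmxA (mulmxA g^T) orthC// mul1mx uu.
have ggu : g *m (g *m u) = (2 * c) *: (g *m u) - u.
  have := congr1 (mulmx g) gu; rewrite mulmxDr -scalemxAr (mulmxA g g^T) og mul1mx => <-.
  by rewrite addrK.
pose w := g *m u - c *: u.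
have ww : w^T *m w = (1 - c ^+ 2)%:M.
  have -> : w^T = (g *m u)^T - c *: u^T by rewrite /w linearB /= linearZ.
  rewrite /w mulmxBl !mulmxBr -!scalemxAl -!scalemxAr gugu ugu ugTu uu.
  by apply/matrixP => i j; rewrite !mxE; case: (i == j); rewrite ?mulr1n ?mulr0n; ring.
have [w0|w0] := eqVneq w 0.
  right; have /eqP : 1 - c ^+ 2 = 0.
    by have /matrixP/(_ 0 0) := ww; rewrite w0 mulmx0 !mxE eqxx mulr1n.
  have -> : 1 - c ^+ 2 = (1 - c) * (1 + c) by ring.
  have guE : g *m u = c *: u by apply/eqP; rewrite -subr_eq0 -/w w0.
  rewrite mulf_eq0 => /orP[] /eqP H; [exists u, false|exists u, true]; split => //; rewrite guE; congr (_ *: _).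
    by rewrite expr0; lra.
  by rewrite expr1; lra.
left; move: w0; rewrite -sqn_gt0 => w0; have sw : sqn w = 1 - c ^+ 2 by rewrite /sqn ww mxE eqxx mulr1n.
pose s := Num.sqrt (1 - c ^+ 2); have s0 : 0 < s by rewrite sqrtr_gt0 -sw.
have s2 : s ^+ 2 = 1 - c ^+ 2 by rewrite sqr_sqrtr// -sw ltW.
have c1 : -1 <= c <= 1 by have := sqr_ge0 s; rewrite s2; nra.
have sN0 : s != 0 by rewrite gt_eqF.
pose v := s^-1 *: w.
have uw : u^T *m w = 0 by rewrite /w mulmxBr ugu -scalemxAr uu scalemx1 subrr.
have uv : u^T *m v = 0 by rewrite /v -scalemxAr uw scaler0.
have vv : v^T *m v = 1%:M.
  have -> : v^T = s^-1 *: w^T by rewrite /v linearZ.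
  by rewrite /v -scalemxAl -scalemxAr ww -s2 scalerA scale_scalar_mx; congr _%:M; field.
have gu' : g *m u = c *: u + s *: v by rewrite /v scalerA divff// scale1r /w addrC subrK.
have gv : g *m v = - s *: u + c *: v.
  rewrite /v -scalemxAr {1}/w mulmxBr ggu -scalemxAr gu' /v !scalerDr !scalerA.
  rewrite scaleNr; apply/matrixP => i j; rewrite !mxE; have := s2.
  rewrite expr2 => s2'; have sE : s = (1 - c * c) / s by rewrite -(expr2 c) -s2' mulfK.
  by rewrite (_ : s * u i j = (1 - c * c) / s * u i j); [field|rewrite -sE].
exists (row_mx u v), (acos c); split.
  rewrite (@tr_row_mx _ _ 1 1) (@mul_col_row _ 1 1 _ 1 1) uu uv vv.
  rewrite (_ : v^T *m u = 0) -?(@scalar_mx_block _ 1 1)//.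
  by rewrite -[LHS]trmxK trmx_mul trmxK uv trmx0.
have cE : cos (acos c) = c by apply: acosK; rewrite in_itv.
have sE : sin (acos c) = s by rewrite sin_acos.
rewrite (@mul_mx_row _ _ _ 1 1) gu' gv -[rot2 _](@submxK _ 1 1 1 1) (@mul_row_block _ _ 1 1 1 1).
rewrite [ulsubmx _]mx11_scalar [dlsubmx _]mx11_scalar [ursubmx _]mx11_scalar [drsubmx _]mx11_scalar.
by rewrite !mul_mx_scalar !mxE /= cE sE.
Qed.

Lemma split_fixed m (g : 'M[R]_(1 + m)) (u : 'cV[R]_(1 + m)) (e : bool) :
  orth g -> sqn u = 1 -> g *m u = (-1) ^+ e *: u ->
  exists (V : 'M[R]_(1 + m)) (g' : 'M[R]_m), [/\ orth V, orth g',
    V *m col_mx 1%:M 0 = u, g *m V = V *m block_mx ((-1) ^+ e)%:M 0 0 g' & \det g = (-1) ^+ e * \det g'].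
Proof.
move=> og u1 gu; have [V oV Vu] := householder u1.
pose A := V^T *m g *m V; have oA : orth A by rewrite /A; apply: orthM => //; apply: orthM => //; exact: orthT.
have Ae : A *m col_mx 1%:M 0 = col_mx ((-1) ^+ e)%:M 0.
  rewrite /A -mulmxA Vu -mulmxA gu -Vu -scalemxAr mulmxA orthC// mul1mx scale_col_mx scaler0.
  by rewrite scalemx1.
have [Aul Adl] : ulsubmx A = ((-1) ^+ e)%:M /\ dlsubmx A = 0.
  move: Ae; rewrite -{1}[A]submxK mul_block_col !mulmx1 !mulmx0 !addr0.
  by move=> /eq_col_mx.
have [AE _ oD] := orth_dl0 oA Adl; exists V, (drsubmx A).
have gV : g *m V = V *m block_mx ((-1) ^+ e)%:M 0 0 (drsubmx A).
  by rewrite -Aul -AE /A !mulmxA oV mul1mx.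
split => //; have := congr1 determinant gV; rewrite !det_mulmx det_ublock det_scalar1.
by rewrite mulrC; apply: mulfI; case: (orth_det oV) => ->; rewrite ?oppr_eq0 oner_neq0.
Qed.

Lemma has_plane_block p m (V g : 'M[R]_(p + m)) (A : 'M[R]_p) g' :
  orth V -> g *m V = V *m block_mx A 0 0 g' -> has_plane g' -> has_plane g.
Proof.
move=> oV gV [W [t [WW gW]]]; exists (V *m col_mx 0 W), t; split.
  by rewrite trmx_mul -mulmxA (mulmxA V^T) orthC// mul1mx tr_col_mx trmx0 mul_row_col mul0mx add0r WW.
rewrite mulmxA gV -!mulmxA mul_block_col mul_col_mx !mul0mx !mulmx0 !add0r.
by rewrite gW.
Qed.

(** Orthogonality and [\det g = -1] force [\det (g^T + 1)] to equal its own opposite. *)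
Lemma eigenN1 m (g : 'M[R]_m) : orth g -> \det g = -1 ->
  exists u : 'cV[R]_m, sqn u = 1 /\ g *m u = - u.
Proof.
move=> og dg; have : \det (g^T + 1%:M) = 0.
  have : \det (g^T + 1%:M) = - \det (g^T + 1%:M).
    rewrite -{1}(orthC og) -{1}[g^T]mulmx1 -mulmxDr det_mulmx det_tr dg mulN1r.
    by rewrite -[in LHS]det_tr linearD /= trmx1 addrC.
  by lra.
move=> /eqP/det0P[v v0 vg]; have vt0 : v^T != 0 by rewrite trmx_eq0.
have [k _ ku] := unit_scale vt0; exists (k *: v^T); split => //.
have vg' : v *m g^T = - v by apply/eqP; rewrite -subr_eq0 opprK -[X in _ + X]mulmx1 -mulmxDr vg.
by rewrite -scalemxAr -[g]trmxK -trmx_mul vg' linearN /= scalerN.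
Qed.

Lemma two_fixed_plane m (g : 'M[R]_m) (u v : 'cV[R]_m) (e : bool) :
  u^T *m u = 1%:M -> v^T *m v = 1%:M -> u^T *m v = 0 ->
  g *m u = (-1) ^+ e *: u -> g *m v = (-1) ^+ e *: v -> has_plane g.
Proof.
move=> uu vv uv gu gv; exists (row_mx u v), (if e then pi else 0); split.
  rewrite (@tr_row_mx _ _ 1 1) (@mul_col_row _ 1 1 _ 1 1) uu uv vv.
  rewrite (_ : v^T *m u = 0) -?(@scalar_mx_block _ 1 1)//.
  by rewrite -[LHS]trmxK trmx_mul trmxK uv trmx0.
rewrite (@mul_mx_row _ _ _ 1 1) gu gv -[rot2 _](@submxK _ 1 1 1 1) (@mul_row_block _ _ 1 1 1 1).
rewrite [ulsubmx _]mx11_scalar [dlsubmx _]mx11_scalar [ursubmx _]mx11_scalar [drsubmx _]mx11_scalar.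
rewrite !mul_mx_scalar !mxE /=.
by case: e {gu gv}; rewrite ?expr1 ?expr0 ?cospi ?sinpi ?cos0 ?sin0 ?oppr0 ?scale0r ?addr0 ?add0r.
Qed.

(** Without a rotated plane two real eigenvectors [u], [v] split off. Equal signs make their span a
    plane rotated by 0 or pi. Opposite signs leave a block of determinant -1, whose eigenvector for
    -1 is paired with the one of [u], [v] that also has sign -1. *)
Lemma plane_exists k (g : 'M[R]_(k.+1.*2.+1)) : orth g -> \det g = 1 -> has_plane g.
Proof.
move=> og dg; have [//|[u [e [u1 gu]]]] := plane_or_fixed og.
have [V [g1 [oV og1 Vu gV]]] := @split_fixed k.+1.*2 g u e og u1 gu; rewrite dg => dg1.
have [hp|[v [e' [v1 gv]]]] := @plane_or_fixed k.*2.+1 g1 og1.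
  exact: (@has_plane_block 1 k.+1.*2 V g _ _ oV gV hp).
have two (w : 'cV[R]_(k.+1.*2)) (f : bool) : f = e -> sqn w = 1 -> g1 *m w = (-1) ^+ f *: w -> has_plane g.
  move=> -> w1 gw; apply: (@two_fixed_plane _ g u (V *m col_mx 0 w) e) => //.
  - by rewrite sqnE u1.
  - by rewrite trmx_mul -mulmxA (mulmxA V^T) orthC// mul1mx tr_col_mx trmx0 mul_row_col mul0mx add0r sqnE w1.
  - rewrite -Vu trmx_mul -mulmxA (mulmxA V^T) orthC// mul1mx tr_col_mx trmx0 mul_row_col.
    by rewrite mulmx0 mul0mx addr0.
  - by rewrite mulmxA gV -mulmxA mul_block_col !mulmx0 mul0mx !add0r gw scalemxAr scale_col_mx scaler0.
have [e'e|ee'] := eqVneq e' e; first exact: two e'e v1 gv.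
have [V1 [g2 [oV1 og2 V1v g1V]]] := @split_fixed k.*2.+1 g1 v e' og1 v1 gv => dg2.
have dg2' : \det g2 = -1.
  have eb : (-1) ^+ e * (-1) ^+ e' = -1 :> R.
    by case: e e' ee' {gu gV dg1 gv g1V dg2 two} => [] [] //= _; rewrite ?expr0 ?expr1 ?mulr1 ?mul1r.
  by move: dg1; rewrite dg2 mulrA eb mulN1r => ->; rewrite opprK.
have [w [w1 gw]] := eigenN1 og2 dg2'.
pose z := V1 *m (col_mx 0 w : 'cV[R]_(1 + k.*2.+1)).
have z1 : z^T *m z = 1%:M.
  by rewrite trmx_mul -mulmxA (mulmxA V1^T) orthC// mul1mx tr_col_mx trmx0 mul_row_col mul0mx add0r sqnE w1.
have gz : g1 *m z = (-1) ^+ true *: z.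
  rewrite mulmxA g1V -mulmxA mul_block_col !mulmx0 mul0mx !add0r gw expr1 scaleN1r -mulmxN.
  by rewrite opp_col_mx oppr0.
case: e' ee' gv g1V {dg2} => ee' gv g1V; last first.
  by apply: (two z true); rewrite ?/sqn ?z1 ?mxE//; case: e ee' {gu gV dg1 two}.
apply: (@has_plane_block 1 k.+1.*2 V g _ _ oV gV).
apply: (@two_fixed_plane _ g1 v z true) => //; first by rewrite sqnE v1.
rewrite -V1v trmx_mul -mulmxA (mulmxA V1^T) orthC// mul1mx tr_col_mx trmx0 mul_row_col.
by rewrite mulmx0 mul0mx addr0.
Qed.

Lemma normal_form n (g : 'M[R]_(n.*2.+1)) : orth g -> \det g = 1 ->
  exists (V : 'M[R]_(n.*2.+1)) x, orth V /\ g *m V = V *m torus_mx n x.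
Proof.
elim: n g => [|k IH] g og dg.
  exists 1%:M, (fun=> 0); split; first exact: orth1.
  rewrite mulmx1 mul1mx /=; move: dg; rewrite (mx11_scalar g) det_scalar1 => ->.
  by rewrite ?mul1mx.
have [W [t [WW gW]]] := plane_exists og dg.
have [V oV VW] := @complete_plane k.*2.+1 W WW.
pose A : 'M[R]_(2 + k.*2.+1) := V^T *m g *m V.
have oA : orth A by rewrite /A; apply: orthM => //; apply: orthM => //; exact: orthT.
have Ae : A *m col_mx 1%:M 0 = col_mx (rot2 t) 0.
  rewrite /A -mulmxA VW -mulmxA gW -VW !mulmxA orthC// mul1mx.
  by rewrite mul_col_mx mul1mx mul0mx.
have [Aul Adl] : ulsubmx A = rot2 t /\ dlsubmx A = 0.
  move: Ae; rewrite -{1}[A]submxK mul_block_col !mulmx1 !mulmx0 !addr0.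
  by move=> /eq_col_mx.
have [AE _ oD] := orth_dl0 oA Adl.
have gV : g *m V = V *m block_mx (rot2 t) 0 0 (drsubmx A).
  by rewrite -Aul -AE /A !mulmxA oV mul1mx.
have dD : \det (drsubmx A) = 1.
  have := congr1 determinant gV; rewrite !det_mulmx (@det_ublock _ 2 k.*2.+1) det_rot2 dg !mul1r -{1}[\det V]mulr1.
  by move/esym; apply: mulfI; case: (orth_det oV) => ->; rewrite ?oppr_eq0 oner_neq0.
have [V' [x [oV' DV]]] := IH _ oD dD.
exists (V *m block_mx 1%:M 0 0 V'), (fun i => if i is j.+1 then x j else t); split.
  exact: orthM oV (orth_block (orth1 2) oV').
change (g *m (V *m block_mx 1%:M 0 0 V') = V *m block_mx 1%:M 0 0 V' *m
  (block_mx (rot2 t) 0 0 (torus_mx k x) : 'M[R]_(2 + k.*2.+1))).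
rewrite mulmxA gV -!mulmxA !mulmx_block !mul1mx !mulmx1 !mul0mx !mulmx0 !addr0 !add0r.
by rewrite DV.
Qed.

(** With [flipn], the generators of the Weyl group of signed permutations, acting on the angles. *)
Definition swapn i (x : nat -> R) : nat -> R :=
  fun j => if j == i then x i.+1 else if j == i.+1 then x i else x j.

Definition flipn i (x : nat -> R) : nat -> R := fun j => if j == i then - x i else x j.

Lemma torus_swap n i x : (i.+1 < n)%N ->
  exists2 V : 'M[R]_(n.*2.+1), orth V & V *m torus_mx n x = torus_mx n (swapn i x) *m V.
Proof.
elim: i n x => [|i IH] [|k]// x ik.
  case: k ik => [//|k] _.
  pose V : 'M[R]_(2 + (2 + k.*2.+1)) :=
    block_mx 0 (row_mx 1%:M 0) (col_mx 1%:M 0) (block_mx 0 0 0 1%:M).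
  exists V.
    suff oV : @orth (2 + (2 + k.*2.+1)) V by exact: oV.
    rewrite /orth /V !tr_block_mx tr_row_mx tr_col_mx !trmx0 !trmx1 mulmx_block.
    rewrite !(mul_row_col, mul_col_row, mulmx_block, mul_row_block, mul_block_col, mulmx0, mul0mx,
      mul1mx, mulmx1, addr0, add0r, add_block_mx, row_mx0, col_mx0).
    by rewrite -!scalar_mx_block.
  change (V *m (block_mx (rot2 (x 0%N)) 0 0 (block_mx (rot2 (x 1%N)) 0 0 (torus_mx k (fun i => x i.+2)) : 'M[R]_(2 + k.*2.+1))) =
    (block_mx (rot2 (x 1%N)) 0 0 (block_mx (rot2 (x 0%N)) 0 0 (torus_mx k (fun i => x i.+2)) : 'M[R]_(2 + k.*2.+1))) *m V).
  rewrite /V.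
  by rewrite !(mul_row_col, mul_col_row, mulmx_block, mul_row_block, mul_block_col, mul_col_mx, mul_mx_row,
      mulmx0, mul0mx, mul1mx, mulmx1, addr0, add0r, add_block_mx, row_mx0, col_mx0).
have [V oV VT] := IH k (fun j => x j.+1) ik.
exists (block_mx 1%:M 0 0 V : 'M[R]_(2 + k.*2.+1)); first exact: orth_block (orth1 2) oV.
change ((block_mx 1%:M 0 0 V : 'M[R]_(2 + k.*2.+1)) *m block_mx (rot2 (x 0%N)) 0 0 (torus_mx k (fun j => x j.+1)) =
  block_mx (rot2 (x 0%N)) 0 0 (torus_mx k (swapn i (fun j => x j.+1))) *m block_mx 1%:M 0 0 V).
by rewrite !mulmx_block !mulmx0 !mul0mx !mul1mx !mulmx1 !addr0 !add0r VT.
Qed.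

Lemma torus_flip n i x : (i < n)%N ->
  exists2 V : 'M[R]_(n.*2.+1), orth V & V *m torus_mx n x = torus_mx n (flipn i x) *m V.
Proof.
elim: i n x => [|i IH] [|k]// x ik.
  pose s : 'M[R]_2 := \matrix_(i, j) if i == j then (-1) ^+ i else 0.
  exists (block_mx s 0 0 1%:M : 'M[R]_(2 + k.*2.+1)).
    suff os : orth s by exact: orth_block os (orth1 _).
    apply/matrixP => i j; rewrite !mxE !big_ord_recl big_ord0 !mxE.
    by case: i => [[|[|//]] ?]; case: j => [[|[|//]] ?]; rewrite /= ?expr0 ?expr1; ring.
  change ((block_mx s 0 0 1%:M : 'M[R]_(2 + k.*2.+1)) *m block_mx (rot2 (x 0%N)) 0 0 (torus_mx k (fun j => x j.+1)) =
    block_mx (rot2 (- x 0%N)) 0 0 (torus_mx k (fun j => x j.+1)) *m block_mx s 0 0 1%:M).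
  rewrite !mulmx_block !mulmx0 !mul0mx !mul1mx !mulmx1 !addr0 !add0r; congr block_mx.
  apply/matrixP => i j; rewrite !mxE !big_ord_recl !big_ord0 !mxE cosN sinN.
  by case: i => [[|[|//]] ?]; case: j => [[|[|//]] ?]; rewrite /= ?expr0 ?expr1; ring.
have [V oV VT] := IH k (fun j => x j.+1) ik.
exists (block_mx 1%:M 0 0 V : 'M[R]_(2 + k.*2.+1)); first exact: orth_block (orth1 2) oV.
change ((block_mx 1%:M 0 0 V : 'M[R]_(2 + k.*2.+1)) *m block_mx (rot2 (x 0%N)) 0 0 (torus_mx k (fun j => x j.+1)) =
  block_mx (rot2 (x 0%N)) 0 0 (torus_mx k (flipn i (fun j => x j.+1))) *m block_mx 1%:M 0 0 V).
by rewrite !mulmx_block !mulmx0 !mul0mx !mul1mx !mulmx1 !addr0 !add0r VT.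
Qed.

End orthogonal_matrices.

(** * Class functions and the triangular convolution operators *)

Section linear_span.
Context {d} {T : measurableType d} {R : realType} (P : probability T R).
Implicit Types (f g : T -> R) (b : nat -> T -> R).

Definition lspan k b f := exists c : nat -> R, forall x, f x = \sum_(j < k) c j * b j x.

Lemma lspanS k b f : lspan k b f -> lspan k.+1 b f.
Proof.
move=> [c E]; exists (fun j => if (j < k)%N then c j else 0) => x.
rewrite big_ord_recr /= ltnn mul0r addr0 E; apply: eq_bigr => j _.
by rewrite ltn_ord.
Qed.

Lemma lspan_le k l b f : (k <= l)%N -> lspan k b f -> lspan l b f.
Proof. by move=> kl H; rewrite -(subnKC kl); elim: (l - k)%N => [|i IH]; rewrite ?addn0// addnS; exact: lspanS. Qed.

Lemma lspan_nth k b j : (j < k)%N -> lspan k b (b j).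
Proof.
move=> jk; exists (fun i => (i == j)%:R) => x; rewrite (bigD1 (Ordinal jk))//= eqxx mul1r.
rewrite big1 ?addr0// => i ij; rewrite (_ : (_ == _) = false) ?mul0r//.
by apply: contraNF ij => /eqP ij; apply/eqP/val_inj.
Qed.

Lemma lspanD k b f g : lspan k b f -> lspan k b g -> lspan k b (fun x => f x + g x).
Proof.
move=> [c E] [c' E']; exists (fun j => c j + c' j) => x.
by rewrite E E' -big_split; apply: eq_bigr => j _; rewrite mulrDl.
Qed.

Lemma lspanZ k b a f : lspan k b f -> lspan k b (fun x => a * f x).
Proof.
by move=> [c E]; exists (fun j => a * c j) => x; rewrite E big_distrr /=; apply: eq_bigr => j _; rewrite mulrA.
Qed.

Lemma lspanB k b f g : lspan k b f -> lspan k b g -> lspan k b (fun x => f x - g x).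
Proof.
move=> Hf /(lspanZ (-1)) Hg; have := lspanD Hf Hg.
by congr (lspan k b); apply/funext => x; rewrite mulN1r.
Qed.

Lemma lspan0 k b : lspan k b (fun=> 0).
Proof. by exists (fun=> 0) => x; rewrite big1// => j _; rewrite mul0r. Qed.

Lemma lspan_sum k b (I : Type) (r : seq I) (p : pred I) (F : I -> T -> R) :
  (forall i, p i -> lspan k b (F i)) -> lspan k b (fun x => \sum_(i <- r | p i) F i x).
Proof.
move=> bF; elim: r => [|i r IH].
  by under eq_fun do rewrite big_nil; exact: lspan0.
under eq_fun do rewrite big_cons.
by case pi : (p i) => //; apply: lspanD => //; exact: bF.
Qed.

Lemma lspan_recr k b f : lspan k.+1 b f ->
  exists a f', lspan k b f' /\ forall x, f x = f' x + a * b k x.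
Proof.
move=> [c E]; exists (c k), (fun x => \sum_(j < k) c j * b j x); split; first by exists c.
by move=> x; rewrite E big_ord_recr.
Qed.

Lemma lspan_bm k b f : (forall j, (j < k)%N -> bm (b j)) -> lspan k b f -> bm f.
Proof.
move=> bb [c E]; rewrite (funext E : f = _); apply: bm_sum => j _.
by apply: bmM; [exact: bm_cst|exact: bb].
Qed.

Lemma lspan_ind k b (Q : (T -> R) -> Prop) : Q (fun=> 0) ->
  (forall a f g, Q f -> Q g -> Q (fun x => f x + a * g x)) -> (forall j, (j < k)%N -> Q (b j)) ->
  forall f, lspan k b f -> Q f.
Proof.
move=> Q0 Qlin Qb f [c E]; rewrite (funext E : f = _) {E}.
elim: k Qb => [|k IH] Qb.
  by under eq_fun do rewrite big_ord0.
under eq_fun do rewrite big_ord_recr /=.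
by apply: Qlin; [apply: IH => j jk; apply: Qb; exact: leqW|exact: Qb].
Qed.

Lemma Ex_lin f g a : bm f -> bm g -> Ex P (fun x => f x + a * g x) = Ex P f + a * Ex P g.
Proof. by move=> bf bg; rewrite ExD ?ExZ//; apply: bmM => //; exact: bm_cst. Qed.

Lemma Ex_sqr0 f g : bm f -> bm g -> Ex P (fun x => g x * g x) = 0 -> Ex P (fun x => f x * g x) = 0.
Proof.
move=> bf bg g0; apply/eqP; rewrite -sqrf_eq0 eq_le sqr_ge0 andbT.
have := Ex_sqr_le P bf bg.
by rewrite (_ : (fun x => g x ^+ 2) = fun x => g x * g x) ?g0 ?mulr0.
Qed.

(** Gram-Schmidt without linear independence: the residual [be] of the new function may have norm
    zero. *)
Lemma orth_projection k b g : (forall j, (j < k)%N -> bm (b j)) -> bm g ->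
  exists2 p, lspan k b p & forall f, lspan k b f -> Ex P (fun x => (g x - p x) * f x) = 0.
Proof.
elim: k g => [|k IH] g bb bg.
  exists (fun=> 0); first exact: lspan0.
  move=> f [c E]; rewrite (_ : (fun x => _) = fun=> 0) ?Ex_cst//; apply/funext => x.
  by rewrite E big_ord0 mulr0.
have bb' j : (j < k)%N -> bm (b j) by move=> jk; apply: bb; exact: leqW.
have bk : bm (b k) by exact: bb.
have [q sq q0] := IH (b k) bb' bk; have [p sp p0] := IH g bb' bg.
have bq := lspan_bm bb' sq; have bp := lspan_bm bb' sp.
pose be x := b k x - q x; have bbe : bm be by exact: bmB.
pose r x := g x - p x; have br : bm r by exact: bmB.
pose n2 := Ex P (fun x => be x * be x).
pose a := Ex P (fun x => r x * be x) / n2.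
have aE : Ex P (fun x => r x * be x) = a * n2.
  (* For a residual of norm zero the inner product with it vanishes by Cauchy-Schwarz, so any
     coefficient is right, including the default value of [a]. *)
  have [n0|n0] := eqVneq n2 0; last by rewrite /a divfK.
  by rewrite n0 mulr0; apply: Ex_sqr0.
exists (fun x => p x + a * be x).
  apply: lspanD; [exact: lspanS|apply/lspanZ/lspanB; [exact: lspan_nth|exact: lspanS]].
move=> f /lspan_recr[c [f' [sf' fE]]]; have bf' := lspan_bm bb' sf'.
pose s x := f' x + c * q x; have ss : lspan k b s by apply: lspanD => //; exact: lspanZ.
have bs := lspan_bm bb' ss.
have E x : (g x - (p x + a * be x)) * f x = (r x * s x + (- a) * (be x * s x)) + c * (r x * be x + (- a) * (be x * be x)).
  by rewrite fE /r /s /be; ring.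
rewrite (funext E) !Ex_lin; try by [exact: bmM|apply: bmD; [exact: bmM|apply: bmM; [exact: bm_cst|exact: bmM]]].
by rewrite p0// q0// aE /n2; ring.
Qed.

Lemma sqrD_le (t u p q a e : R) : 0 <= p -> 0 <= q -> 0 <= a -> 0 <= e ->
  t ^+ 2 <= p * a -> u ^+ 2 <= q * e -> (t + u) ^+ 2 <= (p + q) * (a + e).
Proof.
move=> p0 q0 a0 e0 tp uq.
have h : (2 * (t * u)) ^+ 2 <= (p * e + q * a) ^+ 2.
  apply: (@le_trans _ _ (4 * ((p * a) * (q * e)))).
    rewrite !exprMn (_ : 2 ^+ 2 = 4 :> R); last by ring.
    by rewrite ler_pM2l// ler_pM ?sqr_ge0.
  by have := sqr_ge0 (p * e - q * a); nra.
have : 2 * (t * u) <= p * e + q * a.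
  apply: le_trans (ler_norm _) _; rewrite -(@ler_pXn2r _ 2) ?nnegrE ?addr_ge0 ?mulr_ge0//.
  by rewrite real_normK// num_real.
by nra.
Qed.

(** The squared trace of a kernel of rank [k] is at most [k] times its squared Hilbert-Schmidt norm.
    Induction on the rank: once [b k] is made orthogonal to the other [b j], the Hilbert-Schmidt
    norm splits by Pythagoras, and [sqrD_le] adds the two estimates. *)
Lemma rank_trace_le k (a b : nat -> T -> R) (h : T -> T -> R) :
  (forall j, (j < k)%N -> bm (a j)) -> (forall j, (j < k)%N -> bm (b j)) ->
  (forall x y, h x y = \sum_(j < k) a j x * b j y) ->
  (Ex P (fun x => h x x)) ^+ 2 <= k%:R * Ex P (fun x => Ex P (fun y => h x y ^+ 2)).
Proof.
elim: k a h => [|k IH] a h ba bb hE.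
  rewrite (_ : (fun x => h x x) = fun=> 0); last by apply/funext => x; rewrite hE big_ord0.
  by rewrite Ex_cst expr0n mul0r.
have bb' j : (j < k)%N -> bm (b j) by move=> jk; apply: bb; exact: leqW.
have ba' j : (j < k)%N -> bm (a j) by move=> jk; apply: ba; exact: leqW.
have bk : bm (b k) by exact: bb.
have ak : bm (a k) by exact: ba.
have [q sq q0] := orth_projection bb' bk; have bq := lspan_bm bb' sq.
pose be x := b k x - q x; have bbe : bm be by exact: bmB.
(* Replacing [b k] by its residual moves the multiple [c j] of [a k] into the coefficient of
   [b j]. *)
case: (sq) => c cE; pose a' j x := a j x + c j * a k x.
have ba2 j : (j < k)%N -> bm (a' j).
  by move=> jk; apply: bmD; [exact: ba'|apply: bmM => //; exact: bm_cst].
pose h' x y := \sum_(j < k) a' j x * b j y.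
have hh' x y : h x y = h' x y + a k x * be y.
  rewrite hE big_ord_recr /= /h' /be cE mulrBr big_distrr /= addrCA -sumrB addrC; congr (_ + _).
  by apply: eq_bigr => j _; rewrite /a'; ring.
have sh' x : lspan k b (h' x) by exists (fun j => a' j x).
have bh' x : bm (h' x) := lspan_bm bb' (sh' x).
have bhd : bm (fun x => h' x x).
  by apply: bm_sum => j _; apply: bmM; [exact: ba2|exact: bb'].
set n2 := Ex P (fun y => be y ^+ 2).
have HS x : Ex P (fun y => h x y ^+ 2) = Ex P (fun y => h' x y ^+ 2) + n2 * a k x ^+ 2.
  have E y : h x y ^+ 2 = (h' x y ^+ 2 + (2 * a k x) * (be y * h' x y)) + a k x ^+ 2 * be y ^+ 2.
    by rewrite hh'; ring.
  rewrite (funext E) !Ex_lin; try by [exact: bmX|exact: bmM|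
    apply: bmD; [exact: bmX|apply: bmM; [exact: bm_cst|exact: bmM]]].
  by rewrite (q0 _ (sh' x)) /n2; ring.
have bHS' : bm (fun x => Ex P (fun y => h' x y ^+ 2)).
  have E x : Ex P (fun y => h' x y ^+ 2) = \sum_(i < k) \sum_(j < k) a' i x * a' j x * Ex P (fun y => b i y * b j y).
    have E y : h' x y ^+ 2 = \sum_(i < k) \sum_(j < k) (a' i x * a' j x) * (b i y * b j y).
      rewrite expr2 /h' big_distrl /=; apply: eq_bigr => i _; rewrite big_distrr /=.
      by apply: eq_bigr => j _; ring.
    rewrite (funext E) Ex_sum => [|i _].
      apply: eq_bigr => i _; rewrite Ex_sum => [|j _].
        by apply: eq_bigr => j _; rewrite ExZ//; apply: bmM; exact: bb'.
      by apply: bmM; [exact: bm_cst|apply: bmM; exact: bb'].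
    by apply: bm_sum => j _; apply: bmM; [exact: bm_cst|apply: bmM; exact: bb'].
  rewrite (funext E); apply: bm_sum => i _; apply: bm_sum => j _.
  by apply: bmM; [apply: bmM; exact: ba2|exact: bm_cst].
rewrite (funext HS) Ex_lin//; last exact: bmX.
have E x : h x x = h' x x + 1 * (a k x * be x) by rewrite hh' mul1r.
rewrite (funext E) Ex_lin//; last exact: bmM.
rewrite mul1r -[k.+1%:R]natr1; apply: sqrD_le => //.
- by apply: Ex_ge0 => x; apply: Ex_ge0 => y; exact: sqr_ge0.
- by rewrite mulr_ge0//; apply: Ex_ge0 => x; exact: sqr_ge0.
- exact: (IH a' h').
- by rewrite mul1r mulrC; exact: Ex_sqr_le.
Qed.

End linear_span.

Section translation_spans.
Context {R : realType} {m : nat} (nu : probability (SO R m) R) (nuH : is_haar nu).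
Local Notation C := R[i].
Local Notation G := (SO R m).
Implicit Types (f g : G -> R).

(** Apply the trace inequality to the kernel [f (x^-1 y)]: its diagonal is constantly [f 1], and by
    invariance each row has mean square that of [f]. For a character this bounds the square of the
    degree by the number of separating functions, which stands in for Schur orthogonality. *)
Lemma eval_le (J : finType) (a b : J -> G -> R) f :
  (forall j, bm (a j)) -> (forall j, bm (b j)) -> bm f ->
  (forall x y : G, f (x * y)%g = \sum_j a j x * b j y) ->
  f 1%g ^+ 2 <= #|J|%:R * Ex nu (fun x => f x ^+ 2).
Proof.
move=> ba bb bf fE; have [J0|J0] := posnP #|J|.
  rewrite -[1%g](mulg1 1%g) fE big1 ?expr0n ?J0 ?mul0r// => j.
  by have := fintype0 j J0.
have j0 : J by apply: (enum_val (Ordinal J0)).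
pose n (k : nat) : J := nth j0 (enum J) k.
have := @rank_trace_le _ _ _ nu #|J| (fun k x => a (n k) (x^-1)%g) (fun k => b (n k))
   (fun x y => f (x^-1 * y)%g) _ _ _.
rewrite (_ : (fun x : G => f (x^-1 * x)%g) = fun=> f 1%g); last by apply/funext => x; rewrite mulVg.
rewrite Ex_cst (_ : (fun x : G => Ex nu _) = fun=> Ex nu (fun x => f x ^+ 2)); last first.
  apply/funext => x; exact: (Ex_mull nuH (x^-1)%g (bmX 2 bf)).
rewrite Ex_cst; apply.
- by move=> j _; apply: bm_comp; [exact: ba|exact: measurable_inv].
- by move=> j _; exact: bb.
- move=> x y; rewrite fE [LHS](reindex (fun k : 'I_#|J| => enum_val k)) /=.
    by apply: eq_bigr => k _; rewrite /n (enum_val_nth j0).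
  by exists enum_rank => k _; rewrite ?enum_valK ?enum_rankK.
Qed.

Definition rpol k f := pol k (fun g : G => (f g)%:C%C).

Lemma rpol_bm k f : rpol k f -> bm f.
Proof. by move=> /pol_bmc[]. Qed.

(** Evaluation at a point is controlled by the mean square, so a polynomial that vanishes almost
    everywhere vanishes everywhere. *)
Lemma rpol_null k f : rpol k f -> Ex nu (fun x => f x ^+ 2) = 0 -> forall g : G, f g = 0.
Proof.
move=> pf f0 g; have [I [a [b [c [pabc E]]]]] := pol_sep pf.
(* The boolean separates the two real terms in the real part of a complex product. *)
pose A (s : I * bool) x := if s.2 then complex.Re (a s.1 (g * x)%g) else - complex.Im (a s.1 (g * x)%g).
pose B (s : I * bool) x := if s.2 then complex.Re (b s.1 x * c s.1 1%g) else complex.Im (b s.1 x * c s.1 1%g).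
have bf := rpol_bm pf.
have := @eval_le _ A B (fun x => f (g * x)%g) _ _ _ _.
rewrite mulg1 (Ex_mull nuH g (bmX 2 bf)) f0 mulr0 => H.
apply/eqP; rewrite -sqrf_eq0 eq_le sqr_ge0 andbT; apply: H.
- move=> [i []]; have [/(@pol_mull _ _ _ _ g)/pol_bmc[h1 h2] _ _] := pabc i; rewrite /A /=; first exact: h1.
  exact: bmN.
- move=> [i e]; have [_ /pol_bmc bb _] := pabc i; have [h1 h2] := bmcM bb (bmc_cst (c i 1%g)).
  by case: e; [exact: h1|exact: h2].
- by have /(@pol_mull _ _ _ _ g)/pol_bmc[] := pf.
- move=> x y; have := congr1 (@complex.Re R) (E (g * x)%g y 1%g).
  rewrite mulg1 raddf_sum /= -mulgA => ->; rewrite -(pair_bigA _ (fun i e => A (i, e) x * B (i, e) y)) /=.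
  apply: eq_bigr => i _; rewrite big_bool /A /B /= -mulrA reM; ring.
Qed.

(** A family whose span is stable under left and right translations, like the matrix coefficients of
    a representation. No linear independence is asked for: [#|J|] serves only as an upper bound. *)
Definition birep (J : finType) (B : J -> G -> R) := [/\ forall j, bm (B j),
  exists2 A : J -> J -> G -> R, forall i j, bm (A i j) &
    forall j (x y : G), B j (x * y)%g = \sum_i A j i x * B i y &
  exists2 A : J -> J -> G -> R, forall i j, bm (A i j) &
    forall j (x y : G), B j (x * y)%g = \sum_i B i x * A j i y].

Definition jspan (J : finType) (B : J -> G -> R) f := exists c : J -> R, forall x, f x = \sum_j c j * B j x.

Lemma birep_prod (J J' : finType) (B : J -> G -> R) (B' : J' -> G -> R) :
  birep B -> birep B' -> birep (fun s : J * J' => fun x => B s.1 x * B' s.2 x).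
Proof.
move=> [bB [A bA AE] [A2 bA2 AE2]] [bB' [A' bA' AE'] [A2' bA2' AE2']]; split.
- by move=> j; exact: bmM.
- exists (fun s t x => A s.1 t.1 x * A' s.2 t.2 x); first by move=> *; exact: bmM.
  move=> [j j'] x y; rewrite AE AE' big_distrl /=.
  rewrite -(pair_bigA _ (fun i i' => A j i x * A' j' i' x * (B i y * B' i' y))) /=.
  by apply: eq_bigr => i _; rewrite big_distrr /=; apply: eq_bigr => i' _; ring.
- exists (fun s t x => A2 s.1 t.1 x * A2' s.2 t.2 x); first by move=> *; exact: bmM.
  move=> [j j'] x y; rewrite AE2 AE2' big_distrl /=.
  rewrite -(pair_bigA _ (fun i i' => B i x * B' i' x * (A2 j i y * A2' j' i' y))) /=.
  by apply: eq_bigr => i _; rewrite big_distrr /=; apply: eq_bigr => i' _; ring.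
Qed.

Lemma birep_conj (J : finType) (B : J -> G -> R) f : birep B -> jspan B f ->
  jspan B (fun g : G => Ex nu (fun U : G => f (U * g * U^-1)%g)).
Proof.
move=> [bB [A bA AE] [A2 bA2 AE2]] [c E].
exists (fun l => Ex nu (fun U => \sum_j \sum_i c j * A j i U * A2 i l (U^-1)%g)) => x.
have bb l : bm (fun U => \sum_j \sum_i c j * A j i U * A2 i l (U^-1)%g).
  apply: bm_sum => j _; apply: bm_sum => i _; apply: bmM.
    by apply: bmM => //; exact: bm_cst.
  by apply: (bm_comp (bA2 i l)); exact: measurable_inv.
under [RHS]eq_bigr => l _ do rewrite mulrC -ExZ//.
rewrite -Ex_sum => [|l _]; last by apply: bmM => //; exact: bm_cst.
congr Ex; apply/funext => U; rewrite E.
transitivity (\sum_j \sum_i \sum_l B l x * (c j * A j i U * A2 i l (U^-1)%g)).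
  apply: eq_bigr => j _; rewrite -mulgA AE big_distrr /=; apply: eq_bigr => i _.
  by rewrite AE2 !big_distrr /=; apply: eq_bigr => l _; ring.
under eq_bigr do rewrite exchange_big /=.
rewrite exchange_big /=; apply: eq_bigr => l _; rewrite big_distrr /=; apply: eq_bigr => j _.
by rewrite big_distrr.
Qed.

Lemma jspan_eval (J : finType) (B : J -> G -> R) f : birep B -> jspan B f ->
  f 1%g ^+ 2 <= #|J|%:R * Ex nu (fun x => f x ^+ 2).
Proof.
move=> [bB [A bA AE] _] [c E]; apply: (@eval_le _ (fun i x => \sum_j c j * A j i x) B) => //.
- by move=> i; apply: bm_sum => j _; apply: bmM => //; exact: bm_cst.
- rewrite (funext E : f = _); apply: bm_sum => j _; apply: bmM => //; exact: bm_cst.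
- move=> x y; rewrite E; under eq_bigr do rewrite AE big_distrr /=.
  rewrite exchange_big /=; apply: eq_bigr => i _; rewrite big_distrl /=.
  by apply: eq_bigr => j _; rewrite mulrA.
Qed.

End translation_spans.

Section class_functions.
Context {R : realType} {n : nat}.
Local Notation C := R[i].
Local Notation G := (SO R n.*2.+1).
Local Notation wt := ('I_n -> int).
Implicit Types (f : G -> C) (w v : wt).

Definition classfun (f : G -> C) := forall g U : G, f (U * g * U^-1)%g = f g.

(** In odd dimension [- V] has determinant opposite to that of [V] and conjugates in the same way,
    so conjugation by any orthogonal matrix is available. *)
Lemma classfun_orth f (V : 'M[R]_(n.*2.+1)) (g g' : G) : classfun f -> orth V ->
  V *m SO_mx g = SO_mx g' *m V -> f g = f g'.
Proof.
move=> cf; wlog dV : V / \det V = 1.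
  move=> H oV VE; have [dV|dV] := orth_det oV; first exact: (H V).
  apply: (H (- V)) => //; last by rewrite mulNmx VE mulmxN.
    by rewrite -scaleN1r detZ dV mulrN1 -signr_odd /= odd_double expr1 opprK.
  exact: orthN.
move=> oV VE; have sV : special_orthogonal V by rewrite /special_orthogonal oV dV !eqxx.
pose U : G := MkSO sV; rewrite -(cf g U); congr f; apply: val_inj => /=.
by rewrite VE -mulmxA oV mulmx1.
Qed.

Lemma classfun_torus0 f : classfun f -> (forall x, f (torus n x) = 0) -> forall g : G, f g = 0.
Proof.
move=> cf f0 g; have /andP[/eqP gg /eqP dg] := SO_mxP g.
have [V [x [oV gV]]] := normal_form gg dg.
rewrite -(f0 x); apply/esym; exact: (classfun_orth cf oV).
Qed.

Section symmetry.
Variable K : nat.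

Lemma fcoef_sym (S : wt -> Prop) (F : (nat -> R) -> C) (s : wt -> wt) (tau : (nat -> R) -> nat -> R) v :
  tpol S F -> (forall w, S w -> inbox K w) -> (forall w, inbox K w -> inbox K (s w)) ->
  (forall w, s (s w) = w) -> (forall w x, chr w (tau x) = chr (s w) x :> C) -> (forall x, F (tau x) = F x) ->
  inbox K v -> fcoef K F (s v) = fcoef K F v.
Proof.
move=> [J [w [c [Sw E]]]] SK sK ss sc sF vK.
have E' x : F x = \sum_j c j * chr (s (w j)) x.
  by rewrite -sF E; apply: eq_bigr => j _; rewrite sc.
have wK j := SK _ (Sw j).
rewrite (fcoef_sum (fun j => sK _ (wK j)) (sK _ vK) E') (fcoef_sum wK vK E).
apply: eq_bigl => j; apply/forallP/forallP => [h i|h i].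
  have e : s (w j) = s v by apply/funext => k; apply/eqP.
  by rewrite -[w j]ss e ss.
have -> : w j = v by apply/funext => k; apply/eqP.
exact: eqxx.
Qed.

Definition wswap (a b : 'I_n) w : wt := fun j => w (tperm a b j).
Definition wflip (a : 'I_n) w : wt := fun j => if j == a then - w j else w j.

Lemma chr_swap (a b : 'I_n) w (x : nat -> R) : b = a.+1 :> nat ->
  chr w (swapn a x) = chr (wswap a b w) x :> C.
Proof.
move=> ba; rewrite /chr; congr cis; rewrite (reindex_inj (@perm_inj _ (tperm a b))) /=.
apply: eq_bigr => j _; congr (_ * _); rewrite /swapn.
case: tpermP => [->|->|/eqP ja /eqP jb]; rewrite ?ba ?eqxx //; first by rewrite ifN//; lia.
have -> : (nat_of_ord j == a) = false by exact/negbTE.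
by rewrite -ba; have -> : (nat_of_ord j == b) = false by exact/negbTE.
Qed.

Lemma chr_flip (a : 'I_n) w (x : nat -> R) : chr w (flipn a x) = chr (wflip a w) x :> C.
Proof.
rewrite /chr; congr cis; apply: eq_bigr => j _; rewrite /flipn /wflip.
rewrite (_ : (nat_of_ord j == a) = (j == a))//; case: eqP => [->|//].
by rewrite mulrN mulrNz mulNr.
Qed.

Lemma lev_swap (a b : 'I_n) w : b = a.+1 :> nat -> lev (wswap a b w) = lev w + (w b - w a).
Proof.
move=> ba; have ab : b != a by apply/eqP => e; move: ba; rewrite e; lia.
rewrite /lev (bigD1 a)//= (bigD1 b)//= [in RHS](bigD1 a)//= [in RHS](bigD1 b)//= /wswap tpermL tpermR.
rewrite (eq_bigr (fun i : 'I_n => (n - i)%:Z * w i)) => [|j /andP[ja jb]]; last by rewrite tpermD 1?eq_sym.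
have := ltn_ord a; have := ltn_ord b; rewrite ba => h1 h2.
set X := \sum_(_ < _ | _) _; rewrite -!subzn; lia.
Qed.

Lemma lev_flip (a : 'I_n) w : lev (wflip a w) = lev w - (n - a)%:Z * (w a *+ 2).
Proof.
rewrite /lev (bigD1 a)//= [in RHS](bigD1 a)//= /wflip eqxx.
rewrite (eq_bigr (fun i : 'I_n => (n - i)%:Z * w i)) => [|j /negbTE ->//].
ring.
Qed.

Lemma inbox_nrm w : (nrm w <= K)%N -> inbox K w.
Proof. by move=> wK i; rewrite (leq_trans _ wK)// /nrm (bigD1 i)//= leq_addr. Qed.

Variable f : G -> C.
Hypotheses (pf : pol K f) (cf : classfun f).
Let F x := f (torus n x).

Lemma fcoef_swap (a b : 'I_n) v : b = a.+1 :> nat -> inbox K v -> fcoef K F (wswap a b v) = fcoef K F v.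
Proof.
move=> ba; apply: (fcoef_sym (pol_tpol pf) inbox_nrm (tau := swapn a)).
- by move=> w wK i; exact: wK.
- by move=> w; apply/funext => i; rewrite /wswap tpermK.
- by move=> w x; exact: chr_swap.
- move=> x; have an : (a.+1 < n)%N by rewrite -ba.
  have [V oV VT] := torus_swap x an; apply/esym; exact: (classfun_orth cf oV).
Qed.

Lemma fcoef_flip (a : 'I_n) v : inbox K v -> fcoef K F (wflip a v) = fcoef K F v.
Proof.
apply: (fcoef_sym (pol_tpol pf) inbox_nrm (tau := flipn a)).
- by move=> w wK i; rewrite /wflip; case: ifP => // _; rewrite abszN; exact: wK.
- by move=> w; apply/funext => i; rewrite /wflip; case: (i == a); rewrite ?opprK.
- by move=> w x; exact: chr_flip.
- move=> x; have [V oV VT] := torus_flip x (ltn_ord a).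
  apply/esym; exact: (classfun_orth cf oV).
Qed.

Lemma fcoef_nrm v : inbox K v -> fcoef K F v != 0 -> (nrm v <= K)%N.
Proof.
move=> vK; apply: contraNT; rewrite -ltnNge => Kv; apply/eqP.
apply: (fcoef_tpol0 (pol_tpol pf) inbox_nrm vK) => w wK /forallP wv.
suff : nrm w = nrm v by lia.
by apply: eq_bigr => i _; rewrite (eqP (wv i)).
Qed.

Section top_weight.
Variables (l : int) (v : wt).
Hypotheses (fl : forall w, inbox K w -> l < lev w -> fcoef K F w = 0)
  (vK : inbox K v) (vl : l <= lev v) (fv : fcoef K F v != 0).

(** Flipping the sign of a negative entry would raise the level into the range where all
    coefficients vanish, while Weyl symmetry keeps the coefficient. [top_mono] does the same with a
    swap. *)
Lemma top_ge0 (a : 'I_n) : 0 <= v a.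
Proof.
rewrite leNgt; apply/negP => va; move: fv; rewrite -(fcoef_flip a vK) fl ?eqxx//.
  by move=> i; rewrite /wflip; case: ifP => // _; rewrite abszN; exact: vK.
by rewrite lev_flip; have := ltn_ord a; nia.
Qed.

Lemma top_mono (a b : 'I_n) : b = a.+1 :> nat -> v b <= v a.
Proof.
move=> ba; rewrite leNgt; apply/negP => va; move: fv; rewrite -(fcoef_swap ba vK) fl ?eqxx//.
  by move=> i; exact: vK.
by rewrite lev_swap//; lia.
Qed.

(** A decreasing nonnegative sequence is a list of row lengths; its successive differences, with 0
    after the end, count the columns of each height. *)
Lemma top_dominant : exists m : 'I_n -> nat, v =1 lam m /\ degm m = nrm v.
Proof.
pose vn (k : nat) : int := if insub k is Some j then v j else 0.
have vnE (j : 'I_n) : vn j = v j by rewrite /vn valK.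
have vn0 k : (n <= k)%N -> vn k = 0 by move=> nk; rewrite /vn insubN// -leqNgt.
have vnS (j : 'I_n) : vn j.+1 <= vn j.
  rewrite vnE; have [jn|nj] := ltnP j.+1 n; last by rewrite vn0// top_ge0.
  by rewrite -[j.+1]/(nat_of_ord (Ordinal jn)) vnE; exact: top_mono.
pose m (j : 'I_n) := absz (vn j - vn j.+1).
have mE (j : 'I_n) : (m j)%:Z = vn j - vn j.+1 by rewrite /m; have := vnS j; lia.
have lamE : v =1 lam m.
  move=> j; rewrite /lam (eq_bigr (fun i : 'I_n => if (j <= i)%N then vn i - vn i.+1 else 0)); last first.
    by move=> i _; rewrite mE ltnS; case: (j <= i)%N; rewrite ?mulr1 ?mulr0.
  rewrite -big_mkcond /= -(big_geq_mkord _ _ predT (fun i => vn i - vn i.+1)).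
  under eq_bigr do rewrite -opprB.
  by rewrite sumrN telescope_sumr 1?ltnW// opprB vnE vn0// subr0.
exists m; split=> //; apply/eqP; rewrite -eqz_nat; apply/eqP.
have -> : (nrm v)%:Z = \sum_j lam m j.
  rewrite /nrm (big_morph Posz PoszD (erefl _)); apply: eq_bigr => j _.
  by rewrite -lamE; have := top_ge0 j; lia.
rewrite exchange_big /= /degm (big_morph Posz PoszD (erefl _)); apply: eq_bigr => i _.
rewrite -big_distrr /= PoszM; congr (_ * _).
have -> : \sum_(j < n) (j < i.+1)%N%:Z = (\sum_(j < n) (j < i.+1)%N)%N%:Z.
  by rewrite (big_morph Posz PoszD (erefl _)).
congr Posz; rewrite -big_mkcond /= (big_ord_narrow (ltn_ord i)) /=.
by rewrite sum1_card card_ord.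
Qed.

End top_weight.
End symmetry.

Lemma fcoef_sumF K (I : Type) (r : seq I) (p : pred I) (H : I -> (nat -> R) -> C) v :
  fcoef K (fun x => \sum_(i <- r | p i) H i x) v = \sum_(i <- r | p i) fcoef K (H i) v.
Proof.
elim: r => [|i r IH].
  rewrite big_nil; under eq_fun do rewrite big_nil.
  by rewrite /fcoef big1 ?mulr0// => s _; rewrite mul0r.
rewrite big_cons; under eq_fun do rewrite big_cons.
by case: (p i); rewrite ?fcoefD IH.
Qed.

Definition cspan (S : ('I_n -> nat) -> Prop) (f : G -> C) :=
  exists (J : finType) (mm : J -> 'I_n -> nat) (c : J -> C),
  (forall j, S (mm j)) /\ forall g : G, f g = \sum_j c j * (em (mm j) (SO_mx g))%:C%C.

Lemma em_classfun (m : 'I_n -> nat) : classfun (fun g => (em m (SO_mx g))%:C%C).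
Proof.
by move=> g U /=; rewrite em_conj//; have /andP[/eqP] := SO_mxP U.
Qed.

Lemma em_fcoef K (m : 'I_n -> nat) v : (degm m <= K)%N -> inbox K v -> lev (lam m) <= lev v ->
  fcoef K (fun x => (em m (torus_mx n x))%:C%C) v = (if [forall i, lam m i == v i] then 1 else 0) :> C.
Proof.
move=> mK vK mv; have := em_leading m (1%:M : 'M[R]_(n.*2.+1)).
rewrite (_ : (fun x => _) = fun x => (em m (torus_mx n x))%:C%C); last first.
  by apply/funext => x; rewrite mulmx1.
move=> /fcoef_leading -> //; suff -> : Phi m 1%:M = 1 :> C by [].
rewrite /Phi big1// => i _; rewrite /Delta /adj (map_scalar_mx (real_complex R)) mulmx1 frameK.
by rewrite pminor_det1D subrr mulmx0 addr0 det1 expr1n.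
Qed.

(** Descent on the level: a weight of highest level is dominant, hence the leading weight of some
    [em m] with leading coefficient 1, which can be subtracted. Restriction to the torus determines
    a class function, so nothing is left at the end. *)
Lemma class_span K (l : nat) f : pol K f -> classfun f ->
  (forall v, inbox K v -> l%:Z <= lev v -> fcoef K (fun x => f (torus n x)) v = 0) ->
  cspan (fun m => (degm m <= K)%N /\ lev (lam m) < l%:Z) f.
Proof.
elim: l f => [|l IH] f pf cf fl.
  exists void, (of_void _), (fun=> 0); split=> [[]|g]; rewrite big1 => [|[]].
  apply: (classfun_torus0 cf) => x.
  rewrite (tpol_fcoef (pol_tpol pf) (@inbox_nrm K)) big1// => b _.
  have [-> |fb] := eqVneq (fcoef K (fun x => f (torus n x)) (wbox b)) 0; first by rewrite mul0r.
  pose P (b : {ffun 'I_n -> 'I_K.*2.+1}) := fcoef K (fun x => f (torus n x)) (wbox b) != 0.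
  case: (@arg_maxP _ _ _ b P (fun b => lev (wbox b)) fb) => b0 Pb0 b0max.
  (* At level bound 0 a nonzero coefficient of maximal level would belong to a dominant weight,
     whose level is nonnegative. *)
  exfalso; have fl' w : inbox K w -> lev (wbox b0) < lev w -> fcoef K (fun x => f (torus n x)) w = 0.
    move=> /inbox_wbox[b1 /funext ->] lw; apply/eqP; apply: contraTT lw => fb1.
    by rewrite -leNgt; exact: b0max.
  move/negP: (Pb0); apply; apply/eqP; apply: fl; first exact: wbox_in.
  apply: sumr_ge0 => i _; apply: mulr_ge0 => //.
  exact: (top_ge0 pf cf fl' (wbox_in b0) (lexx _) Pb0 i).
pose F f x : C := f (torus n x).
pose J := {b : {ffun 'I_n -> 'I_K.*2.+1} | (lev (wbox b) == l%:Z) && (fcoef K (F f) (wbox b) != 0)}.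
have fl' w : inbox K w -> l%:Z < lev w -> fcoef K (F f) w = 0 by move=> wK lw; apply: fl => //; lia.
have /choice[mm mmP] : forall j : J, exists m : 'I_n -> nat, wbox (val j) =1 lam m /\ (degm m <= K)%N.
  move=> [b /= /andP[/eqP lb fb]].
  have lb' : l%:Z <= lev (wbox b) by rewrite lb.
  have [m [vm mn]] := top_dominant pf cf fl' (wbox_in b) lb' fb.
  by exists m; split => //; rewrite mn (fcoef_nrm pf (wbox_in b) fb).
pose e (j : J) g : C := (em (mm j) (SO_mx g))%:C%C.
pose c (j : J) := fcoef K (F f) (wbox (val j)).
pose f1 g := f g + \sum_j (- c j) * e j g.
have pe j : pol K (e j) by apply: pol_le (em_pol _); have [] := mmP j.
have [] := IH f1.
- by apply: polD => //; apply: pol_sum => j _; exact: polZ.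
- by move=> g U; rewrite /f1 cf; congr (_ + _); apply: eq_bigr => j _; rewrite /e (em_classfun _ g U).
- move=> v vK lv; rewrite /f1 fcoefD fcoef_sumF.
  have E j : fcoef K (fun x => - c j * e j (torus n x)) v =
      - c j * (if [forall i, wbox (val j) i == v i] then 1 else 0).
    rewrite fcoefZ em_fcoef//; [|by have [] := mmP j|].
      congr (_ * _); congr (if _ then _ else _); apply: eq_forallb => i.
      by have [-> _] := mmP j.
    rewrite (_ : lam (mm j) = wbox (val j)); last by apply/funext => i; have [->] := mmP j.
    by have /andP[/eqP -> _] := valP j.
  under eq_bigr do rewrite E.
  have [b vb] := inbox_wbox vK; rewrite (_ : v = wbox b); last exact/funext.
  have [fb|fb] := eqVneq (fcoef K (F f) (wbox b)) 0.
    rewrite -/(F f) fb add0r big1// => j _; case: ifP => [/forallP h|_]; last by rewrite mulr0.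
    have /andP[_ /negP[]] := valP j; apply/eqP.
    by rewrite (_ : wbox (val j) = wbox b)//; apply/funext => i; apply/eqP.
  have lb : lev (wbox b) = l%:Z.
    move: lv; rewrite (_ : v = wbox b) ?le_eqVlt; last exact/funext.
    move=> /orP[/eqP//|lb]; by rewrite fl' ?eqxx // in fb; exact: wbox_in.
  have bJ : (lev (wbox b) == l%:Z) && (fcoef K (F f) (wbox b) != 0) by rewrite lb eqxx fb.
  rewrite (bigD1 (Sub b bJ : J))//= big1 => [|j jb].
    rewrite (_ : [forall i, _]) ?mulr1 ?addr0 /c /= ?addrN//.
    by apply/forallP => i.
  rewrite ifN ?mulr0//; apply: contra jb => /forallP h; apply/eqP/val_inj/ffunP => i /=.
  by apply: val_inj => /=; have := h i; rewrite /wbox => /eqP; lia.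
move=> J1 [mm1 [c1 [S1 E1]]].
exists (J + J1)%type, (fun s => match s with inl j => mm j | inr j => mm1 j end),
  (fun s => match s with inl j => c j | inr j => c1 j end); split.
  move=> [j|j]; last by have [] := S1 j; split => //; lia.
  have [h1 h2] := mmP j; split => //; rewrite (_ : lam (mm j) = wbox (val j)); last by apply/funext.
  by have /andP[/eqP -> _] := valP j; rewrite ltz_nat.
move=> g; rewrite big_sumType /= -E1 /f1 addrCA -big_split /= big1 ?addr0// => j _.
by rewrite -mulrDl subrr mul0r.
Qed.

End class_functions.

Section class_operators.
Context {R : realType} {n : nat} (nu : probability (SO R n.*2.+1) R) (nuH : is_haar nu).
Local Notation C := R[i].
Local Notation G := (SO R n.*2.+1).
Implicit Types (f : G -> R).

Definition cop (h : G) f : G -> R := fun g => Ex nu (fun U : G => f (g * (U * h * U^-1))%g).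

Lemma bm_cop_arg (g h : G) f : bm f -> bm (fun U : G => f (g * (U * h * U^-1))%g).
Proof.
move=> bf; apply: (bm_comp bf); apply: measurable_mul; first exact: measurable_cst.
apply: measurable_mul; last exact: measurable_inv.
by apply: measurable_mul => //; exact: measurable_cst.
Qed.

Lemma cop_complex h f : bm f -> class_op nu h (fun g => (f g)%:C%C) = fun g => (cop h f g)%:C%C.
Proof. by move=> bf; apply/funext => g; rewrite /class_op Ec_real//; exact: bm_cop_arg. Qed.

Lemma cop_pol k h f : rpol k f -> rpol k (cop h f).
Proof. by move=> pf; rewrite /rpol -cop_complex; [exact: class_op_pol|exact: rpol_bm pf]. Qed.

Lemma cop_lin h f f' a : bm f -> bm f' ->
  cop h (fun g => f g + a * f' g) = fun g => cop h f g + a * cop h f' g.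
Proof. by move=> bf bf'; apply/funext => g; rewrite /cop Ex_lin//; exact: bm_cop_arg. Qed.

Lemma cop_cst h a : cop h (fun=> a) = fun=> a.
Proof. by apply/funext => g; rewrite /cop Ex_cst. Qed.

Definition rclass f := forall g U : G, f (U * g * U^-1)%g = f g.

Lemma cop_class h f : bm f -> rclass f -> rclass (cop h f).
Proof.
move=> bf cf g V; rewrite /cop -(Ex_mull nuH V^-1%g (bm_cop_arg g h bf)).
congr Ex; apply/funext => U; rewrite -[LHS](cf _ V^-1%g); congr f.
by rewrite !invgM !invgK !mulgA mulVg mul1g.
Qed.

(** For fixed [U], translate the integration variable on the right by [U h U^-1]. *)
Lemma cop_adj h f f' : bm f -> bm f' ->
  Ex nu (fun g => cop h f g * f' g) = Ex nu (fun g => f g * cop h^-1%g f' g).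
Proof.
move=> bf bf'.
have E1 g : cop h f g * f' g = Ex nu (fun U : G => f (g * (U * h * U^-1))%g * f' g).
  rewrite mulrC -ExZ; last exact: bm_cop_arg.
  by congr Ex; apply/funext => U; rewrite mulrC.
have E2 g : f g * cop h^-1%g f' g = Ex nu (fun U : G => f g * f' (g * (U * h^-1 * U^-1))%g).
  by rewrite -ExZ//; exact: bm_cop_arg.
rewrite (funext E1) (funext E2).
have mc (k : G) : measurable_fun setT (fun p : G * G => p.1 * (p.2 * k * p.2^-1))%g.
  apply: measurable_mul => //; apply: measurable_mul; last by apply: measurable_inv; exact: measurable_snd.
  by apply: measurable_mul; [exact: measurable_snd|exact: measurable_cst].
have b1 : bm (fun p : G * G => f (p.1 * (p.2 * h * p.2^-1))%g * f' p.1).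
  by apply: bmM; [exact: (bm_comp bf)|apply: (bm_comp bf'); exact: measurable_fst].
have b2 : bm (fun p : G * G => f p.1 * f' (p.1 * (p.2 * h^-1 * p.2^-1))%g).
  by apply: bmM; [apply: (bm_comp bf); exact: measurable_fst|exact: (bm_comp bf')].
rewrite (Ex_swap nu nu b1) (Ex_swap nu nu b2); congr Ex; apply/funext => U /=.
rewrite -(Ex_mulr nuH (U * h * U^-1)%g (bm_pair2 U b2)); congr Ex; apply/funext => g /=.
congr (_ * f' _); rewrite -!mulgA (mulgA U^-1%g) mulVg mul1g (mulgA h) mulgV mul1g mulgV.
by rewrite mulg1.
Qed.

Definition opl (hs : seq G) f := foldr cop f hs.

Lemma Delta_pol k : (k <= n)%N -> pol k (fun g : G => Delta k (SO_mx g)).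
Proof.
move=> kn; rewrite /Delta /pminor; apply: pol_sum => s _; apply: polZ.
have := @pol_prod R n.*2.+1 _ (index_enum 'I_n.*2.+1) (mem (top n k)) (fun=> 1%N)
  (fun i (x : G) => adj (SO_mx x) i (s i)) _.
rewrite sum1_card card_top//; apply=> i _.
under eq_fun do rewrite /adj mxE; apply: pol_sum => j _.
under eq_fun do rewrite mulrC; apply: polZ.
under eq_fun do rewrite mxE; apply: pol_sum => l _; apply: polZ.
under eq_fun do rewrite mxE; exact: pol_entry.
Qed.

Lemma Phi_pol (m : 'I_n -> nat) : pol (degm m) (fun g : G => Phi m (SO_mx g)).
Proof.
apply: pol_prod => i _; elim: (m i) => [|e IH]; first by under eq_fun do rewrite expr0; exact: pol_cst.
under eq_fun do rewrite exprS.
by rewrite mulSn; apply: polM IH; exact: Delta_pol.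
Qed.

Definition phi (m : 'I_n -> nat) (h : G) : R :=
  Ex nu (fun U : G => complex.Re (Phi m (SO_mx (U * h * U^-1)%g))).

Definition emG (m : 'I_n -> nat) : G -> R := fun g => em m (SO_mx g).

Lemma emG_rpol m : rpol (degm m) (emG m).
Proof. exact: em_pol. Qed.

Lemma emG_bm m : bm (emG m).
Proof. exact: rpol_bm (emG_rpol m). Qed.

Lemma emG_class m : rclass (emG m).
Proof. by move=> g U; rewrite /emG em_conj//; have /andP[/eqP] := SO_mxP U. Qed.

(** On the torus the coefficient of [lam m] in the translate by [U h U^-1] is [Phi m] at that
    element; averaging over [U] turns it into [phi m h]. The difference is a class function without
    coefficients from the level of [lam m] upwards, so [class_span] applies. *)
Lemma cop_em K m h : (degm m <= K)%N -> exists (J : finType) (mm : J -> 'I_n -> nat) (c : J -> R),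
  (forall j, (degm (mm j) <= K)%N /\ lev (lam (mm j)) < lev (lam m)) /\
  forall g, cop h (emG m) g - phi m h * emG m g = \sum_j c j * emG (mm j) g.
Proof.
move=> mK; pose F := Ec nu (fun U : G => Phi m (SO_mx (U * h * U^-1)%g)).
have lm : lev (lam m) = `|lev (lam m)|%N%:Z.
  rewrite gez0_abs//; apply: sumr_ge0 => i _; apply: mulr_ge0 => //.
  by apply: sumr_ge0 => j _; rewrite mulr_ge0.
pose f g : C := class_op nu h (fun g => (emG m g)%:C%C) g + (- F) * (emG m g)%:C%C.
have pm := emG_rpol m; have bPhi := bmc_conj h (pol_bmc (Phi_pol m)).
have [] := @class_span R n K `|lev (lam m)|%N f.
- by apply: polD; [apply: class_op_pol|apply: polZ]; apply: pol_le pm.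
- move=> g U; rewrite /f cop_complex ?(cop_class h (emG_bm m) (@emG_class m))//.
    by rewrite emG_class.
  exact: emG_bm.
- move=> v vK; rewrite -lm => lv; rewrite /f fcoefD fcoefZ em_fcoef//.
  have E x : class_op nu h (fun g => (emG m g)%:C%C) (torus n x) =
      Ec nu (fun U : G => (em m (torus_mx n x *m SO_mx (U * h * U^-1)%g))%:C%C) by [].
  have bE x : bmc (fun U : G => (em m (torus_mx n x *m SO_mx (U * h * U^-1)%g))%:C%C).
    exact/bmc_real/(bm_cop_arg (torus n x) h (emG_bm m)).
  rewrite [X in X + _](_ : _ = Ec nu (fun U : G =>
      fcoef K (fun x => (em m (torus_mx n x *m SO_mx (U * h * U^-1)%g))%:C%C) v)).
    rewrite (_ : (fun U : G => _) = fun U : G => (if [forall i, lam m i == v i] then 1 else 0) *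
        Phi m (SO_mx (U * h * U^-1)%g)).
      by rewrite EcZ// -/F mulrC mulNr addrN.
    apply/funext => U; rewrite (fcoef_leading (em_leading m _) mK vK lv).
    by case: ifP; rewrite ?mul1r ?mul0r.
  rewrite /fcoef EcZ.
    congr (_ * _); rewrite Ec_sum => [|s _].
      by apply: eq_bigr => s _; rewrite E mulrC -EcZ//; congr Ec; apply/funext => U; rewrite mulrC.
    by apply: bmcM => //; exact: bmc_cst.
  by apply: bmc_sum => s _; apply: bmcM => //; exact: bmc_cst.
move=> J [mm [c [S E]]]; exists J, mm, (fun j => complex.Re (c j)); split.
  by move=> j; rewrite lm; exact: S.
move=> g; have := congr1 (@complex.Re R) (E g).
rewrite /f cop_complex; last exact: emG_bm.
have ReD (x y : C) : complex.Re (x + y) = complex.Re x + complex.Re y by case: x y => [? ?] [? ?].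
rewrite ReD reM /= mulr0 subr0 raddf_sum /= mulNr => ->; apply: eq_bigr => j _.
by rewrite reM /= mulr0 subr0.
Qed.

(** * Eigenfunctions of the convolution operators *)

Section spectral_bound.
Variable K : nat.
Notation MT := {ffun 'I_n -> 'I_K.+1}.

Definition toN (a : MT) : 'I_n -> nat := fun i => a i.
Definition weights_upto (a : MT) := (degm (toN a) <= K)%N && [exists i, a i != ord0].

Let leqL (a a' : MT) := lev (lam (toN a)) <= lev (lam (toN a')).
Let L := sort leqL (enum weights_upto).
(** The basis, by increasing level after the constant 1. Ties may be broken at will, since the
    corrections in [cop_em] have strictly smaller level. *)
Let b (k : nat) : G -> R := if k is k'.+1 then emG (toN (nth [ffun=> ord0] L k')) else fun=> 1.

Let LP k : (k < size L)%N -> weights_upto (nth [ffun=> ord0] L k).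
Proof. by move=> kL; have := mem_nth [ffun=> ord0] kL; rewrite mem_sort mem_enum. Qed.

Let b_pol k : (k <= size L)%N -> rpol K (b k).
Proof.
case: k => [_|k kL]; first exact: (pol_cst K (1%:C%C)).
by apply: pol_le (emG_rpol _); have /andP[] := LP kL.
Qed.

Let b_bm k : (k <= size L)%N -> bm (b k).
Proof. by move=> /b_pol/rpol_bm. Qed.

Let em0 (m : 'I_n -> nat) : (forall i, m i = 0%N) -> emG m = fun=> 1.
Proof. by move=> m0; apply/funext => g; rewrite /emG /em big1// => i _; rewrite m0 expr0. Qed.

Let em_index m : (degm m <= K)%N -> emG m = (fun=> 1) \/
  exists2 k, (k < size L)%N & toN (nth [ffun=> ord0] L k) = m.
Proof.
move=> mK; pose a : MT := [ffun i => inord (m i)].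
have aE : toN a = m.
  apply/funext => i; rewrite /toN ffunE inordK// ltnS (leq_trans _ mK)//.
  by rewrite /degm (bigD1 i)//= (leq_trans _ (leq_addr _ _))// leq_pmulr.
have [/existsP ai|/existsPn a0] := boolP [exists i, a i != ord0]; last first.
  by left; apply: em0 => i; have := a0 i; rewrite negbK -aE /toN => /eqP ->.
right; have aL : a \in L.
  by rewrite mem_sort mem_enum unfold_in aE mK; exact/existsP.
by exists (index a L); rewrite ?index_mem// nth_index.
Qed.

Let em_lspan k m : (degm m <= K)%N -> (k < size L)%N ->
  lev (lam m) < lev (lam (toN (nth [ffun=> ord0] L k))) -> lspan k.+1 b (emG m).
Proof.
move=> mK kL lm; have [->|[i iL im]] := em_index mK; first exact: (@lspan_nth _ _ _ _ b 0).
have ik : (i < k)%N.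
  rewrite ltnNge; apply/negP => ki; have : leqL (nth [ffun=> ord0] L k) (nth [ffun=> ord0] L i).
    apply: (sorted_leq_nth _ _ [ffun=> ord0] (sort_sorted _ _)) => //.
    - by move=> x y z; exact: le_trans.
    - by move=> x; exact: lexx.
    - by move=> x y; exact: le_total.
  by rewrite /leqL im; move: lm; lia.
by rewrite -im; exact: (@lspan_nth _ _ _ k.+1 b i.+1).
Qed.

Let cop_b k h : (k < size L)%N -> lspan k.+1 b
  (fun g => cop h (b k.+1) g - phi (toN (nth [ffun=> ord0] L k)) h * b k.+1 g).
Proof.
move=> kL; have /andP[mK _] := LP kL; have [J [mm [c [S E]]]] := cop_em h mK.
rewrite (funext E); apply: lspan_sum => j _; apply: lspanZ.
by have [s1 s2] := S j; exact: em_lspan.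
Qed.

Let lspan_b_bm k f : (k <= size L)%N -> lspan k.+1 b f -> bm f.
Proof. by move=> kL; apply: lspan_bm => j jk; apply: b_bm; rewrite (leq_trans _ kL). Qed.

Let cop_lspan k h f : (k <= size L)%N -> lspan k.+1 b f -> lspan k.+1 b (cop h f).
Proof.
move=> kL sf; suff : bm f /\ lspan k.+1 b (cop h f) by case.
move: f sf; apply: lspan_ind.
- by split; [exact: bm_cst|rewrite cop_cst; exact: lspan0].
- move=> a f f' [bf sf] [bf' sf']; rewrite cop_lin//; split.
    by apply: bmD => //; apply: bmM => //; exact: bm_cst.
  by apply: lspanD => //; exact: lspanZ.
- move=> j jk; split; first by apply: b_bm; rewrite (leq_trans _ kL).
  case: j jk => [|j] jk; first by rewrite cop_cst; exact: (@lspan_nth _ _ _ _ b 0).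
  have jL : (j < size L)%N by rewrite (leq_trans _ kL).
  have := lspanD (lspan_le (ltnW jk) (cop_b h jL))
    (lspanZ (phi (toN (nth [ffun=> ord0] L j)) h) (lspan_nth b jk)).
  by congr lspan; apply/funext => g; rewrite subrK.
Qed.

Let opl_lspan k hs f : (k <= size L)%N -> lspan k.+1 b f -> lspan k.+1 b (opl hs f).
Proof. by move=> kL sf; elim: hs => //= h hs IH; exact: cop_lspan. Qed.

Let opl_lin k hs f f' a : (k <= size L)%N -> lspan k.+1 b f -> lspan k.+1 b f' ->
  opl hs (fun g => f g + a * f' g) = fun g => opl hs f g + a * opl hs f' g.
Proof.
move=> kL sf sf'; elim: hs => //= h hs ->.
by rewrite cop_lin//; apply: (lspan_b_bm kL); exact: opl_lspan.
Qed.

Let lspan_pol k f : (k <= size L)%N -> lspan k.+1 b f -> rpol K f.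
Proof.
move=> kL; apply: lspan_ind; first exact: pol_cst.
  move=> a f1 f2 p1 p2; rewrite /rpol; under eq_fun do rewrite rmorphD rmorphM /=.
  by apply: polD => //; exact: polZ.
by move=> j jk; apply: b_pol; rewrite (leq_trans _ kL).
Qed.

Let lspan_class k f : (k <= size L)%N -> lspan k.+1 b f -> rclass f.
Proof.
move=> kL; apply: lspan_ind => // [a f1 f2 p1 p2|]; first by move=> g U; rewrite p1 p2.
by move=> [|j] jk g U //; exact: emG_class.
Qed.

Variable D : ('I_n -> nat) -> R.
Hypothesis dimD : forall m : 'I_n -> nat, (exists i, m i <> 0%N) ->
  exists (J : finType) (B : J -> G -> R), [/\ birep B, jspan B (phi m) & #|J|%:R <= D m].

(** Peels off the last basis function. Its residual [chi] after projection is a common eigenfunction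
    of all [cop h], so its part of the error is explicit; both squared errors and squared norms then
    combine through [sqrD_le]. *)
Let bound_step k hs f : (k <= size L)%N -> lspan k.+1 b f ->
  (opl hs f 1%g - Ex nu f) ^+ 2 <= (\sum_(i < k) D (toN (nth [ffun=> ord0] L i)) *
     \prod_(h <- hs) phi (toN (nth [ffun=> ord0] L i)) h ^+ 2) * Ex nu (fun g => f g ^+ 2).
Proof.
elim: k f => [|k IH] f kL sf.
  have [a [f' [[c f'0] fE]]] := lspan_recr sf.
  have -> : f = fun=> a by apply/funext => g; rewrite fE f'0 big_ord0 add0r mulr1.
  have -> : opl hs (fun=> a) = fun=> a by elim: hs => //= h hs ->; exact: cop_cst.
  by rewrite !Ex_cst subrr expr0n big_ord0 mul0r.
have [a [f' [sf' fE]]] := lspan_recr sf; have kL' : (k <= size L)%N := ltnW kL.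
have bbk j : (j < k.+1)%N -> bm (b j) by move=> jk; apply: b_bm; exact: leq_trans (ltnW _) kL.
have [p sp p0] := orth_projection nu bbk (b_bm kL).
pose m := toN (nth [ffun=> ord0] L k).
pose chi g := b k.+1 g - p g.
have schi : lspan k.+2 b chi by apply: lspanB; [exact: lspan_nth|exact: lspanS].
have bchi : bm chi by exact: lspan_b_bm schi.
have cchi : rclass chi by exact: lspan_class schi.
(* By triangularity the defect lies in the span of the earlier functions, and by the adjoint
   relation it is orthogonal to that span; hence it is null, and [rpol_null] makes this
   pointwise. *)
have eig h g : cop h chi g = phi m h * chi g.
  pose de g := cop h chi g - phi m h * chi g.
  have sde : lspan k.+1 b de.
    have := lspanB (cop_b h kL) (lspanB (cop_lspan h kL' sp) (lspanZ (phi m h) sp)).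
    congr lspan; apply/funext => x; rewrite /de -/m.
    have -> : cop h chi x = cop h (b k.+1) x - cop h p x.
      rewrite (_ : chi = fun g => b k.+1 g + (-1) * p g); last by apply/funext => y; rewrite mulN1r.
      by rewrite cop_lin ?mulN1r//; [exact: b_bm|exact: lspan_b_bm sp].
    by rewrite /chi; ring.
  have bde : bm de := lspan_b_bm kL' sde.
  apply/eqP; rewrite -subr_eq0; apply/eqP; apply: (rpol_null nuH (lspan_pol kL' sde)).
  have E x : de x ^+ 2 = cop h chi x * de x + (- phi m h) * (chi x * de x) by rewrite /de; ring.
  have bc : bm (cop h chi) by apply: rpol_bm; apply: cop_pol; exact: lspan_pol schi.
  rewrite (funext E) Ex_lin; [|exact: bmM|exact: bmM].
  by rewrite cop_adj// !p0// ?mulr0 ?addr0//; exact: cop_lspan.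
(* The eigenvalue equation at the identity, since [chi] is constant on conjugacy classes. So [chi]
   lies in any span that contains [phi m], which is where the degree bound is needed. *)
have chiE h : chi h = chi 1%g * phi m h.
  rewrite mulrC -eig /cop; transitivity (Ex nu (fun=> chi h)); first by rewrite Ex_cst.
  by congr Ex; apply/funext => U; rewrite mul1g cchi.
pose f1 g := f' g + a * p g; have sf1 : lspan k.+1 b f1 by apply: lspanD => //; exact: lspanZ.
have bf1 : bm f1 := lspan_b_bm kL' sf1.
(* Regroups [f] into a part in the smaller span and a multiple of [chi], orthogonal to each
   other. *)
have fE' : f = fun g => f1 g + a * chi g by apply/funext => g; rewrite fE /f1 /chi; ring.
have ochi : Ex nu (fun g => chi g * f1 g) = 0 by exact: p0.
have chi0 : Ex nu chi = 0.
  have := p0 (fun=> 1) (@lspan_nth _ _ _ k.+1 b 0 isT).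
  by under eq_fun do rewrite mulr1.
have oplchi : opl hs chi 1%g = (\prod_(h <- hs) phi m h) * chi 1%g.
  have -> : opl hs chi = fun g => (\prod_(h <- hs) phi m h) * chi g.
    elim: hs {IH} => [|h hs IHhs]; first by apply/funext => g; rewrite big_nil mul1r.
    have cZ c : cop h (fun g => c * chi g) = fun g => c * (phi m h * chi g).
      have := cop_lin h c (bm_cst 0) bchi; rewrite cop_cst.
      rewrite (_ : (fun g => 0 + c * chi g) = fun g => c * chi g); last by apply/funext => g; rewrite add0r.
      by move=> ->; apply/funext => g; rewrite add0r eig.
    by rewrite /= IHhs cZ; apply/funext => g; rewrite big_cons; ring.
  by [].
have chi1 : chi 1%g ^+ 2 <= D m * Ex nu (fun g => chi g ^+ 2).
  have [J [B [bB [c cE] JD]]] : exists (J : finType) (B : J -> G -> R),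
      [/\ birep B, jspan B (phi m) & #|J|%:R <= D m].
    apply: dimD; have /andP[_ /existsP[i ai]] := LP kL; exists i.
    by move=> ai0; case/eqP: ai; apply: val_inj.
  have sB : jspan B chi.
    by exists (fun j => chi 1%g * c j) => x; rewrite chiE cE big_distrr /=; apply: eq_bigr => j _; rewrite mulrA.
  apply: le_trans (jspan_eval nuH bB sB) _; apply: ler_wpM2r => //.
  by apply: Ex_ge0 => g; exact: sqr_ge0.
have N0 : 0 <= Ex nu (fun g => chi g ^+ 2) by apply: Ex_ge0 => g; exact: sqr_ge0.
have D0 (m' : 'I_n -> nat) : (exists i, m' i <> 0%N) -> 0 <= D m'.
  by move=> /dimD[J [B [_ _]]]; apply: le_trans.
have DL i : (i < size L)%N -> 0 <= D (toN (nth [ffun=> ord0] L i)).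
  move=> iL; apply: D0; have /andP[_ /existsP[j aj]] := LP iL; exists j.
  by move=> aj0; case/eqP: aj; apply: val_inj.
have E2 : Ex nu (fun g => f g ^+ 2) = Ex nu (fun g => f1 g ^+ 2) + a ^+ 2 * Ex nu (fun g => chi g ^+ 2).
  have E g : f g ^+ 2 = (f1 g ^+ 2 + (2 * a) * (chi g * f1 g)) + a ^+ 2 * chi g ^+ 2 by rewrite fE'; ring.
  rewrite (funext E) !Ex_lin ?ochi ?mulr0 ?addr0//; try exact: bmX; try exact: bmM.
  by apply: bmD; [exact: bmX|apply: bmM; [exact: bm_cst|exact: bmM]].
have -> : opl hs f 1%g - Ex nu f = (opl hs f1 1%g - Ex nu f1) + a * ((\prod_(h <- hs) phi m h) * chi 1%g).
  rewrite {1}fE' (opl_lin hs a kL (lspanS sf1) schi) oplchi fE' Ex_lin// chi0.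
  ring.
rewrite big_ord_recr /= E2; apply: sqrD_le.
- by apply: sumr_ge0 => i _; rewrite mulr_ge0 ?DL ?(ltn_trans (ltn_ord i))// prodr_ge0// => h _; exact: sqr_ge0.
- by rewrite mulr_ge0 ?DL// prodr_ge0// => h _; exact: sqr_ge0.
- by apply: Ex_ge0 => g; exact: sqr_ge0.
- by rewrite mulr_ge0 ?sqr_ge0.
- exact: IH.
rewrite -/m !exprMn -prodrXl.
have := ler_wpM2l (_ : 0 <= a ^+ 2 * \prod_(h <- hs) phi m h ^+ 2) chi1.
rewrite mulr_ge0 ?sqr_ge0 ?prodr_ge0// => [|h _]; last exact: sqr_ge0.
by move=> /(_ isT); congr (_ <= _); ring.
Qed.

Lemma spectral_bound hs f : rpol K f -> rclass f ->
  (opl hs f 1%g - Ex nu f) ^+ 2 <= (\sum_(a : MT | weights_upto a) D (toN a) *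
     \prod_(h <- hs) phi (toN a) h ^+ 2) * Ex nu (fun g => f g ^+ 2).
Proof.
move=> pf cf; have sf : lspan (size L).+1 b f.
  have [] := @class_span R n K (\sum_(i < n) (n - i) * K).+1 (fun g => (f g)%:C%C) pf.
  - by move=> g U; rewrite cf.
  - move=> v vK lv; exfalso; suff : lev v <= (\sum_(i < n) (n - i) * K)%N%:Z by move: lv; lia.
    rewrite (big_morph Posz PoszD (erefl _)); apply: ler_sum => i _; rewrite PoszM.
    by apply: ler_wpM2l => //; have := vK i; lia.
  move=> J [mm [c [S E]]].
  have Ef g : f g = \sum_j complex.Re (c j) * emG (mm j) g.
    have := congr1 (@complex.Re R) (E g); rewrite /= => ->; rewrite raddf_sum /=.
    by apply: eq_bigr => j _; rewrite reM /= mulr0 subr0.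
  rewrite (funext Ef : f = _); apply: lspan_sum => j _; apply: lspanZ.
  have [mK _] := S j; have [->|[k kL <-]] := em_index mK; first exact: (@lspan_nth _ _ _ _ b 0).
  exact: (@lspan_nth _ _ _ _ b k.+1).
have := bound_step hs (leqnn _) sf; congr (_ <= _ * _).
rewrite -(big_mkord predT (fun i => D (toN (nth [ffun=> ord0] L i)) *
  \prod_(h <- hs) phi (toN (nth [ffun=> ord0] L i)) h ^+ 2)).
rewrite -(big_nth [ffun=> ord0] predT (fun a => D (toN a) * \prod_(h <- hs) phi (toN a) h ^+ 2)).
by rewrite (perm_big _ (permEl (perm_sort _ _))) big_enum.
Qed.

End spectral_bound.
End class_operators.

(** * Degrees of the representations *)

Section immanants.
Context {R : realType} {N : nat}.
Local Notation C := R[i].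
Local Notation G := (SO R N).

Definition cjspan (J : finType) (B : J -> G -> R) (f : G -> C) :=
  exists c : J -> C, forall x, f x = \sum_j c j * (B j x)%:C%C.

Lemma cjspan_re (J : finType) (B : J -> G -> R) f : cjspan B f -> jspan B (fun x => complex.Re (f x)).
Proof.
move=> [c E]; exists (fun j => complex.Re (c j)) => x; rewrite E raddf_sum /=.
by apply: eq_bigr => j _; rewrite reM /= mulr0 subr0.
Qed.

Lemma cjspan_prod (J J' : finType) (B : J -> G -> R) (B' : J' -> G -> R) f f' :
  cjspan B f -> cjspan B' f' ->
  cjspan (fun s : J * J' => fun x => B s.1 x * B' s.2 x) (fun x => f x * f' x).
Proof.
move=> [c E] [c' E']; exists (fun s => c s.1 * c' s.2) => x; rewrite E E' big_distrl /=.
rewrite -(pair_bigA _ (fun i i' => c i * c' i' * (B i x * B' i' x)%:C%C)) /=.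
by apply: eq_bigr => i _; rewrite big_distrr /=; apply: eq_bigr => i' _; rewrite rmorphM; ring.
Qed.

Lemma cjspanZ (J : finType) (B : J -> G -> R) a f : cjspan B f -> cjspan B (fun x => a * f x).
Proof.
move=> [c E]; exists (fun j => a * c j) => x; rewrite E big_distrr /=.
by apply: eq_bigr => j _; rewrite mulrA.
Qed.

Lemma cjspan_sum (J : finType) (B : J -> G -> R) (I : finType) (F : I -> G -> C) :
  (forall i, cjspan B (F i)) -> cjspan B (fun x => \sum_i F i x).
Proof.
move=> /choice[c E]; exists (fun j => \sum_i c i j) => x.
under eq_bigr do rewrite E; rewrite exchange_big /=; apply: eq_bigr => j _.
by rewrite big_distrl.
Qed.

Lemma birep1 : birep (fun (_ : unit) (_ : G) => 1 : R).
Proof.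
split=> [_|//|]; first exact: bm_cst.
  exists (fun _ _ _ => 1) => [*|j x y]; first exact: bm_cst.
  by rewrite big_const card_unit /= addr0 mulr1.
exists (fun _ _ _ => 1) => [*|j x y]; first exact: bm_cst.
by rewrite big_const card_unit /= addr0 mulr1.
Qed.

Lemma birep_bigprod (I : Type) (r : seq I) (J : I -> finType) (B : forall i, J i -> G -> R) :
  (forall i, birep (B i)) -> exists (K : finType) (H : K -> G -> R), [/\ birep H,
    #|K| = (\prod_(i <- r) #|J i|)%N &
    forall f : I -> G -> C, (forall i, cjspan (B i) (f i)) -> cjspan H (fun g => \prod_(i <- r) f i g)].
Proof.
move=> bB; elim: r => [|i r [K [H [bH cK sH]]]].
  exists unit, (fun _ _ => 1); split; first exact: birep1.
    by rewrite card_unit big_nil.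
  move=> f _; exists (fun=> 1) => x; rewrite big_nil.
  by rewrite big_const card_unit /= addr0 mul1r.
exists (J i * K)%type, (fun s x => B i s.1 x * H s.2 x); split.
- exact: birep_prod.
- by rewrite card_prod big_cons cK.
- move=> f sf; rewrite (_ : (fun g => _) = fun g => f i g * \prod_(j <- r) f j g); last first.
    by apply/funext => g; rewrite big_cons.
  by apply: cjspan_prod => //; exact: sH.
Qed.

Lemma birep_sub (J : finType) (P : pred J) (B : J -> G -> R) : birep B ->
  (forall j, (forall x, B j x = 0) \/ exists j' c, P j' /\ forall x, B j x = c * B j' x) ->
  birep (fun (s : {j | P j}) => B (val s)) /\
  forall f, cjspan B f -> cjspan (fun (s : {j | P j}) => B (val s)) f.
Proof.
move=> [bB [A bA AE] [A' bA' AE']] red.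
have /choice[rc rcE] : forall j, exists oc : option {j | P j} * R,
    forall x, B j x = if oc.1 is Some s then oc.2 * B (val s) x else 0.
  move=> j; case: (red j) => [B0|[j' [c [Pj' E]]]]; first by exists (None, 0).
  by exists (Some (Sub j' Pj'), c) => x; rewrite E.
have sumE (V : comNzRingType) (a : J -> V) (h : {rmorphism R -> V}) x : \sum_i a i * h (B i x) =
    \sum_(s : {j | P j}) (\sum_(i | (rc i).1 == Some s) a i * h (rc i).2) * h (B (val s) x).
  under [RHS]eq_bigr do rewrite big_distrl /= big_mkcond /=.
  rewrite exchange_big /=; apply: eq_bigr => i _; rewrite rcE.
  case: (rc i).1 => [s|]; last by rewrite rmorph0 mulr0 big1.
  rewrite (bigD1 s)//= eqxx rmorphM mulrA big1 ?addr0// => s' ss'.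
  by rewrite ifN//; apply: contra ss' => /eqP[->].
split; last first.
  move=> f [c E]; exists (fun s => \sum_(i | (rc i).1 == Some s) c i * ((rc i).2)%:C%C) => x.
  by rewrite E (sumE _ c (real_complex R)).
split; first by move=> s; exact: bB.
- exists (fun s s' x => \sum_(i | (rc i).1 == Some s') A (val s) i x * (rc i).2).
    by move=> s s'; apply: bm_sum => i _; apply: bmM => //; exact: bm_cst.
  by move=> s x y; rewrite AE (sumE _ (fun i => A (val s) i x) idfun).
- exists (fun s s' x => \sum_(i | (rc i).1 == Some s') A' (val s) i x * (rc i).2).
    by move=> s s'; apply: bm_sum => i _; apply: bmM => //; exact: bm_cst.
  move=> s x y; rewrite AE'; under eq_bigr do rewrite mulrC.
  rewrite (sumE _ (fun i => A' (val s) i y) idfun).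
  by apply: eq_bigr => s' _; rewrite mulrC.
Qed.

Section immanant.
Variables (e : bool) (d : nat).
Notation idx := {ffun 'I_d -> 'I_N}.

Definition ichar (s : {perm 'I_d}) : R := if e then (-1) ^+ s else 1.

Lemma icharM s t : ichar (s * t)%g = ichar s * ichar t.
Proof. by rewrite /ichar; case: e; rewrite ?odd_permM ?signr_addb ?mulr1. Qed.

Lemma icharV s : ichar (s^-1)%g = ichar s.
Proof. by rewrite /ichar; case: e; rewrite ?odd_permV. Qed.

Lemma ichar_sqr s : ichar s * ichar s = 1.
Proof. by rewrite /ichar; case: e; rewrite ?mulr1// -expr2 sqrr_sign. Qed.

(** A minor for [e = true] and a permanent for [e = false], with rows [r] and columns [s] possibly
    repeated: up to normalisation, matrix coefficients of the exterior and the symmetric power. *)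
Definition imm (g : 'M[R]_N) (r s : idx) : R :=
  \sum_(p : {perm 'I_d}) ichar p * \prod_j g (r j) (s (p j)).

Definition pidx (p : {perm 'I_d}) (r : idx) : idx := [ffun j => r (p j)].

Lemma imm_perml g r s p : imm g (pidx p r) s = ichar p * imm g r s.
Proof.
rewrite /imm big_distrr /= (reindex_inj (mulgI p)) /=; apply: eq_bigr => q _.
rewrite mulrA -icharM; congr (_ * _); rewrite [RHS](reindex_inj (@perm_inj _ p)) /=.
by apply: eq_bigr => j _; rewrite ffunE permM.
Qed.

Lemma imm_permr g r s p : imm g r (pidx p s) = ichar p * imm g r s.
Proof.
rewrite /imm big_distrr /= (reindex_inj (mulIg (p^-1)%g)) /=; apply: eq_bigr => q _.
rewrite icharM icharV mulrA [ichar p * _]mulrC; congr (_ * _).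
by apply: eq_bigr => j _; rewrite ffunE permM permKV.
Qed.

Lemma pidx_bij p : bijective (pidx p).
Proof.
by exists (pidx (p^-1)%g); move=> r; apply/ffunP => j; rewrite !ffunE ?permKV ?permK.
Qed.

(** Cauchy-Binet summed over all index maps at once; the price is a redundant family, reduced
    afterwards to sorted indices. *)
Lemma birep_imm : birep (fun (rs : idx * idx) (g : G) => imm (SO_mx g) rs.1 rs.2).
Proof.
have bP (a b : 'I_d -> 'I_N) : bm (fun x : G => \prod_j SO_mx x (a j) (b j)).
  by apply: bm_prod => j _; exact: bm_entry.
split.
- by move=> [r s]; apply: bm_sum => p _; apply: bmM; [exact: bm_cst|exact: bP].
- exists (fun (rs ts : idx * idx) (x : G) => (ts.2 == rs.2)%:R * \prod_j SO_mx x (rs.1 j) (ts.1 j)).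
    by move=> [r s] [t u] /=; apply: bmM; [exact: bm_cst|exact: bP].
  move=> [r s] x y /=.
  rewrite -(pair_bigA _ (fun t u : idx => (u == s)%:R * \prod_j SO_mx x (r j) (t j) * imm (SO_mx y) t u)) /=.
  transitivity (\sum_(t : idx) (\prod_j SO_mx x (r j) (t j)) * imm (SO_mx y) t s); last first.
    apply: eq_bigr => t _; rewrite (bigD1 s)//= eqxx mul1r [X in _ + X]big1 ?addr0// => u /negbTE ->.
    by rewrite !mul0r.
  rewrite /imm; under [RHS]eq_bigr do rewrite big_distrr /=.
  rewrite exchange_big /=; apply: eq_bigr => p _.
  under eq_bigr do rewrite mxE; rewrite bigA_distr_bigA big_distrr /=; apply: eq_bigr => t _.
  by rewrite big_split /=; ring.
- exists (fun (rs tu : idx * idx) (y : G) => (tu.1 == rs.1)%:R * \prod_j SO_mx y (tu.2 j) (rs.2 j)).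
    by move=> [r s] [t u] /=; apply: bmM; [exact: bm_cst|exact: bP].
  move=> [r s] x y /=.
  rewrite -(pair_bigA _ (fun t u : idx => imm (SO_mx x) t u * ((t == r)%:R * \prod_j SO_mx y (u j) (s j)))) /=.
  rewrite (bigD1 r)//= eqxx [X in _ + X]big1 ?addr0; last first.
    by move=> t /negbTE ->; rewrite big1// => u _; rewrite mul0r mulr0.
  under [RHS]eq_bigr do rewrite mul1r.
  rewrite /imm; under [RHS]eq_bigr do rewrite big_distrl /=.
  rewrite exchange_big /=; apply: eq_bigr => p _.
  under eq_bigr do rewrite mxE; rewrite bigA_distr_bigA big_distrr /=.
  rewrite (reindex (pidx p)) /=; last exact/onW_bij/pidx_bij.
  apply: eq_bigr => u _; rewrite big_split /= mulrA; congr (_ * _ * _).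
    by apply: eq_bigr => j _; rewrite ffunE.
  rewrite [RHS](reindex_inj (@perm_inj _ p)) /=.
  by apply: eq_bigr => j _; rewrite ffunE.
Qed.

Definition sorted_idx : pred idx := fun r =>
  if e then sorted ltn [seq val (r j) | j <- enum 'I_d] else sorted leq [seq val (r j) | j <- enum 'I_d].

Lemma card_sorted_idx : #|sorted_idx| = if e then 'C(N, d) else if N is N'.+1 then 'C(d + N', d) else (d == 0)%N.
Proof.
pose tup (r : idx) : d.-tuple 'I_N := [tuple r j | j < d].
pose untup (t : d.-tuple 'I_N) : idx := [ffun j => tnth t j].
have tK : cancel tup untup by move=> r; apply/ffunP => j; rewrite ffunE tnth_mktuple.
have uK : cancel untup tup by move=> t; apply: eq_from_tnth => j; rewrite tnth_mktuple ffunE.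
have mE r : map val (tup r) = [seq val (r j) | j <- enum 'I_d] by rewrite /tup /= -map_comp.
rewrite -(card_imset _ (can_inj tK)).
rewrite (_ : imset tup _ = [set t : d.-tuple 'I_N | if e then sorted ltn (map val t) else sorted leq (map val t)]%SET).
  case: e {tK uK mE}; first exact: card_ltn_sorted_tuples.
  case: N => [|N']; last exact: card_sorted_tuples.
  case: d => [|d'].
    rewrite (_ : [set _ | _]%SET = [set: _]%SET) ?cardsT ?card_tuple ?expn0//.
    by apply/setP => t; rewrite !inE tuple0.
  by apply: eq_card0 => t; case: (tnth t ord0).
apply/setP => t; rewrite inE; apply/imsetP/idP => [[r rs ->]|ts].
  by move: rs; rewrite mE /in_mem /= /sorted_idx.
exists (untup t); last by rewrite uK.
by rewrite /in_mem /= /sorted_idx -mE uK.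
Qed.

Lemma sort_idx (r : idx) : exists p, sorted leq [seq val (pidx p r j) | j <- enum 'I_d].
Proof.
pose t : d.-tuple 'I_N := [tuple r j | j < d].
pose le (a b : 'I_N) := (a <= b)%N.
have /tuple_permP[p tp] : perm_eq (sort le t) t by rewrite perm_sort.
exists p; rewrite (_ : [seq _ | _ <- _] = map val (sort le t)).
  by rewrite sorted_map sort_sorted// => a b; exact: leq_total.
rewrite tp /= -map_comp; apply: eq_map => j /=.
by rewrite ffunE tnth_mktuple.
Qed.

Lemma imm_noninj g (r s : idx) i j : e -> i != j -> r i = r j -> imm g r s = 0.
Proof.
move=> e1 ij rij; have := imm_perml g r s (tperm i j).
rewrite (_ : pidx _ r = r); last first.
  by apply/ffunP => k; rewrite ffunE; case: tpermP => [->|->|].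
by rewrite /ichar e1 odd_tperm ij expr1; lra.
Qed.

Lemma imm_noninjr g (r s : idx) i j : e -> i != j -> s i = s j -> imm g r s = 0.
Proof.
move=> e1 ij rij; have := imm_permr g r s (tperm i j).
rewrite (_ : pidx _ s = s); last first.
  by apply/ffunP => k; rewrite ffunE; case: tpermP => [->|->|].
by rewrite /ichar e1 odd_tperm ij expr1; lra.
Qed.

Lemma sort_idx_or (r : idx) : (exists p, sorted_idx (pidx p r)) \/
  (e /\ exists i j, i != j /\ r i = r j).
Proof.
have [p sp] := sort_idx r; rewrite /sorted_idx; case: e; last by left; exists p.
have [/injectiveP ri|/injectivePn[i [j ij rij]]] := boolP (injectiveb r); last by right; split => //; exists i, j.
left; exists p; rewrite ltn_sorted_uniq_leq sp andbT map_inj_uniq ?enum_uniq// => i j /val_inj.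
by rewrite !ffunE => /ri /perm_inj.
Qed.

(** Up to sign the indices may be sorted, strictly for minors, since a repeated index kills them,
    and weakly for permanents. Rows and columns are sorted independently, hence the square. *)
Lemma imm_family : exists (J : finType) (B : J -> G -> R), [/\ birep B,
   #|J| = ((if e then 'C(N, d) else if N is N'.+1 then 'C(d + N', d) else (d == 0)%N) ^ 2)%N &
   forall r s, cjspan B (fun g => (imm (SO_mx g) r s)%:C%C)].
Proof.
have [|bB sB] := @birep_sub _ (fun rs : idx * idx => sorted_idx rs.1 && sorted_idx rs.2) _ birep_imm.
  move=> [r s] /=; have [[p sp]|[e1 [i [j [ij rij]]]]] := sort_idx_or r; last first.
    by left=> x; exact: imm_noninj ij rij.
  have [[q sq]|[e1 [i [j [ij rij]]]]] := sort_idx_or s; last first.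
    by left=> x; exact: imm_noninjr ij rij.
  right; exists (pidx p r, pidx q s), (ichar p * ichar q); split; first by rewrite /= sp sq.
  move=> x /=; rewrite imm_perml imm_permr.
  have := ichar_sqr p; have := ichar_sqr q => hq hp.
  by rewrite -[LHS]mul1r -[X in X * _ = _]mul1r -{1}hp -hq; ring.
exists {rs : idx * idx | sorted_idx rs.1 && sorted_idx rs.2}, (fun s x => imm (SO_mx x) (val s).1 (val s).2).
split=> //.
  rewrite card_sig -card_sorted_idx expnS expn1 -cardX; apply: eq_card => -[r s].
  by rewrite !inE.
move=> r s; apply: sB; exists (fun rs => (rs == (r, s))%:R) => x.
by rewrite (bigD1 (r, s))//= eqxx mul1r big1 ?addr0// => i /negbTE ->; rewrite mul0r.
Qed.

End immanant.
End immanants.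

Section dimension_bound.
Context {R : realType} {n : nat}.
Local Notation C := R[i].
Local Notation N := (n.*2.+1).
Local Notation G := (SO R N).
Local Notation toC := (map_mx (fun x : R => x%:C%C)).

Definition topP k : 'M[C]_(N, k) := \matrix_(i, j) (i == j.*2 :> nat)%:R.

Lemma topPK k : (k <= n)%N -> (topP k)^T *m topP k = 1%:M.
Proof.
move=> kn; apply/matrixP => i j; rewrite !mxE.
have i2 : (i.*2 < N)%N by have := ltn_ord i; lia.
rewrite (bigD1 (Ordinal i2))//= !mxE /= eqxx mul1r big1 => [|l li].
  by rewrite addr0 (inj_eq double_inj).
rewrite !mxE [in X in X%:R * _](_ : (_ == _) = false) ?mul0r//.
by apply: contraNF li => /eqP e; apply/eqP/val_inj.
Qed.

Lemma topPPT k : (k <= n)%N -> topP k *m (topP k)^T = diag_mx (\row_i (i \in top n k)%:R).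
Proof.
move=> kn; apply/matrixP => i j; rewrite !mxE inE.
under eq_bigr do rewrite !mxE -natrM mulnb.
have [/andP[oi ik]|ni] := boolP (~~ odd i && (i < k.*2)%N).
  have i2 : (i./2 < k)%N by lia.
  have ie : i = i./2.*2 :> nat by rewrite -{1}(odd_double_half i) (negbTE oi).
  rewrite (bigD1 (Ordinal i2))//= -ie eqxx /= big1 ?addr0 => [|l li].
    by rewrite eq_sym.
  rewrite (_ : (nat_of_ord i == l.*2) = false)//; apply: contraNF li => /eqP e.
  by apply/eqP/val_inj => /=; rewrite e doubleK.
rewrite mul0rn big1// => l _; rewrite (_ : (nat_of_ord i == l.*2) = false)//.
apply: contraNF ni => /eqP ->; rewrite odd_double /=.
by have := ltn_ord l; lia.
Qed.

(** Sylvester's identity with the coordinate projection on [top n k] factored through [k]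
    coordinates. *)
Lemma Delta_det k (g : 'M[R]_N) : (k <= n)%N ->
  Delta k g = \det ((topP k)^T *m frameV n *m toC g *m (frame n *m topP k)).
Proof.
move=> kn; rewrite /Delta pminor_det1D -topPPT// -(mulmxA (topP k)) det1D_mulC.
by congr determinant; rewrite mulmxBr mulmx1 mulmxBl topPK// addrC subrK /adj !mulmxA.
Qed.

Lemma det_minors k (X : 'M[C]_(k, N)) (Y : 'M[C]_(N, k)) (g : 'M[R]_N) :
  \det (X *m toC g *m Y) = \sum_(r : {ffun 'I_k -> 'I_N}) \sum_(s : {ffun 'I_k -> 'I_N})
    (\prod_i X i (r i)) * (\prod_i Y (s i) i) * (imm true g r s)%:C%C.
Proof.
rewrite /determinant.
transitivity (\sum_(p : {perm 'I_k}) \sum_(r : {ffun 'I_k -> 'I_N}) \sum_(s : {ffun 'I_k -> 'I_N})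
    (\prod_i X i (r i)) * (\prod_i Y (s i) i) * ((-1) ^+ p * \prod_i (g (r i) (s (p i)))%:C%C)).
  apply: eq_bigr => p _.
  have E i : (X *m toC g *m Y) i (p i) = \sum_(u : 'I_N * 'I_N) X i u.1 * (g u.1 u.2)%:C%C * Y u.2 (p i).
    rewrite -(pair_bigA _ (fun a b => X i a * (g a b)%:C%C * Y b (p i))) /= exchange_big /= mxE.
    by apply: eq_bigr => b _; rewrite mxE big_distrl /=; apply: eq_bigr => a _; rewrite mxE.
  under eq_bigr do rewrite mxE.
  have E2 i : (X *m toC g *m Y) i (p i) = \sum_a X i a * \sum_b (g a b)%:C%C * Y b (p i).
    by rewrite E -(pair_bigA _ (fun a b => X i a * (g a b)%:C%C * Y b (p i))) /=;
      apply: eq_bigr => a _; rewrite big_distrr /=; apply: eq_bigr => b _; rewrite mulrA.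
  transitivity ((-1) ^+ p * \prod_i \sum_a X i a * \sum_b (g a b)%:C%C * Y b (p i)).
    by congr (_ * _); apply: eq_bigr => i _; rewrite -E2 mxE.
  rewrite bigA_distr_bigA big_distrr /=; apply: eq_bigr => r _.
  rewrite big_split /= bigA_distr_bigA !big_distrr /=.
  rewrite (reindex (pidx p)) /=; last exact/onW_bij/pidx_bij.
  apply: eq_bigr => s _; rewrite big_split /=.
  rewrite [X in _ = _ * X * _](reindex_inj (@perm_inj _ p)) /=.
  have e1 : \prod_(i < k) (g (r i) (pidx p s i))%:C%C = \prod_(i < k) (g (r i) (s (p i)))%:C%C :> C.
    by apply: eq_bigr => i _; rewrite ffunE.
  have e2 : \prod_(i < k) Y (pidx p s i) (p i) = \prod_(i < k) Y (s (p i)) (p i).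
    by apply: eq_bigr => i _; rewrite ffunE.
  have ac (a b c z : C) : a * (b * (c * z)) = b * z * (a * c) by ring.
  by rewrite e1 e2 ac.
rewrite exchange_big /=; apply: eq_bigr => r _; rewrite exchange_big /=; apply: eq_bigr => s _.
rewrite -big_distrr /=; congr (_ * _); rewrite /imm rmorph_sum; apply: eq_bigr => p _.
by rewrite rmorphM rmorph_prod /ichar rmorph_sign.
Qed.

Lemma Delta_family k : (k <= n)%N -> exists (J : finType) (B : J -> G -> R), [/\ birep B,
   #|J| = ('C(N, k) ^ 2)%N & cjspan B (fun g => Delta k (SO_mx g))].
Proof.
move=> kn; have [J [B [bB cJ sB]]] := @imm_family R N true k; exists J, B; split => //.
rewrite (_ : (fun g => _) = fun g : G => \sum_(r : {ffun 'I_k -> 'I_N}) \sum_(s : {ffun 'I_k -> 'I_N})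
    (\prod_i ((topP k)^T *m frameV n) i (r i)) *
    (\prod_i (frame n *m topP k) (s i) i) * (imm true (SO_mx g) r s)%:C%C); last first.
  by apply/funext => g; rewrite Delta_det// det_minors.
by apply: cjspan_sum => r; apply: cjspan_sum => s; apply: cjspanZ; exact: sB.
Qed.

Definition col_frame (i : 'I_n) : 'cV[C]_N := \col_a frame n a (inord i.*2).

(** Polynomials in the vectors [g (col_frame i)], homogeneous of degree [l i] in the one of index
    [i]. This is what makes symmetric powers of the rows count. *)
Definition multihom (l : 'I_n -> nat) (f : G -> C) := exists (J : finType) (c : J -> C)
  (x : J -> 'I_n -> nat -> 'rV[C]_N), forall g : G, f g =
    \sum_j c j * \prod_(i < n) \prod_(k < l i) (x j i k *m toC (SO_mx g) *m col_frame i) 0 0.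

Lemma multihom1 : multihom (fun=> 0%N) (fun=> 1).
Proof.
exists unit, (fun=> 1), (fun _ _ _ => 0) => g.
rewrite big_const card_unit /= addr0 big1 ?mulr1// => i _.
by rewrite big_ord0.
Qed.

Lemma multihom_eq l l' f : l =1 l' -> multihom l f -> multihom l' f.
Proof. by move=> /funext ->. Qed.

(** The determinant [Delta k] is linear in each of the first [k] vectors [g (col_frame i)]; it is
    expanded after a transposition so that the permutation acts on the rows. *)
Lemma multihom_Delta k l f : (k <= n)%N -> multihom l f ->
  multihom (fun i => l i + (i < k))%N (fun g => Delta k (SO_mx g) * f g).
Proof.
move=> kn [J [c [x E]]].
pose row (p : {perm 'I_k}) (i : 'I_n) : 'rV[C]_N :=
  if insub (i : nat) is Some a then \row_b ((topP k)^T *m frameV n) (p a) b else 0.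
exists ({perm 'I_k} * J)%type, (fun s : {perm 'I_k} * J => (-1) ^+ s.1 * c s.2),
  (fun (s : {perm 'I_k} * J) i m => if m == l i then row s.1 i else x s.2 i m) => g.
rewrite Delta_det// -det_tr /determinant E big_distrl /=.
rewrite -(pair_bigA _ (fun (p : {perm 'I_k}) j => (-1) ^+ p * c j * \prod_(i < n) \prod_(m < l i + (i < k))
   ((if m == l i :> nat then row p i else x j i m) *m toC (SO_mx g) *m col_frame i) 0 0)) /=.
apply: eq_bigr => p _; rewrite big_distrr /=; apply: eq_bigr => j _.
rewrite mulrACA; congr (_ * _).
have -> : \prod_(i < n) \prod_(m < l i + (i < k))
    ((if m == l i :> nat then row p i else x j i m) *m toC (SO_mx g) *m col_frame i) 0 0 =
  (\prod_(i < n | (i < k)%N) (row p i *m toC (SO_mx g) *m col_frame i) 0 0) *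
   \prod_(i < n) \prod_(m < l i) (x j i m *m toC (SO_mx g) *m col_frame i) 0 0.
  rewrite [X in X * _]big_mkcond -big_split /=; apply: eq_bigr => i _.
  have Elt : \prod_(m < l i) ((if m == l i :> nat then row p i else x j i m) *m toC (SO_mx g) *m col_frame i) 0 0
      = \prod_(m < l i) (x j i m *m toC (SO_mx g) *m col_frame i) 0 0.
    by apply: eq_bigr => m _; rewrite ifN// neq_ltn ltn_ord.
  case: ifP => ik; last by rewrite addn0 mul1r.
  by rewrite addn1 big_ord_recr /= eqxx Elt mulrC.
congr (_ * _); rewrite (big_ord_narrow kn) /=; apply: eq_bigr => a _.
rewrite mxE; have Er : row p (widen_ord kn a) = \row_b ((topP k)^T *m frameV n) (p a) b.
  by rewrite /row; case: insubP => [b _ /val_inj ->//|]; rewrite /= ltn_ord.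
rewrite Er.
have Ec : col_frame (widen_ord kn a) = \col_b (frame n *m topP k) b a.
  apply/colP => b; rewrite !mxE (bigD1 (inord a.*2))//= big1 => [|u ua].
    by rewrite !mxE inordK ?eqxx ?mulr1 ?addr0//; have := ltn_ord a; lia.
  rewrite mxE (_ : (nat_of_ord u == a.*2) = false) ?mulr0//.
  apply: contraNF ua => /eqP ua; apply/eqP/val_inj; rewrite /= inordK//.
  by have := ltn_ord a; lia.
rewrite Ec !mxE; apply: eq_bigr => u _; rewrite !mxE; congr (_ * _).
by apply: eq_bigr => v _; rewrite !mxE.
Qed.

Lemma multihom_prod (m : 'I_n -> nat) :
  multihom (fun i : 'I_n => \sum_(j < n) m j * (i < j.+1))%N (fun g => Phi m (SO_mx g)).
Proof.
rewrite /Phi; elim: (index_enum 'I_n) => [|j r IH].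
  have := multihom1; rewrite (_ : (fun g : G => _) = fun=> 1); last by apply/funext => g; rewrite big_nil.
  by apply: multihom_eq => i; rewrite big_nil.
rewrite (_ : (fun g : G => _) = fun g : G => Delta j.+1 (SO_mx g) ^+ m j * \prod_(i <- r) Delta i.+1 (SO_mx g) ^+ m i);
  last by apply/funext => g; rewrite big_cons.
apply: (@multihom_eq (fun i : 'I_n => m j * (i < j.+1) + \sum_(j <- r) m j * (i < j.+1))%N).
  by move=> i; rewrite big_cons.
elim: (m j) => [|e IHe].
  rewrite (_ : (fun g : G => _) = fun g : G => \prod_(i <- r) Delta i.+1 (SO_mx g) ^+ m i) //.
  by apply/funext => g; rewrite mul1r.
rewrite (_ : (fun g : G => _) = fun g : G => Delta j.+1 (SO_mx g) *
  (Delta j.+1 (SO_mx g) ^+ e * \prod_(i <- r) Delta i.+1 (SO_mx g) ^+ m i)); last first.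
  by apply/funext => g; rewrite exprS -mulrA.
apply: multihom_eq (multihom_Delta (ltn_ord j) IHe) => i.
by rewrite mulSn [LHS]addnC addnA.
Qed.

(** A product of [d] linear forms in the one vector [g y] is symmetric in its factors; averaging
    over the permutations expresses it by permanents. *)
Lemma permanent_family d : exists (J : finType) (B : J -> G -> R), [/\ birep B,
   #|J| = ('C(d + n.*2, d) ^ 2)%N &
   forall (x : nat -> 'rV[C]_N) (y : 'cV[C]_N),
     cjspan B (fun g : G => \prod_(k < d) (x k *m toC (SO_mx g) *m y) 0 0)].
Proof.
have [J [B [bB cJ sB]]] := @imm_family R N false d; exists J, B; split => // x y.
have fact0 : (d`!)%:R != 0 :> C by rewrite pnatr_eq0 -lt0n fact_gt0.
rewrite (_ : (fun g : G => _) = fun g : G => \sum_(r : {ffun 'I_d -> 'I_N}) \sum_(s : {ffun 'I_d -> 'I_N})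
   (\prod_(k < d) x k 0 (r k)) * (\prod_(k < d) y (s k) 0) / (d`!)%:R * (imm false (SO_mx g) r s)%:C%C); last first.
  apply/funext => g.
  have E (k : 'I_d) : (x k *m toC (SO_mx g) *m y) 0 0 = \sum_a x k 0 a * \sum_b (SO_mx g a b)%:C%C * y b 0.
    rewrite -mulmxA mxE; apply: eq_bigr => a _; congr (_ * _).
    by rewrite mxE; apply: eq_bigr => b _; rewrite mxE.
  under eq_bigr do rewrite E; rewrite bigA_distr_bigA /=; apply: eq_bigr => r _.
  rewrite big_split /= bigA_distr_bigA big_distrr /=.
  set H := fun s : {ffun 'I_d -> 'I_N} => (\prod_(k < d) x k 0 (r k)) * \prod_(k < d) ((SO_mx g (r k) (s k))%:C%C * y (s k) 0).
  have Hp (p : {perm 'I_d}) : \sum_(s : {ffun 'I_d -> 'I_N}) H s = \sum_(s : {ffun 'I_d -> 'I_N}) (\prod_(k < d) x k 0 (r k)) * (\prod_(k < d) y (s k) 0) * \prod_(k < d) (SO_mx g (r k) (s (p k)))%:C%C.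
    rewrite (reindex (pidx p)) /=; last exact/onW_bij/pidx_bij.
    apply: eq_bigr => s _; rewrite /H big_split /= [X in _ = _ * X * _](reindex_inj (@perm_inj _ p)) /=.
    have e1 : \prod_(i < d) (SO_mx g (r i) (pidx p s i))%:C%C = \prod_(i < d) (SO_mx g (r i) (s (p i)))%:C%C :> C.
      by apply: eq_bigr => i _; rewrite ffunE.
    have e2 : \prod_(i < d) y (pidx p s i) 0 = \prod_(i < d) y (s (p i)) 0.
      by apply: eq_bigr => i _; rewrite ffunE.
    by rewrite e1 e2 [X in _ * X]mulrC mulrA.
  (* The sum [H] is repeated once per permutation; each copy is then rewritten with permuted
     columns, which assembles a permanent. *)
  have : \sum_(p : {perm 'I_d}) \sum_(s : {ffun 'I_d -> 'I_N}) H s = (d`!)%:R * \sum_(s : {ffun 'I_d -> 'I_N}) H s.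
    by rewrite sumr_const mulr_natl; congr (_ *+ _); exact: card_Sn.
  move=> Hs; transitivity ((d`!)%:R^-1 * \sum_(p : {perm 'I_d}) \sum_(s : {ffun 'I_d -> 'I_N}) H s).
    by rewrite Hs mulKf.
  rewrite (eq_bigr _ (fun p _ => Hp p)).
  rewrite exchange_big big_distrr /=; apply: eq_bigr => s _.
  have -> : (imm false (SO_mx g) r s)%:C%C = \sum_(p : {perm 'I_d}) \prod_(k < d) (SO_mx g (r k) (s (p k)))%:C%C :> C.
    by rewrite /imm rmorph_sum; apply: eq_bigr => p _; rewrite /ichar mul1r rmorph_prod.
  by rewrite -big_distrr /= mulrC mulrAC.
by apply: cjspan_sum => r; apply: cjspan_sum => s; apply: cjspanZ; exact: sB.
Qed.

Lemma multihom_family (l : 'I_n -> nat) : exists (J : finType) (B : J -> G -> R), [/\ birep B,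
   #|J| = (\prod_i 'C(l i + n.*2, l i) ^ 2)%N & forall f, multihom l f -> cjspan B f].
Proof.
have /choice[F P] : forall i : 'I_n, exists F : {J : finType & J -> G -> R}, [/\ birep (projT2 F),
   #|projT1 F| = ('C(l i + n.*2, l i) ^ 2)%N &
   forall (x : nat -> 'rV[C]_N) (y : 'cV[C]_N),
     cjspan (projT2 F) (fun g : G => \prod_(k < l i) (x k *m toC (SO_mx g) *m y) 0 0)].
  by move=> i; have [J [B H]] := permanent_family (l i); exists (existT _ J B).
pose J i := projT1 (F i); pose B i : J i -> G -> R := projT2 (F i).
have bB i : birep (B i) by have [] := P i.
have [K [H [bH cK sH]]] := birep_bigprod (index_enum 'I_n) bB; exists K, H; split => //.
  by rewrite cK; apply: eq_bigr => i _; have [] := P i.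
move=> f [J' [c [x E]]]; rewrite (funext E : f = _); apply: cjspan_sum => j; apply: cjspanZ.
by apply: sH => i; have [_ _] := P i; exact.
Qed.

Definition rowlen (m : 'I_n -> nat) (i : 'I_n) : nat := \sum_(j < n) m j * (i < j.+1).

(** Any splitting of the columns is allowed: those in [m'] are counted as minors, one factor per
    column, and the remaining ones as permanents, one factor per row. The freedom of [m'] is what
    the degree estimates exploit. *)
Lemma phi_dim (nu : probability G R) (m m' : 'I_n -> nat) :
  (forall i, m' i <= m i)%N ->
  exists (J : finType) (B : J -> G -> R), [/\ birep B, jspan B (phi nu m) &
    #|J| = ((\prod_(i < n) 'C(N, i.+1) ^ (2 * m' i)) *
      \prod_(i < n) 'C(rowlen (fun j => m j - m' j)%N i + n.*2, rowlen (fun j => m j - m' j)%N i) ^ 2)%N].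
Proof.
move=> mm.
have /choice[F1 P1] : forall i : 'I_n, exists F : {J : finType & J -> G -> R}, [/\ birep (projT2 F),
   #|projT1 F| = ('C(N, i.+1) ^ 2)%N & cjspan (projT2 F) (fun g => Delta i.+1 (SO_mx g))].
  by move=> i; have [J [B H]] := Delta_family (ltn_ord i); exists (existT _ J B).
pose J1 i := projT1 (F1 i); pose B1 i : J1 i -> G -> R := projT2 (F1 i).
have bB1 i : birep (B1 i) by have [] := P1 i.
have /choice[F2 P2] : forall i : 'I_n, exists F : {J : finType & J -> G -> R}, [/\ birep (projT2 F),
   #|projT1 F| = ('C(N, i.+1) ^ (2 * m' i))%N & cjspan (projT2 F) (fun g => Delta i.+1 (SO_mx g) ^+ m' i)].
  move=> i; have [J [B [bB cB sB]]] := birep_bigprod (nseq (m' i) tt) (fun _ : unit => bB1 i).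
  exists (existT _ J B); have [_ c1 s1] := P1 i; split => //=.
    by rewrite cB big_nseq iter_muln_1 c1 -expnM.
  have := sB (fun _ g => Delta i.+1 (SO_mx g)) (fun=> s1).
  by congr cjspan; apply/funext => g; rewrite big_nseq iter_mulr_1.
pose J2 i := projT1 (F2 i); pose B2 i : J2 i -> G -> R := projT2 (F2 i).
have bB2 i : birep (B2 i) by have [] := P2 i.
have [J3 [B3 [bB3 c3 s3]]] := birep_bigprod (index_enum 'I_n) bB2.
have [J4 [B4 [bB4 c4 s4]]] := multihom_family (rowlen (fun j => m j - m' j)%N).
exists (J3 * J4)%type, (fun s x => B3 s.1 x * B4 s.2 x).
have bb : birep (fun s : J3 * J4 => fun x => B3 s.1 x * B4 s.2 x) by exact: birep_prod.
split => //; last first.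
  rewrite card_prod c3 c4; congr (_ * _)%N; apply: eq_bigr => i _.
  by have [_ c2 _] := P2 i.
apply: (birep_conj nu bb (f := fun g => complex.Re (Phi m (SO_mx g)))).
apply: cjspan_re; rewrite (_ : (fun x : G => _) = fun x : G =>
   (\prod_(i < n) Delta i.+1 (SO_mx x) ^+ m' i) * Phi (fun j => m j - m' j)%N (SO_mx x)).
  apply: cjspan_prod; last exact/s4/multihom_prod.
  by apply: s3 => i; have [_ _ s2] := P2 i.
apply/funext => g; rewrite /Phi -big_split /=; apply: eq_bigr => i _.
by rewrite -exprD subnKC.
Qed.

End dimension_bound.

(** * Eigenvalues at plane rotations *)

Section rotation_determinant.
Context {R : realType} {n : nat}.
Local Notation C := R[i].
Local Notation N := (n.*2.+1).
Local Notation G := (SO R N).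
Local Notation toC := (map_mx (fun x : R => x%:C%C)).

Definition ent (U : G) (i a : nat) : R := SO_mx U (inord i) (inord a).
Definition pairsq (a i : nat) (U : G) : R := ent U i.*2 a ^+ 2 + ent U i.*2.+1 a ^+ 2.
Definition hsum (a h : nat) (U : G) : R := \sum_(i < h) pairsq a i U.
Definition hdot (h : nat) (U : G) : R := \sum_(i < h) (ent U i.*2 0 * ent U i.*2 1 + ent U i.*2.+1 0 * ent U i.*2.+1 1).
Definition hdet (h : nat) (U : G) : R := \sum_(i < h) (ent U i.*2 0 * ent U i.*2.+1 1 - ent U i.*2.+1 0 * ent U i.*2 1).
(** Read the first two columns in complex coordinates [U_(2i,a) + i U_(2i+1,a)], cut to the first
    [h] planes, and let [H] be half their Hermitian Gram matrix. Then [hS] is the trace of [H], [he]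
    its determinant and [hX] the trace of [H - H^2]. *)
Definition hS (h : nat) (U : G) : R := (hsum 0 h U + hsum 1 h U) / 2.
Definition he (h : nat) (U : G) : R := (hsum 0 h U * hsum 1 h U - hdot h U ^+ 2 - hdet h U ^+ 2) / 4.
Definition hX (h : nat) (U : G) : R := hS h U - hS h U ^+ 2 + 2 * he h U.

Lemma bm_ent i a : bm (fun U => ent U i a).
Proof. exact: bm_entry. Qed.

Lemma bm_pairsq a i : bm (pairsq a i).
Proof. by apply: bmD; apply: bmX; exact: bm_ent. Qed.

Lemma bm_hsum a h : bm (hsum a h).
Proof. by apply: bm_sum => i _; exact: bm_pairsq. Qed.

Lemma bm_hS h : bm (hS h).
Proof. by apply: bmM; [apply: bmD; exact: bm_hsum|exact: bm_cst]. Qed.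

Lemma bm_he h : bm (he h).
Proof.
apply: bmM; last exact: bm_cst.
apply: bmB; [apply: bmB; [apply: bmM; exact: bm_hsum|apply: bmX]|apply: bmX].
  by apply: bm_sum => i _; apply: bmD; apply: bmM; exact: bm_ent.
by apply: bm_sum => i _; apply: bmB; apply: bmM; exact: bm_ent.
Qed.

Lemma bm_hX h : bm (hX h).
Proof.
apply: bmD; first by apply: bmB; [|apply: bmX]; exact: bm_hS.
by apply: bmM; [exact: bm_cst|exact: bm_he].
Qed.

Definition sqmod (z : C) : R := complex.Re z ^+ 2 + complex.Im z ^+ 2.

Lemma sqmodM z w : sqmod (z * w) = sqmod z * sqmod w.
Proof. by rewrite /sqmod reM imM; ring. Qed.

Lemma sqmod_ge0 z : 0 <= sqmod z.
Proof. by rewrite addr_ge0 ?sqr_ge0. Qed.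

Lemma sqmodX z k : sqmod (z ^+ k) = sqmod z ^+ k.
Proof. by elim: k => [|k IH]; rewrite ?exprS ?sqmodM ?IH// /sqmod /=; ring. Qed.

Lemma sqmod_prod (I : Type) (r : seq I) (F : I -> C) :
  sqmod (\prod_(i <- r) F i) = \prod_(i <- r) sqmod (F i).
Proof.
elim: r => [|i r IH]; last by rewrite !big_cons sqmodM IH.
by rewrite !big_nil /sqmod /=; ring.
Qed.

End rotation_determinant.

Section rotation_determinant_computation.
Context {R : realType}.
Local Notation C := R[i].
Local Notation toC := (map_mx (fun x : R => x%:C%C)).

Lemma frame_even n (a b : 'I_(n.*2.+1)) i : (i < n)%N -> b = i.*2 :> nat ->
  frame n a b = (a == i.*2 :> nat)%:R + (a == i.*2.+1 :> nat)%:R * (0 -i* 1)%C :> C.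
Proof.
elim: n a b i => [//|n IH] a b i iN bi.
change ((block_mx frame2 0 0 (frame n) : 'M[C]_(2 + n.*2.+1)) a b =
  (a == i.*2 :> nat)%:R + (a == i.*2.+1 :> nat)%:R * (0 -i* 1)%C).
case: i iN bi => [|i] iN bi.
  have -> : b = lshift n.*2.+1 (ord0 : 'I_2) :> 'I_(2 + n.*2.+1) by apply: val_inj.
  rewrite block_mxEh row_mxEl -[a](splitK (a : 'I_(2 + n.*2.+1))); case: (fintype.split _) => c /=.
    rewrite col_mxEu mxE; case: c => [[|[|//]] ?] /=; first by rewrite mul0r addr0.
    by rewrite mul1r add0r.
  by rewrite col_mxEd mxE /= mul0r addr0.
have b2 : (b - 2 < n.*2.+1)%N by have := ltn_ord b; lia.
have -> : b = rshift 2 (Ordinal b2) :> 'I_(2 + n.*2.+1) by apply: val_inj; rewrite /= subnKC// bi doubleS.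
rewrite block_mxEh row_mxEr -[a](splitK (a : 'I_(2 + n.*2.+1))); case: (fintype.split _) => c /=.
  by rewrite col_mxEu mxE; case: c => [[|[|//]] ?] /=; rewrite mul0r addr0.
by rewrite col_mxEd (IH _ _ i) //=; lia.
Qed.

Lemma frameV_even n (a b : 'I_(n.*2.+1)) i : (i < n)%N -> a = i.*2 :> nat ->
  frameV n a b = 2^-1 * ((b == i.*2 :> nat)%:R + (b == i.*2.+1 :> nat)%:R * (0 +i* 1)%C) :> C.
Proof.
elim: n a b i => [//|n IH] a b i iN bi.
change ((block_mx frameV2 0 0 (frameV n) : 'M[C]_(2 + n.*2.+1)) a b =
  2^-1 * ((b == i.*2 :> nat)%:R + (b == i.*2.+1 :> nat)%:R * (0 +i* 1)%C)).
case: i iN bi => [|i] iN bi.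
  have -> : a = lshift n.*2.+1 (ord0 : 'I_2) :> 'I_(2 + n.*2.+1) by apply: val_inj.
  rewrite block_mxEv col_mxEu -[b](splitK (b : 'I_(2 + n.*2.+1))); case: (fintype.split _) => c /=.
    rewrite row_mxEl !mxE; case: c => [[|[|//]] ?] /=; first by rewrite mul0r addr0.
    by rewrite mul1r add0r.
  by rewrite row_mxEr mxE /= mul0r addr0 mulr0.
have b2 : (a - 2 < n.*2.+1)%N by have := ltn_ord a; lia.
have -> : a = rshift 2 (Ordinal b2) :> 'I_(2 + n.*2.+1) by apply: val_inj; rewrite /= subnKC// bi doubleS.
rewrite block_mxEv col_mxEd -[b](splitK (b : 'I_(2 + n.*2.+1))); case: (fintype.split _) => c /=.
  by rewrite row_mxEl mxE; case: c => [[|[|//]] ?] /=; rewrite mul0r addr0 mulr0.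
by rewrite row_mxEr (IH _ _ i) //=; lia.
Qed.

Lemma det2 (A : 'M[C]_2) : \det A = A 0 0 * A 1 1 - A 0 1 * A 1 0.
Proof.
rewrite (expand_det_row _ ord0) !big_ord_recl big_ord0 addr0 /cofactor !det_mx11 !mxE /=.
rewrite expr0 mul1r expr1 mulN1r mulrN.
by congr (_ * A _ _ - A _ _ * A _ _); apply: val_inj.
Qed.

Variable n : nat.
Local Notation N := (n.+1.*2.+1).
Local Notation G := (SO R N).

(** The conjugated rotation is [1 + W (r - 1) W^T] with [W] the first two columns of [U], so
    Sylvester's identity leaves the two by two determinant of [1 + H (r - 1)], with [H] half the
    Hermitian Gram matrix of these columns. *)
Lemma Delta_rotation h (U : G) theta : (h <= n.+1)%N ->
  let s := sin (theta / 2) ^+ 2 in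
  Delta h (SO_mx (U * rot12 n.+1 theta * U^-1)%g) =
  ((1 - 2 * s * hS h U + 4 * s * he h U) +i* (sin theta * hdet h U))%C.
Proof.
move=> hn s; rewrite Delta_det// !SO_mxM SO_mxV -[SO_mx (rot12 _ _)]/(rot12_mx n.*2.+1 theta).
have ct : cos theta = 1 - 2 * s.
  rewrite /s [in LHS](_ : theta = (theta / 2) *+ 2); last by lra.
  by rewrite cos_mulr2n; have := cos2Dsin2 (theta / 2); lra.
have st : sin theta ^+ 2 = 4 * s * (1 - s) by have := cos2Dsin2 theta; rewrite ct; lra.
pose W : 'M[R]_(N, 2) := SO_mx U *m (col_mx 1%:M 0 : 'M[R]_(2 + n.*2.+1, 2)).
have /andP[/eqP UU _] := SO_mxP U.
have ME : SO_mx U *m rot12_mx n.*2.+1 theta *m (SO_mx U)^T = 1%:M + W *m (rot2 theta - 1%:M) *m W^T.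
  have -> : rot12_mx n.*2.+1 theta = 1%:M + col_mx 1%:M 0 *m (rot2 theta - 1%:M) *m row_mx 1%:M 0.
    rewrite mul_col_mx mul1mx mul0mx mul_col_mx mul0mx !mul_mx_row mulmx1 mulmx0.
    rewrite /rot12_mx scalar_mx_block -row_mx0 -block_mxEv add_block_mx !add0r addr0.
    by rewrite addrC subrK.
  have tc : (col_mx 1%:M 0 : 'M[R]_(2 + n.*2.+1, 2))^T = row_mx 1%:M 0 by rewrite tr_col_mx trmx1 trmx0.
  have WT : W^T = @mulmx R 2 N N (row_mx (1%:M : 'M[R]_2) (0 : 'M[R]_(2, n.*2.+1))) (SO_mx U)^T.
    by rewrite /W trmx_mul -tc.
  by rewrite WT mulmxDr mulmx1 mulmxDl UU /W !mulmxA.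
pose X : 'M[C]_(h, N) := (topP h)^T *m frameV n.+1.
pose Y : 'M[C]_(N, h) := frame n.+1 *m topP h.
have XY : X *m Y = 1%:M.
  by rewrite /X /Y mulmxA -(mulmxA _ (frameV _)) frameK mulmx1 topPK.
have -> : X *m toC (SO_mx U *m rot12_mx n.*2.+1 theta *m (SO_mx U)^T) *m Y =
    1%:M + (X *m toC W *m toC (rot2 theta - 1%:M)) *m (toC W^T *m Y).
  rewrite ME (map_mxD (real_complex R)) (map_scalar_mx (real_complex R)) !(map_mxM (real_complex R)).
  by rewrite mulmxDr mulmx1 mulmxDl XY !mulmxA.
rewrite det1D_mulC -/X -/Y.
pose H := toC W^T *m Y *m (X *m toC W).
have -> : toC W^T *m Y *m (X *m toC W *m toC (rot2 theta - 1%:M)) = H *m toC (rot2 theta - 1%:M).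
  by rewrite /H !mulmxA.
have WE i (a : 'I_2) : W i a = SO_mx U i (inord a).
  have ea : (inord a : 'I_N) = lshift n.*2.+1 a.
    by apply: ord_inj; rewrite inordK//=; have := ltn_ord a; lia.
  have cE (j : 'I_(2 + n.*2.+1)) : (col_mx 1%:M 0 : 'M[R]_(2 + n.*2.+1, 2)) j a = (j == lshift n.*2.+1 a)%:R.
    rewrite -[j]splitK; case: (fintype.split j) => c /=; last by rewrite col_mxEd mxE eq_rlshift.
    by rewrite col_mxEu mxE eq_lshift.
  transitivity (\sum_(j < N) SO_mx U i j * (j == inord a)%:R).
    by rewrite /W mxE; apply: eq_bigr => j _; congr (_ * _); rewrite ea; exact: cE.
  rewrite (bigD1 (inord a))//= eqxx mulr1 big1 ?addr0// => j /negbTE ->.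
  by rewrite mulr0.
have tE (j : 'I_N) (b : 'I_h) : topP h j b = (j == b.*2 :> nat)%:R :> C by rewrite mxE.
have wTE (a : 'I_2) j : (toC W^T) a j = (SO_mx U j (inord a))%:C%C by rewrite -WE mxE [in LHS]mxE.
have wE (a : 'I_2) j : (toC W) j a = (SO_mx U j (inord a))%:C%C by rewrite -WE mxE.
have sum2 (V : C) (F : 'I_N -> C) i (c1 c2 : C) : (i < h)%N ->
   \sum_l F l * ((l == i.*2 :> nat)%:R * c1 + (l == i.*2.+1 :> nat)%:R * c2) =
   F (inord i.*2) * c1 + F (inord i.*2.+1) * c2.
  move=> ih; have e1 : (inord i.*2 : 'I_N) = i.*2 :> nat by rewrite (@inordK n.+1.*2)//; lia.
  have e2 : (inord i.*2.+1 : 'I_N) = i.*2.+1 :> nat by rewrite (@inordK n.+1.*2)//; lia.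
  have ne : (inord i.*2.+1 : 'I_N) != inord i.*2 by apply/eqP => /(congr1 (@nat_of_ord _)); rewrite e1 e2; lia.
  rewrite (bigD1 (inord i.*2))//= (bigD1 (inord i.*2.+1))//= big1 ?addr0 => [|l /andP[l1 l2]].
    rewrite e1 e2 !eqxx (_ : (i.*2 == i.*2.+1) = false); last lia.
    by rewrite (_ : (i.*2.+1 == i.*2) = false); [rewrite !mul0r !mul1r addr0 add0r|lia].
  have -> : (l == i.*2 :> nat) = false by apply: contraNF l1 => /eqP l1; apply/eqP/ord_inj; rewrite e1.
  have -> : (l == i.*2.+1 :> nat) = false by apply: contraNF l2 => /eqP l2; apply/eqP/ord_inj; rewrite e2.
  by rewrite !mul0r addr0 mulr0.
have YE (a : 'I_2) (i : 'I_h) : (toC W^T *m Y) a i = (ent U i.*2 a -i* ent U i.*2.+1 a)%C.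
  rewrite mxE; have iN : (i < n.+1)%N := leq_trans (ltn_ord i) hn.
  have YEl l : Y l i = (l == i.*2 :> nat)%:R * 1 + (l == i.*2.+1 :> nat)%:R * (0 -i* 1)%C.
    rewrite /Y mxE (bigD1 (inord i.*2))// big1 => [|j ji].
      have i2 : (inord i.*2 : 'I_N) = i.*2 :> nat by rewrite (@inordK n.+1.*2)//; lia.
      by rewrite [LHS]addr0 tE i2 eqxx mulr1 (frame_even _ iN i2) mulr1.
    rewrite tE (_ : (_ == _) = false) ?mulr0//; apply: contraNF ji => /eqP ji.
    by apply/eqP/ord_inj; rewrite ji (@inordK n.+1.*2)//; lia.
  under eq_bigr do rewrite YEl; rewrite (sum2 0)// !wTE mulr1 /ent.
  by apply: complex_ext; rewrite /=; ring.
have XE (i : 'I_h) (a : 'I_2) : (X *m toC W) i a = 2^-1 * (ent U i.*2 a +i* ent U i.*2.+1 a)%C.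
  rewrite mxE; have iN : (i < n.+1)%N := leq_trans (ltn_ord i) hn.
  have XEl l : X i l = 2^-1 * ((l == i.*2 :> nat)%:R * 1 + (l == i.*2.+1 :> nat)%:R * (0 +i* 1)%C).
    rewrite /X mxE (bigD1 (inord i.*2))// big1 => [|j ji].
      have i2 : (inord i.*2 : 'I_N) = i.*2 :> nat by rewrite (@inordK n.+1.*2)//; lia.
      by rewrite [LHS]addr0 mxE tE i2 eqxx mul1r (frameV_even _ iN i2) mulr1.
    rewrite mxE tE (_ : (_ == _) = false) ?mul0r//; apply: contraNF ji => /eqP ji.
    by apply/eqP/ord_inj; rewrite ji (@inordK n.+1.*2)//; lia.
  transitivity (2^-1 * \sum_l (toC W) l a * ((l == i.*2 :> nat)%:R * 1 + (l == i.*2.+1 :> nat)%:R * (0 +i* 1)%C)).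
    by rewrite big_distrr /=; apply: eq_bigr => l _; rewrite XEl -mulrA; congr (_ * _); rewrite mulrC.
  congr (_ * _); rewrite (sum2 0)// !wE mulr1 /ent.
  by apply: complex_ext; rewrite /=; ring.
have half : (2^-1 : C) = (2^-1 : R)%:C%C by rewrite fmorphV rmorph_nat.
have HE (a b : 'I_2) : H a b = (2^-1 * (\sum_(i < h) (ent U i.*2 a * ent U i.*2 b + ent U i.*2.+1 a * ent U i.*2.+1 b))
     +i* (2^-1 * \sum_(i < h) (ent U i.*2 a * ent U i.*2.+1 b - ent U i.*2.+1 a * ent U i.*2 b)))%C.
  rewrite /H mxE; apply: complex_ext; rewrite raddf_sum /= big_distrr /=; apply: eq_bigr => i _.
    rewrite YE XE half; transitivity (complex.Re ((ent U i.*2 a -i* ent U i.*2.+1 a)%C * ((2^-1)%:C%C * (ent U i.*2 b +i* ent U i.*2.+1 b)%C))) => //.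
    by rewrite reM /=; ring.
  rewrite YE XE half; transitivity (complex.Im ((ent U i.*2 a -i* ent U i.*2.+1 a)%C * ((2^-1)%:C%C * (ent U i.*2 b +i* ent U i.*2.+1 b)%C))) => //.
  by rewrite imM /=; ring.
have xx a : \sum_(i < h) (ent U i.*2 a * ent U i.*2 a + ent U i.*2.+1 a * ent U i.*2.+1 a) = hsum a h U.
  by apply: eq_bigr => i _; rewrite /pairsq !expr2.
have dd a : \sum_(i < h) (ent U i.*2 a * ent U i.*2.+1 a - ent U i.*2.+1 a * ent U i.*2 a) = 0.
  by apply: big1 => i _; ring.
have q' : \sum_(i < h) (ent U i.*2 1 * ent U i.*2 0 + ent U i.*2.+1 1 * ent U i.*2.+1 0) = hdot h U.
  by apply: eq_bigr => i _; ring.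
have d' : \sum_(i < h) (ent U i.*2 1 * ent U i.*2.+1 0 - ent U i.*2.+1 1 * ent U i.*2 0) = - hdet h U.
  by rewrite -sumrN; apply: eq_bigr => i _; ring.
rewrite det2 !mxE !big_ord_recl !big_ord0 !addr0 !HE !mxE /= ?lift0 /= !xx !dd !q' !d' -/(hdot h U) -/(hdet h U) ct.
apply: complex_ext; rewrite /= ?mulr1n ?mulr0n ?subr0 ?add0r /hS /he.
  have := st; set si := sin theta => st'; have -> : 4 * s = si ^+ 2 + 4 * s ^+ 2 by rewrite st'; ring.
  by field.
by field.
Qed.

End rotation_determinant_computation.

Section eigenvalue_bound.
Context {R : realType} {n : nat}.
Local Notation C := R[i].
Local Notation G := (SO R n.+1.*2.+1).

(** The squared modulus is at most [(1 - 2 s X)^2], the difference being a combination of squares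
    with nonnegative coefficients; then [1 - x <= exp (- x)]. *)
Lemma sqmod_Delta_rotation h (U : G) theta : (h <= n.+1)%N ->
  sqmod (Delta h (SO_mx (U * rot12 n.+1 theta * U^-1)%g)) <= expR (- 2 * sin (theta / 2) ^+ 2 * hX h U) ^+ 2.
Proof.
move=> hn; rewrite Delta_rotation//; set s := sin (theta / 2) ^+ 2.
have ct : cos theta = 1 - 2 * s.
  rewrite /s [in LHS](_ : theta = (theta / 2) *+ 2); last by lra.
  by rewrite cos_mulr2n; have := cos2Dsin2 (theta / 2); lra.
have st : sin theta ^+ 2 = 4 * s * (1 - s) by have := cos2Dsin2 theta; rewrite ct; lra.
have s0 : 0 <= s by exact: sqr_ge0.
have s1 : s <= 1 by have := sqr_ge0 (cos (theta / 2)); have := cos2Dsin2 (theta / 2); rewrite -/s; lra.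
set S := hS h U; set e := he h U; set d := hdet h U; set q := hdot h U.
pose x := hsum 0 h U; pose y := hsum 1 h U.
have X12 : 1 - 2 * s * hX h U >= 0.
  have -> : 1 - 2 * s * hX h U = (1 - s) + s * (1 - S) ^+ 2 + s * (((x - y) / 2) ^+ 2 + q ^+ 2 + d ^+ 2).
    by rewrite /hX -/S -/e /S /hS /e /he -/x -/y -/q -/d; field.
  by apply: addr_ge0; [apply: addr_ge0; rewrite ?subr_ge0// mulr_ge0 ?sqr_ge0|rewrite mulr_ge0// !addr_ge0 ?sqr_ge0].
apply: (@le_trans _ _ ((1 - 2 * s * hX h U) ^+ 2)); last first.
  rewrite ler_pXn2r ?nnegrE ?expR_ge0//; apply: le_trans (expR_ge1Dx _).
  lra.
rewrite -subr_ge0 /sqmod /= exprMn st.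
have -> : (1 - 2 * s * hX h U) ^+ 2 - ((1 - 2 * s * S + 4 * s * e) ^+ 2 + 4 * s * (1 - s) * d ^+ 2) =
   4 * s * ((1 - s) * (((x - y) / 2) ^+ 2 + q ^+ 2) + s * (1 - S) ^+ 2 * (((x - y) / 2) ^+ 2 + q ^+ 2 + d ^+ 2)).
  by rewrite /hX -/S -/e /S /hS /e /he -/x -/y -/q -/d; field.
apply: mulr_ge0; first by rewrite mulr_ge0.
have A : 0 <= ((x - y) / 2) ^+ 2 + q ^+ 2 by rewrite addr_ge0 ?sqr_ge0.
apply: addr_ge0; first by rewrite mulr_ge0// subr_ge0.
by apply: mulr_ge0; [rewrite mulr_ge0 ?sqr_ge0|rewrite addr_ge0 ?sqr_ge0].
Qed.

Definition wX (m : 'I_n.+1 -> nat) (U : G) : R := \sum_(i < n.+1) (m i)%:R * hX i.+1 U.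

Lemma bm_wX m : bm (wX m).
Proof. by apply: bm_sum => i _; apply: bmM; [exact: bm_cst|exact: bm_hX]. Qed.

Lemma bm_expR d (T : measurableType d) (f : T -> R) : bm f -> bm (fun x => expR (f x)).
Proof.
move=> [mf [M fM]]; split; first by apply: measurableT_comp.
by exists (expR M) => x; rewrite ger0_norm ?expR_ge0// ler_expR (le_trans (ler_norm _)).
Qed.

Lemma Re_Phi_le m (U : G) theta :
  `|complex.Re (Phi m (SO_mx (U * rot12 n.+1 theta * U^-1)%g))| <=
  expR (- 2 * sin (theta / 2) ^+ 2 * wX m U).
Proof.
set z := Phi _ _; rewrite -(@ler_pXn2r _ 2) ?nnegrE ?expR_ge0// real_normK ?num_real//.
apply: (@le_trans _ _ (sqmod z)); first by rewrite /sqmod lerDl sqr_ge0.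
rewrite /z /Phi sqmod_prod; under eq_bigr do rewrite sqmodX.
have -> : expR (- 2 * sin (theta / 2) ^+ 2 * wX m U) ^+ 2 =
    \prod_(i < n.+1) (expR (- 2 * sin (theta / 2) ^+ 2 * hX i.+1 U) ^+ 2) ^+ m i.
  rewrite /wX big_distrr /= expR_sum -prodrXl; apply: eq_bigr => i _.
  by rewrite exprAC -[in RHS]expRM_natl; congr (expR _ ^+ 2); ring.
by apply: ler_prod => i _; rewrite exprn_ge0 ?sqmod_ge0//= lerXn2r ?nnegrE ?sqmod_ge0 ?sqr_ge0 ?sqmod_Delta_rotation.
Qed.

(** Concavity of the power [s]: average [exp (s a) <= (1 - s) + s exp a] at [a = f - ln mu]. *)
Lemma expR_jensen d (T : measurableType d) (P : probability T R) (f : T -> R) (s : R) :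
  bm f -> 0 <= s <= 1 -> 0 < Ex P (fun x => expR (f x)) ->
  Ex P (fun x => expR (s * f x)) <= expR (s * ln (Ex P (fun x => expR (f x)))).
Proof.
move=> bf /andP[s0 s1]; set mu := Ex P (fun x => expR (f x)) => mu0.
have be : bm (fun x => expR (f x)) by exact: bm_expR.
have conv (a : R) : expR (s * a) <= (1 - s) + s * expR a.
  have h1 := expR_ge1Dx ((1 - s) * a); have h2 := expR_ge1Dx (- (s * a)).
  have E1 : expR a = expR (s * a) * expR ((1 - s) * a) by rewrite -expRD; congr expR; ring.
  have E2 : 1 = expR (s * a) * expR (- (s * a)) by rewrite -expRD subrr expR0.
  have u0 := expR_ge0 (s * a); have s1' : 0 <= 1 - s by rewrite subr_ge0.
  have k1 := ler_wpM2l u0 h1; have k2 := ler_wpM2l u0 h2; rewrite -E1 in k1; rewrite -E2 in k2.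
  by have := ler_wpM2l s0 k1; have := ler_wpM2l s1' k2; lra.
have bs : bm (fun x => expR (s * f x)) by apply: bm_expR; apply: bmM => //; exact: bm_cst.
have pt x : expR (s * f x) <= expR (s * ln mu) * ((1 - s) + s * (expR (f x) / mu)).
  have -> : expR (f x) / mu = expR (f x - ln mu) by rewrite expRB (lnK mu0).
  have -> : expR (s * f x) = expR (s * ln mu) * expR (s * (f x - ln mu)).
    by rewrite -expRD; congr expR; ring.
  by rewrite ler_pM2l ?expR_gt0.
have bb : bm (fun x => expR (s * ln mu) * ((1 - s) + s * (expR (f x) / mu))).
  apply: bmM; first exact: bm_cst.
  by apply: bmD; [exact: bm_cst|apply: bmM; [exact: bm_cst|apply: bmM; [|exact: bm_cst]]].
apply: le_trans (Ex_le P bs bb pt) _.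
have E x : expR (s * ln mu) * ((1 - s) + s * (expR (f x) / mu)) =
   expR (s * ln mu) * (1 - s) + (expR (s * ln mu) * s / mu) * expR (f x) by ring.
rewrite (funext E) Ex_lin//; last exact: bm_cst.
by rewrite Ex_cst -/mu divfK ?gt_eqF//; lra.
Qed.

Lemma phi_le (nu : probability G R) m theta :
  `|phi nu m (rot12 n.+1 theta)| <=
  expR (sin (theta / 2) ^+ 2 * ln (Ex nu (fun U => expR (- 2 * wX m U)))).
Proof.
have bw : bm (fun U => - 2 * wX m U) by apply: bmM; [exact: bm_cst|exact: bm_wX].
have s01 : 0 <= sin (theta / 2) ^+ 2 <= 1.
  by rewrite sqr_ge0; have := sqr_ge0 (cos (theta / 2)); have := cos2Dsin2 (theta / 2); lra.
have bP : bm (fun U : G => complex.Re (Phi m (SO_mx (U * rot12 n.+1 theta * U^-1)%g))).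
  by have [] := bmc_conj (rot12 n.+1 theta) (pol_bmc (Phi_pol m)).
have bE : bm (fun U => expR (sin (theta / 2) ^+ 2 * (- 2 * wX m U))).
  by apply: bm_expR; apply: bmM => //; exact: bm_cst.
apply: le_trans (Ex_norm nu bP) _.
apply: (@le_trans _ _ (Ex nu (fun U => expR (sin (theta / 2) ^+ 2 * (- 2 * wX m U))))).
  apply: Ex_le => //; first exact: bm_norm.
  by move=> U; have := Re_Phi_le m U theta; congr (_ <= expR _); ring.
apply: expR_jensen => //.
have [_ [M fM]] := bw.
apply: (@lt_le_trans _ _ (Ex nu (fun=> expR (- M)))); first by rewrite Ex_cst expR_gt0.
apply: Ex_le; [exact: bm_cst|exact: bm_expR|move=> U].
by rewrite ler_expR lerNl (le_trans _ (fM U))// -normrN ler_norm.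
Qed.

End eigenvalue_bound.

(** * Integration by parts on the group *)

Section plane_rotations.
Context {R : realType} {N : nat}.
Local Notation G := (SO R N).

(** Multiplication by it on the right mixes the columns [a] and [j] and fixes the others. *)
Definition prot_mx (a j : 'I_N) (s : R) : 'M[R]_N :=
  1%:M + ((cos s - 1) *: (delta_mx a a + delta_mx j j) + sin s *: (delta_mx j a - delta_mx a j)).

Lemma mul_deltaE (A : 'M[R]_N) (p q i b : 'I_N) : (A *m (delta_mx p q : 'M[R]_N)) i b = A i p * (b == q)%:R.
Proof.
rewrite mxE (bigD1 p)//= mxE eqxx /= big1 ?addr0// => k /negbTE kp.
by rewrite mxE kp mulr0.
Qed.

Lemma mul_prot (A : 'M[R]_N) a j s i b : (A *m prot_mx a j s) i b =
  A i b + (cos s - 1) * (A i a * (b == a)%:R + A i j * (b == j)%:R) +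
  sin s * (A i j * (b == a)%:R - A i a * (b == j)%:R).
Proof.
have aD (X Y : 'M[R]_N) : (X + Y) i b = X i b + Y i b by rewrite mxE.
have aZ c (X : 'M[R]_N) : (c *: X) i b = c * X i b by rewrite mxE.
have aN (X : 'M[R]_N) : (- X) i b = - X i b by rewrite mxE.
rewrite /prot_mx !mulmxDr mulmx1 -!scalemxAr mulmxDr mulmxBr !(aD, aZ, aN) !mul_deltaE.
by rewrite addrA.
Qed.

Lemma prot_entry_a (U : 'M[R]_N) a j s i : a != j -> (U *m prot_mx a j s) i a = cos s * U i a + sin s * U i j.
Proof. by move=> aj; rewrite mul_prot eqxx (negbTE aj) /=; ring. Qed.

Lemma prot_entry_j (U : 'M[R]_N) a j s i : a != j -> (U *m prot_mx a j s) i j = cos s * U i j - sin s * U i a.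
Proof. by move=> aj; rewrite mul_prot eqxx eq_sym (negbTE aj) /=; ring. Qed.

Lemma prot_entry_o (U : 'M[R]_N) a j s i b : b != a -> b != j -> (U *m prot_mx a j s) i b = U i b.
Proof. by move=> ba bj; rewrite mul_prot (negbTE ba) (negbTE bj) /=; ring. Qed.

Lemma prot_mul a j s t : a != j -> prot_mx a j s *m prot_mx a j t = prot_mx a j (s + t).
Proof.
move=> aj; apply/matrixP => i b.
have E u c : prot_mx a j u i c = (1%:M *m prot_mx a j u : 'M[R]_N) i c by rewrite mul1mx.
have [->|ba] := eqVneq b a.
  rewrite prot_entry_a// !E !prot_entry_a// !prot_entry_j// cosD sinD; ring.
have [->|bj] := eqVneq b j.
  rewrite prot_entry_j// !E !prot_entry_a// !prot_entry_j// cosD sinD; ring.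
by rewrite prot_entry_o// !E !prot_entry_o.
Qed.

Lemma prot_tr a j s : (prot_mx a j s)^T = prot_mx a j (- s).
Proof.
apply/matrixP => i b; rewrite !mxE cosN sinN eq_sym.
by rewrite [(b == a) && _]andbC [(b == j) && (i == j)]andbC [(b == j) && (i == a)]andbC [(b == a) && (i == j)]andbC; ring.
Qed.

Lemma prot0 a j : prot_mx a j 0 = 1%:M.
Proof. by rewrite /prot_mx cos0 sin0 subrr !scale0r !addr0. Qed.

Lemma prot_special a j s : a != j -> special_orthogonal (prot_mx a j s).
Proof.
move=> aj; have o u : prot_mx a j u *m (prot_mx a j u)^T = 1%:M by rewrite prot_tr prot_mul// subrr prot0.
rewrite /special_orthogonal o eqxx /= [s](splitr) -prot_mul// det_mulmx -expr2.
have /(congr1 determinant) := o (s / 2).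
by rewrite det_mulmx det_tr det1 -expr2 => ->.
Qed.

Variables (a j : 'I_N) (aj : a != j).

Definition prot s : G := MkSO (prot_special s aj).

Definition der (F D : G -> R) := forall (U : G) (s : R),
  is_derive s 1 (fun s => F (U * prot s)%g) (D (U * prot s)%g).

Lemma der_fixed F : (forall (U : G) s, F (U * prot s)%g = F U) -> der F (fun=> 0).
Proof.
move=> FI U s; rewrite (_ : (fun s => _) = cst (F U)); last exact/funext.
exact: is_derive_cst.
Qed.

Lemma derD F D H E : der F D -> der H E -> der (fun U => F U + H U) (fun U => D U + E U).
Proof. by move=> dF dH U s; exact: is_deriveD. Qed.

Lemma derM F D H E : der F D -> der H E -> der (fun U => F U * H U) (fun U => D U * H U + F U * E U).
Proof.
move=> dF dH U s; apply: is_derive_eq; first exact: is_deriveM.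
by rewrite /GRing.scale /= addrC mulrC.
Qed.

Lemma der_sum (I : Type) (r : seq I) (p : pred I) (F D : I -> G -> R) :
  (forall i, p i -> der (F i) (D i)) ->
  der (fun U => \sum_(i <- r | p i) F i U) (fun U => \sum_(i <- r | p i) D i U).
Proof.
move=> dF; elim: r => [|i r IH].
  rewrite (_ : (fun U => _) = fun=> 0); last by apply/funext => U; rewrite big_nil.
  rewrite (_ : (fun U => \sum_(i <- [::] | p i) D i U) = fun=> 0); last by apply/funext => U; rewrite big_nil.
  exact: der_fixed.
rewrite (_ : (fun U => _) = fun U => if p i then F i U + \sum_(k <- r | p k) F k U else \sum_(k <- r | p k) F k U);
  last by apply/funext => U; rewrite big_cons.
rewrite (_ : (fun U => \sum_(i <- _ | p i) D i U) = fun U => if p i then D i U + \sum_(k <- r | p k) D k U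
  else \sum_(k <- r | p k) D k U); last by apply/funext => U; rewrite big_cons.
by case pi : (p i) => //; apply: derD => //; exact: dF.
Qed.

Lemma der_comp F D (W W' : R -> R) : (forall z : R, is_derive z 1 W (W' z)) -> der F D ->
  der (fun U => W (F U)) (fun U => W' (F U) * D U).
Proof.
move=> dW dF U s; apply: is_derive_eq; first exact: (is_derive1_comp (f := W)).
by rewrite mulrC.
Qed.

Lemma der_a i : der (fun U => SO_mx U i a) (fun U => SO_mx U i j).
Proof.
move=> U s; rewrite (_ : (fun s => _) = fun s => cos s * SO_mx U i a + sin s * SO_mx U i j); last first.
  by apply/funext => u; rewrite SO_mxM prot_entry_a.
rewrite SO_mxM prot_entry_j//; apply: is_derive_eq.
by rewrite /GRing.scale /=; ring.
Qed.

Lemma der_j i : der (fun U => SO_mx U i j) (fun U => - SO_mx U i a).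
Proof.
move=> U s; rewrite (_ : (fun s => _) = fun s => cos s * SO_mx U i j - sin s * SO_mx U i a); last first.
  by apply/funext => u; rewrite SO_mxM prot_entry_j.
rewrite SO_mxM prot_entry_a//; apply: is_derive_eq.
by rewrite /GRing.scale /=; ring.
Qed.

Variables (nu : probability G R) (nuH : is_haar nu).

(** By right invariance every difference quotient has mean zero; the mean value theorem bounds the
    quotients by the bound of [D], and bounded convergence passes to the derivative. *)
Lemma Ex_der0 F D : bm F -> bm D -> der F D -> Ex nu D = 0.
Proof.
move=> bF bD dF; have [_ [M DM]] := bD; have [mF _] := bF.
pose u n : R := n.+1%:R^-1.
pose Q n (U : G) := (F (U * prot (u n))%g - F U) / u n.
have u0 n : 0 < u n by rewrite invr_gt0.
have prot00 (U : G) : (U * prot 0)%g = U by apply: val_inj; rewrite /= prot0 mulmx1.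
have mR s : measurable_fun setT (fun U : G => (U * prot s)%g).
  by apply: measurable_mul; [exact: measurable_id|exact: measurable_cst].
have bFR s : bm (fun U : G => F (U * prot s)%g) by exact: bm_comp bF (mR s).
have QE n : Ex nu (Q n) = 0.
  rewrite (_ : Q n = fun U => (u n)^-1 * (F (U * prot (u n))%g - F U)); last first.
    by apply/funext => U; rewrite mulrC.
  rewrite ExZ; last exact: bmB.
  by rewrite ExB// (Ex_mulr nuH _ bF) subrr mulr0.
have QM n U : `|Q n U| <= M.
  have cF : {within `[0, u n], continuous (fun s => F (U * prot s)%g)}.
    apply: continuous_subspaceT => x; apply/differentiable_continuous/derivable1_diffP.
    by have [] := dF U x.
  have [c _] := @MVT R (fun s => F (U * prot s)%g) (fun s => D (U * prot s)%g) 0 (u n) (u0 n)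
    (fun x _ => dF U x) cF.
  by rewrite prot00 subr0 /Q => ->; rewrite mulfK ?gt_eqF// DM.
have Qc U : Q n U @[n --> \oo] --> D U.
  have [dd dv] := dF U 0; move/cvg_ex: (dd) => [l ll].
  have El : l = D U by rewrite -[in RHS](prot00 U) -dv; apply/esym/cvg_lim.
  rewrite El in ll.
  have uc : (forall n, u n != 0) /\ (u n @[n --> \oo] --> (0 : R)).
    by split=> [n|]; [rewrite gt_eqF|exact: cvg_harmonic].
  have E n : Q n U = (u n)^-1 *: (F (U * prot (u n *: 1 + 0))%g - F (U * prot 0)%g).
    by rewrite /Q /GRing.scale /= mulr1 addr0 prot00 mulrC.
  rewrite (_ : (fun n => Q n U) = fun n => (u n)^-1 *: (F (U * prot (u n *: 1 + 0))%g - F (U * prot 0)%g)).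
    by move/cvgr_dnbhsP: ll; apply.
  exact/funext.
have [_ H] := Ex_cvg nu (fun n => (proj1 (bmM (bmB (bFR (u n)) bF) (bm_cst _)))) QM Qc.
have : Ex nu (Q n) @[n --> \oo] --> (0 : R) by under eq_fun do rewrite QE; exact: cvg_cst.
by move=> /(cvg_unique _ H); apply.
Qed.

End plane_rotations.

Section quadratic_forms.
Context {R : realType} {N : nat}.
Local Notation G := (SO R N).
Variables (nu : probability G R) (nuH : is_haar nu) (a : 'I_N) (K : pred 'I_N).

Definition qf (A : G -> 'M[R]_N) (b c : 'I_N) (U : G) : R := ((SO_mx U)^T *m A U *m SO_mx U) b c.

Definition bmx (A : G -> 'M[R]_N) := forall p q, bm (fun U => A U p q).

Lemma qfE A b c U : qf A b c U = \sum_(p < N) \sum_(q < N) SO_mx U p b * A U p q * SO_mx U q c.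
Proof.
rewrite /qf mxE exchange_big /=; apply: eq_bigr => q _; rewrite mxE big_distrl /=.
by apply: eq_bigr => p _; rewrite mxE.
Qed.

Lemma bm_qf A b c : bmx A -> bm (qf A b c).
Proof.
move=> bA; rewrite (funext (qfE A b c)).
by apply: bm_sum => p _; apply: bm_sum => q _; apply: bmM; [apply: bmM => //|]; exact: bm_entry.
Qed.

(** Holds when [A U] depends only on the columns in [K], provided [a] is outside [K]: the rotations
    in question never move them. It permits conditioning on these columns. *)
Definition fixed_by_rotations (A : G -> 'M[R]_N) :=
  forall j (aj : a != j), ~~ K j -> forall U s, A (U * prot aj s)%g = A U.

Lemma der_qf_ja A j (aj : a != j) : ~~ K j -> fixed_by_rotations A ->
  der aj (qf A j a) (fun U => qf A j j U - qf A a a U).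
Proof.
move=> Kj fA; rewrite (funext (qfE A j a)).
rewrite (_ : (fun U => _ - _) = fun U => \sum_(p < N) \sum_(q < N)
  ((- SO_mx U p a * A U p q + SO_mx U p j * 0) * SO_mx U q a + SO_mx U p j * A U p q * SO_mx U q j)); last first.
  apply/funext => U; rewrite !qfE -sumrB; apply: eq_bigr => p _; rewrite -sumrB; apply: eq_bigr => q _.
  by rewrite mulr0 addr0 !mulNr addrC.
apply: der_sum => p _; apply: der_sum => q _; apply: derM; last exact: der_a.
have E U s : A (U * prot aj s)%g p q = A U p q by rewrite fA.
have d0 : der aj (fun U => A U p q) (fun=> 0) by exact: der_fixed.
exact: (derM (der_j aj p) d0).
Qed.

Lemma der_qf_aa A j (aj : a != j) : ~~ K j -> fixed_by_rotations A ->
  der aj (qf A a a) (fun U => qf A j a U + qf A a j U).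
Proof.
move=> Kj fA; rewrite (funext (qfE A a a)).
rewrite (_ : (fun U => _ + _) = fun U => \sum_(p < N) \sum_(q < N)
  ((SO_mx U p j * A U p q + SO_mx U p a * 0) * SO_mx U q a + SO_mx U p a * A U p q * SO_mx U q j)); last first.
  apply/funext => U; rewrite !qfE -big_split; apply: eq_bigr => p _; rewrite -big_split; apply: eq_bigr => q _ /=.
  by rewrite mulr0 addr0.
apply: der_sum => p _; apply: der_sum => q _; apply: derM; last exact: der_a.
have E U s : A (U * prot aj s)%g p q = A U p q by rewrite fA.
have d0 : der aj (fun U => A U p q) (fun=> 0) by exact: der_fixed.
exact: (derM (der_a aj p) d0).
Qed.

Lemma qf_sym A b c U : (A U)^T = A U -> qf A b c U = qf A c b U.
Proof. move=> sA; have E : ((SO_mx U)^T *m A U *m SO_mx U)^T = (SO_mx U)^T *m A U *m SO_mx U.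
  by rewrite !trmx_mul trmxK sA mulmxA.
by rewrite /qf -{1}E mxE. Qed.

(* Stein's identity: the derivatives of [qf B j a * W (qf A a a)] along the rotations of the planes
   (a, j), j running over the columns outside of K, have mean zero. *)
Lemma qf_identity A B (W W' : R -> R) :
  ~~ K a -> bmx A -> bmx B -> fixed_by_rotations A -> fixed_by_rotations B ->
  (forall U, (A U)^T = A U) -> (forall U, (B U)^T = B U) ->
  (forall U j c, K j -> qf B j c U = 0) ->
  (forall z : R, is_derive z 1 W (W' z)) ->
  bm (fun U => W (qf A a a U)) -> bm (fun U => W' (qf A a a U)) ->
  Ex nu (fun U => (\tr (B U) - (N - #|K|)%:R * qf B a a U) * W (qf A a a U) +
    2 * W' (qf A a a U) * (qf (fun U => B U *m A U) a a U - qf B a a U * qf A a a U)) = 0.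
Proof.
move=> Ka bA bB fA fB sA sB kB dW bW bW'.
pose D j U := (qf B j j U - qf B a a U) * W (qf A a a U) +
   qf B j a U * (W' (qf A a a U) * (qf A j a U + qf A a j U)).
have bD j : bm (D j).
  apply: bmD; first by apply: bmM => //; apply: bmB; exact: bm_qf.
  by apply: bmM; [exact: bm_qf|apply: bmM => //; apply: bmD; exact: bm_qf].
have D0 j : (a != j) && ~~ K j -> Ex nu (D j) = 0.
  case/andP => aj Kj; apply: (@Ex_der0 _ _ a j aj nu nuH (fun U => qf B j a U * W (qf A a a U))) => //.
    by apply: bmM => //; exact: bm_qf.
  by apply: derM; [exact: der_qf_ja|apply: der_comp => //; exact: der_qf_aa].
transitivity (\sum_(j < N | (a != j) && ~~ K j) Ex nu (D j)); last exact: big1.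
rewrite -Ex_sum//; congr Ex; apply/funext => U.
have /andP[/eqP UU _] := SO_mxP U.
have tB : \sum_(j < N) qf B j j U = \tr (B U).
  by rewrite -[LHS]/(\tr _) mxtrace_mulC mulmxA UU mul1mx.
have BA : \sum_(j < N) qf B j a U * qf A j a U = qf (fun U => B U *m A U) a a U.
  rewrite /qf -[in RHS](mulmx1 (B U)) -UU !mulmxA.
  rewrite -[in RHS](mulmxA _ _ (A U)) -[in RHS](mulmxA _ (_ *m A U)) mxE; apply: eq_bigr => j _.
  by congr (_ * _); exact: (qf_sym j a (sB U)).
rewrite (eq_bigr (fun j => (qf B j j U - qf B a a U) * W (qf A a a U) +
   2 * W' (qf A a a U) * (qf B j a U * qf A j a U))) => [|j _]; last first.
  by rewrite /D [qf A a j U](qf_sym _ _ (sA U)); ring.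
rewrite big_split /= -big_distrl /= -big_distrr /= sumrB.
have K0 (F : 'I_N -> R) : (forall j, K j -> F j = 0) ->
    \sum_(j < N | (a != j) && ~~ K j) F j = \sum_(j < N) F j - F a.
  move=> F0; rewrite [in RHS](bigD1 a)//= [RHS]addrC addKr.
  rewrite [RHS](bigID K) /= [X in _ = X + _]big1 ?add0r; last by move=> j /andP[_ /F0].
  by apply: eq_bigl => j; rewrite eq_sym.
rewrite (_ : \sum_(j < N | (a != j) && ~~ K j) qf B a a U = ((N - #|K|)%:R - 1) * qf B a a U); last first.
  rewrite sumr_const -[LHS]mulr_natl; congr (_ * _).
  have -> : #|[pred j | (a != j) && ~~ K j]| = (N - #|K|).-1.
    have NE : (#|K| + #|[predC K]| = N)%N by rewrite (cardC K) card_ord.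
    have CE : #|[predC K]| = #|[pred j | (a != j) && ~~ K j]|.+1.
      rewrite (cardD1 a [predC K]) !inE Ka add1n; congr _.+1.
      by apply: eq_card => j; rewrite !inE eq_sym.
    by lia.
  rewrite -subn1 natrB// subn_gt0.
  have : (#|K| < #|'I_N|)%N; last by rewrite card_ord.
  by apply: proper_card; apply/properP; split; [exact: subset_predT|exists a].
rewrite K0 => [|j Kj]; last by rewrite kB.
rewrite K0 => [|j Kj]; last by rewrite kB ?mul0r.
rewrite tB BA; ring.
Qed.

End quadratic_forms.

(** * Gronwall's inequality for Laplace transforms and its applications to columns *)

Section exponential_decay.
Context {R : realType} d (T : measurableType d) (P : probability T R).

Lemma le1_of_expR (x c : R) : (forall m : nat, x <= expR (c / m.+1%:R)) -> x <= 1.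
Proof.
move=> h; rewrite leNgt; apply/negP => x1.
have lx : 0 < ln x by rewrite ln_gt0.
have [m cm] : exists m : nat, c / ln x < m.+1%:R.
  by exists (Num.truncn (`|c / ln x|)); apply: le_lt_trans (ler_norm _) _; exact: truncnS_gt.
have := h m; apply/negP; rewrite -ltNge -[ltRHS](lnK (x := x)) ?posrE ?(lt_trans _ x1)//.
by rewrite ltr_expR ltr_pdivrMr// mulrC -ltr_pdivrMr.
Qed.

(** Discrete Gronwall inequality. The function [b] is the derivative of [B] up to second order, and
    the last hypothesis says that the Laplace transform decays at logarithmic rate at least [b].
    Steps of length [s / (m + 1)] cost in all a factor [exp (C s^2 / (m + 1))], which tends to 1. *)
Lemma exp_decay (Z : T -> R) (B b : R -> R) (c b0 s : R) :
  bm Z -> (forall x, 0 <= Z x) -> 0 <= s ->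
  (forall t, 0 <= t -> 0 <= b t <= b0) ->
  (forall t h, 0 <= t -> 0 <= h -> B (t + h) - B t <= h * b (t + h) + c * h ^+ 2) ->
  (forall t, 0 <= t -> b t * Ex P (fun x => expR (- t * Z x)) <= Ex P (fun x => Z x * expR (- t * Z x))) ->
  Ex P (fun x => expR (- s * Z x)) <= expR (B 0 - B s).
Proof.
move=> bZ Z0 s0 bb Bb EZ.
have bE t : bm (fun x => expR (- t * Z x)) by apply: bm_expR; apply: bmM => //; exact: bm_cst.
pose phi t := Ex P (fun x => expR (- t * Z x)).
have phi0 t : 0 <= phi t by apply: Ex_ge0 => x; exact: expR_ge0.
have step t h : 0 <= t -> 0 <= h -> phi (t + h) * (1 + h * b (t + h)) <= phi t.
  move=> t0 h0; apply: (@le_trans _ _ (Ex P (fun x => expR (- (t + h) * Z x) + h * (Z x * expR (- (t + h) * Z x))))).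
    rewrite ExD ?ExZ//; [|exact: bmM|by apply: bmM; [exact: bm_cst|exact: bmM]].
    by rewrite mulrDr mulr1 lerD2l mulrCA ler_wpM2l// mulrC EZ ?addr_ge0.
  apply: Ex_le => //; first by apply: bmD => //; apply: bmM; [exact: bm_cst|exact: bmM].
  move=> x; have -> : expR (- t * Z x) = expR (- (t + h) * Z x) * expR (h * Z x).
    by rewrite -expRD; congr expR; ring.
  have := ler_wpM2l (expR_ge0 (- (t + h) * Z x)) (expR_ge1Dx (h * Z x)).
  by apply: le_trans; rewrite le_eqVlt; apply/orP; left; apply/eqP; ring.
pose C := c + b0 ^+ 2.
have step2 t h : 0 <= t -> 0 <= h -> phi (t + h) * expR (B (t + h)) <= phi t * expR (B t) * expR (C * h ^+ 2).
  move=> t0 h0; have /andP[b1 b2] := bb (t + h) (addr_ge0 t0 h0).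
  set x := h * b (t + h); have x0 : 0 <= x by rewrite mulr_ge0.
  (* Turns the factor [1 + x] gained in one step into an exponential at a second order cost. *)
  have ex : expR x <= (1 + x) * expR (x ^+ 2).
    rewrite -ler_pdivrMr ?expR_gt0// -expRN -expRD.
    have := expR_ge1Dx (- (x - x ^+ 2)) => h1.
    have p1 : 0 < 1 - x + x ^+ 2.
      have -> : 1 - x + x ^+ 2 = (x - 2^-1) ^+ 2 + 3 / 4 by field.
      by rewrite ltr_wpDl ?sqr_ge0.
    have -> : expR (x - x ^+ 2) = (expR (- (x - x ^+ 2)))^-1 by rewrite expRN invrK.
    rewrite -[leLHS]mul1r ler_pdivrMr ?expR_gt0//.
    apply: (@le_trans _ _ ((1 + x) * (1 - x + x ^+ 2))); last by apply: ler_wpM2l; lra.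
    have -> : (1 + x) * (1 - x + x ^+ 2) = 1 + x ^+ 3 by ring.
    by rewrite lerDl exprn_ge0.
  apply: (@le_trans _ _ (phi (t + h) * (expR (B t) * ((1 + x) * expR (x ^+ 2) * expR (c * h ^+ 2))))).
    apply: ler_wpM2l => //; rewrite -[B (t + h)](subrK (B t)) expRD mulrC.
    apply: ler_wpM2l; first exact: expR_ge0.
    apply: (@le_trans _ _ (expR x * expR (c * h ^+ 2))); first by rewrite -expRD ler_expR Bb.
    by apply: ler_wpM2r; rewrite ?expR_ge0.
  have -> : phi (t + h) * (expR (B t) * ((1 + x) * expR (x ^+ 2) * expR (c * h ^+ 2))) =
      (phi (t + h) * (1 + x)) * expR (B t) * expR (x ^+ 2 + c * h ^+ 2) by rewrite expRD; ring.
  apply: ler_pM; rewrite ?expR_ge0 ?mulr_ge0 ?expR_ge0 ?addr_ge0//.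
    by apply: ler_wpM2r; rewrite ?expR_ge0// step.
  rewrite ler_expR /C mulrDl [leRHS]addrC lerD2r /x exprMn mulrC ler_wpM2r ?sqr_ge0//.
  by rewrite ler_pXn2r ?nnegrE ?(le_trans b1 b2).
have phiB0 : phi 0 = 1.
  by rewrite /phi (_ : (fun x => _) = fun=> 1) ?Ex_cst//; apply/funext => x; rewrite oppr0 mul0r expR0.
have it (h : R) (k : nat) : 0 <= h -> phi (k%:R * h) * expR (B (k%:R * h)) <= expR (B 0) * expR (k%:R * (C * h ^+ 2)).
  move=> h0; elim: k => [|k IH]; first by rewrite !mul0r phiB0 expR0 mul1r mulr1.
  have k0 : 0 <= k%:R * h by rewrite mulr_ge0.
  have -> : k.+1%:R * h = k%:R * h + h by rewrite -[k.+1%:R]natr1; ring.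
  apply: le_trans (step2 _ _ k0 h0) _.
  have -> : k.+1%:R * (C * h ^+ 2) = k%:R * (C * h ^+ 2) + C * h ^+ 2 by rewrite -[k.+1%:R]natr1; ring.
  by rewrite expRD mulrA ler_wpM2r ?expR_ge0.
suff H : phi s * expR (B s) / expR (B 0) <= 1.
  by rewrite expRD expRN ler_pdivlMr ?expR_gt0//; rewrite ler_pdivrMr ?expR_gt0// mul1r in H.
apply: (@le1_of_expR _ (C * s ^+ 2)) => m.
have h0 : 0 <= s / m.+1%:R by rewrite divr_ge0.
have m0 : (m.+1%:R : R) != 0 by rewrite pnatr_eq0.
have := it _ m.+1 h0; rewrite mulrCA divff// mulr1 => h1.
rewrite ler_pdivrMr ?expR_gt0//; apply: le_trans h1 _.
rewrite [leRHS]mulrC ler_wpM2l ?expR_ge0// ler_expR.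
by rewrite le_eqVlt; apply/orP; left; apply/eqP; field.
Qed.

End exponential_decay.

Section column_laplace_transforms.
Context {R : realType} {N : nat}.
Local Notation G := (SO R N.+1).
Local Notation NN := (N.+1%:R : R).
Variables (nu : probability G R) (nuH : is_haar nu).

Lemma ln_le_subr1 (x : R) : 0 < x -> ln x <= x - 1.
Proof. by move=> x0; have := expR_ge1Dx (ln x); rewrite lnK//; lra. Qed.

(** Increment of the logarithm of a Gaussian Laplace transform, whose derivative in [t] is
    [k / (M + 2 t k)]. *)
Lemma half_ln_increment (M k t h : R) : 0 < M -> 0 <= k -> 0 <= t -> 0 <= h ->
  2^-1 * ln (1 + 2 * (t + h) * k / M) - 2^-1 * ln (1 + 2 * t * k / M) <=
  h * (k / (M + 2 * (t + h) * k)) + (2 * k ^+ 2 / M ^+ 2) * h ^+ 2.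
Proof.
move=> M0 k0 t0 h0.
pose u := M + 2 * (t + h) * k; pose v := M + 2 * t * k.
have tk : 0 <= t * k by exact: mulr_ge0.
have hk : 0 <= h * k by exact: mulr_ge0.
have v0 : 0 < v by rewrite /v; nra.
have u0 : 0 < u by rewrite /u; nra.
have -> : 1 + 2 * (t + h) * k / M = u / M by rewrite /u; field; rewrite gt_eqF.
have -> : 1 + 2 * t * k / M = v / M by rewrite /v; field; rewrite gt_eqF.
have := ln_le_subr1 (divr_gt0 u0 v0).
rewrite !ln_div ?posrE// => l1; rewrite -/u.
have E : u / v - 1 = 2 * (h * (k / u)) + 4 * (h * k) ^+ 2 / (u * v).
  have -> : h * k = (u - v) / 2 by rewrite /u /v; field.
  have -> : h * (k / u) = (u - v) / 2 / u by rewrite mulrA; congr (_ / _); rewrite /u /v; field.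
  by field; rewrite !gt_eqF.
have le2 : 4 * (h * k) ^+ 2 / (u * v) <= 4 * (h * k) ^+ 2 / M ^+ 2.
  apply: ler_wpM2l; first by rewrite mulr_ge0 ?sqr_ge0.
  rewrite lef_pV2 ?posrE ?mulr_gt0 ?exprn_gt0// expr2 /u /v.
  by apply: ler_pM; lra.
have -> : 2 * k ^+ 2 / M ^+ 2 * h ^+ 2 = 2^-1 * (4 * (h * k) ^+ 2 / M ^+ 2) by field; rewrite gt_eqF.
by rewrite E in l1; lra.
Qed.

Lemma is_derive_expRM (t z : R) : is_derive z 1 (fun z => expR (- t * z)) (- t * expR (- t * z)).
Proof.
have dg : is_derive z 1 (fun z => - t * z) (- t).
  by apply: is_derive_eq; rewrite /GRing.scale /= mulr1.
by apply: (is_derive_eq (is_derive1_comp (is_derive_expR _) dg)); rewrite mulrC.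
Qed.

Lemma qf_diag (d : 'rV[R]_N.+1) a (U : G) :
  qf (fun=> diag_mx d) a a U = \sum_(p < N.+1) d 0 p * SO_mx U p a ^+ 2.
Proof.
rewrite qfE; apply: eq_bigr => p _; rewrite (bigD1 p)//= big1 ?addr0 => [|q /negbTE qp].
  by rewrite mxE eqxx mulr1n; ring.
by rewrite mxE eq_sym qp mulr0n mulr0 mul0r.
Qed.

Lemma bmx_cst (A : 'M[R]_N.+1) : @bmx R N.+1 (fun=> A).
Proof. by move=> p q; exact: bm_cst. Qed.

(** The right side is the Laplace transform for independent centred Gaussians of variance [1 / NN]:
    a Haar column is dominated by them. *)
Lemma weighted_column_exp (a : 'I_N.+1) (k : 'I_N.+1 -> R) : (forall p, 0 <= k p) ->
  Ex nu (fun U => expR (- \sum_(p < N.+1) k p * SO_mx U p a ^+ 2)) <=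
  expR (- (2^-1 * \sum_(p < N.+1) ln (1 + 2 * k p / NN))).
Proof.
move=> k0.
have N0 : 0 < NN by rewrite ltr0n.
pose A : 'M[R]_N.+1 := diag_mx (\row_p k p).
pose Z U := qf (fun=> A) a a U.
have ZE U : Z U = \sum_(p < N.+1) k p * SO_mx U p a ^+ 2.
  by rewrite /Z qf_diag; apply: eq_bigr => p _; rewrite mxE.
have bZ : bm Z by apply: bm_qf; exact: bmx_cst.
have Z0 U : 0 <= Z U by rewrite ZE sumr_ge0// => p _; rewrite mulr_ge0 ?sqr_ge0.
pose B t : R := \sum_(p < N.+1) 2^-1 * ln (1 + 2 * t * k p / NN).
pose b t : R := \sum_(p < N.+1) k p / (NN + 2 * t * k p).
have den t p : 0 <= t -> NN <= NN + 2 * t * k p.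
  by move=> t0; rewrite lerDl !mulr_ge0.
have := @exp_decay R _ _ nu Z B b (\sum_(p < N.+1) 2 * k p ^+ 2 / NN ^+ 2) (\sum_(p < N.+1) k p / NN) 1 bZ Z0 ler01.
rewrite (_ : (fun U => expR (- 1 * Z U)) = fun U => expR (- \sum_(p < N.+1) k p * SO_mx U p a ^+ 2)); last first.
  by apply/funext => U; rewrite ZE mulN1r.
have -> : B 0 - B 1 = - (2^-1 * \sum_(p < N.+1) ln (1 + 2 * k p / NN)).
  rewrite /B big1 ?sub0r => [|p _]; last by rewrite mulr0 mul0r mul0r addr0 ln1 mulr0.
  by rewrite big_distrr; congr (- _); apply: eq_bigr => p _; rewrite mulr1.
apply.
- move=> t t0; apply/andP; split.
    by apply: sumr_ge0 => p _; rewrite divr_ge0// (le_trans (ltW N0))// den.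
  apply: ler_sum => p _; apply: ler_wpM2l => //.
  by rewrite lef_pV2 ?posrE// ?den// (lt_le_trans N0)// den.
- move=> t h t0 h0; rewrite /B /b -sumrB [h * _]big_distrr /= big_distrl /= -big_split /=.
  by apply: ler_sum => p _; exact: half_ln_increment.
move=> t t0.
(* With [Bt = A / (NN + 2 t A)] the linear terms of Stein's identity add up to [Z] exactly ([MB]
   below); the leftover is [2 t] times a product of two nonnegative forms. *)
pose Bt : 'M[R]_N.+1 := diag_mx (\row_p (k p / (NN + 2 * t * k p))).
have bE : bm (fun U => expR (- t * Z U)) by apply: bm_expR; apply: bmM => //; exact: bm_cst.
have fixc (M : 'M[R]_N.+1) : fixed_by_rotations a pred0 (fun=> M) by [].
have I := @qf_identity _ _ nu nuH a pred0 (fun=> A) (fun=> Bt) (fun z => expR (- t * z)) (fun z => - t * expR (- t * z))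
  isT (bmx_cst _) (bmx_cst _) (fixc _) (fixc _) (fun=> tr_diag_mx _) (fun=> tr_diag_mx _) (fun _ _ _ (h : pred0 _) => match notF h with end)
  (is_derive_expRM t) bE (bmM (bm_cst (- t)) bE).
rewrite -/Z in I; rewrite -subr_ge0.
have bqB : bm (qf (fun=> Bt) a a) by apply: bm_qf; exact: bmx_cst.
have tB : \tr Bt = b t.
  by rewrite /b; apply: eq_bigr => p _; rewrite !mxE eqxx mulr1n.
have MB U : NN * qf (fun=> Bt) a a U + 2 * t * qf (fun=> Bt *m A) a a U = Z U.
  rewrite ZE /A /Bt mulmx_diag !qf_diag !big_distrr /= -big_split; apply: eq_bigr => p _ /=; rewrite !mxE.
  have d0 : NN + 2 * t * k p != 0 by rewrite gt_eqF// (lt_le_trans N0)// den.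
  by move: d0; generalize NN => M d0; field.
have -> : Ex nu (fun U => Z U * expR (- t * Z U)) - b t * Ex nu (fun U => expR (- t * Z U)) =
    Ex nu (fun U => 2 * t * (qf (fun=> Bt) a a U * Z U * expR (- t * Z U))).
  rewrite -[LHS]addr0 -I -ExZ// -ExB//; [|exact: bmM|by apply: bmM => //; exact: bm_cst].
  rewrite -ExD.
  - congr Ex; apply/funext => U; rewrite tB card0 subn0 -/(Z U); have := MB U.
    move: (Z U) (qf (fun=> Bt) a a U) (qf (fun=> Bt *m A) a a U) (b t) NN => z q r be M E.
    rewrite [LHS](_ : _ = 2 * t * (q * z * expR (- t * z)) + (z - (M * q + 2 * t * r)) * expR (- t * z)); last by ring.
    by rewrite E subrr mul0r addr0.
  - by apply: bmB; [exact: bmM|apply: bmM => //; exact: bm_cst].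
  - apply: bmD; apply: bmM => //.
    + by apply: bmB; [exact: bm_cst|apply: bmM => //; exact: bm_cst].
    + by apply: bmM; [exact: bm_cst|apply: bmM => //; exact: bm_cst].
    + by apply: bmB; [apply: bm_qf; exact: bmx_cst|exact: bmM].
apply: Ex_ge0 => U; apply: mulr_ge0; first by rewrite mulr_ge0.
rewrite !mulr_ge0 ?expR_ge0// qf_diag sumr_ge0// => p _; rewrite mxE mulr_ge0 ?sqr_ge0// divr_ge0//.
by rewrite (le_trans (ltW N0))// den.
Qed.

Lemma qf_proj_ge0 (A : G -> 'M[R]_N.+1) a U : (A U)^T = A U -> A U *m A U = A U -> 0 <= qf A a a U.
Proof.
move=> sA AA; have -> : qf A a a U = ((A U *m SO_mx U)^T *m (A U *m SO_mx U)) a a.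
  by rewrite /qf trmx_mul sA -!mulmxA [in RHS](mulmxA (A U)) AA.
by rewrite mxE sumr_ge0// => p _; rewrite mxE -expr2 sqr_ge0.
Qed.

Section projections.
Variables (a : 'I_N.+1) (K : pred 'I_N.+1) (A : G -> 'M[R]_N.+1).
Hypotheses (Ka : ~~ K a) (bA : bmx A) (fA : fixed_by_rotations a K A).
Hypotheses (sA : forall U, (A U)^T = A U) (AA : forall U, A U *m A U = A U).
Hypothesis kA : forall U j c, K j -> qf A j c U = 0.
Local Notation M := ((N.+1 - #|K|)%:R : R).

Lemma proj_M_gt0 : 0 < M.
Proof.
rewrite ltr0n subn_gt0; have : (#|K| < #|'I_N.+1|)%N; last by rewrite card_ord.
by apply: proper_card; apply/properP; split; [exact: subset_predT|exists a].
Qed.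

(** Comparison with a sum of [r] squares of Gaussians of variance [1 / M], [M] being the number of
    columns outside [K]. Stein's identity is used with [B = A], and idempotence closes it. *)
Lemma proj_exp (r : nat) (t : R) : (forall U, r%:R <= \tr (A U)) -> 0 <= t ->
  Ex nu (fun U => expR (- t * qf A a a U)) <= expR (- (r%:R / 2 * ln (1 + 2 * t / M))).
Proof.
move=> rA t0; have M0 := proj_M_gt0.
have bZ : bm (qf A a a) by exact: bm_qf.
pose B s : R := r%:R * (2^-1 * ln (1 + 2 * s * 1 / M)).
pose b s : R := r%:R / (M + 2 * s).
have den s : 0 <= s -> M <= M + 2 * s by move=> s0; rewrite lerDl mulr_ge0.
have := @exp_decay R _ _ nu (qf A a a) B b (r%:R * (2 / M ^+ 2)) (r%:R / M) t bZ _ t0.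
have -> : B 0 - B t = - (r%:R / 2 * ln (1 + 2 * t / M)).
  by rewrite /B mulr0 mul0r mul0r addr0 ln1 !mulr0 sub0r mulr1 mulrA.
apply.
- by move=> U; exact: qf_proj_ge0.
- move=> s s0; have ds := le_trans (ltW M0) (den s s0); rewrite divr_ge0//=.
  by apply: ler_wpM2l => //; rewrite lef_pV2 ?posrE// ?den// (lt_le_trans M0)// den.
- move=> s h s0 h0; rewrite /B /b -mulrBr.
  have := half_ln_increment M0 ler01 s0 h0; rewrite expr1n !mulr1 => /(ler_wpM2l (ler0n R r)).
  move=> H; apply: (le_trans H); rewrite mul1r le_eqVlt; apply/orP; left; apply/eqP.
  by generalize (M + 2 * (s + h))^-1 => x; generalize (M ^+ 2)^-1 => y; ring.
move=> s s0.
have bE : bm (fun U => expR (- s * qf A a a U)) by apply: bm_expR; apply: bmM => //; exact: bm_cst.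
have I := @qf_identity _ _ nu nuH a K A A (fun z => expR (- s * z)) (fun z => - s * expR (- s * z))
  Ka bA bA fA fA sA sA kA (is_derive_expRM s) bE (bmM (bm_cst (- s)) bE).
have AAf : (fun U : G => A U *m A U) = A by apply/funext => U; rewrite AA.
rewrite AAf in I.
have d0 : 0 < M + 2 * s by rewrite (lt_le_trans M0)// den.
rewrite /b mulrAC ler_pdivrMr// [leRHS]mulrC -!ExZ//; last exact: bmM.
have bT : bm (fun U => \tr (A U)) by apply: bm_sum => p _; exact: bA.
have bX : bm (fun U => (\tr (A U) - M * qf A a a U) * expR (- s * qf A a a U) +
   2 * (- s * expR (- s * qf A a a U)) * (qf A a a U - qf A a a U * qf A a a U)).
  apply: bmD; first by apply: bmM => //; apply: bmB => //; apply: bmM => //; exact: bm_cst.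
  by apply: bmM; [apply: bmM; [exact: bm_cst|apply: bmM => //; exact: bm_cst]|apply: bmB => //; exact: bmM].
rewrite -subr_ge0 -ExB//; first last.
- by apply: bmM => //; exact: bm_cst.
- by apply: bmM; [exact: bm_cst|exact: bmM].
rewrite -[X in 0 <= X]add0r -[X in X + _]I -ExD//; last first.
  by apply: bmB; apply: bmM; first [exact: bm_cst|exact: bmM|exact: bE].
apply: Ex_ge0 => U; set z := qf A a a U; set e := expR _.
have -> : (\tr (A U) - M * z) * e + 2 * (- s * e) * (z - z * z) + ((M + 2 * s) * (z * e) - r%:R * e) =
   (\tr (A U) - r%:R) * e + 2 * s * (z ^+ 2 * e) by ring.
apply: addr_ge0; first by apply: mulr_ge0; [rewrite subr_ge0 rA|exact: expR_ge0].
by apply: mulr_ge0; [exact: mulr_ge0|apply: mulr_ge0; [exact: sqr_ge0|exact: expR_ge0]].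
Qed.

End projections.

Section constant_projection.
Variables (a : 'I_N.+1) (A : 'M[R]_N.+1) (sA : A^T = A) (AA : A *m A = A).
Local Notation Z := (qf (fun=> A) a a).

Let fixc : fixed_by_rotations a pred0 (fun=> A). Proof. by []. Qed.

Lemma proj_mean : NN * Ex nu Z = \tr A.
Proof.
have bZ : bm Z by apply: bm_qf; exact: bmx_cst.
have := @qf_identity _ _ nu nuH a pred0 (fun=> A) (fun=> A) (fun=> 1) (fun=> 0)
  isT (bmx_cst _) (bmx_cst _) fixc fixc (fun=> sA) (fun=> sA) (fun _ _ _ (h : pred0 _) => match notF h with end)
  (fun z => is_derive_cst (1 : R) z 1) (bm_cst 1) (bm_cst 0).
rewrite card0 subn0 (_ : (fun U => _) = fun U => \tr A - NN * Z U); last by apply/funext => U; ring.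
rewrite ExB ?ExZ ?Ex_cst//; [lra|exact: bm_cst|by apply: bmM => //; exact: bm_cst].
Qed.

Lemma proj_square_mean : (NN + 2) * Ex nu (fun U => Z U ^+ 2) = (\tr A + 2) * Ex nu Z.
Proof.
have bZ : bm Z by apply: bm_qf; exact: bmx_cst.
have := @qf_identity _ _ nu nuH a pred0 (fun=> A) (fun=> A) (fun z => z) (fun=> 1)
  isT (bmx_cst _) (bmx_cst _) fixc fixc (fun=> sA) (fun=> sA) (fun _ _ _ (h : pred0 _) => match notF h with end)
  (fun z => is_derive_id z 1) bZ (bm_cst 1).
rewrite card0 subn0 AA (_ : (fun U => _) = fun U => (\tr A + 2) * Z U - (NN + 2) * Z U ^+ 2); last by apply/funext => U; ring.
have bZ2 := bmX 2 bZ.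
rewrite ExB ?ExZ ?Ex_cst//; [lra| |]; by apply: bmM => //; exact: bm_cst.
Qed.

End constant_projection.

End column_laplace_transforms.

Lemma pair_sum (R : realType) (F : nat -> R) H :
  \sum_(p < H.*2) F p = \sum_(i < H) (F i.*2 + F i.*2.+1).
Proof.
elim: H => [|H IH]; first by rewrite !big_ord0.
by rewrite doubleS !big_ord_recr /= IH addrA.
Qed.

(** * Laplace transforms of the first two columns *)

Section first_two_columns.
Context {R : realType} {n : nat}.
Local Notation N' := (n.+1.*2).
Local Notation G := (SO R N'.+1).
Local Notation NN := (N'.+1%:R : R).
Variables (nu : probability G R) (nuH : is_haar nu).
Local Notation c0 := (inord 0 : 'I_N'.+1).
Local Notation c1 := (inord 1 : 'I_N'.+1).

Lemma column_norm (U : G) a : \sum_(p < N'.+1) SO_mx U p a ^+ 2 = 1.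
Proof.
have /andP[/eqP /mulmx1C UU _] := SO_mxP U.
have := congr1 (fun M : 'M[R]_N'.+1 => M a a) UU; rewrite !mxE eqxx mulr1n => <-.
by apply: eq_bigr => p _; rewrite mxE expr2.
Qed.

Lemma pairs_to_entries (k : nat -> R) a (U : G) H : (H <= n.+1)%N ->
  \sum_(i < H) k i * pairsq a i U =
  \sum_(p < N'.+1) (if (p < H.*2)%N then k p./2 else 0) * SO_mx U p (inord a) ^+ 2.
Proof.
move=> Hn; pose F (p : nat) : R := k p./2 * ent U p a ^+ 2.
transitivity (\sum_(p < H.*2) F p).
  rewrite pair_sum; apply: eq_bigr => i _; rewrite /F /pairsq mulrDr doubleK.
  by rewrite -uphalfE uphalf_double.
have HN : (H.*2 <= N'.+1)%N by lia.
rewrite (big_ord_widen _ F HN) [RHS](bigID (fun p : 'I_N'.+1 => (p < H.*2)%N)) /=.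
rewrite [X in _ = _ + X]big1 ?addr0 => [|p /negbTE ->]; last by rewrite mul0r.
by apply: eq_bigr => p ->; rewrite /F /ent inord_val.
Qed.

Lemma hsum_entries a (U : G) H : (H <= n.+1)%N ->
  hsum a H U = \sum_(p < N'.+1) (p < H.*2)%:R * SO_mx U p (inord a) ^+ 2.
Proof.
move=> Hn; transitivity (\sum_(i < H) 1 * pairsq a i U); first by apply: eq_bigr => i _; rewrite mul1r.
by rewrite (pairs_to_entries (fun=> 1))//; apply: eq_bigr => p _; case: ifP.
Qed.

(** The two columns are dependent, but only half of each is in the exponent, so Cauchy-Schwarz
    reduces to one column at a time. *)
Lemma average_exp (d : 'I_N'.+1 -> R) : (forall p, 0 <= d p) ->
  Ex nu (fun U => expR (- \sum_(p < N'.+1) d p * ((SO_mx U p c0 ^+ 2 + SO_mx U p c1 ^+ 2) / 2))) <=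
  expR (- (2^-1 * \sum_(p < N'.+1) ln (1 + 2 * d p / NN))).
Proof.
move=> d0; pose f a (U : G) := expR (- (\sum_(p < N'.+1) d p * SO_mx U p a ^+ 2) / 2).
have bf a : bm (f a).
  apply: bm_expR; apply: bmM; last exact: bm_cst.
  by apply: bmN; apply: bm_sum => p _; apply: bmM; [exact: bm_cst|apply: bmX; exact: bm_entry].
have fE : (fun U => expR (- \sum_(p < N'.+1) d p * ((SO_mx U p c0 ^+ 2 + SO_mx U p c1 ^+ 2) / 2))) =
    fun U => f c0 U * f c1 U.
  apply/funext => U; rewrite -expRD -mulrDl -opprD -big_split /= mulNr big_distrl /=.
  by congr (expR (- _)); apply: eq_bigr => p _; rewrite -mulrDr mulrA.
have f2 a : Ex nu (fun U => f a U ^+ 2) <= expR (- (2^-1 * \sum_(p < N'.+1) ln (1 + 2 * d p / NN))).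
  apply: le_trans (weighted_column_exp nuH a d0).
  rewrite (_ : (fun U => f a U ^+ 2) = fun U => expR (- \sum_(p < N'.+1) d p * SO_mx U p a ^+ 2))//.
  by apply/funext => U; rewrite /f expr2 -expRD -splitr.
rewrite fE -(@ler_pXn2r _ 2) ?nnegrE ?expR_ge0//; last first.
  by apply: Ex_ge0 => U; rewrite mulr_ge0 ?expR_ge0.
apply: le_trans (Ex_sqr_le nu (bf c0) (bf c1)) _.
by rewrite expr2; apply: ler_pM; rewrite ?f2// Ex_ge0// => U; exact: sqr_ge0.
Qed.

Lemma pairs_exp (k : nat -> R) H : (H <= n.+1)%N -> (forall i, 0 <= k i) ->
  Ex nu (fun U => expR (- \sum_(i < H) k i * ((pairsq 0 i U + pairsq 1 i U) / 2))) <=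
  expR (- \sum_(i < H) ln (1 + 2 * k i / NN)).
Proof.
move=> Hn k0; pose d (p : 'I_N'.+1) : R := if (p < H.*2)%N then k p./2 else 0.
have d0 p : 0 <= d p by rewrite /d; case: ifP.
have := average_exp d0; congr (_ <= _).
  congr Ex; apply/funext => U; congr (expR (- _)).
  transitivity ((\sum_(i < H) k i * pairsq 0 i U + \sum_(i < H) k i * pairsq 1 i U) / 2).
    rewrite !pairs_to_entries// -big_split /= big_distrl /=; apply: eq_bigr => p _.
    by rewrite -mulrDr mulrA.
  by rewrite -big_split big_distrl /=; apply: eq_bigr => i _; rewrite -mulrDr mulrA.
congr (expR (- _)); pose F (p : nat) : R := ln (1 + 2 * k p./2 / NN).
have HN : (H.*2 <= N'.+1)%N by lia.
have -> : \sum_(p < N'.+1) ln (1 + 2 * d p / NN) = \sum_(p < H.*2) F p.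
  rewrite (big_ord_widen _ F HN) [LHS](bigID (fun p : 'I_N'.+1 => (p < H.*2)%N)) /=.
  rewrite [X in _ + X]big1 ?addr0 => [|p /negbTE pH]; last by rewrite /d pH mulr0 mul0r addr0 ln1.
  by apply: eq_bigr => p pH; rewrite /F /d pH.
rewrite pair_sum big_distrr; apply: eq_bigr => i _ /=; rewrite /F doubleK.
rewrite -uphalfE uphalf_double.
by set l := ln _; lra.
Qed.

Lemma hS_complement (U : G) H : (H <= n.+1)%N ->
  1 - hS H U = \sum_(p < N'.+1) (H.*2 <= p)%:R * ((SO_mx U p c0 ^+ 2 + SO_mx U p c1 ^+ 2) / 2).
Proof.
move=> Hn; have E : 1 = \sum_(p < N'.+1) (SO_mx U p c0 ^+ 2 + SO_mx U p c1 ^+ 2) / 2.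
  by rewrite -big_distrl big_split /= !column_norm; lra.
rewrite {1}E /hS !hsum_entries// -big_split big_distrl -sumrB; apply: eq_bigr => p _ /=.
by rewrite ltnNge; case: leqP => _ /=; lra.
Qed.

Lemma complement_exp (kappa : R) H : (H <= n.+1)%N -> 0 <= kappa ->
  Ex nu (fun U => expR (- kappa * (1 - hS H U))) <=
  expR (- ((N'.+1 - H.*2)%:R / 2 * ln (1 + 2 * kappa / NN))).
Proof.
move=> Hn k0; pose d (p : 'I_N'.+1) : R := kappa * (H.*2 <= p)%:R.
have d0 p : 0 <= d p by rewrite mulr_ge0.
have := average_exp d0; congr (_ <= _).
  congr Ex; apply/funext => U; rewrite hS_complement// mulNr big_distrr /=.
  by congr (expR (- _)); apply: eq_bigr => p _; rewrite /d -mulrA.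
congr (expR (- _)).
have -> : \sum_(p < N'.+1) ln (1 + 2 * d p / NN) = \sum_(p < N'.+1 | (H.*2 <= p)%N) ln (1 + 2 * kappa / NN).
  rewrite [RHS]big_mkcond; apply: eq_bigr => p _; rewrite /d; case: leqP => _; rewrite ?mulr1//.
  by rewrite !mulr0 mul0r addr0 ln1.
rewrite sumr_const -[X in 2^-1 * X]mulr_natl mulrA; congr (_ * _); rewrite mulrC; congr (_%:R / _).
rewrite -sum1_card -(big_mkord (fun p => H.*2 <= p)%N (fun=> 1%N)).
by rewrite -(big_nat_widenl _ _ _ predT (fun=> 1%N) (leq0n _)) sum_nat_const_nat muln1.
Qed.

Lemma hS_ge0 H (U : G) : 0 <= hS H U.
Proof.
rewrite /hS divr_ge0// addr_ge0// /hsum sumr_ge0// => i _; by rewrite addr_ge0 ?sqr_ge0.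
Qed.

Lemma hS_le1 H (U : G) : (H <= n.+1)%N -> hS H U <= 1.
Proof.
move=> Hn; rewrite -subr_ge0 hS_complement// sumr_ge0// => p _.
by rewrite mulr_ge0// divr_ge0// addr_ge0 ?sqr_ge0.
Qed.

Lemma hS_mono h H (U : G) : (h <= H)%N -> hS h U <= hS H U.
Proof.
move=> hH; rewrite /hS ler_pM2r ?invr_gt0//.
have m a : hsum a h U <= hsum a H U.
  rewrite /hsum (big_ord_widen _ (fun i => pairsq a i U) hH).
  rewrite [leRHS](bigID (fun i : 'I_H => (i < h)%N)) /= lerDl sumr_ge0// => i _.
  by rewrite addr_ge0 ?sqr_ge0.
by rewrite lerD.
Qed.

(** Lagrange's identity: a further complex coordinate increases the Gram determinant of two complex
    vectors by at least a sum of squared moduli of two by two minors. *)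
Lemma he_recr h (U : G) : he h U <= he h.+1 U.
Proof.
pose a i := ent U i.*2 0; pose b i := ent U i.*2.+1 0.
pose c i := ent U i.*2 1; pose d i := ent U i.*2.+1 1.
have : 0 <= \sum_(i < h) ((a i * c h - b i * d h - a h * c i + b h * d i) ^+ 2 +
    (a i * d h + b i * c h - a h * d i - b h * c i) ^+ 2).
  by apply: sumr_ge0 => i _; rewrite addr_ge0 ?sqr_ge0.
rewrite (eq_bigr (fun i : 'I_h => (pairsq 0 i U * (c h ^+ 2 + d h ^+ 2) + pairsq 1 i U * (a h ^+ 2 + b h ^+ 2)) +
    ((a i * c i + b i * d i) * (- 2 * (a h * c h + b h * d h)) +
     (a i * d i - b i * c i) * (- 2 * (a h * d h - b h * c h))))); last first.
  by move=> i _; rewrite /pairsq -/(a i) -/(b i) -/(c i) -/(d i); ring.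
rewrite !big_split /= -!big_distrl /= -/(hsum 0 h U) -/(hsum 1 h U) -/(hdot h U) -/(hdet h U).
rewrite /he /hsum /hdot /hdet !big_ord_recr /= -/(hsum 0 h U) -/(hsum 1 h U) -/(hdot h U) -/(hdet h U).
rewrite /pairsq -/(a h) -/(b h) -/(c h) -/(d h).
move: (hsum 0 h U) (hsum 1 h U) (hdot h U) (hdet h U) (a h) (b h) (c h) (d h) => x y q e A B C D H.
rewrite ler_pM2r ?invr_gt0// -subr_ge0; apply: le_trans H _.
by rewrite le_eqVlt; apply/orP; left; apply/eqP; ring.
Qed.

Lemma he_mono h H (U : G) : (h <= H)%N -> he h U <= he H U.
Proof.
by elim: H => [|H IH]; [rewrite leqn0 => /eqP ->|rewrite leq_eqVlt => /orP[/eqP ->//|/IH /le_trans]; apply; exact: he_recr].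
Qed.

Lemma he_ge0 H (U : G) : 0 <= he H U.
Proof.
apply: le_trans (he_mono U (leq0n H)).
by rewrite /he /hsum /hdot /hdet !big_ord0; lra.
Qed.

Lemma hX_le_hS H (U : G) : hX H U <= hS H U.
Proof.
rewrite /hX; have := sqr_ge0 (hsum 0 H U - hsum 1 H U); have := sqr_ge0 (hdot H U); have := sqr_ge0 (hdet H U).
by rewrite /hS /he; have := sqr_ge0 (hS H U); rewrite /hS; nra.
Qed.

(** For [h <= H] the term [S (1 - S)] of [hX] is used, for [h > H] the term [2 he]. One random
    factor thus serves all heights at once. *)
Lemma hX_ge h H (U : G) : (h <= n.+1)%N -> (H <= n.+1)%N ->
  Num.min (1 - hS H U) (2 * he H U) * hS (minn h H) U <= hX h U.
Proof.
move=> hn Hn; have S0 := hS_ge0 (minn h H) U; have e0 := he_ge0 h U.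
case: (leqP h H) => hH.
  have m := hS_mono U hH; have hS0 := hS_ge0 h U.
  apply: (@le_trans _ _ ((1 - hS h U) * hS h U)).
    by apply: ler_wpM2r => //; rewrite ge_min; apply/orP; left; lra.
  by rewrite /hX; lra.
have S1 := hS_le1 U Hn; have eH := he_ge0 H U.
have m := he_mono U (ltnW hH).
apply: (@le_trans _ _ (2 * he H U * 1)).
  apply: ler_pM; rewrite ?hS_ge0//; last by rewrite ge_min lexx orbT.
  by rewrite le_min subr_ge0 S1 mulr_ge0.
rewrite mulr1 /hX; have : 0 <= hS h U * (1 - hS h U) by rewrite mulr_ge0 ?hS_ge0// subr_ge0 hS_le1.
by lra.
Qed.

End first_two_columns.

Section pair_of_columns.
Context {R : realType} {n : nat}.
Local Notation N' := (n.+1.*2).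
Local Notation G := (SO R N'.+1).
Local Notation NN := (N'.+1%:R : R).
Variables (nu : probability G R) (nuH : is_haar nu) (H : nat) (Hn : (H <= n.+1)%N).
Local Notation c0 := (inord 0 : 'I_N'.+1).
Local Notation c1 := (inord 1 : 'I_N'.+1).

Lemma masked_sum (F : nat -> R) :
  \sum_(p < N'.+1) (p < H.*2)%:R * F p = \sum_(i < H) (F i.*2 + F i.*2.+1).
Proof.
have HN : (H.*2 <= N'.+1)%N by lia.
rewrite -pair_sum (big_ord_widen _ F HN) [LHS](bigID (fun p : 'I_N'.+1 => (p < H.*2)%N)) /=.
rewrite [X in _ + X]big1 ?addr0 => [|p /negbTE ->]; last by rewrite mul0r.
by apply: eq_bigr => p ->; rewrite mul1r.
Qed.

Definition head_proj : 'M[R]_N'.+1 := diag_mx (\row_p ((p : 'I_N'.+1) < H.*2)%:R).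

Lemma head_projK : head_proj *m head_proj = head_proj.
Proof.
rewrite /head_proj mulmx_diag; congr diag_mx; apply/rowP => p; rewrite !mxE.
by case: (_ < _)%N; rewrite ?mulr1 ?mulr0.
Qed.

Lemma head_proj_tr : head_proj^T = head_proj.
Proof. exact: tr_diag_mx. Qed.

Lemma head_proj_trace : \tr head_proj = H.*2%:R.
Proof.
transitivity (\sum_(p < N'.+1) (p < H.*2)%:R * (fun=> 1 : R) p).
  by apply: eq_bigr => p _; rewrite !mxE eqxx mulr1n mulr1.
by rewrite (masked_sum (fun=> 1)) sumr_const card_ord -muln2 mulnC mulrnA mulr2n.
Qed.

Lemma qf_head_proj a (U : G) : qf (fun=> head_proj) (inord a) (inord a) U = hsum a H U.
Proof. by rewrite qf_diag hsum_entries//; apply: eq_bigr => p _; rewrite mxE. Qed.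

Lemma hsum_mean a : NN * Ex nu (hsum a H) = H.*2%:R.
Proof.
rewrite -head_proj_trace -(proj_mean nuH (inord a) head_proj_tr).
by congr (_ * Ex _ _); apply/funext => U; rewrite qf_head_proj.
Qed.

Lemma hsum_square_mean a : (NN + 2) * Ex nu (fun U => hsum a H U ^+ 2) = (H.*2%:R + 2) * Ex nu (hsum a H).
Proof.
have := proj_square_mean nuH (inord a) head_proj_tr head_projK; rewrite head_proj_trace.
rewrite (_ : qf (fun=> head_proj) _ _ = hsum a H)//.
by apply/funext => U; exact: qf_head_proj.
Qed.

Definition hu (U : G) : 'cV[R]_N'.+1 := \col_p (((p : 'I_N'.+1) < H.*2)%:R * ent U p 0).
Definition hv (U : G) : 'cV[R]_N'.+1 :=
  \col_p (((p : 'I_N'.+1) < H.*2)%:R * (if odd p then ent U p.-1 0 else - ent U p.+1 0)).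

Lemma huE U (F : nat -> R) : \sum_(p < N'.+1) F p * hu U p 0 = \sum_(i < H) (F i.*2 * ent U i.*2 0 + F i.*2.+1 * ent U i.*2.+1 0).
Proof. by rewrite -(masked_sum (fun p => F p * ent U p 0)); apply: eq_bigr => p _; rewrite mxE mulrCA. Qed.

Lemma hvE U (F : nat -> R) : \sum_(p < N'.+1) F p * hv U p 0 = \sum_(i < H) (F i.*2.+1 * ent U i.*2 0 - F i.*2 * ent U i.*2.+1 0).
Proof.
transitivity (\sum_(p < N'.+1) (p < H.*2)%:R * (fun p => F p * (if odd p then ent U p.-1 0 else - ent U p.+1 0)) p).
  by apply: eq_bigr => p _; rewrite mxE mulrCA.
rewrite (masked_sum (fun p => F p * (if odd p then ent U p.-1 0 else - ent U p.+1 0))).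
by apply: eq_bigr => i _; rewrite /= odd_double /= mulrN addrC.
Qed.

Lemma sum_hu2 U : \sum_p hu U p 0 ^+ 2 = hsum 0 H U.
Proof.
transitivity (\sum_(p < N'.+1) ((p < H.*2)%:R * ent U p 0) * hu U p 0).
  by apply: eq_bigr => p _; rewrite expr2 {1}mxE.
rewrite (huE U (fun p => (p < H.*2)%:R * ent U p 0)); apply: eq_bigr => i _; have := ltn_ord i => iH.
by rewrite ltn_double ltn_Sdouble iH !mul1r -!expr2.
Qed.

Lemma sum_hv2 U : \sum_p hv U p 0 ^+ 2 = hsum 0 H U.
Proof.
transitivity (\sum_(p < N'.+1) ((p < H.*2)%:R * (if odd p then ent U p.-1 0 else - ent U p.+1 0)) * hv U p 0).
  by apply: eq_bigr => p _; rewrite expr2 {1}mxE.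
rewrite (hvE U (fun p => (p < H.*2)%:R * (if odd p then ent U p.-1 0 else - ent U p.+1 0))).
apply: eq_bigr => i _; have := ltn_ord i => iH.
by rewrite ltn_double ltn_Sdouble iH !mul1r /= odd_double /= mulNr opprK -!expr2.
Qed.

Lemma sum_huv U : \sum_p hu U p 0 * hv U p 0 = 0.
Proof.
transitivity (\sum_(p < N'.+1) ((p < H.*2)%:R * ent U p 0) * hv U p 0).
  by apply: eq_bigr => p _; rewrite {1}mxE.
rewrite (hvE U (fun p => (p < H.*2)%:R * ent U p 0)); apply: big1 => i _; have := ltn_ord i => iH.
by rewrite ltn_double ltn_Sdouble iH; ring.
Qed.

Lemma sum_col_hu U (a : nat) : \sum_p SO_mx U p (inord a) * hu U p 0 =
  \sum_(i < H) (ent U i.*2 a * ent U i.*2 0 + ent U i.*2.+1 a * ent U i.*2.+1 0).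
Proof. by rewrite -(huE U (fun p => ent U p a)); apply: eq_bigr => p _; rewrite /ent inord_val. Qed.

Lemma sum_col_hv U (a : nat) : \sum_p SO_mx U p (inord a) * hv U p 0 =
  \sum_(i < H) (ent U i.*2.+1 a * ent U i.*2 0 - ent U i.*2 a * ent U i.*2.+1 0).
Proof. by rewrite -(hvE U (fun p => ent U p a)); apply: eq_bigr => p _; rewrite /ent inord_val. Qed.

Lemma scal11 (u v : 'cV[R]_N'.+1) : u^T *m v = (\sum_p u p 0 * v p 0)%:M.
Proof. by apply/matrixP => i j; rewrite !mxE !ord1 eqxx mulr1n; apply: eq_bigr => p _; rewrite mxE. Qed.

(* The orthogonal projection onto the complement, inside the first [2 H] coordinates, of the first
   column and of its image under the rotation by a right angle in every coordinate plane. *)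
Definition cond_proj (U : G) : 'M[R]_N'.+1 :=
  head_proj - (hsum 0 H U)^-1 *: (hu U *m (hu U)^T + hv U *m (hv U)^T).

Lemma head_proj_mul (w : 'cV[R]_N'.+1) (f : nat -> R) :
  (forall p : 'I_N'.+1, w p 0 = (p < H.*2)%:R * f p) -> head_proj *m w = w.
Proof.
move=> wE; apply/colP => p; rewrite mul_diag_mx !mxE wE.
by case: (_ < _)%N; rewrite ?mul1r ?mul0r.
Qed.

Lemma cond_proj_tr U : (cond_proj U)^T = cond_proj U.
Proof.
have T w : (w *m w^T : 'M[R]_N'.+1)^T = w *m w^T by rewrite trmx_mul trmxK.
have aB (X Y : 'M[R]_N'.+1) : (X - Y)^T = X^T - Y^T by rewrite linearB.
have aD (X Y : 'M[R]_N'.+1) : (X + Y)^T = X^T + Y^T by rewrite linearD.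
have aZ c (X : 'M[R]_N'.+1) : (c *: X)^T = c *: X^T by rewrite linearZ.
by rewrite /cond_proj aB aZ aD !T head_proj_tr.
Qed.

Lemma cond_projK U : cond_proj U *m cond_proj U = cond_proj U.
Proof.
set x := hsum 0 H U; set Q := hu U *m (hu U)^T + hv U *m (hv U)^T.
have Pu : head_proj *m hu U = hu U by apply: (@head_proj_mul _ (fun p => ent U p 0)) => p; rewrite mxE.
have Pv : head_proj *m hv U = hv U.
  by apply: (@head_proj_mul _ (fun p => if odd p then ent U p.-1 0 else - ent U p.+1 0)) => p; rewrite mxE.
have PQ : head_proj *m Q = Q by rewrite /Q mulmxDr !mulmxA Pu Pv.
have QT : Q^T = Q by rewrite /Q [LHS]linearD /= !trmx_mul !trmxK.
have QP : Q *m head_proj = Q by rewrite -{1}QT -head_proj_tr -trmx_mul PQ.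
have uu : (hu U)^T *m hu U = x%:M by rewrite scal11 /x -sum_hu2; congr (_%:M); apply: eq_bigr => p _; rewrite expr2.
have vv : (hv U)^T *m hv U = x%:M by rewrite scal11 /x -sum_hv2; congr (_%:M); apply: eq_bigr => p _; rewrite expr2.
have uv : (hu U)^T *m hv U = 0 by rewrite scal11 sum_huv raddf0.
have vu : (hv U)^T *m hu U = 0 by rewrite -[LHS]trmxK trmx_mul trmxK uv trmx0.
have Q1 : Q *m hu U = x *: hu U by rewrite /Q mulmxDl -!mulmxA uu vu mulmx0 addr0 mul_mx_scalar.
have Q2 : Q *m hv U = x *: hv U by rewrite /Q mulmxDl -!mulmxA uv vv mulmx0 add0r mul_mx_scalar.
have QQ : Q *m Q = x *: Q by rewrite {2}/Q mulmxDr !mulmxA Q1 Q2 -!scalemxAl -scalerDr.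
rewrite /cond_proj -/x -/Q mulmxBl !mulmxBr head_projK -!scalemxAr -!scalemxAl PQ QP QQ !scalerA.
have [->|x0] := eqVneq x 0; first by rewrite invr0 !mul0r !scale0r !subr0.
by rewrite divfK// subrr subr0.
Qed.

Lemma cond_proj_trace U : (H.*2 - 2)%:R <= \tr (cond_proj U).
Proof.
rewrite /cond_proj raddfB /= linearZ /= raddfD /= head_proj_trace.
rewrite [\tr (hu U *m _)]mxtrace_mulC [\tr (hv U *m _)]mxtrace_mulC !scal11 !mxtrace_scalar !mulr1n.
have -> : \sum_p hu U p 0 * hu U p 0 = hsum 0 H U.
  by rewrite -sum_hu2; apply: eq_bigr => p _; rewrite expr2.
have -> : \sum_p hv U p 0 * hv U p 0 = hsum 0 H U.
  by rewrite -sum_hv2; apply: eq_bigr => p _; rewrite expr2.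
case: (posnP H) => [->|H0].
  by rewrite sub0n /hsum big_ord0 addr0 mulr0 subr0.
rewrite natrB; last by lia.
have [->|x0] := eqVneq (hsum 0 H U) 0; first by rewrite invr0 mul0r; lra.
by rewrite mulrDr mulVf//; lra.
Qed.

Lemma hsum_zero U : hsum 0 H U = 0 -> hu U = 0 /\ hv U = 0.
Proof.
have Z (w : 'cV[R]_N'.+1) : \sum_p w p 0 ^+ 2 = 0 -> w = 0.
  move=> w0; apply/colP => p; rewrite [RHS]mxE; apply/eqP.
  by rewrite -(sqrf_eq0 (w p 0)) (psumr_eq0P (fun i _ => sqr_ge0 (w i 0)) w0).
by move=> x0; split; apply: Z; rewrite ?sum_hu2 ?sum_hv2.
Qed.

(** Allows Stein's identity along column 1 with column 0 frozen, that is with [K] reduced to column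
    0. *)
Lemma cond_proj_kills U c : qf cond_proj c0 c U = 0.
Proof.
suff W : (col c0 (SO_mx U))^T *m cond_proj U = 0.
  transitivity (((col c0 (SO_mx U))^T *m cond_proj U *m SO_mx U) 0 c); last by rewrite W mul0mx mxE.
  by rewrite /qf tr_col -!row_mul [RHS]mxE.
rewrite /cond_proj mulmxBr -scalemxAr mulmxDr !mulmxA !scal11.
set x := hsum 0 H U.
have -> : \sum_p col c0 (SO_mx U) p 0 * hu U p 0 = x.
  transitivity (\sum_p SO_mx U p c0 * hu U p 0); first by apply: eq_bigr => p _; rewrite [X in X * _]mxE.
  by rewrite sum_col_hu; apply: eq_bigr => i _; rewrite /pairsq !expr2.
have -> : \sum_p col c0 (SO_mx U) p 0 * hv U p 0 = 0.
  transitivity (\sum_p SO_mx U p c0 * hv U p 0); first by apply: eq_bigr => p _; rewrite [X in X * _]mxE.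
  by rewrite sum_col_hv; apply: big1 => i _; ring.
have -> : (col c0 (SO_mx U))^T *m head_proj = (hu U)^T.
  apply/rowP => p; rewrite mul_mx_diag !mxE mulrC; congr (_ * _).
  by rewrite /ent inord_val.
rewrite raddf0 mul0mx addr0 mul_scalar_mx scalerA.
have [x0|x0] := eqVneq x 0; last by rewrite mulVf// scale1r subrr.
by have [-> _] := hsum_zero x0; rewrite trmx0 scaler0 subrr.
Qed.

Lemma cond_proj_fixed : fixed_by_rotations c1 (pred1 c0) cond_proj.
Proof.
move=> j c1j jc0 U s.
have c01 : c0 != c1 by apply/eqP => /(congr1 (@nat_of_ord _)); rewrite !inordK.
have E p : ent (U * prot c1j s)%g p 0 = ent U p 0.
  by rewrite /ent SO_mxM prot_entry_o// eq_sym.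
rewrite /cond_proj (_ : hu _ = hu U); last by apply/colP => p; rewrite !mxE E.
rewrite (_ : hv _ = hv U); last by apply/colP => p; rewrite !mxE !E.
by congr (_ - _^-1 *: _); apply: eq_bigr => i _; rewrite /pairsq !E.
Qed.

(** Where [x] vanishes so does [f], and the quotient is 0 by convention; elsewhere it is bounded by
    [c]. *)
Lemma bm_quot (f x : G -> R) (c : R) : bm f -> bm x -> (forall U, `|f U| <= c * x U) -> (forall U, 0 <= x U) ->
  bm (fun U => (x U)^-1 * f U).
Proof.
move=> [mf _] [mx _] fx x0; split.
  rewrite (_ : (fun U => _) = fun U => (x U) `^ (- 1) * f U); last by apply/funext => U; rewrite powR_inv1.
  apply: measurable_funM => //.
  by apply: (measurableT_comp (f := fun y : R => y `^ (- 1))) => //; exact: measurable_powR.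
exists `|c| => U; rewrite normrM normfV (ger0_norm (x0 U)).
have [->|xn] := eqVneq (x U) 0; first by rewrite invr0 mul0r.
rewrite mulrC ler_pdivrMr ?lt_def ?xn ?x0//.
by apply: le_trans (fx U) _; apply: ler_wpM2r => //; exact: ler_norm.
Qed.

Lemma bm_cond_proj : bmx cond_proj.
Proof.
move=> p q; rewrite (_ : (fun U => _) = fun U => head_proj p q - (hsum 0 H U)^-1 * (hu U p 0 * hu U q 0 + hv U p 0 * hv U q 0)); last first.
  apply/funext => U; have aB (X Y : 'M[R]_N'.+1) : (X - Y) p q = X p q - Y p q by rewrite !mxE.
  have aD (X Y : 'M[R]_N'.+1) : (X + Y) p q = X p q + Y p q by rewrite !mxE.
  have aZ c (X : 'M[R]_N'.+1) : (c *: X) p q = c * X p q by rewrite !mxE.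
  have o (w : 'cV[R]_N'.+1) : (w *m w^T) p q = w p 0 * w q 0 by rewrite mxE big_ord1 mxE.
  by rewrite /cond_proj aB aZ aD !o.
have bu r : bm (fun U => hu U r 0).
  rewrite (_ : (fun U => _) = fun U => (r < H.*2)%:R * ent U r 0); last by apply/funext => U; rewrite mxE.
  by apply: bmM; [exact: bm_cst|exact: bm_ent].
have bv r : bm (fun U => hv U r 0).
  rewrite (_ : (fun U => _) = fun U => (r < H.*2)%:R * (if odd r then ent U r.-1 0 else - ent U r.+1 0)); last by apply/funext => U; rewrite mxE.
  by apply: bmM; [exact: bm_cst|case: (odd r); [|apply: bmN]; exact: bm_ent].
have le1 (w : G -> 'cV[R]_N'.+1) U r : \sum_s w U s 0 ^+ 2 = hsum 0 H U -> w U r 0 ^+ 2 <= hsum 0 H U.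
  by move=> <-; rewrite (bigD1 r)//= lerDl sumr_ge0// => s _; exact: sqr_ge0.
apply: bmB; first exact: bm_cst.
apply: (@bm_quot _ _ 2); [by apply: bmD; apply: bmM|exact: bm_hsum| |].
  move=> U; rewrite ler_norml.
  have := le1 hu U p (sum_hu2 U); have := le1 hu U q (sum_hu2 U).
  have := le1 hv U p (sum_hv2 U); have := le1 hv U q (sum_hv2 U).
  move: (hu U p 0) (hu U q 0) (hv U p 0) (hv U q 0) (hsum 0 H U) => a b c d x H1 H2 H3 H4.
  by have := sqr_ge0 (a - b); have := sqr_ge0 (c - d); have := sqr_ge0 (a + b); have := sqr_ge0 (c + d);
     move=> K1 K2 K3 K4; apply/andP; split; nra.
by move=> U; rewrite -sum_hu2 sumr_ge0// => r _; exact: sqr_ge0.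
Qed.

Definition cond_size (U : G) : R := qf cond_proj c1 c1 U.

(** Base times height: the Gram determinant of two complex vectors is the squared length of the
    first times that of the component of the second orthogonal to it. *)
Lemma cond_sizeE U : hsum 0 H U * cond_size U = 4 * he H U.
Proof.
set x := hsum 0 H U.
have E : cond_size U = hsum 1 H U - x^-1 * ((\sum_p SO_mx U p c1 * hu U p 0) ^+ 2 + (\sum_p SO_mx U p c1 * hv U p 0) ^+ 2).
  have S (w : 'cV[R]_N'.+1) : ((col c1 (SO_mx U))^T *m (w *m w^T) *m col c1 (SO_mx U)) 0 0 = (\sum_p SO_mx U p c1 * w p 0) ^+ 2.
    have -> : \sum_p SO_mx U p c1 * w p 0 = \sum_p col c1 (SO_mx U) p 0 * w p 0.
      by apply: eq_bigr => p _; rewrite [in RHS]mxE.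
    rewrite mulmxA scal11 mul_scalar_mx -scalemxAl mxE scal11 mxE eqxx mulr1n expr2; congr (_ * _).
    by apply: eq_bigr => p _; rewrite mulrC.
  have Q (A : G -> 'M[R]_N'.+1) : qf A c1 c1 U = ((col c1 (SO_mx U))^T *m A U *m col c1 (SO_mx U)) 0 0.
    by rewrite /qf tr_col -row_mul [LHS]mxE [RHS]mxE; apply: eq_bigr => p _; congr (_ * _); rewrite [RHS]mxE.
  rewrite /cond_size Q /cond_proj mulmxBr mulmxBl -scalemxAr -scalemxAl mulmxDr mulmxDl -/x.
  have aB (X Y : 'M[R]_1) : (X - Y) 0 0 = X 0 0 - Y 0 0 by rewrite !mxE.
  have aD (X Y : 'M[R]_1) : (X + Y) 0 0 = X 0 0 + Y 0 0 by rewrite !mxE.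
  have aZ c (X : 'M[R]_1) : (c *: X) 0 0 = c * X 0 0 by rewrite !mxE.
  by rewrite aB aZ aD !S -qf_head_proj Q.
rewrite E sum_col_hu sum_col_hv /he -/x.
have -> : \sum_(i < H) (ent U i.*2 1 * ent U i.*2 0 + ent U i.*2.+1 1 * ent U i.*2.+1 0) = hdot H U.
  by apply: eq_bigr => i _; ring.
have -> : \sum_(i < H) (ent U i.*2.+1 1 * ent U i.*2 0 - ent U i.*2 1 * ent U i.*2.+1 0) = hdet H U.
  by apply: eq_bigr => i _; ring.
have [x0|x0] := eqVneq x 0; last by field.
have [u0 v0] := hsum_zero x0.
have q0 : hdot H U = 0.
  transitivity (\sum_p SO_mx U p c1 * hu U p 0); last by apply: big1 => p _; rewrite u0 mxE mulr0.
  by rewrite sum_col_hu; apply: eq_bigr => i _; ring.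
have d0 : hdet H U = 0.
  transitivity (\sum_p SO_mx U p c1 * hv U p 0); last by apply: big1 => p _; rewrite v0 mxE mulr0.
  by rewrite sum_col_hv; apply: eq_bigr => i _; ring.
by rewrite x0 q0 d0; lra.
Qed.

Lemma bm_cond_size : bm cond_size.
Proof. by apply: bm_qf; exact: bm_cond_proj. Qed.

Lemma cond_size_exp (t : R) : 0 <= t ->
  Ex nu (fun U => expR (- t * cond_size U)) <= expR (- ((H.*2 - 2)%:R / 2 * ln (1 + 2 * t / N'%:R))).
Proof.
move=> t0; have c10 : ~~ pred1 c0 c1.
  by apply/eqP => /(congr1 (@nat_of_ord _)); rewrite !inordK.
have := @proj_exp _ _ nu nuH c1 (pred1 c0) cond_proj c10 bm_cond_proj cond_proj_fixed cond_proj_tr cond_projK _ _ t cond_proj_trace t0.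
by rewrite card1 subSS subn0; apply => U j c /eqP ->; exact: cond_proj_kills.
Qed.

End pair_of_columns.

(** * Inequalities for logarithms, and an exponential tail bound *)

Section real_inequalities.
Context {R : realType}.
Implicit Types x y a v : R.

Lemma ln_sum1_ge0 a : 0 <= a -> 0 <= ln (1 + a).
Proof. by move=> a0; apply: ln_ge0; lra. Qed.

Lemma ln_concave v a : 0 <= v -> v <= 1 -> 0 <= a -> v * ln (1 + a) <= ln (1 + v * a).
Proof.
move=> v0 v1 a0; have va : 0 <= v * a by rewrite mulr_ge0.
have p1 : 0 < 1 + a by lra.
have p2 : 0 < 1 + v * a by lra.
have p3 : 0 < (1 + a) / (1 + v * a) by rewrite divr_gt0.
have h1 := ln_le_subr1 p3; rewrite ln_div ?posrE// in h1.
have p4 : 0 < (1 + v * a)^-1 by rewrite invr_gt0.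
have h2 := ln_le_subr1 p4; rewrite lnV ?posrE// in h2.
have E : v * ((1 + a) / (1 + v * a) - 1) + (1 - v) * ((1 + v * a)^-1 - 1) = 0.
  by field; rewrite gt_eqF.
have := ler_wpM2l v0 h1; have v1' : 0 <= 1 - v by lra.
have := ler_wpM2l v1' h2; move: E.
move: (ln (1 + a)) (ln (1 + v * a)) ((1 + a) / (1 + v * a)) ((1 + v * a)^-1) => A B C D; nra.
Qed.

Lemma ln_scale_lower v a : 0 < v -> v <= 1 -> 0 <= a -> ln v + ln (1 + a) <= ln (1 + v * a).
Proof.
move=> v0 v1 a0; have p1 : 0 < 1 + a by lra.
by rewrite -lnM ?posrE// ler_ln ?posrE ?mulr_gt0//; [lra|have := mulr_ge0 (ltW v0) a0; lra].
Qed.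

(** The weight [v] may decay exponentially in the sum [L] itself. For moderate [L] it is still at
    least [v0^3] and concavity suffices; for large [L], factoring [v] out of all [H] logarithms
    costs at most three quarters of [L]. *)
Lemma sum_ln_lower (I : finType) (f : I -> R) (H : nat) (v0 : R) :
  let L := \sum_i ln (1 + f i) in
  #|I| = H -> (0 < H)%N -> (forall i, 0 <= f i) -> 0 < v0 -> v0 <= 2^-1 ->
  v0 ^+ 3 * L <= \sum_i ln (1 + v0 * expR (- L / (2 * H%:R)) * f i).
Proof.
move=> L cI H0 f0 v00 v02; have HR : 0 < H%:R :> R by rewrite ltr0n.
have L0 : 0 <= L by apply: sumr_ge0 => i _; exact: ln_sum1_ge0.
set v := v0 * _.
have e1 : expR (- L / (2 * H%:R)) <= 1.
  by rewrite -[leRHS]expR0 ler_expR mulNr oppr_le0 divr_ge0// mulr_ge0// ltW.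
have v0' : 0 < v by rewrite mulr_gt0 ?expR_gt0.
have v1 : v <= 1 by have := ler_wpM2l (ltW v00) e1; rewrite -/v; lra.
have l0 : ln v0 < 0 by rewrite ln_lt0// v00; lra.
have [Ls|Ls] := leP L (- 4 * ln v0 * H%:R).
  have vv : v0 ^+ 3 <= v.
    have -> : v0 ^+ 3 = v0 * expR (2 * ln v0) by rewrite exprS expRM_natl lnK.
    rewrite /v ler_pM2l// ler_expR mulNr lerNr ler_pdivrMr ?mulr_gt0//; lra.
  apply: (@le_trans _ _ (v * L)); first exact: ler_wpM2r.
  by rewrite big_distrr; apply: ler_sum => i _; apply: ln_concave => //; exact: ltW.
apply: (@le_trans _ _ (\sum_i (ln v + ln (1 + f i)))); last first.
  by apply: ler_sum => i _; exact: ln_scale_lower.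
rewrite big_split /= sumr_const cI -mulr_natl -/L /v lnM ?posrE ?expR_gt0// expRK.
have -> : H%:R * (ln v0 + - L / (2 * H%:R)) + L = H%:R * ln v0 + L / 2 by field; rewrite gt_eqF.
have v3 : v0 ^+ 3 <= 4^-1 by rewrite !exprS expr0; nra.
have := ler_wpM2r L0 v3; lra.
Qed.

Lemma ln_prod_lower (I : finType) (f : I -> R) : (forall i, 0 <= f i) ->
  ln (1 + \sum_i f i) <= \sum_i ln (1 + f i).
Proof.
move=> f0; elim: (index_enum I) => [|i r IH]; first by rewrite !big_nil addr0 ln1.
rewrite !big_cons; set s := \sum_(j <- r) f j; have s0 : 0 <= s by exact: sumr_ge0.
have fi := f0 i; apply: (@le_trans _ _ (ln (1 + f i) + ln (1 + s))); last by rewrite lerD2l.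
rewrite -lnM ?posrE; [|lra|lra]; rewrite ler_ln ?posrE; [|lra|rewrite mulr_gt0; lra].
by have := mulr_ge0 fi s0; lra.
Qed.

Lemma expR_half_le x : 0 <= x -> x <= 1 -> expR (- 2 * x) <= 1 - 2 / 3 * x.
Proof.
move=> x0 x1; have := expR_ge1Dx (2 * x) => h; rewrite mulNr expRN.
rewrite -[leLHS]mul1r ler_pdivrMr ?expR_gt0//.
apply: (@le_trans _ _ ((1 - 2 / 3 * x) * (1 + 2 * x))); first by nra.
by apply: ler_wpM2l => //; lra.
Qed.

Lemma expR_quad_le x : 0 <= x -> expR (- x) <= 1 - x + x ^+ 2.
Proof.
move=> x0; have := expR_ge1Dx x => h; rewrite expRN.
rewrite -[leLHS]mul1r ler_pdivrMr ?expR_gt0//.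
apply: (@le_trans _ _ ((1 - x + x ^+ 2) * (1 + x))).
  have -> : (1 - x + x ^+ 2) * (1 + x) = 1 + x ^+ 3 by ring.
  by rewrite lerDl exprn_ge0.
by apply: ler_wpM2l => //; nra.
Qed.

(** Chernoff's bound for a variable with at least the decay of a Gamma law of shape [lam], at the
    point [k = lam / u]; it controls the event that [W] is below [u]. *)
Lemma tail_exp d (T : measurableType d) (P : probability T R) (W : T -> R) (lam r rho u : R) :
  bm W -> 0 <= lam -> 0 < r -> 0 < u -> 0 < rho -> rho <= lam * r ->
  (forall k, 0 <= k -> Ex P (fun U => expR (- k * W U)) <= expR (- (lam * ln (1 + r * k)))) ->
  Ex P (fun U => expR (lam - lam / u * W U)) <= expR (lam * (1 + ln (u / rho))).
Proof.
move=> bW l0 r0 u0 rho0 lr H.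
have k0 : 0 <= lam / u by rewrite divr_ge0// ltW.
have bE : bm (fun U => expR (- (lam / u) * W U)) by apply: bm_expR; apply: bmM => //; exact: bm_cst.
rewrite (_ : (fun U => _) = fun U => expR lam * expR (- (lam / u) * W U)); last first.
  by apply/funext => U; rewrite -expRD mulNr.
rewrite ExZ// mulrDr mulr1 expRD ler_pM2l ?expR_gt0//.
apply: le_trans (H _ k0) _; rewrite ler_expR -mulrN; apply: ler_wpM2l => //.
rewrite lerNl -lnV ?posrE ?divr_gt0// invf_div ler_ln ?posrE ?divr_gt0//.
  rewrite mulrA [r * lam]mulrC; apply: (@le_trans _ _ (lam * r / u)); first by rewrite ler_pM2r ?invr_gt0.
  by lra.
have := mulr_ge0 (ltW r0) k0; lra.
Qed.

End real_inequalities.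

(** * Comparison of degrees and eigenvalues *)

Section row_lengths.
Context {n : nat}.
Implicit Types m : 'I_n -> nat.

Definition rl m (i : nat) : nat := \sum_(j < n) m j * (i < j.+1).

Lemma rl_mono m i j : (i <= j)%N -> (rl m j <= rl m i)%N.
Proof.
move=> ij; apply: leq_sum => k _; rewrite leq_mul2l; apply/orP; right.
by rewrite ltnS; case: (leqP j k) => //= jk; have -> : (i < k.+1)%N by exact: (leq_trans ij jk).
Qed.

Lemma rl_over m i : (n <= i)%N -> rl m i = 0.
Proof.
move=> ni; apply: big1 => j _; rewrite (_ : (i < j.+1)%N = false) ?muln0//.
by apply/negbTE; rewrite -leqNgt (leq_trans _ ni).
Qed.

Lemma sum_rl m : \sum_(i < n) rl m i = degm m.
Proof.
rewrite /rl exchange_big /=; apply: eq_bigr => j _; rewrite -big_distrr /=; congr (_ * _)%N.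
transitivity (\sum_(i < j.+1) 1)%N; last by rewrite sum1_card card_ord.
rewrite (big_ord_widen n (fun=> 1%N) (ltn_ord j)) [RHS]big_mkcond; apply: eq_bigr => i _.
by case: (_ < _)%N.
Qed.

(** Counts the boxes of the first [H] rows by columns and by rows. *)
Lemma sum_columns (R : realType) m (q : nat -> R) H : (H <= n)%N ->
  \sum_(j < n) (m j)%:R * (\sum_(i < minn j.+1 H) q i) = \sum_(i < H) (rl m i)%:R * q i.
Proof.
move=> Hn.
transitivity (\sum_(j < n) \sum_(i < H) (m j * (i < j.+1))%N%:R * q i).
  apply: eq_bigr => j _; rewrite (big_ord_widen H q (geq_minr j.+1 H)) big_distrr big_mkcond /=.
  apply: eq_bigr => i _; rewrite leq_min ltn_ord andbT.
  by case: (_ < _)%N; rewrite ?muln1 ?muln0 ?mul0r.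
by rewrite exchange_big /=; apply: eq_bigr => i _; rewrite -big_distrl /= natr_sum.
Qed.

End row_lengths.

Section gains.
Context {R : realType} {n : nat}.
Local Notation N' := (n.+1.*2).
Local Notation G := (SO R N'.+1).
Local Notation NN := (N'.+1%:R : R).
Variables (nu : probability G R) (nuH : is_haar nu).
Implicit Types (m : 'I_n.+1 -> nat) (U : G).

Definition lap m : R := Ex nu (fun U => expR (- 2 * wX m U)).
Definition rlR m (i : nat) : R := (rl m i)%:R / n.+1%:R.
(** The Gaussian exponent of the gain: replacing the row weights in [wX] by independent Gaussian
    squares leads to this sum. It measures gain and degree on the same scale. *)
Definition Gam m : R := \sum_(i < n.+1) ln (1 + rlR m i).

Definition hq (i : nat) U : R := (pairsq 0 i U + pairsq 1 i U) / 2.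

Lemma hSE h U : hS h U = \sum_(i < h) hq i U.
Proof. by rewrite /hS /hsum -big_split big_distrl. Qed.

Lemma bm_lap m : bm (fun U : G => expR (- 2 * wX m U)).
Proof. by apply: bm_expR; apply: bmM; [exact: bm_cst|exact: bm_wX]. Qed.

Lemma lap_gt0 m : 0 < lap m.
Proof.
have bw : bm (fun U => - 2 * wX m U) by apply: bmM; [exact: bm_cst|exact: bm_wX].
have [_ [M fM]] := bw.
apply: (@lt_le_trans _ _ (Ex nu (fun=> expR (- M)))); first by rewrite Ex_cst expR_gt0.
apply: Ex_le; [exact: bm_cst|exact: bm_expR|move=> U].
by rewrite ler_expR lerNl (le_trans _ (fM U))// -normrN ler_norm.
Qed.

Lemma Gam_ge0 m : 0 <= Gam m.
Proof. by apply: sumr_ge0 => i _; apply: ln_sum1_ge0; rewrite divr_ge0. Qed.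

Lemma Gam_le_deg m : Gam m <= (degm m)%:R / n.+1%:R.
Proof.
rewrite -sum_rl natr_sum big_distrl; apply: ler_sum => i _.
by apply: le_trans (ln_le_subr1 _) _; [rewrite ltr_wpDr// divr_ge0|rewrite addrC addKr].
Qed.

Lemma Gam_ge_ln m : ln (1 + (degm m)%:R / n.+1%:R) <= Gam m.
Proof.
rewrite -sum_rl natr_sum big_distrl; apply: ln_prod_lower => i.
by rewrite divr_ge0.
Qed.

Lemma hX_ge0 h U : (h <= n.+1)%N -> 0 <= hX h U.
Proof.
move=> hn; have := he_ge0 h U; have : 0 <= hS h U * (1 - hS h U) by rewrite mulr_ge0 ?hS_ge0// subr_ge0 hS_le1.
by rewrite /hX; lra.
Qed.

Lemma wX_ge0 m U : 0 <= wX m U.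
Proof. by apply: sumr_ge0 => i _; rewrite mulr_ge0// hX_ge0. Qed.

Lemma hS_mean h : (h <= n.+1)%N -> NN * Ex nu (hS h) = h.*2%:R.
Proof.
move=> hn; have := hsum_mean nuH hn 0; have := hsum_mean nuH hn 1.
rewrite (_ : hS h = fun U => 2^-1 * hsum 0 h U + 2^-1 * hsum 1 h U); last first.
  by apply/funext => U; rewrite /hS; lra.
have bh a : bm (fun U : G => 2^-1 * hsum a h U) by apply: bmM; [exact: bm_cst|exact: bm_hsum].
rewrite ExD// !ExZ; [lra|exact: bm_hsum|exact: bm_hsum].
Qed.

Lemma hS_square_mean h : (h <= n.+1)%N ->
  NN * (NN + 2) * Ex nu (fun U => hS h U ^+ 2) <= (h.*2%:R + 2) * h.*2%:R.
Proof.
move=> hn; have N0 : 0 < NN by rewrite ltr0n.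
have b2 a : bm (fun U : G => 2^-1 * hsum a h U ^+ 2) by apply: bmM; [exact: bm_cst|apply: bmX; exact: bm_hsum].
have bX a : bm (fun U : G => hsum a h U ^+ 2) by apply: bmX; exact: bm_hsum.
have E a : NN * (NN + 2) * Ex nu (fun U => hsum a h U ^+ 2) = (h.*2%:R + 2) * h.*2%:R.
  have E1 := hsum_mean nuH hn a; have E2 := hsum_square_mean nuH hn a.
  by rewrite -mulrA E2 mulrCA E1.
have le : Ex nu (fun U => hS h U ^+ 2) <= Ex nu (fun U => 2^-1 * hsum 0 h U ^+ 2 + 2^-1 * hsum 1 h U ^+ 2).
  apply: Ex_le; [apply: bmX; exact: bm_hS|exact: bmD|move=> U].
  by rewrite /hS; have := sqr_ge0 (hsum 0 h U - hsum 1 h U); nra.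
have p : 0 <= NN * (NN + 2) by rewrite mulr_ge0// ?addr_ge0// ltW.
apply: le_trans (ler_wpM2l p le) _; rewrite ExD// !ExZ// mulrDr.
have := E 0%N; have := E 1%N; move: (NN * (NN + 2)) => M; lra.
Qed.

Lemma hS_square_le h : (h <= n.+1)%N -> Ex nu (fun U => hS h U ^+ 2) <= 8 * (h%:R / NN) ^+ 2.
Proof.
move=> hn; have N0 : 0 < NN by rewrite ltr0n.
have := hS_square_mean hn; set e := Ex _ _.
have e0 : 0 <= e by apply: Ex_ge0 => U; exact: sqr_ge0.
have hh : h%:R <= (h ^ 2)%:R :> R by rewrite ler_nat; case: (h) => // k; rewrite -mulnn leq_pmulr.
have h2 : h.*2%:R = 2 * h%:R :> R by rewrite -muln2 natrM mulrC.
rewrite natrX in hh; rewrite h2 => H.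
rewrite expr_div_n mulrA ler_pdivlMr ?exprn_gt0// mulrC.
by have := mulr_ge0 (ltW N0) e0; nra.
Qed.

(** The exponent [4 k / NN] is exact to first order, as needed for the constant in front of [ln n].
    Expand [exp (- 2 w) <= 1 - 2 w + 4 w^2], with the mean of [wX] at least [2 k / NN] up to second
    order and its second moment of second order; [48 = 2 * 8 + 4 * 8]. *)
Lemma lap_small m : lap m <= expR (- (4 * (degm m)%:R / NN - 48 * ((degm m)%:R / NN) ^+ 2)).
Proof.
set K := (degm m)%:R; have N0 : 0 < NN by rewrite ltr0n.
have bW : bm (wX m : G -> R) by exact: bm_wX.
have bW2 : bm (fun U : G => wX m U ^+ 2) by exact: bmX.
have bS h : bm (hS h : G -> R) by exact: bm_hS.
have KE : K = \sum_(i < n.+1) (m i)%:R * i.+1%:R.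
  by rewrite /K /degm natr_sum; apply: eq_bigr => i _; rewrite natrM.
have W2 : Ex nu (fun U => wX m U ^+ 2) <= 8 * (K / NN) ^+ 2.
  have bMS : bm (fun U : G => \sum_(i < n.+1) (m i)%:R * hS i.+1 U).
    by apply: bm_sum => i _; apply: bmM; [exact: bm_cst|].
  apply: (@le_trans _ _ (Ex nu (fun U => (\sum_(i < n.+1) (m i)%:R * hS i.+1 U) ^+ 2))).
    apply: Ex_le => //; first exact: bmX.
    move=> U; rewrite ler_pXn2r ?nnegrE ?wX_ge0//; last by apply: sumr_ge0 => i _; rewrite mulr_ge0// hS_ge0.
    by apply: ler_sum => i _; apply: ler_wpM2l => //; exact: hX_le_hS.
  have -> : (fun U : G => (\sum_(i < n.+1) (m i)%:R * hS i.+1 U) ^+ 2) =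
      fun U => \sum_(i < n.+1) \sum_(j < n.+1) (m i)%:R * (m j)%:R * (hS i.+1 U * hS j.+1 U).
    apply/funext => U; rewrite expr2 big_distrl; apply: eq_bigr => i _ /=; rewrite big_distrr.
    by apply: eq_bigr => j _ /=; ring.
  have bij i j : bm (fun U : G => (m i)%:R * (m j)%:R * (hS i.+1 U * hS j.+1 U)).
    by apply: bmM; [exact: bm_cst|exact: bmM].
  rewrite Ex_sum => [|i _]; last by apply: bm_sum => j _.
  have -> : 8 * (K / NN) ^+ 2 = \sum_(i < n.+1) \sum_(j < n.+1) (m i)%:R * (m j)%:R * (8 * (i.+1%:R / NN) * (j.+1%:R / NN)).
    rewrite KE expr2 !big_distrl mulrC big_distrl /=; apply: eq_bigr => i _.
    by rewrite big_distrr big_distrl /=; apply: eq_bigr => j _; ring.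
  apply: ler_sum => i _; rewrite Ex_sum//; apply: ler_sum => j _; rewrite ExZ; last exact: bmM.
  apply: ler_wpM2l; first by rewrite mulr_ge0.
  have i0 k : 0 <= k.+1%:R / NN by rewrite divr_ge0.
  rewrite -(@ler_pXn2r _ 2) ?nnegrE; first last.
  - by rewrite !mulr_ge0.
  - by apply: Ex_ge0 => U; rewrite mulr_ge0 ?hS_ge0.
  - by [].
  apply: le_trans (Ex_sqr_le nu (bS _) (bS _)) _.
  have -> : (8 * (i.+1%:R / NN) * (j.+1%:R / NN)) ^+ 2 = 8 * (i.+1%:R / NN) ^+ 2 * (8 * (j.+1%:R / NN) ^+ 2) by ring.
  by apply: ler_pM; rewrite ?hS_square_le// Ex_ge0// => U; exact: sqr_ge0.
have W1 : 2 * K / NN - 8 * (K / NN) ^+ 2 <= Ex nu (wX m).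
  apply: (@le_trans _ _ (\sum_(i < n.+1) (m i)%:R * (2 * (i.+1%:R / NN) - 8 * (i.+1%:R / NN) ^+ 2))).
    under eq_bigr do rewrite mulrBr; rewrite sumrB; apply: lerB.
      rewrite KE -mulrA big_distrl big_distrr /=; rewrite le_eqVlt; apply/orP; left; apply/eqP.
      by apply: eq_bigr => i _; ring.
    rewrite KE; set a := fun i : 'I_n.+1 => (m i)%:R * i.+1%:R / NN.
    have -> : (\sum_(i < n.+1) (m i)%:R * i.+1%:R) / NN = \sum_i a i by rewrite big_distrl.
    apply: (@le_trans _ _ (\sum_i 8 * a i ^+ 2)).
      apply: ler_sum => i _; have -> : 8 * a i ^+ 2 = (m i)%:R ^+ 2 * (8 * (i.+1%:R / NN) ^+ 2) by rewrite /a; ring.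
      apply: ler_wpM2r; first by rewrite mulr_ge0 ?sqr_ge0.
      by rewrite -natrX ler_nat; case: (m i) => // k; rewrite -mulnn leq_pmulr.
    rewrite -big_distrr /= ler_pM2l// expr2 big_distrl /=; apply: ler_sum => i _.
    have ai j : 0 <= a j by rewrite /a !mulr_ge0// invr_ge0 ltW.
    by rewrite expr2; apply: ler_wpM2l => //; rewrite (bigD1 i)//= lerDl sumr_ge0.
  rewrite /wX Ex_sum => [|i _]; last by apply: bmM; [exact: bm_cst|exact: bm_hX].
  apply: ler_sum => i _; rewrite ExZ; last exact: bm_hX.
  apply: ler_wpM2l => //; apply: (@le_trans _ _ (Ex nu (fun U => hS i.+1 U - hS i.+1 U ^+ 2))).
    rewrite ExB//; last exact: bmX.
    apply: lerB; last exact: hS_square_le.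
    have h2 : (i.+1).*2%:R = 2 * i.+1%:R :> R by rewrite -muln2 natrM mulrC.
    have := hS_mean (ltn_ord i); rewrite h2 => E.
    by rewrite mulrA ler_pdivrMr// mulrC [leRHS]mulrC E; lra.
  apply: Ex_le; [apply: bmB => //; exact: bmX|exact: bm_hX|move=> U].
  by rewrite /hX lerDl mulr_ge0// he_ge0.
apply: (@le_trans _ _ (1 - 2 * Ex nu (wX m) + 4 * Ex nu (fun U => wX m U ^+ 2))); last first.
  apply: le_trans (expR_ge1Dx _); have -> : 4 * K / NN = 2 * (2 * K / NN) by ring.
  by move: W1 W2; move: ((K / NN) ^+ 2) (2 * K / NN) => x y; lra.
have bZ (c : R) (f : G -> R) : bm f -> bm (fun U : G => c * f U) by move=> bf; apply: bmM => //; exact: bm_cst.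
rewrite -!ExZ// -[X in _ <= X - _ + _](Ex_cst nu) -ExB//; [|exact: bm_cst|exact: bZ].
rewrite -ExD//; [|apply: bmB; [exact: bm_cst|exact: bZ]|exact: bZ].
apply: Ex_le; [exact: bm_lap|by apply: bmD; [apply: bmB; [exact: bm_cst|exact: bZ]|exact: bZ]|move=> U].
have w0 := wX_ge0 m U; have : 0 <= 2 * wX m U by rewrite mulr_ge0.
by move/expR_quad_le; rewrite mulNr => /le_trans; apply; rewrite exprMn; lra.
Qed.

(** A gap that degenerates with the dimension but holds for every nontrivial weight; it settles
    bounded dimensions. *)
Lemma lap_pos m i : m i <> 0 -> lap m <= 1 - 2 / 3 * (2 / (NN * (NN + 2))).
Proof.
move=> mi; have N0 : 0 < NN by rewrite ltr0n.
have bX : bm (hX i.+1 : G -> R) by exact: bm_hX.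
have bE : bm (fun U : G => 1 - 2 / 3 * hX i.+1 U) by apply: bmB; [exact: bm_cst|apply: bmM => //; exact: bm_cst].
apply: (@le_trans _ _ (Ex nu (fun U => 1 - 2 / 3 * hX i.+1 U))).
  apply: Ex_le => //; first exact: bm_lap.
  move=> U; have X0 := hX_ge0 U (ltn_ord i).
  apply: le_trans (expR_half_le X0 (le_trans (hX_le_hS _ _) (hS_le1 U (ltn_ord i)))).
  rewrite ler_expR ler_wnM2l// /wX (bigD1 i)//= -[leLHS]addr0; apply: lerD.
    by rewrite -[leLHS]mul1r ler_wpM2r// ler1n; case: (m i) mi.
  by apply: sumr_ge0 => j _; rewrite mulr_ge0// hX_ge0.
rewrite ExB; [|exact: bm_cst|by apply: bmM => //; exact: bm_cst].
rewrite Ex_cst ExZ// lerD2l lerN2 ler_pM2l//.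
have bS : bm (hS i.+1 : G -> R) by exact: bm_hS.
apply: (@le_trans _ _ (Ex nu (fun U => hS i.+1 U - hS i.+1 U ^+ 2))); last first.
  apply: Ex_le => //; first by apply: bmB => //; exact: bmX.
  by move=> U; rewrite /hX lerDl mulr_ge0// he_ge0.
rewrite ExB//; last exact: bmX.
have p : 0 < NN * (NN + 2) by rewrite mulr_gt0// addr_gt0.
rewrite ler_pdivrMr// mulrBl [X in _ <= _ - X]mulrC.
have := hS_square_mean (ltn_ord i); have := hS_mean (ltn_ord i).
set e1 := Ex _ _; set e2 := Ex _ _ => E1 E2.
have -> : e1 * (NN * (NN + 2)) = (NN + 2) * (i.+1).*2%:R by rewrite -E1; ring.
have Ni : (i.+1).*2%:R + 1 <= NN by rewrite natr1 ler_nat; have := ltn_ord i; lia.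
have i2 : 2 <= (i.+1).*2%:R :> R by rewrite ler_nat.
by nra.
Qed.

End gains.

Lemma quarter_bounds n : (6 <= n)%N -> let H := (n %/ 4).+1 in
  [/\ H <= n, n + 1 <= 4 * H & 4 * H <= n + 4]%N.
Proof. by move=> n6 H; rewrite /H; split; lia. Qed.

Section uniform_gain.
Context {R : realType} {n : nat}.
Local Notation N' := (n.+1.*2).
Local Notation G := (SO R N'.+1).
Local Notation NN := (N'.+1%:R : R).
Variables (nu : probability G R) (nuH : is_haar nu).
Implicit Types (m : 'I_n.+1 -> nat) (U : G).

Lemma wX_ge H m U : (H <= n.+1)%N ->
  Num.min (1 - hS H U) (2 * he H U) * \sum_(i < H) (rl m i)%:R * hq i U <= wX m U.
Proof.
move=> Hn; rewrite -(sum_columns m (hq^~ U) Hn) big_distrr; apply: ler_sum => j _ /=.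
by rewrite mulrCA -hSE; apply: ler_wpM2l => //; apply: hX_ge.
Qed.

Lemma wX_ge_top m U : (1 - hS n.+1 U) * \sum_(i < n.+1) (rl m i)%:R * hq i U <= wX m U.
Proof.
rewrite -(sum_columns m (hq^~ U) (leqnn _)) big_distrr; apply: ler_sum => j _ /=.
have jn := ltn_ord j; rewrite mulrCA -hSE; apply: ler_wpM2l => //.
rewrite (minn_idPl jn); have := hS_mono U jn; have := hS_ge0 j.+1 U; have := he_ge0 j.+1 U.
by rewrite /hX => e0 s0 s1; have := ler_wpM2r s0 s1; lra.
Qed.

Lemma hq_ge0 i U : 0 <= hq i U.
Proof. by rewrite divr_ge0// !addr_ge0 ?sqr_ge0. Qed.

(** Where [V] is at least [v] the exponent is a deterministic multiple of a weighted sum of squares,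
    covered by [pairs_exp]; elsewhere the integrand is at most 1, hence at most [T]. *)
Lemma lap_split_weights H m (V T : G -> R) (v : R) (l : nat -> R) : (H <= n.+1)%N -> 0 < v ->
  (forall i, 0 <= l i) -> (forall U, V U * \sum_(i < H) l i * hq i U <= wX m U) ->
  bm T -> (forall U, 0 <= T U) -> (forall U, V U < v -> 1 <= T U) ->
  lap nu m <= Ex nu T + expR (- \sum_(i < H) ln (1 + 4 * v * l i / NN)).
Proof.
move=> Hn v0 l0 VW bT T0 T1.
have k0 i : 0 <= 2 * v * l i by rewrite !mulr_ge0// ltW.
pose E U := expR (- \sum_(i < H) (2 * v * l i) * hq i U).
have bE : bm E.
  apply: bm_expR; apply: bmN; apply: bm_sum => i _; apply: bmM; first exact: bm_cst.
  by apply: bmM; [apply: bmD; exact: bm_pairsq|exact: bm_cst].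
apply: (@le_trans _ _ (Ex nu T + Ex nu E)).
  rewrite -ExD//; apply: Ex_le; [exact: bm_lap|exact: bmD|move=> U].
  have [Vv|vV] := ltP (V U) v.
    apply: (@le_trans _ _ 1).
      by rewrite -[leRHS]expR0 ler_expR mulNr oppr_le0 mulr_ge0// wX_ge0.
    by rewrite -[leLHS]addr0 lerD ?T1// expR_ge0.
  rewrite -[leLHS]add0r lerD// ler_expR mulNr lerN2.
  apply: (@le_trans _ _ (2 * (V U * \sum_(i < H) l i * hq i U))); last by rewrite ler_pM2l.
  rewrite mulrA big_distrr /=; apply: ler_sum => i _; rewrite -mulrA; apply: ler_wpM2r.
    by rewrite mulr_ge0// hq_ge0.
  by rewrite ler_pM2l.
rewrite lerD2l; apply: le_trans (pairs_exp nuH Hn k0) _; rewrite ler_expR lerN2.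
rewrite le_eqVlt; apply/orP; left; apply/eqP; apply: eq_bigr => i _.
by congr (ln (1 + _ / _)); ring.
Qed.

Lemma lap_split H m (V T : G -> R) (v : R) : (H <= n.+1)%N -> 0 < v ->
  (forall U, V U * \sum_(i < H) (rl m i)%:R * hq i U <= wX m U) ->
  bm T -> (forall U, 0 <= T U) -> (forall U, V U < v -> 1 <= T U) ->
  lap nu m <= Ex nu T + expR (- \sum_(i < H) ln (1 + v * rlR m i)).
Proof.
move=> Hn v0 VW bT T0 T1; apply: le_trans (lap_split_weights Hn v0 (fun i => ler0n R (rl m i)) VW bT T0 T1) _.
rewrite lerD2l ler_expR lerN2; apply: ler_sum => i _; have r0 : 0 <= rlR m i :> R by rewrite divr_ge0.
have vl : 0 <= v * (rl m i)%:R by rewrite mulr_ge0// ltW.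
rewrite ler_ln ?posrE; first last.
- by rewrite ltr_pwDl// divr_ge0// -mulrA mulr_ge0.
- by have := mulr_ge0 (ltW v0) r0; lra.
have nN : n.+1%:R^-1 <= 4 * NN^-1.
  by rewrite ler_pdivlMr ?ltr0n// mulrC ler_pdivrMr ?ltr0n// -natrM ler_nat; lia.
rewrite lerD2l /rlR; have := ler_wpM2l vl nN.
by move: (n.+1%:R^-1) (NN^-1) ((rl m i)%:R) => a b l; lra.
Qed.

Lemma proj_head_exp a H t : (H <= n.+1)%N -> 0 <= t ->
  Ex nu (fun U => expR (- t * hsum a H U)) <= expR (- (H%:R * ln (1 + 2 * t / NN))).
Proof.
move=> Hn t0.
have fixc : fixed_by_rotations (inord a : 'I_N'.+1) pred0 (fun=> head_proj H : 'M[R]_N'.+1) by [].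
have := @proj_exp _ _ nu nuH (inord a) pred0 (fun=> head_proj H) isT (bmx_cst _) fixc
  (fun=> head_proj_tr H) (fun=> head_projK H) (fun _ _ _ (h : pred0 _) => match notF h with end) H.*2 t.
rewrite (_ : (fun U => expR (- t * qf _ _ _ U)) = fun U => expR (- t * hsum a H U)); last first.
  by apply/funext => U; rewrite qf_head_proj.
rewrite card0 subn0 (_ : H.*2%:R / 2 = H%:R); last by rewrite -muln2 natrM mulfK.
by apply => // U; rewrite head_proj_trace.
Qed.

(** Exponential majorant of the indicator of [W < u], a bounded measurable function with computable
    mean. *)
Definition ge_tail (lam u : R) (W : G -> R) U : R := expR (lam - lam / u * W U).

Lemma ge_tail_ge1 lam u W U : 0 <= lam -> 0 < u -> W U < u -> 1 <= ge_tail lam u W U.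
Proof.
move=> l0 u0 Wu; rewrite -[leLHS]expR0 ler_expR subr_ge0 -mulrA ler_piMr//.
by rewrite mulrC ler_pdivrMr// mul1r ltW.
Qed.

Lemma bm_ge_tail lam u W : bm W -> bm (ge_tail lam u W).
Proof. by move=> bW; apply: bm_expR; apply: bmB; [exact: bm_cst|apply: bmM => //; exact: bm_cst]. Qed.

(** As [2 he] is half the product of [hsum 0] and [cond_size], a small minimum requires one of three
    variables to be small. Cutting at about a quarter of the height leaves each of them a Gamma
    shape of at least [n.+1 / 8]. *)
Lemma middle_tail (u : R) : (6 <= n.+1)%N -> 0 < u -> u <= 1 -> let H := (n.+1 %/ 4).+1 in
  exists T : G -> R, [/\ bm T, forall U, 0 <= T U,
    forall U, Num.min (1 - hS H U) (2 * he H U) < u ^+ 2 / 2 -> 1 <= T U &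
    1 + ln (8 * u) <= 0 -> Ex nu T <= 3 * expR (n.+1%:R / 8 * (1 + ln (8 * u)))].
Proof.
move=> n6 u0 u1 H; have Hn : (H <= n.+1)%N by rewrite /H; lia.
have N0 : 0 < NN by rewrite ltr0n.
have n0 : 0 < n.+1%:R :> R by rewrite ltr0n.
have v0 : 0 < u ^+ 2 / 2 by rewrite divr_gt0 ?exprn_gt0.
have vu : u ^+ 2 / 2 <= u by rewrite expr2; nra.
pose l1 : R := (N'.+1 - H.*2)%:R / 2; pose l3 : R := (H.*2 - 2)%:R / 2.
have l10 : 0 <= l1 by rewrite divr_ge0.
have l30 : 0 <= l3 by rewrite divr_ge0.
pose W1 U := 1 - hS H U; pose W2 U := hsum 0 H U; pose W3 U := cond_size H U.
have b1 : bm W1 by apply: bmB; [exact: bm_cst|exact: bm_hS].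
have b2 : bm W2 by exact: bm_hsum.
have b3 : bm W3 by exact: bm_cond_size.
exists (fun U => ge_tail l1 (u ^+ 2 / 2) W1 U + (ge_tail H%:R u W2 U + ge_tail l3 u W3 U)).
split.
- by apply: bmD; [exact: bm_ge_tail|apply: bmD; exact: bm_ge_tail].
- by move=> U; rewrite !addr_ge0 ?expR_ge0.
- move=> U; have p k w W : 0 <= ge_tail k w W U by exact: expR_ge0.
  have [|w1] := ltP (W1 U) (u ^+ 2 / 2).
    by move/(ge_tail_ge1 l10 v0) => h _; rewrite -[leLHS]addr0 lerD ?addr_ge0.
  rewrite gt_min => /orP[|e1]; first by rewrite -/(W1 U) ltNge w1.
  have E := cond_sizeE Hn U; rewrite -/(W3 U) -/(W2 U) in E.
  have [|w2] := ltP (W2 U) u.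
    move/(ge_tail_ge1 (ler0n _ H) u0) => h; rewrite -[leLHS]add0r lerD//.
    by rewrite -[leLHS]addr0 lerD.
  have [|w3] := ltP (W3 U) u.
    move/(ge_tail_ge1 l30 u0) => h; rewrite -[leLHS]add0r lerD//.
    by rewrite -[leLHS]add0r lerD.
  by have := ler_pM (ltW u0) (ltW u0) w2 w3; rewrite E; lra.
move=> lu; set B := expR _.
have [_ H4n H5n] := quarter_bounds n6; rewrite -/H in H4n H5n.
have lnu w : 0 < w -> w <= u -> 1 + ln (w / (8^-1)) <= 1 + ln (8 * u).
  by move=> w0 wu; rewrite lerD2l invrK mulrC ler_ln ?posrE ?mulr_gt0// ler_pM2l.
have key lam w : 0 < w -> w <= u -> n.+1%:R / 8 <= lam -> expR (lam * (1 + ln (w / 8^-1))) <= B.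
  move=> w0 wu ll; rewrite ler_expR; have l0 : 0 <= lam by apply: le_trans ll; rewrite divr_ge0.
  apply: le_trans (ler_wpM2l l0 (lnu w w0 wu)) _; exact: ler_wnM2r.
have HN : H.*2%:R = 2 * H%:R :> R by rewrite -muln2 natrM mulrC.
have H2 : (2 <= H.*2 <= N'.+1)%N by rewrite /H; clear -Hn; lia.
have [H2a H2b] := andP H2.
have l3E : l3 = H%:R - 1 by rewrite /l3 natrB// HN mulrBl mulrAC divff// mul1r.
have l1E : l1 = NN / 2 - H%:R by rewrite /l1 natrB// HN mulrBl [2 * _]mulrC mulfK.
have NE : NN = 2 * n.+1%:R + 1 by rewrite -natr1 -muln2 natrM mulrC.
have H4 : n.+1%:R + 1 <= 4 * H%:R :> R by move: H4n; rewrite -(ler_nat R) natrD natrM.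
have H5 : 4 * H%:R <= n.+1%:R + 4 :> R by move: H5n; rewrite -(ler_nat R) natrD natrM.
have n6R : 6 <= n.+1%:R :> R by rewrite ler_nat.
rewrite ExD; [|exact: bm_ge_tail|by apply: bmD; exact: bm_ge_tail].
rewrite ExD; [|exact: bm_ge_tail|exact: bm_ge_tail].
have -> : 3 * B = B + (B + B) by ring.
have c8 : 0 < 8^-1 :> R by rewrite invr_gt0.
have r0 : 0 < 2 / NN by rewrite divr_gt0.
apply: lerD; last apply: lerD.
- apply: le_trans (tail_exp b1 l10 r0 v0 c8 _ _) (key _ _ v0 vu _); last by rewrite l1E NE; lra.
    by rewrite mulrA ler_pdivlMr// l1E; lra.
  move=> k k0; apply: le_trans (complement_exp nuH Hn k0) _.
  by rewrite [2 / NN * k]mulrAC.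
- apply: le_trans (tail_exp b2 (ler0n _ H) r0 u0 c8 _ _) (key _ _ u0 (lexx _) _); last by lra.
    by rewrite mulrA ler_pdivlMr// NE; lra.
  move=> k k0; apply: le_trans (proj_head_exp 0 Hn k0) _.
  by rewrite [2 / NN * k]mulrAC.
- have N'0 : 0 < N'%:R :> R by rewrite ltr0n.
  have r0' : 0 < 2 / N'%:R :> R by rewrite divr_gt0.
  have N'E : N'%:R = 2 * n.+1%:R :> R by rewrite -muln2 natrM mulrC.
  apply: le_trans (tail_exp b3 l30 r0' u0 c8 _ _) (key _ _ u0 (lexx _) _); last by rewrite l3E; lra.
    by rewrite mulrA ler_pdivlMr// l3E N'E; lra.
  move=> k k0; apply: le_trans (cond_size_exp nuH Hn k0) _.
  by rewrite [2 / N'%:R * k]mulrAC.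
Qed.

End uniform_gain.

Lemma sum_initial_blocks (R : realType) (f : nat -> R) c H :
  (forall i j, (i <= j)%N -> f j <= f i) -> \sum_(i < c * H) f i <= c%:R * \sum_(i < H) f i.
Proof.
move=> fm; elim: c => [|c IH]; first by rewrite mul0n big_ord0 mul0r.
rewrite mulSn big_split_ord /= -natr1 mulrDl mul1r addrC; apply: lerD => //.
by apply: le_trans IH; apply: ler_sum => i _; apply: fm; exact: leq_addl.
Qed.

Lemma expRN_le_inv (R : realType) (x : R) : 0 < x -> expR (- x) <= x^-1.
Proof.
move=> x0; rewrite expRN lef_pV2 ?posrE ?expR_gt0//.
by apply: le_trans (expR_ge1Dx _); lra.
Qed.

Section gain_lower_bound.
Context {R : realType}.
Local Notation G n := (SO R n.+1.*2.+1).

(** Row lengths decrease, so the first quarter of the rows carries a quarter of the sum. *)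
Lemma Gam_initial n (m : 'I_n.+1 -> nat) H : (H <= n.+1)%N -> (n.+1 <= 4 * H)%N ->
  Gam m <= 4 * \sum_(i < H) ln (1 + rlR m i) :> R.
Proof.
move=> Hn nH; pose f i : R := ln (1 + rlR m i).
have f0 i : 0 <= f i by apply: ln_sum1_ge0; rewrite divr_ge0.
apply: (@le_trans _ _ (\sum_(i < 4 * H) f i)).
  rewrite /Gam (big_ord_widen _ f nH) [leRHS](bigID (fun i : 'I_(4 * H) => (i < n.+1)%N)) /= lerDl.
  by apply: sumr_ge0.
apply: sum_initial_blocks => i j ij; rewrite /f /rlR.
have r0 k : 0 <= (rl m k)%:R / n.+1%:R :> R by rewrite divr_ge0.
rewrite ler_ln ?posrE; [|by rewrite ltr_pwDl// r0|by rewrite ltr_pwDl// r0].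
by rewrite lerD2l ler_pM2r ?invr_gt0 ?ltr0n// ler_nat rl_mono.
Qed.

(** A bounded [Gam m] is handled by [lap_pos]. A large one is handled by splitting, with [1 - hS] at
    full height, which consists of the last row alone; hence the shape 1/2 and a constant depending
    on [n]. *)
Lemma gain_fixed_dimension n : exists2 eta : R, 0 < eta &
  forall (nu : probability (G n) R) m, is_haar nu -> (exists i, m i <> 0) -> lap nu m <= expR (- (eta * Gam m)).
Proof.
pose NN : R := n.+1.*2.+1%:R; have N3 : 3 <= NN by rewrite ler_nat.
have N0 : 0 < NN by lra.
have n0 : 0 < n.+1%:R :> R by rewrite ltr0n.
have NE : NN = 2 * n.+1%:R + 1 by rewrite /NN -natr1 -muln2 natrM mulrC.
(* Cancels the 1 in the exponent of [tail_exp], which becomes a negative multiple of [L]. *)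
pose v0 : R := expR (- 1) / NN.
have v00 : 0 < v0 by rewrite divr_gt0 ?expR_gt0.
have v0N : v0 * NN <= 1.
  by rewrite /v0 divfK ?gt_eqF// -[leRHS]expR0 ler_expR lerN10.
have v02 : v0 <= 2^-1 by nra.
pose v2 := v0 ^+ 3; have v20 : 0 < v2 by exact: exprn_gt0.
have v2n : v2 <= (4 * n.+1%:R)^-1.
  rewrite -[leRHS]mul1r ler_pdivlMr ?mulr_gt0// /v2 !exprS expr0 mulr1.
  have a1 : v0 * (4 * n.+1%:R) <= 2 by move: v0N; rewrite NE; nra.
  have a2 : v0 * v0 <= 2^-1 by nra.
  by have := mulr_ge0 (ltW v00) (ltW n0); nra.
pose be : R := 2 / 3 * (2 / (NN * (NN + 2))).
have be0 : 0 < be by rewrite mulr_gt0// divr_gt0// mulr_gt0// addr_gt0.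
have be1 : be <= 1.
  by rewrite /be mulrA ler_pdivrMr ?mulr_gt0 ?addr_gt0//; nra.
exists (be * v2 / 2); first by rewrite divr_gt0// mulr_gt0.
move=> nu m nuH [i mi]; set L := Gam m.
have L0 : 0 <= L by exact: Gam_ge0.
have [Ls|Ls] := leP (v2 * L) 2.
  apply: le_trans (lap_pos nuH mi) _; apply: le_trans (expR_ge1Dx _) _; rewrite -/NN -/be ler_expR lerN2.
  by nra.
(* This decay makes the tail exponentially small in [L], and [sum_ln_lower] still recovers a
   multiple of [L] from the main term. *)
pose v := v0 * expR (- L / (2 * n.+1%:R)).
have vp : 0 < v by rewrite mulr_gt0 ?expR_gt0.
pose V U : R := 1 - hS n.+1 (U : G n).
have bV : bm V by apply: bmB; [exact: bm_cst|exact: bm_hS].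
have h2 : 0 <= 2^-1 :> R by rewrite invr_ge0.
have := @lap_split R n nu nuH n.+1 m V (ge_tail 2^-1 v V) v (leqnn _) vp (wX_ge_top m) (bm_ge_tail _ _ bV)
  (fun U => expR_ge0 _) (fun U => @ge_tail_ge1 _ _ _ _ _ _ h2 vp).
move=> H; apply: le_trans H _.
have E1 : Ex nu (ge_tail 2^-1 v V) <= expR (- (L / (4 * n.+1%:R))).
  have rN : 0 < 2 / NN by rewrite divr_gt0.
  have iN : 0 < NN^-1 by rewrite invr_gt0.
  have := @tail_exp R _ _ nu V 2^-1 (2 / NN) NN^-1 v bV h2 rN vp iN.
  have -> : 2^-1 * (1 + ln (v / NN^-1)) = - (L / (4 * n.+1%:R)).
    rewrite invrK (_ : v * NN = expR (- 1 - L / (2 * n.+1%:R))); last first.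
      by rewrite expRD -mulNr /v /v0 mulrAC divfK ?gt_eqF.
    by rewrite expRK; field; rewrite gt_eqF.
  apply; first by rewrite mulKf.
  move=> k k0; apply: le_trans (complement_exp nuH (leqnn _) k0) _.
  by rewrite subSn// subnn mul1r -/NN [2 / NN * k]mulrAC.
have E2 : v2 * L <= \sum_(i < n.+1) ln (1 + v * rlR m i).
  apply: (@sum_ln_lower R _ (fun i : 'I_n.+1 => rlR m i)) => //; first by rewrite card_ord.
  by move=> j; rewrite divr_ge0.
apply: (@le_trans _ _ (expR (- (v2 * L)) + expR (- (v2 * L)))).
  apply: lerD; last by rewrite ler_expR lerN2.
  apply: le_trans E1 _; rewrite ler_expR lerN2 mulrC; exact: ler_wpM2l.
have e1 : 2 <= expR 1 :> R by have := expR_ge1Dx (1 : R); lra.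
have -> : expR (- (v2 * L)) + expR (- (v2 * L)) = 2 * expR (- (v2 * L)) by ring.
apply: (@le_trans _ _ (expR 1 * expR (- (v2 * L)))); first by rewrite ler_wpM2r ?expR_ge0.
rewrite -expRD ler_expR; move: Ls; set z := v2 * L => z2.
have -> : be * v2 / 2 * L = be * z / 2 by rewrite /z; ring.
by nra.
Qed.

(** Small degrees come from [lap_small]. For the others the exceptional event has probability at
    most [3 exp (- n.+1 / 8)] times the target decay, so for large [n] it costs a factor close to 1,
    which is absorbed because [Gam m] is bounded below. *)
Lemma gain_high_dimension : exists (eta : R) (n0 : nat), 0 < eta /\
  forall n (nu : probability (G n) R) m, (n0 <= n)%N -> is_haar nu -> lap nu m <= expR (- (eta * Gam m)).
Proof.
(* Makes [1 + ln (8 u) = - 1 - S / (4 H)]: the first summand gives decay in [n], the second in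
   [S]. *)
pose u0 : R := expR (- 2) / 8; pose v0 := u0 ^+ 2 / 2; pose v1 := v0 ^+ 3.
have u00 : 0 < u0 by rewrite divr_gt0 ?expR_gt0.
have u01 : u0 <= 8^-1.
  by rewrite /u0 ler_pdivrMr// mulVf// -[leRHS]expR0 ler_expR; lra.
have v00 : 0 < v0 by rewrite divr_gt0 ?exprn_gt0.
have v0s : v0 <= 8^-1 by rewrite /v0 expr2; nra.
have v10 : 0 < v1 by exact: exprn_gt0.
have v1s : v1 <= 32^-1 by rewrite /v1 !exprS expr0 mulr1; nra.
pose g0 : R := ln (1 + 12^-1); have g00 : 0 < g0 by apply: ln_gt0; rewrite ltrDl invr_gt0.
pose c := v1 / 8 * g0; have c0 : 0 < c by rewrite !mulr_gt0// invr_gt0.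
exists (v1 / 8), (maxn 6 (Num.truncn (24 / c)).+1); split; first by rewrite divr_gt0.
move=> n nu m; rewrite geq_max => /andP[n6 nc] nuH.
set k := (degm m)%:R : R; set L := Gam m; set NN := (n.+1.*2.+1%:R : R).
have L0 : 0 <= L by exact: Gam_ge0.
have n0 : 0 < n.+1%:R :> R by rewrite ltr0n.
have NE : NN = 2 * n.+1%:R + 1 by rewrite /NN -natr1 -muln2 natrM mulrC.
have N0 : 0 < NN by rewrite ltr0n.
have n1 : 1 <= n.+1%:R :> R by rewrite ler1n.
have k0 : 0 <= k by rewrite ler0n.
(* Below this threshold the term [48 x^2] is at most half of [4 x], with [x = k / NN]; above it
   [k / n.+1] exceeds 1/12, whence [g0]. *)
have [ks|kl] := leP k (NN / 24).
  apply: le_trans (lap_small nuH m) _; rewrite ler_expR lerN2 -/k -/NN.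
  have kN : k / NN <= 24^-1 by rewrite ler_pdivrMr// mulrC.
  have kN0 : 0 <= k / NN by rewrite divr_ge0// ltW.
  have := Gam_le_deg (R := R) m; rewrite -/k -/L => Lk.
  have kn : k / n.+1%:R <= 3 * (k / NN).
    have : n.+1%:R^-1 <= 3 * NN^-1 by rewrite ler_pdivlMr// mulrC ler_pdivrMr// NE; lra.
    by move/(ler_wpM2l k0); rewrite mulrCA.
  have -> : 4 * k / NN = 4 * (k / NN) by ring.
  by move: kN kN0 Lk kn; set x := k / NN; set y := k / _ => *; nra.
set H := (n.+1 %/ 4).+1.
have n6' : (6 <= n.+1)%N by exact: leq_trans n6 (leqnSn n).
have [Hn nH _] := quarter_bounds n6'; rewrite -/H in Hn nH.
have H0 : 0 < H%:R :> R by rewrite ltr0n.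
pose S : R := \sum_(i < H) ln (1 + rlR m i).
have S0 : 0 <= S by apply: sumr_ge0 => i _; apply: ln_sum1_ge0; rewrite divr_ge0.
have LS : L <= 4 * S.
  by apply: Gam_initial => //; apply: leq_trans nH; rewrite addn1.
pose u := u0 * expR (- S / (4 * H%:R)).
have up : 0 < u by rewrite mulr_gt0 ?expR_gt0.
have e1 : expR (- S / (4 * H%:R)) <= 1.
  by rewrite -[leRHS]expR0 ler_expR mulNr oppr_le0 divr_ge0// mulr_ge0// ltW.
have u1 : u <= 1 by have := ler_wpM2l (ltW u00) e1; rewrite -/u; lra.
have vE : u ^+ 2 / 2 = v0 * expR (- S / (2 * H%:R)).
  rewrite /u exprMn -expRM_natl /v0 mulrAC; congr (_ * expR _); field; by rewrite gt_eqF.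
have lu : 1 + ln (8 * u) = - (1 + S / (4 * H%:R)).
  rewrite (_ : 8 * u = expR (- 2 - S / (4 * H%:R))); last first.
    by rewrite expRD -mulNr /u /u0; field.
  by rewrite expRK; ring.
have SH0 : 0 <= S / (4 * H%:R) by rewrite divr_ge0// mulr_ge0// ltW.
have [T [bT T0 T1 T2]] := middle_tail nuH n6' up u1.
have vp : 0 < u ^+ 2 / 2 by rewrite divr_gt0 ?exprn_gt0.
have := @lap_split R n nu nuH H m (fun U => Num.min (1 - hS H U) (2 * he H U)) T _ Hn vp
  (fun U => wX_ge m U Hn) bT T0 T1.
have lu0 : 1 + ln (8 * u) <= 0 by rewrite lu; lra.
have {}T2 := T2 lu0; rewrite lu in T2.
have E2 : v1 * S <= \sum_(i < H) ln (1 + u ^+ 2 / 2 * rlR m i).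
  rewrite vE; apply: (@sum_ln_lower R _ (fun i : 'I_H => rlR m i)) => //; first by rewrite card_ord.
    by move=> j; rewrite divr_ge0.
  by lra.
move=> B; apply: le_trans B _.
have T3 : Ex nu T <= 3 * expR (- (n.+1%:R / 8)) * expR (- (v1 * S)).
  apply: le_trans T2 _; rewrite -[leRHS]mulrA; apply: ler_wpM2l => //; rewrite -expRD ler_expR.
  have : S / 32 <= n.+1%:R / 8 * (S / (4 * H%:R)).
    have : 1 <= n.+1%:R / H%:R :> R by rewrite ler_pdivlMr// mul1r ler_nat.
    have -> : n.+1%:R / 8 * (S / (4 * H%:R)) = S / 32 * (n.+1%:R / H%:R) by field; rewrite gt_eqF.
    have s32 : 0 <= S / 32 by rewrite divr_ge0.
    by move/(ler_wpM2l s32); rewrite mulr1.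
  have := ler_wpM2r S0 v1s; lra.
have T4 : expR (- \sum_(i < H) ln (1 + u ^+ 2 / 2 * rlR m i)) <= expR (- (v1 * S)) by rewrite ler_expR lerN2.
apply: le_trans (lerD T3 T4) _.
have Lg : g0 <= L.
  apply: le_trans (Gam_ge_ln _); rewrite ler_ln ?posrE; first last.
  - by rewrite ltr_pwDl// divr_ge0.
  - by rewrite addr_gt0// invr_gt0.
  rewrite lerD2l -/k ler_pdivlMr//; move: kl; rewrite NE; lra.
have en : 3 * expR (- (n.+1%:R / 8)) <= c.
  have p8 : 0 < n.+1%:R / 8 :> R by rewrite divr_gt0.
  have := expRN_le_inv p8; rewrite invf_div => h.
  have cn : 24 / c <= n.+1%:R.
    by apply: ltW; apply: lt_le_trans (truncnS_gt _) _; rewrite ler_nat ltnW.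
  rewrite ler_pdivrMr// in cn.
  have h3 : 3 * (8 / n.+1%:R) <= c by rewrite mulrA ler_pdivrMr//; lra.
  by apply: le_trans h3; apply: ler_wpM2l.
apply: (@le_trans _ _ ((1 + c) * expR (- (v1 * S)))).
  have -> : (1 + c) * expR (- (v1 * S)) = c * expR (- (v1 * S)) + expR (- (v1 * S)) by ring.
  by apply: lerD => //; apply: ler_wpM2r; rewrite ?expR_ge0.
apply: (@le_trans _ _ (expR c * expR (- (v1 * S)))); first by rewrite ler_wpM2r ?expR_ge0 ?expR_ge1Dx.
rewrite -expRD ler_expR; have a1 := ler_wpM2l (ltW v10) LS.
have : c <= v1 / 8 * L by rewrite /c ler_wpM2l// divr_ge0// ltW.
lra.
Qed.

Lemma gain_lower : exists2 eta : R, 0 < eta &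
  forall n (nu : probability (G n) R) m, is_haar nu -> (exists i, m i <> 0) -> lap nu m <= expR (- (eta * Gam m)).
Proof.
have [e1 [n0 [e10 H1]]] := gain_high_dimension.
have [e2 e20 H2] : exists2 e2 : R, 0 < e2 & forall n (nu : probability (G n) R) m, (n < n0)%N -> is_haar nu ->
    (exists i, m i <> 0) -> lap nu m <= expR (- (e2 * Gam m)).
  elim: n0 {H1} => [|n0 [e e0 IH]]; first by exists 1.
  have [e' e'0 H] := gain_fixed_dimension n0.
  exists (Num.min e e'); first by rewrite lt_min e0.
  move=> n nu m nn nuH mi; have L0 := Gam_ge0 (R := R) m.
  have [lt|ge] := ltnP n n0.
    apply: le_trans (IH _ _ _ lt nuH mi) _; rewrite ler_expR lerN2 ler_wpM2r//.
    by rewrite ge_min lexx.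
  have E : n = n0 by apply/eqP; rewrite eqn_leq ge -ltnS nn.
  subst n; apply: le_trans (H _ _ nuH mi) _; rewrite ler_expR lerN2 ler_wpM2r//.
  by rewrite ge_min lexx orbT.
exists (Num.min e1 e2); first by rewrite lt_min e10.
move=> n nu m nuH mi; have L0 := Gam_ge0 (R := R) m.
have [lt|ge] := ltnP n n0.
  apply: le_trans (H2 _ _ _ lt nuH mi) _; rewrite ler_expR lerN2 ler_wpM2r//.
  by rewrite ge_min lexx orbT.
apply: le_trans (H1 _ _ _ ge nuH) _; rewrite ler_expR lerN2 ler_wpM2r//.
by rewrite ge_min lexx.
Qed.

End gain_lower_bound.

Section short_columns.
Context {R : realType} {n : nat}.
Local Notation N' := (n.+1.*2).
Local Notation G := (SO R N'.+1).
Local Notation NN := (N'.+1%:R : R).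
Local Notation nn := (n.+1%:R : R).
Variables (nu : probability G R) (nuH : is_haar nu).
Implicit Types (m : 'I_n.+1 -> nat) (U : G).

Lemma ln1D_lower (z : R) : 0 <= z -> z * (1 - z) <= ln (1 + z).
Proof.
move=> z0; have p : 0 < (1 + z)^-1 by rewrite invr_gt0; lra.
have := ln_le_subr1 p; rewrite lnV ?posrE; last lra.
have -> : (1 + z)^-1 - 1 = - (z / (1 + z)) by field; lra.
have : z * (1 - z) <= z / (1 + z) by rewrite ler_pdivlMr; [have := sqr_ge0 z; nra|lra].
lra.
Qed.

(** The columns of heights from [a + 1] to [a + W]. *)
Definition mid m (a W : nat) : 'I_n.+1 -> nat := fun j => (m j * ((a <= j) && (j < a + W)))%N.

Lemma rl_mid_le m a W i : (rl (mid m a W) i <= rl m a)%N.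
Proof.
apply: leq_sum => j _; rewrite /mid -mulnA leq_mul2l; apply/orP; right; rewrite !ltnS.
by case: (a <= j)%N => //=; case: (j < a + W)%N; case: (i <= j)%N.
Qed.

Lemma rl_mid_over m a W i : (a + W <= i)%N -> rl (mid m a W) i = 0.
Proof.
move=> ai; apply: big1 => j _; rewrite /mid ltnS.
case: (ltnP j (a + W)) => ja; last by rewrite andbF muln0.
by rewrite (_ : (i <= j)%N = false) ?muln0//; apply/negbTE; rewrite -ltnNge (leq_trans ja).
Qed.

Lemma degm_mid_le m a W : (a + W <= n.+1)%N -> (degm (mid m a W) <= (a + W) * rl m a)%N.
Proof.
move=> aW.
have E : degm (mid m a W) = \sum_(i < n.+1 | (i < a + W)%N) rl (mid m a W) i.
  rewrite -sum_rl [RHS]big_mkcond; apply: eq_bigr => i _.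
  by case: ltnP => // /rl_mid_over ->.
rewrite E; apply: (@leq_trans (\sum_(i < n.+1 | (i < a + W)%N) rl m a)).
  by apply: leq_sum => i _; exact: rl_mid_le.
rewrite sum_nat_const leq_mul2r; apply/orP; right.
rewrite -sum1_card [leqLHS](_ : _ = \sum_(i < a + W) 1)%N; first by rewrite sum1_card card_ord.
by rewrite (big_ord_widen n.+1 (fun=> 1%N) aW).
Qed.

Lemma wX_ge_mid m a W U : (a + W <= n.+1)%N ->
  (1 - hS (a + W) U) * \sum_(i < n.+1) (rl (mid m a W) i)%:R * hq i U <= wX m U.
Proof.
move=> Hn; rewrite -(sum_columns _ (hq^~ U) (leqnn _)) big_distrr; apply: ler_sum => j _ /=.
have jn := ltn_ord j; rewrite mulrCA -hSE (minn_idPl jn) /mid.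
case: (leqP a j) => [aj|_]; last by rewrite andFb muln0 mul0r mulr_ge0// hX_ge0.
case: (ltnP j (a + W)) => ja /=; last by rewrite muln0 mul0r mulr_ge0// hX_ge0.
rewrite muln1; apply: ler_wpM2l => //.
have := hS_mono U ja; have := hS_ge0 j.+1 U; have := he_ge0 j.+1 U.
by rewrite /hX => e0 s0 s1; have := ler_wpM2r s0 s1; lra.
Qed.

Lemma expR_small (x : R) : 100 * 100 * 100 * 100 * 10 <= x -> expR (- (x / (32 * 100))) <= 5^-1 * x^-1.
Proof.
move=> xB; have x0 : 0 < x by apply: lt_le_trans xB; rewrite !mulr_gt0 ?ltr0n.
have -> : - (x / (32 * 100)) = 2 * - (x / (64 * 100)) by field.
have p : 0 < x / (64 * 100) by rewrite divr_gt0// mulr_gt0.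
rewrite expRM_natl; have := expRN_le_inv p; rewrite invf_div => h.
apply: (@le_trans _ _ ((64 * 100 / x) ^+ 2)).
  by rewrite ler_pXn2r ?nnegrE ?expR_ge0// divr_ge0 ?mulr_ge0// ltW.
have By : 100 * 100 * 100 * 100 * 10 / x <= 1 by rewrite ler_pdivrMr// mul1r.
have i0 : 0 < x^-1 by rewrite invr_gt0.
have := ler_wpM2r (ltW i0) By; generalize x^-1 i0 => y y0; rewrite expr2; lra.
Qed.

(** A nearly sharp gain for columns that are short compared with [n], under rows shorter than
    [n / 1000]. Sharp would be 2 in place of 7/5; after the factor [n / 2] the rate is 7/10 per box,
    which beats the cost of [2/3 ln n] per box in [logdim_narrow]. *)
Lemma gain_columns m a W : 100 * 100 * 100 * 100 * 10 <= nn -> (40 * (a + W) <= N'.+1)%N ->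
  (rl m a)%:R <= nn / (10 * 100) -> lap nu m <= expR (- (7 / 5 * (degm (mid m a W))%:R / nn)).
Proof.
move=> nbig aW la; set H := (a + W)%N in aW *; set K := degm _.
have [K0|K0] := posnP K.
  rewrite K0 mulr0 mul0r oppr0 expR0 -[leRHS](Ex_cst nu).
  apply: Ex_le; [exact: bm_lap|exact: bm_cst|move=> U].
  by rewrite -[leRHS]expR0 ler_expR mulNr oppr_le0 mulr_ge0// wX_ge0.
have Hn : (H <= n.+1)%N by clear - aW; lia.
have f1 := expR_small nbig; have big : 100 <= nn by apply: le_trans nbig; lra.
clear nbig.
have n0 : 0 < nn by rewrite ltr0n.
have N0 : 0 < NN by rewrite ltr0n.
have NE : NN = 2 * nn + 1 by rewrite -natr1 -muln2 natrM mulrC.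
have HN : 40 * H%:R <= NN by rewrite -natrM ler_nat.
have HR0 : 0 <= H%:R :> R by rewrite ler0n.
have K1 : 1 <= K%:R :> R by rewrite ler1n.
have KH : K%:R <= H%:R * (nn / (10 * 100)).
  apply: (@le_trans _ _ (H * rl m a)%:R); first by rewrite ler_nat degm_mid_le.
  by rewrite natrM ler_wpM2l.
pose V U := 1 - hS H (U : G).
have bV : bm V by apply: bmB; [exact: bm_cst|exact: bm_hS].
(* Heights up to [NN / 40] leave [1 - hS] with mean at least 19/20, so falling below 9/10 is
   exponentially rare in [n]. *)
pose v : R := 9 / 10; pose kap : R := NN / 80; pose lam := kap * v.
have v0 : 0 < v by rewrite divr_gt0.
have kap0 : 0 <= kap by rewrite divr_ge0// ltW.
have lam0 : 0 <= lam by rewrite mulr_ge0// ltW.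
have l0 i : 0 <= (rl (mid m a W) i)%:R :> R by rewrite ler0n.
have B := lap_split_weights nuH (leqnn _) v0 l0 (fun U => wX_ge_mid m U Hn) (bm_ge_tail lam v bV) (fun U => expR_ge0 _)
  (fun U => @ge_tail_ge1 _ _ lam v V U lam0 v0).
apply: le_trans B _.
have T1 : Ex nu (ge_tail lam v V) <= expR (- (nn / (16 * 100))).
  rewrite (_ : ge_tail lam v V = fun U => expR lam * expR (- kap * V U)); last first.
    by apply/funext => U; rewrite /ge_tail /lam mulfK ?gt_eqF// -expRD mulNr.
  rewrite ExZ; last by apply: bm_expR; apply: bmM => //; exact: bm_cst.
  apply: le_trans (ler_wpM2l (expR_ge0 _) (complement_exp nuH Hn kap0)) _.
  rewrite -expRD ler_expR; have -> : 2 * kap / NN = 40^-1 by rewrite /kap; field; rewrite gt_eqF.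
  have l40 : 40^-1 * (1 - 40^-1) <= ln (1 + 40^-1) :> R by apply: ln1D_lower; rewrite invr_ge0.
  have H2 : (N'.+1 - H.*2)%:R = NN - 2 * H%:R :> R.
    rewrite natrB; first by rewrite -[in X in _ - X]muln2 natrM mulrC.
    by clear - aW; lia.
  rewrite H2 /lam /kap /v.
  have c0 : 0 <= (NN - 2 * H%:R) / 2 by lra.
  have := ler_wpM2l c0 l40; lra.
have T2 : 17 / 10 * K%:R / nn <= \sum_(i < n.+1) ln (1 + 4 * v * (rl (mid m a W) i)%:R / NN).
  apply: (@le_trans _ _ (\sum_(i < n.+1) (4 * v / NN * (1 - 1 / (5 * 100))) * (rl (mid m a W) i)%:R)).
    rewrite -big_distrr /= -natr_sum sum_rl -/K mulrAC; apply: ler_wpM2r => //.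
    rewrite ler_pdivrMr// mulrAC -mulrA mulrAC ler_pdivlMr// NE /v; lra.
  apply: ler_sum => i _; set l := (rl _ i)%:R.
  have ll : l <= nn / (10 * 100) by apply: le_trans la; rewrite ler_nat rl_mid_le.
  have z0 : 0 <= 4 * v * l / NN by rewrite divr_ge0 ?mulr_ge0// ltW.
  apply: le_trans (ln1D_lower z0); rewrite -[4 * v * l / NN]mulrAC -mulrA [_ * l]mulrC mulrA.
  apply: ler_wpM2l; first by rewrite mulrAC.
  rewrite lerD2l lerN2 mulrAC ler_pdivrMr// /v NE; lra.
apply: le_trans (lerD T1 (_ : _ <= expR (- (17 / 10 * K%:R / nn)))) _; first by rewrite ler_expR lerN2.
have kn : K%:R / nn <= nn / (100 * 100).
  by rewrite ler_pdivrMr//; have := ler_wpM2r (ltW n0) HN; rewrite NE; nra.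
set x := K%:R / nn in kn; have xn : nn^-1 <= x by rewrite /x -[leLHS]mul1r ler_wpM2r// invr_ge0 ltW.
have i0 : 0 < nn^-1 by rewrite invr_gt0.
have i1 : nn^-1 <= 1 by rewrite invf_le1//; lra.
have -> : 17 / 10 * K%:R / nn = 17 / 10 * x by rewrite /x mulrA.
have -> : 7 / 5 * K%:R / nn = 7 / 5 * x by rewrite /x mulrA.
(* The rate 17/10 exceeds 7/5 by 3/10, worth a factor [1 - 1 / (5 nn)] since [x >= 1 / nn]; the
   tail, relative to the target, is at most [1 / (5 nn)]. *)
have e1 : expR (- (nn / (16 * 100))) <= expR (- (7 / 5 * x)) * expR (- (nn / (32 * 100))).
  by rewrite -expRD ler_expR; lra.
have e2 : expR (- (17 / 10 * x)) <= expR (- (7 / 5 * x)) * expR (- (3 / 10 * nn^-1)).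
  by rewrite -expRD ler_expR; move: xn; generalize nn^-1 x => y z yx; lra.
apply: le_trans (lerD e1 e2) _; rewrite -mulrDr -[leRHS]mulr1; apply: ler_wpM2l; first exact: expR_ge0.
have f2 : expR (- (3 / 10 * nn^-1)) <= 1 - 5^-1 * nn^-1.
  have z0 : 0 <= 3 / 10 * nn^-1 by rewrite mulr_ge0// ltW.
  apply: le_trans (expR_quad_le z0) _; move: i0 i1; generalize nn^-1 => y y0 y1; nra.
move: f1 f2; generalize nn^-1 => y; lra.
Qed.

End short_columns.

(** * Estimates of binomial coefficients and of the degrees *)

Section binomial_bounds.
Context {R : realType}.

Lemma ln_fact_lower (r : nat) : r%:R * ln r%:R - r%:R <= ln (r`!)%:R :> R.
Proof.
elim: r => [|r IH]; first by rewrite fact0 ln1 mul0r subr0.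
rewrite factS natrM lnM ?posrE ?ltr0n ?fact_gt0//.
case: r IH => [|r] IH; first by rewrite fact0 ln1 mul1r; lra.
have r0 : 0 < r.+1%:R :> R by rewrite ltr0n.
have : r.+1%:R * (ln r.+2%:R - ln r.+1%:R) <= 1 :> R.
  rewrite -ln_div ?posrE ?ltr0n//; apply: (@le_trans _ _ (r.+1%:R * (r.+2%:R / r.+1%:R - 1))).
    by apply: ler_wpM2l => //; apply: ln_le_subr1; rewrite divr_gt0 ?ltr0n.
  by rewrite mulrBr mulrCA divff ?gt_eqF// mulr1 -[r.+2%:R]natr1; lra.
move: IH; rewrite -[r.+2%:R]natr1; move: (r.+1%:R : R) (ln _) (ln _) (ln _) => x a b c; lra.
Qed.

Lemma ln_bin_le (M r : nat) : (0 < r)%N -> (r <= M)%N ->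
  ln ('C(M, r))%:R <= r%:R * (1 + ln M%:R - ln r%:R) :> R.
Proof.
move=> r0 rM; have M0 : (0 < M)%N by exact: leq_trans r0 rM.
have H : ('C(M, r) * r`! <= M ^ r)%N.
  rewrite bin_ffact; elim: r {r0 rM} => [|r IH]; first by rewrite ffactn0 expn0.
  by rewrite ffactnSr expnSr leq_mul// leq_subr.
have b0 : 0 < ('C(M, r))%:R :> R by rewrite ltr0n bin_gt0.
have : ln ('C(M, r) * r`!)%:R <= ln (M ^ r)%:R :> R.
  by rewrite ler_ln ?posrE ?ltr0n ?muln_gt0 ?bin_gt0 ?rM ?fact_gt0 ?expn_gt0 ?M0// ler_nat.
have -> : ln (M ^ r)%:R = r%:R * ln M%:R :> R by rewrite natrX lnXn ?ltr0n// mulr_natl.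
rewrite natrM lnM ?posrE ?ltr0n ?bin_gt0 ?fact_gt0// => h.
by have := ln_fact_lower r; move: h; lra.
Qed.

(** Tangent inequality for [x ln x] at [a], at the price of the term [a]. *)
Lemma xlnx_lower (x a : R) : 0 <= x -> 0 < a -> x * ln a - a <= x * ln x.
Proof.
move=> x0 a0; have [->|xn] := eqVneq x 0; first by rewrite !mul0r; lra.
have xp : 0 < x by rewrite lt_def xn.
have := ler_wpM2l x0 (ln_le_subr1 (divr_gt0 a0 xp)); rewrite ln_div ?posrE//.
by rewrite mulrBr [X in _ <= X]mulrBr mulrCA divff// !mulr1; lra.
Qed.

Lemma cube_root (k : nat) : exists T : nat, (T ^ 3 <= k)%N /\ (k < T.+1 ^ 3)%N.
Proof.
elim: k => [|k [T [T1 T2]]]; first by exists 0.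
have [h|h] := ltnP k.+1 (T.+1 ^ 3); first by exists T; split => //; exact: leqW.
exists T.+1; split => //; apply: leq_ltn_trans T2 _.
by rewrite ltn_exp2r.
Qed.

Lemma ln2_ge : 2^-1 <= ln 2 :> R.
Proof.
have := ln_le_subr1 (x := 2^-1 : R); rewrite lnV ?posrE//.
by rewrite invr_gt0 => /(_ (ltr0n _ _)); lra.
Qed.

Lemma ln3_le : ln 3 <= 2 :> R.
Proof. by have := ln_le_subr1 (x := 3 : R); move/(_ (ltr0n _ _)); lra. Qed.

End binomial_bounds.

Section dimension_bounds.
Context {R : realType} {n : nat}.
Local Notation N' := (n.+1.*2).
Local Notation G := (SO R N'.+1).
Local Notation nn := (n.+1%:R : R).
Implicit Types (m : 'I_n.+1 -> nat).

Definition tall m (T : nat) : 'I_n.+1 -> nat := fun j => (m j * (T <= j))%N.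
Definition short m (T : nat) : 'I_n.+1 -> nat := fun j => (m j * (j < T))%N.

Definition lnbinN (h : nat) : R := ln ('C(N'.+1, h))%:R.
Definition lnbinl (l : nat) : R := ln ('C(l + N', l))%:R.

(* Half the logarithm of the degree bound: minors for the columns of height above [T], permanents for
   the rows of what remains. *)
Definition logdim m T : R := \sum_(j < n.+1) (tall m T j)%:R * lnbinN j.+1 + \sum_(i < n.+1) lnbinl (rl (short m T) i).

Lemma phi_logdim (nu : probability G R) m T : is_haar nu ->
  exists (J : finType) (B : J -> G -> R), [/\ birep B, jspan B (phi nu m) & ln #|J|%:R = 2 * logdim m T].
Proof.
move=> nuH.
have tm i : (tall m T i <= m i)%N by rewrite /tall; case: (T <= i)%N; rewrite ?muln1 ?muln0.
have [J [B [bB jB cJ]]] := @phi_dim R n.+1 nu m (tall m T) tm.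
exists J, B; split => //; rewrite cJ.
have ex (I : finType) (F : I -> nat) : (forall i, (0 < F i)%N) -> ln (\prod_i F i)%N%:R = \sum_i ln (F i)%:R :> R.
  move=> F0; rewrite natr_prod; elim: (index_enum I) => [|i r IH]; first by rewrite !big_nil ln1.
  rewrite !big_cons lnM ?IH ?posrE ?ltr0n// -natr_prod ltr0n; apply: prodn_gt0 => j; exact: F0.
have mS : (fun j => m j - tall m T j)%N = short m T.
  apply/funext => j; rewrite /tall /short leqNgt; case: (j < T)%N; rewrite ?muln1 ?muln0 ?subn0//.
  by rewrite subnn.
have b0 i : (0 < 'C(N'.+1, (i : 'I_n.+1).+1))%N by rewrite bin_gt0; have := ltn_ord i; lia.
have c0 l : (0 < 'C(l + N', l))%N by rewrite bin_gt0 leq_addr.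
rewrite natrM lnM; first last.
- by rewrite posrE ltr0n; apply: prodn_gt0 => i; rewrite expn_gt0 c0.
- by rewrite posrE ltr0n; apply: prodn_gt0 => i; rewrite expn_gt0 b0.
rewrite ex => [|i]; last by rewrite expn_gt0 b0.
rewrite ex => [|i]; last by rewrite expn_gt0 c0.
rewrite /logdim mulrDr !big_distrr /=; congr (_ + _); apply: eq_bigr => i _.
  by rewrite natrX lnXn ?ltr0n// -[LHS]mulr_natl natrM mulrA.
by rewrite natrX lnXn ?ltr0n// -[LHS]mulr_natl mS.
Qed.

Lemma lnbinN_le h : (0 < h)%N -> (h <= n.+1)%N -> lnbinN h <= h%:R * (ln nn + 3 - ln h%:R).
Proof.
move=> h0 hn; have hN : (h <= N'.+1)%N by lia.
apply: le_trans (ln_bin_le h0 hN) _; apply: ler_wpM2l => //.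
have : ln N'.+1%:R <= ln (3 * nn).
  rewrite ler_ln ?posrE ?mulr_gt0 ?ltr0n// -natrM ler_nat; lia.
by rewrite lnM ?posrE ?ltr0n//; have := ln3_le (R := R); lra.
Qed.

Lemma lnbinl0 : lnbinl 0 = 0. Proof. by rewrite /lnbinl bin0 ln1. Qed.

Lemma lnbinl_small l : (l <= n.+1)%N -> lnbinl l <= l%:R * (ln nn + 3) - l%:R * ln l%:R.
Proof.
case: l => [|l] ln_; first by rewrite lnbinl0 !mul0r subr0.
have h : (l.+1 <= l.+1 + N')%N by rewrite leq_addr.
apply: le_trans (ln_bin_le (ltn0Sn l) h) _; rewrite -mulrBr; apply: ler_wpM2l => //.
have : ln (l.+1 + N')%:R <= ln (3 * nn).
  rewrite ler_ln ?posrE ?mulr_gt0 ?ltr0n// -natrM ler_nat; lia.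
by rewrite lnM ?posrE ?ltr0n//; have := ln3_le (R := R); lra.
Qed.

(** For long rows the binomial is read as a choice of [N'] out of [l + N'], so the length enters
    through its logarithm, as in [Gam]. *)
Lemma lnbinl_large l : lnbinl l <= 2 * nn * (1 + ln (1 + l%:R / nn)).
Proof.
have n0 : 0 < nn by rewrite ltr0n.
have N'E : N'%:R = 2 * nn :> R by rewrite -muln2 natrM mulrC.
have h : (N' <= l + N')%N by rewrite leq_addl.
rewrite /lnbinl -bin_sub ?leq_addr// addKn.
apply: le_trans (ln_bin_le _ h) _ => //; rewrite N'E; apply: ler_wpM2l; first by rewrite mulr_ge0// ltW.
rewrite -addrA lerD2l -ln_div ?posrE ?mulr_gt0 ?ltr0n ?addn_gt0 ?orbT//.
rewrite natrD N'E ler_ln ?posrE; first last.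
- by rewrite ltr_pwDl// divr_ge0// ltW.
- by rewrite divr_gt0 ?mulr_gt0// ltr_wpDl// mulr_gt0.
rewrite mulrDl divff ?mulf_neq0 ?gt_eqF// addrC lerD2l; apply: ler_wpM2l => //.
by rewrite lef_pV2 ?posrE ?mulr_gt0//; lra.
Qed.

Lemma degm_split m T : (degm (short m T) + degm (tall m T) = degm m)%N.
Proof.
rewrite /degm -big_split; apply: eq_bigr => j _ /=; rewrite /short /tall [(T <= j)%N]leqNgt.
by case: (j < T)%N; rewrite ?muln1 ?muln0 ?mul0n ?addn0.
Qed.

Lemma rl_short_over m T i : (T <= i)%N -> rl (short m T) i = 0.
Proof.
move=> Ti; apply: big1 => j _; rewrite /short ltnS.
case: (ltnP j T) => jT; last by rewrite muln0.
by rewrite (_ : (i <= j)%N = false) ?muln0//; apply/negbTE; rewrite -ltnNge (leq_trans jT).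
Qed.

Lemma rl_le_degm m i : (rl m i <= degm m)%N.
Proof. by apply: leq_sum => j _; rewrite leq_mul2l; case: (_ < _)%N; rewrite ?orbT. Qed.

Lemma sum_rl_short (F : nat -> R) m T : F 0%N = 0 ->
  \sum_(i < n.+1) F (rl (short m T) i) = \sum_(i < n.+1 | (i < T)%N) F (rl (short m T) i).
Proof.
move=> F0; rewrite [RHS]big_mkcond; apply: eq_bigr => i _.
by case: ltnP => // /rl_short_over ->.
Qed.

Lemma card_below T : \sum_(i < n.+1 | (i < T)%N) (1 : R) <= T%:R.
Proof.
rewrite sumr_const ler_nat -sum1_card.
have [h|h] := leqP T n.+1.
  by rewrite -(big_ord_widen n.+1 (fun=> 1%N) h) sum1_card card_ord.
apply: leq_trans (ltnW h); rewrite -[leqRHS](card_ord n.+1) sum1_card; exact: max_card.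
Qed.

(* A height above the cube root of [a] makes [ln 'C(N, h)] lose a third of its logarithm, and at most a
   cube root of [a] rows of length [l] lose two thirds of it by [x ln x >= x ln b - b], [b = a^(2/3)]. *)
Lemma logdim_small m : (0 < degm m)%N -> (degm m <= n.+1)%N ->
  exists T, logdim m T <= (degm m)%:R * (ln nn + 4 - 3^-1 * ln (degm m)%:R).
Proof.
set k := degm m => k0 kn; have [T [T1 T2]] := cube_root k; exists T.
have kR : 0 < k%:R :> R by rewrite ltr0n.
have lk : 0 <= ln k%:R :> R by rewrite ln_ge0// ler1n.
have tallB : \sum_(j < n.+1) (tall m T j)%:R * lnbinN j.+1 <= (degm (tall m T))%:R * (ln nn + 3 - 3^-1 * ln k%:R).
  rewrite /degm natr_sum big_distrl; apply: ler_sum => j _ /=; rewrite natrM -mulrA.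
  have [Tj|jT] := leqP T j; last by rewrite /tall leqNgt jT muln0 !mul0r.
  apply: ler_wpM2l => //; apply: le_trans (lnbinN_le (ltn0Sn j) (ltn_ord j)) _.
  apply: ler_wpM2l => //; rewrite lerD2l lerN2.
  have : ln k%:R <= ln (j.+1%:R ^+ 3) :> R.
    rewrite ler_ln ?posrE ?exprn_gt0 ?ltr0n// -natrX ler_nat (leq_trans (ltnW T2))//.
    by rewrite leq_exp2r.
  by rewrite lnXn ?ltr0n// -mulr_natl; lra.
pose b : R := expR (2 / 3 * ln k%:R).
have b0 : 0 < b by exact: expR_gt0.
have Tb : T%:R * b <= k%:R.
  case: (posnP T) => [->|Tp]; first by rewrite mul0r.
  have : ln (T%:R ^+ 3) <= ln k%:R :> R by rewrite ler_ln ?posrE ?exprn_gt0 ?ltr0n// -natrX ler_nat.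
  have -> : ln (T%:R ^+ 3) = 3 * ln T%:R :> R by rewrite lnXn ?ltr0n// mulr_natl.
  move=> h; have -> : T%:R * b = expR (ln T%:R + 2 / 3 * ln k%:R) by rewrite expRD lnK ?posrE ?ltr0n.
  rewrite -[leRHS]lnK ?posrE// ler_expR; lra.
have dE : \sum_(i < n.+1 | (i < T)%N) (rl (short m T) i)%:R = (degm (short m T))%:R :> R.
  by rewrite -[in RHS]sum_rl natr_sum (sum_rl_short (F := fun l => l%:R)).
have shortB : \sum_(i < n.+1) lnbinl (rl (short m T) i) <= (degm (short m T))%:R * (ln nn + 3 - 2 / 3 * ln k%:R) + k%:R.
  rewrite (sum_rl_short _ _ lnbinl0).
  apply: (@le_trans _ _ (\sum_(i < n.+1 | (i < T)%N) ((rl (short m T) i)%:R * (ln nn + 3 - 2 / 3 * ln k%:R) + b * 1))).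
    apply: ler_sum => i _; set l := rl _ _.
    have ll : (l <= n.+1)%N.
      apply: leq_trans kn; apply: leq_trans (rl_le_degm _ _) _.
      by rewrite /k -(degm_split m T) leq_addr.
    apply: le_trans (lnbinl_small ll) _.
    have := xlnx_lower (ler0n R l) b0; rewrite expRK; lra.
  rewrite big_split /= -big_distrl -big_distrr /=; apply: lerD.
    by rewrite dE.
  by rewrite mulrC; apply: le_trans Tb; rewrite ler_wpM2r ?card_below// ltW.
rewrite /logdim; apply: le_trans (lerD tallB shortB) _.
have : k%:R = (degm (short m T))%:R + (degm (tall m T))%:R :> R by rewrite -natrD degm_split.
have s0 : 0 <= (degm (short m T))%:R :> R by rewrite ler0n.
move: (degm (short m T))%:R (degm (tall m T))%:R s0 => s t s0 E.
have := mulr_ge0 s0 lk; rewrite E; nra.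
Qed.

(** Here [x] is the rank, [y] the degree divided by the rank, and [2 x + 1] the dimension; the loss
    13/2 allows for replacing [NN] by twice the rank. *)
Lemma star_aux (x y : R) : 0 <= x -> 1 <= y * x -> 0 < y -> y <= 20^-1 ->
  (1 - 13 / 2 * y) * (2 * x + 1) ^+ 2 <= (2 * (2 * x + 1) - 24 * (y * x)) * x.
Proof. by move=> x0 yx y0 y1; have := ler_wpM2r x0 yx; nra. Qed.

(** The gain loses a factor [1 - 13/2 r], with [r = k / nn], which would cost a multiple of
    [r ln nn] per box. The saving of a third of [ln k] in [logdim_small] pays for it. *)
Lemma star_small (nu : probability G R) m : is_haar nu -> (0 < degm m)%N -> 20 * (degm m)%:R <= nn ->
  exists T, logdim m T <= (ln nn + 16) * (nn / 2 * - ln (lap nu m)).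
Proof.
move=> nuH k0 kn; set k := degm m in k0 kn *.
have n0 : 0 < nn by rewrite ltr0n.
have kR : 1 <= k%:R :> R by rewrite ler1n.
have kn' : (k <= n.+1)%N by rewrite -(ler_nat R); lra.
have [T HT] := logdim_small k0 kn'; exists T; apply: le_trans HT _; rewrite -/k.
set r := k%:R / nn; have r0 : 0 < r by rewrite divr_gt0// (lt_le_trans _ kR).
have r1 : r <= 20^-1 by rewrite ler_pdivrMr//; lra.
have lnn : ln nn = ln k%:R - ln r by rewrite /r ln_div ?posrE//; [lra|lra].
have lk : 0 <= ln k%:R :> R by rewrite ln_ge0.
have rl1 : - r * ln r <= 1.
  have p : 0 < r^-1 by rewrite invr_gt0.
  have := ler_wpM2l (ltW r0) (ln_le_subr1 p); rewrite lnV ?posrE// mulrBr divff ?gt_eqF//; lra.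
have lr : ln r <= 0 by rewrite ln_le0//; lra.
have g : k%:R * (1 - 13 / 2 * r) <= nn / 2 * - ln (lap nu m).
  have := lap_small nuH m; rewrite -/k -[leLHS](lnK (x := lap nu m)) ?posrE ?lap_gt0//.
  rewrite ler_expR => h.
  have N0 : 0 < N'.+1%:R :> R by rewrite ltr0n.
  have NE : N'.+1%:R = 2 * nn + 1 by rewrite -natr1 -muln2 natrM mulrC.
  apply: (@le_trans _ _ (nn / 2 * (4 * k%:R / N'.+1%:R - 48 * (k%:R / N'.+1%:R) ^+ 2))); last first.
    by apply: ler_wpM2l; [rewrite divr_ge0// ltW|rewrite lerNr].
  have -> : nn / 2 * (4 * k%:R / N'.+1%:R - 48 * (k%:R / N'.+1%:R) ^+ 2) =
     (k%:R * nn) * (2 * N'.+1%:R - 24 * k%:R) / N'.+1%:R ^+ 2 by field; rewrite gt_eqF.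
  rewrite ler_pdivlMr ?exprn_gt0//.
  have -> : k%:R * (1 - 13 / 2 * r) * N'.+1%:R ^+ 2 = k%:R * nn * ((1 - 13 / 2 * r) * N'.+1%:R ^+ 2 / nn) by field; rewrite gt_eqF.
  apply: ler_wpM2l; first by rewrite mulr_ge0//; lra.
  rewrite ler_pdivrMr// NE; have kE : k%:R = r * nn by rewrite /r divfK ?gt_eqF.
  rewrite kE; have rn : 1 <= r * nn by rewrite -kE.
  have : 0 <= nn by exact: ltW.
  by move=> x0; exact: star_aux.
have g' : 0 <= 1 - 13 / 2 * r by lra.
apply: le_trans (ler_wpM2l _ g); last by rewrite addr_ge0// ln_ge0// ler1n.
rewrite mulrCA; apply: ler_wpM2l; first by lra.
(* With [ln nn = ln k - ln r] the loss is at most [13/40 ln k] plus [13/2 * r ln (1/r)]: 13/40 is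
   below 1/3, and [r ln (1/r) <= 1]. The remaining constants determine 16. *)
rewrite lnn; set a := ln k%:R in lk *; set l := ln r in rl1 lr *.
have := mulr_ge0 lk (ltW r0); nra.
Qed.

End dimension_bounds.

Section large_representations.
Context {R : realType} {n : nat}.
Local Notation N' := (n.+1.*2).
Local Notation G := (SO R N'.+1).
Local Notation nn := (n.+1%:R : R).
Implicit Types (m : 'I_n.+1 -> nat).

Lemma rl_tall_le m a i : (rl (tall m a) i <= rl m (maxn a i))%N.
Proof.
apply: leq_sum => j _; rewrite /tall -mulnA leq_mul2l !ltnS geq_max; apply/orP; right.
by case: (a <= j)%N; case: (i <= j)%N.
Qed.

(** On rows of length at most [nn] the logarithm in [Gam] is linear up to a factor 2, by concavity
    and [ln 2 >= 1/2]. *)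
Lemma degm_tall_le m a : (rl m a)%:R <= nn -> (degm (tall m a))%:R <= 2 * (nn * Gam m).
Proof.
move=> la; have n0 : 0 < nn by rewrite ltr0n.
rewrite -sum_rl natr_sum /Gam mulrA big_distrr /=; apply: ler_sum => i _.
set x := (rl (tall m a) i)%:R; have x0 : 0 <= x / nn by rewrite divr_ge0.
have xl : x / nn <= rlR m i.
  rewrite ler_pM2r ?invr_gt0// ler_nat; apply: leq_trans (rl_tall_le m a i) _.
  by rewrite rl_mono// leq_maxr.
have x1 : x / nn <= 1.
  rewrite ler_pdivrMr// mul1r; apply: le_trans la; rewrite ler_nat; apply: leq_trans (rl_tall_le m a i) _.
  by rewrite rl_mono// leq_maxl.
have := ln_concave x0 x1 (@ler01 R); rewrite mulr1 => h1.
have h2 : ln (1 + x / nn) <= ln (1 + rlR m i).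
  by rewrite ler_ln ?posrE ?lerD2l// ltr_pwDl// (le_trans x0).
have l2 := ln2_ge (R := R); have h3 := ler_wpM2l x0 l2.
have : x / nn <= 2 * ln (1 + rlR m i) by move: h1 h2 h3; rewrite -[1 + 1]/(2 : R); generalize (x / nn) => y; lra.
by rewrite ler_pdivrMr//; rewrite mulrAC.
Qed.

Lemma rows_le m (a : nat) (T : nat) : (a <= n.+1)%N ->
  \sum_(i < n.+1 | (i < a)%N) (@lnbinl R n) (rl (short m T) i) <= 2 * nn * a%:R + 2 * (nn * Gam m).
Proof.
move=> an; have n0 : 0 < nn by rewrite ltr0n.
apply: (@le_trans _ _ (\sum_(i < n.+1 | (i < a)%N) (2 * nn * 1 + 2 * nn * ln (1 + rlR m i)))).
  apply: ler_sum => i _; apply: le_trans (lnbinl_large _) _; rewrite mulrDr lerD2l.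
  apply: ler_wpM2l; first by rewrite mulr_ge0// ltW.
  rewrite ler_ln ?posrE ?ltr_pwDl// ?divr_ge0// lerD2l ler_pM2r ?invr_gt0// ler_nat.
  by apply: leq_sum => j _; rewrite /short -mulnA leq_mul2l; case: (j < T)%N; rewrite ?mul1n ?leqnn ?orbT.
rewrite big_split /= -!big_distrr /=; apply: lerD.
  by rewrite ler_pM2l ?mulr_gt0// card_below.
rewrite -mulrA ler_pM2l// ler_pM2l// /Gam [leRHS](bigID (fun i : 'I_n.+1 => (i < a)%N)) /= lerDl.
by apply: sumr_ge0 => i _; apply: ln_sum1_ge0; rewrite divr_ge0.
Qed.

Lemma logdim_low_dimension m : logdim m n.+1 <= 2 * nn * nn + 2 * (nn * Gam m) :> R.
Proof.
rewrite /logdim big1 ?add0r => [|j _]; last by rewrite /tall leqNgt ltn_ord muln0 mul0r.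
apply: le_trans (rows_le m n.+1 (leqnn _)); rewrite le_eqVlt; apply/orP; left; apply/eqP.
by apply: eq_bigl => i; rewrite ltn_ord.
Qed.

(** Tall columns have height above [e nn], so a box in a minor costs the constant [3 - ln e] in
    place of [ln nn]. *)
Lemma logdim_wide m (a : nat) (e : R) : 0 < e -> (a <= n.+1)%N -> e * nn <= a%:R -> (rl m a)%:R <= nn ->
  logdim m a <= 2 * nn * a%:R + 2 * (nn * Gam m) + (3 - ln e) * (2 * (nn * Gam m)).
Proof.
move=> e0 an ea la; have n0 : 0 < nn by rewrite ltr0n.
rewrite /logdim addrC; apply: lerD.
  by rewrite (sum_rl_short _ _ lnbinl0); exact: rows_le.
have e1 : e <= 1.
  by rewrite -(ler_pM2r n0) mul1r (le_trans ea)// ler_nat.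
have le0 : ln e <= 0 by rewrite ln_le0.
have c0 : 0 <= 3 - ln e by lra.
apply: le_trans (ler_wpM2l c0 (degm_tall_le la)).
rewrite /degm natr_sum big_distrr /=; apply: ler_sum => j _; rewrite natrM [leRHS]mulrC -mulrA.
have [aj|ja] := leqP a j; last by rewrite /tall leqNgt ja muln0 !mul0r.
apply: ler_wpM2l => //; apply: le_trans (lnbinN_le (ltn0Sn j) (ltn_ord j)) _.
apply: ler_wpM2l => //.
have : ln (e * nn) <= ln j.+1%:R :> R.
  rewrite ler_ln ?posrE ?mulr_gt0 ?ltr0n//; apply: le_trans ea _; rewrite ler_nat; exact: leqW.
by rewrite lnM ?posrE//; lra.
Qed.

(* The columns of height in (a, a + W] pay two thirds of [ln n] per box, all others a constant. *)
Lemma logdim_narrow m (a Q W : nat) : (a + Q <= n.+1)%N -> (Q <= W)%N -> (Q ^ 3 <= n.+1)%N -> (n.+1 < Q.+1 ^ 3)%N ->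
  (rl m a)%:R <= nn -> (0 < W)%N -> (W <= n.+1)%N ->
  logdim m (a + Q) <= 2 / 3 * ln nn * (degm (mid m a W))%:R + 2 * nn * a%:R + 2 * (nn * Gam m) + nn +
     (6 + ln nn - ln W%:R) * (2 * (nn * Gam m)).
Proof.
move=> aQ QW Q1 Q2 la W0 Wn; have n0 : 0 < nn by rewrite ltr0n.
have ln0 : 0 <= ln nn by rewrite ln_ge0// ler1n.
set T := (a + Q)%N; pose cW := ln nn - ln W%:R : R.
have cW0 : 0 <= cW by rewrite subr_ge0 ler_ln ?posrE ?ltr0n// ler_nat.
pose P j := (j.+1)%:R : R.
pose k1 : R := \sum_(j < n.+1 | (j < T)%N) (mid m a W j)%:R * P j.
pose k2 : R := \sum_(j < n.+1 | (T <= j)%N) (mid m a W j)%:R * P j.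
pose k3 : R := \sum_(j < n.+1 | (T <= j)%N) (tall m a j)%:R * P j.
have kK : k1 + k2 = (degm (mid m a W))%:R.
  by rewrite /degm natr_sum [RHS](bigID (fun j : 'I_n.+1 => (j < T)%N)) /=; congr (_ + _);
    [apply: eq_bigr => j _; rewrite natrM|apply: eq_big => [j|j _]; [rewrite -leqNgt|rewrite natrM]].
pose A : R := (degm (tall m a))%:R.
have A0 : 0 <= A by rewrite ler0n.
have AG : A <= 2 * (nn * Gam m) by exact: degm_tall_le.
have AE : A = \sum_(j < n.+1) (tall m a j)%:R * P j.
  by rewrite /A /degm natr_sum; apply: eq_bigr => j _; rewrite natrM.
have tP j : 0 <= (tall m a j)%:R * P j by rewrite mulr_ge0.
have mP j : 0 <= (mid m a W j)%:R * P j by rewrite mulr_ge0.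
have mt j : (mid m a W j)%:R * P j <= (tall m a j)%:R * P j.
  apply: ler_wpM2r => //; rewrite ler_nat /mid /tall leq_mul2l; apply/orP; right.
  by case: (a <= j)%N => //=; case: (j < a + W)%N.
have k3A : k3 <= A.
  rewrite AE [leRHS](bigID (fun j : 'I_n.+1 => (T <= j)%N)) /= lerDl.
  by apply: sumr_ge0 => j _.
have k1A : k1 <= A.
  rewrite AE [leRHS](bigID (fun j : 'I_n.+1 => (j < T)%N)) /= -[leLHS]addr0; apply: lerD.
    by apply: ler_sum => j _.
  by apply: sumr_ge0 => j _.
have lQ j : (T <= j)%N -> 3^-1 * ln nn <= ln (P j).
  move=> Tj; have : ln nn <= ln (P j ^+ 3).
    rewrite ler_ln ?posrE ?exprn_gt0 ?ltr0n// -natrX ler_nat (leq_trans (ltnW Q2))// leq_exp2r// ltnS.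
    by apply: leq_trans Tj; exact: leq_addl.
  have -> : ln (P j ^+ 3) = 3 * ln (P j) by rewrite lnXn ?ltr0n// mulr_natl.
  by lra.
have tallB : \sum_(j < n.+1) (tall m T j)%:R * (@lnbinN R n) j.+1 <= 2 / 3 * ln nn * k2 + (3 + cW) * k3.
  have -> : \sum_(j < n.+1) (tall m T j)%:R * (@lnbinN R n) j.+1 = \sum_(j < n.+1 | (T <= j)%N) (m j)%:R * (@lnbinN R n) j.+1.
    rewrite [RHS]big_mkcond; apply: eq_bigr => j _; rewrite /tall.
    by case: (T <= j)%N; rewrite ?muln1 ?muln0 ?mul0r.
  rewrite /k2 /k3 [2 / 3 * ln nn * _]big_distrr [(3 + cW) * _]big_distrr -big_split /=.
  apply: ler_sum => j Tj; have aj : (a <= j)%N by apply: leq_trans Tj; exact: leq_addr.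
  rewrite /tall aj muln1 /mid aj /=.
  apply: (@le_trans _ _ ((m j)%:R * (P j * (ln nn + 3 - ln (P j))))).
    by apply: ler_wpM2l => //; exact: lnbinN_le.
  have l3 := lQ j Tj; have mPj : 0 <= (m j)%:R * P j by rewrite mulr_ge0.
  case: (ltnP j (a + W)) => jW; rewrite ?muln1 ?muln0 ?mul0r ?mulr0 ?add0r.
    have : ln nn + 3 - ln (P j) <= 2 / 3 * ln nn + (3 + cW) by lra.
    by move/(ler_wpM2l mPj); lra.
  have : ln nn + 3 - ln (P j) <= 3 + cW.
    have : ln W%:R <= ln (P j).
      rewrite ler_ln ?posrE ?ltr0n// ler_nat; apply: leqW; apply: leq_trans jW; exact: leq_addl.
    by rewrite /cW; lra.
  by move/(ler_wpM2l mPj); lra.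
pose b : R := expR (2 / 3 * ln nn).
have b0 : 0 < b by exact: expR_gt0.
have Qb : Q%:R * b <= nn.
  case: (posnP Q) => [->|Qp]; first by rewrite mul0r ltW.
  have : ln (Q%:R ^+ 3) <= ln nn by rewrite ler_ln ?posrE ?exprn_gt0 ?ltr0n// -natrX ler_nat.
  have -> : ln (Q%:R ^+ 3) = 3 * ln Q%:R :> R by rewrite lnXn ?ltr0n// mulr_natl.
  move=> h; have -> : Q%:R * b = expR (ln Q%:R + 2 / 3 * ln nn) by rewrite expRD lnK ?posrE ?ltr0n.
  rewrite -[leRHS]lnK ?posrE// ler_expR; lra.
have shortB : \sum_(i < n.+1) (@lnbinl R n) (rl (short m T) i) <= 2 * nn * a%:R + 2 * (nn * Gam m) + (3^-1 * ln nn + 3) * k1 + nn.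
  rewrite (bigID (fun i : 'I_n.+1 => (i < a)%N)) /= -[leRHS]addrA; apply: lerD.
    by apply: rows_le; apply: leq_trans aQ; exact: leq_addr.
  apply: (@le_trans _ _ (\sum_(i < n.+1 | (a <= i < T)%N) ((rl (short m T) i)%:R * (3^-1 * ln nn + 3) + b * 1))).
    rewrite (eq_bigl (fun i : 'I_n.+1 => (a <= i)%N)) => [|i]; last by rewrite -leqNgt.
    rewrite [leRHS]big_mkcondr /=; apply: ler_sum => i ai.
    case: ltnP => [iT|Ti]; last by rewrite (rl_short_over m Ti) lnbinl0.
    set l := rl _ _; have ll : (l <= n.+1)%N.
      rewrite -(ler_nat R); apply: le_trans la; rewrite ler_nat; apply: leq_trans (rl_mono m ai).
      by apply: leq_sum => j _; rewrite /short -mulnA leq_mul2l; case: (j < T)%N; rewrite ?mul1n ?leqnn ?orbT.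
    apply: le_trans (lnbinl_small ll) _.
    have := xlnx_lower (ler0n R l) b0; rewrite expRK; lra.
  rewrite big_split /= -big_distrl -big_distrr /=; apply: lerD.
    rewrite mulrC; apply: ler_wpM2l; first by rewrite addr_ge0// mulr_ge0.
    rewrite /k1 -natr_sum [leRHS](_ : _ = (\sum_(j < n.+1 | (j < T)%N) mid m a W j * j.+1)%N%:R); last first.
      by rewrite natr_sum; apply: eq_bigr => j _; rewrite natrM.
    rewrite ler_nat (eq_bigr (fun i : 'I_n.+1 => rl (mid m a Q) i)) => [|i /andP[ai iT]]; last first.
      apply: eq_bigr => j _; rewrite /short /mid ltnS -!mulnA; congr (_ * _)%N.
      case: (leqP i j) => ij; last by rewrite !muln0.
      by rewrite (leq_trans ai ij).
    apply: (@leq_trans (\sum_(i < n.+1) rl (mid m a Q) i)).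
      by rewrite [leqRHS](bigID (fun i : 'I_n.+1 => (a <= i < T)%N)) /= leq_addr.
    rewrite sum_rl /degm [leqRHS]big_mkcond; apply: leq_sum => j _; rewrite /mid -/T.
    case: (ltnP j T) => jT; last by rewrite andbF muln0.
    by rewrite (leq_trans jT) ?leq_add2l// andbT.
  apply: le_trans Qb; rewrite mulrC; apply: ler_wpM2r; first exact: ltW.
  have <- : \sum_(a <= i < T) (1 : R) = Q%:R by rewrite sumr_const_nat /T addKn.
  rewrite -(big_mkord (fun i => a <= i < T)%N (fun=> 1 : R)).
  rewrite (big_nat_widenl a 0 T predT (fun=> 1 : R) (leq0n _)) (big_nat_widen 0 T n.+1 _ _ aQ).
  by rewrite le_eqVlt; apply/orP; left; apply/eqP; apply: eq_bigl => i.
rewrite /logdim; apply: le_trans (lerD tallB shortB) _.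
have k10 : 0 <= k1 by apply: sumr_ge0 => j _.
have k30 : 0 <= k3 by apply: sumr_ge0 => j _.
have G0 : 0 <= 2 * (nn * Gam m) by exact: le_trans A0 AG.
rewrite -kK -[6 + ln nn - _]addrA -/cW.
have h1 : (3 + cW) * k3 <= (3 + cW) * (2 * (nn * Gam m)) by apply: ler_wpM2l; [lra|exact: le_trans k3A AG].
have h2 : 3 * k1 <= 3 * (2 * (nn * Gam m)) by apply: ler_wpM2l => //; exact: le_trans k1A AG.
have h3 := mulr_ge0 ln0 k10.
move: h1 h2 h3; move: (2 * (nn * Gam m)) (2 * nn * a%:R) => g q; lra.
Qed.

End large_representations.

Section star.
Context {R : realType}.
Local Notation G n := (SO R n.+1.*2.+1).

(** Bounds the number of long rows by [Gam m], each contributing at least [ln (1 + e)]. *)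
Lemma rows_above n (m : 'I_n.+1 -> nat) (a : nat) (e : R) : 0 < e ->
  (forall i, (i < a)%N -> e * n.+1%:R < (rl m i)%:R) -> a%:R * ln (1 + e) <= Gam m.
Proof.
move=> e0 h; have n0 : 0 < n.+1%:R :> R by rewrite ltr0n.
have an : (a <= n.+1)%N.
  rewrite leqNgt; apply/negP => /h; rewrite rl_over// => /ltW; apply/negP; rewrite -ltNge.
  exact: mulr_gt0.
rewrite /Gam [leRHS](bigID (fun i : 'I_n.+1 => (i < a)%N)) /= -[leLHS]addr0; apply: lerD; last first.
  by apply: sumr_ge0 => i _; apply: ln_sum1_ge0; rewrite divr_ge0.
apply: (@le_trans _ _ (\sum_(i < n.+1 | (i < a)%N) ln (1 + e))); last first.
  apply: ler_sum => i ia; rewrite ler_ln ?posrE; [|lra|by rewrite ltr_pwDl// divr_ge0].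
  by rewrite lerD2l ler_pdivlMr// ltW// h.
by rewrite -(big_ord_widen n.+1 (fun=> ln (1 + e)) an) sumr_const card_ord -[leRHS]mulr_natl.
Qed.

(** Four cases: few boxes; bounded dimension; so many long rows that all remaining columns are tall;
    or few long rows. Only the first and the last pay a multiple of [ln n], and there the gain is
    known sharply enough. All other costs are multiples of [n * Gam m], collected in [c] and
    converted by [gain_lower]. *)
Lemma star : exists2 C : R, 0 <= C & forall n (nu : probability (G n) R) m, is_haar nu -> (exists i, m i <> 0) ->
  exists T, logdim m T <= (ln n.+1%:R + C) * (n.+1%:R / 2 * - ln (lap nu m)).
Proof.
have [eta eta0 Heta] := gain_lower (R := R).
pose B : R := 100 * 100 * 100 * 100 * 10.
have B0 : 0 < B by rewrite /B !mulr_gt0 ?ltr0n.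
pose e : R := (10 * 100)^-1.
have e0 : 0 < e by rewrite invr_gt0 mulr_gt0 ?ltr0n.
pose g0 : R := ln (1 + 20^-1); have g00 : 0 < g0 by rewrite ln_gt0// ltrDl invr_gt0.
pose g1 : R := ln (1 + e); have g10 : 0 < g1 by rewrite ln_gt0// ltrDl.
have e1 : e <= 2^-1 by rewrite lef_pV2 ?posrE ?mulr_gt0 ?ltr0n//; lra.
have le0 : ln e <= 0 by rewrite ln_le0//; lra.
have le2 : ln (e / 2) <= 0 by rewrite ln_le0//; lra.
have a3 : 0 <= (3 - ln e) * 2 by rewrite mulr_ge0// subr_ge0 (le_trans le0).
have a6 : 0 <= (6 - ln (e / 2)) * 2 by rewrite mulr_ge0// subr_ge0 (le_trans le2).
have g0E : g0 = ln (1 + 20^-1) by [].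
have g1E : g1 = ln (1 + e) by [].
pose c : R := 2 * B / g0 + 2 / g1 + 2 + g0^-1 + (3 - ln e) * 2 + (6 - ln (e / 2)) * 2.
have cB : 0 <= 2 * B / g0 by rewrite divr_ge0 ?mulr_ge0// ltW.
have cg1 : 0 <= 2 / g1 by rewrite divr_ge0// ltW.
have cg0 : 0 <= g0^-1 by rewrite invr_ge0 ltW.
have c0 : 0 <= c by rewrite /c; lra.
have cE Gm : c * Gm = 2 * B / g0 * Gm + 2 / g1 * Gm + 2 * Gm + g0^-1 * Gm + (3 - ln e) * 2 * Gm + (6 - ln (e / 2)) * 2 * Gm.
  by rewrite /c; ring.
have BE : B = 100 * 100 * 100 * 100 * 10 by [].
have eE : e = (10 * 100)^-1 by [].
clearbody c g0 g1 B e.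
exists (16 + 2 * c / eta).
  by rewrite addr_ge0// divr_ge0 ?(ltW eta0)// mulr_ge0.
move=> n nu m nuH mi; set nn : R := n.+1%:R; set g := nn / 2 * - ln (lap nu m).
have n0 : 0 < nn by rewrite ltr0n.
have lnn : 0 <= ln nn by rewrite ln_ge0// ler1n.
set Gm := nn * Gam m; have Gm0 : 0 <= Gm by rewrite mulr_ge0 ?Gam_ge0// ltW.
have lb : eta * Gam m <= - ln (lap nu m).
  have := Heta n nu m nuH mi; rewrite -[leLHS](lnK (x := lap nu m)) ?posrE ?lap_gt0// ler_expR; lra.
have gG : eta / 2 * Gm <= g.
  have -> : eta / 2 * Gm = nn / 2 * (eta * Gam m) by rewrite /Gm; ring.
  by apply: ler_wpM2l => //; rewrite divr_ge0// ltW.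
have g_ge0 : 0 <= g by apply: le_trans gG; rewrite mulr_ge0 ?divr_ge0// ltW.
have cg : c * Gm <= 2 * c / eta * g.
  have -> : c * Gm = 2 * c / eta * (eta / 2 * Gm) by field; rewrite gt_eqF.
  by apply: ler_wpM2l => //; rewrite divr_ge0 ?(ltW eta0)// mulr_ge0.
(* The accounting for all but the first case: [ln nn] may be charged only to a number [K] of boxes
   with [2/3 K <= g]. *)
have fin (x K : R) : 0 <= K -> 2 / 3 * K <= g -> x <= 2 / 3 * ln nn * K + c * Gm -> x <= (ln nn + (16 + 2 * c / eta)) * g.
  move=> K0 Kg xl; apply: (le_trans xl).
  have -> : (ln nn + (16 + 2 * c / eta)) * g = ln nn * g + 16 * g + 2 * c / eta * g by ring.
  have h1 := ler_wpM2l lnn Kg; have h2 : 0 <= 16 * g by rewrite mulr_ge0.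
  by move: cg; move: (2 * c / eta * g) (c * Gm) => z y; lra.
have fin0 (x : R) : x <= c * Gm -> x <= (ln nn + (16 + 2 * c / eta)) * g.
  by move=> xl; apply: (fin _ 0); rewrite ?mulr0 ?add0r.
have [ks|kl] := leP (20 * (degm m)%:R) nn.
  have k0 : (0 < degm m)%N.
    have [i mi0] := mi; rewrite /degm (bigD1 i)//= ltn_addr// muln_gt0 lt0n andbT; exact/eqP.
  have [T HT] := star_small nuH k0 ks; exists T; apply: le_trans HT _; rewrite -/nn -/g.
  apply: ler_wpM2r => //; rewrite lerD2l lerDl; apply: divr_ge0; [exact: mulr_ge0|exact: ltW].
have Gg : nn * g0 <= Gm.
  apply: ler_wpM2l; first exact: ltW.
  rewrite g0E; apply: le_trans (Gam_ge_ln _); rewrite ler_ln ?posrE; first last.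
  - by rewrite ltr_pwDl// divr_ge0.
  - by rewrite addr_gt0// invr_gt0.
  by rewrite lerD2l ler_pdivlMr// -/nn; lra.
have nG : nn <= g0^-1 * Gm by rewrite ler_pdivlMl// mulrC.
have [nB|nB] := ltP nn B.
  exists n.+1; apply: fin0; apply: le_trans (logdim_low_dimension m) _; rewrite -/nn -/Gm.
  have h1 : 2 * nn * nn <= 2 * B / g0 * Gm.
    apply: (@le_trans _ _ (2 * B * nn)); first by rewrite ler_pM2r// ler_pM2l// ltW.
    by rewrite -[leRHS]mulrA; apply: ler_wpM2l => //; rewrite mulr_ge0// ltW.
  rewrite cE; have p1 : 0 <= 2 / g1 * Gm by exact: mulr_ge0.
  have p2 : 0 <= g0^-1 * Gm by exact: mulr_ge0.
  have p3 : 0 <= (3 - ln e) * 2 * Gm by exact: mulr_ge0.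
  have p4 : 0 <= (6 - ln (e / 2)) * 2 * Gm by exact: mulr_ge0.
  by move: h1 p1 p2 p3 p4; move: (2 * B / g0 * Gm) (2 / g1 * Gm) (g0^-1 * Gm) ((6 - ln (e / 2)) * 2 * Gm) ((3 - ln e) * 2 * Gm) (2 * nn * nn); clear; move=> *; lra.
have ex : exists a, ((rl m a)%:R <= e * nn).
  by exists n.+1; rewrite rl_over// mulr_ge0// ltW.
(* The number of rows longer than [e nn]. *)
case: (ex_minnP ex) => a la amin.
have above i : (i < a)%N -> e * nn < (rl m i)%:R.
  by move=> ia; rewrite ltNge; apply/negP => /amin; rewrite leqNgt ia.
have aG : nn * a%:R <= g1^-1 * Gm.
  rewrite ler_pdivlMl// mulrCA; apply: ler_wpM2l; first exact: ltW.
  by rewrite mulrC g1E; exact: rows_above above.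
have an : (a <= n.+1)%N by apply: amin; rewrite rl_over// mulr_ge0// ltW.
have lan : (rl m a)%:R <= nn.
  by apply: le_trans la _; rewrite ler_piMl// ?(ltW n0)//; lra.
have [ea|ae] := leP (e * nn) a%:R.
  exists a; apply: fin0; apply: le_trans (logdim_wide e0 an ea lan) _; rewrite -/nn -/Gm.
  have h1 : 2 * nn * a%:R <= 2 / g1 * Gm by move: aG; rewrite -mulrA => h; rewrite -[leRHS]mulrA ler_pM2l.
  rewrite cE; have p1 : 0 <= 2 * B / g0 * Gm by exact: mulr_ge0.
  have p2 : 0 <= g0^-1 * Gm by exact: mulr_ge0.
  have p4 : 0 <= (6 - ln (e / 2)) * 2 * Gm by exact: mulr_ge0.
  have -> : (3 - ln e) * (2 * Gm) = (3 - ln e) * 2 * Gm by rewrite mulrA.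
  by move: h1 p1 p2 p4; move: (2 * B / g0 * Gm) (2 / g1 * Gm) (g0^-1 * Gm) ((6 - ln (e / 2)) * 2 * Gm) ((3 - ln e) * 2 * Gm) (2 * nn * a%:R); clear; move=> *; lra.
(* As [a] is below [e nn] too, [a + W] is at most [nn / 500], well within the range of
   [gain_columns], while columns higher than [a + W] are tall enough to cost a constant per box. *)
pose W := Num.truncn (e * nn).
have en0 : 0 <= e * nn by rewrite mulr_ge0// ltW.
have W1 : W%:R <= e * nn by rewrite /W Num.Theory.truncn_le.
have W2 : e * nn < W%:R + 1 by rewrite natr1 truncnS_gt.
have nE : nn = 10 * 100 * (e * nn) by rewrite eE mulVKf// mulf_neq0.
set E := e * nn in la above ae en0 W1 W2 nE.
have E3 : 100 * 100 * 100 <= E by move: nB; rewrite BE nE; lra.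
have [Q [Q1 Q2]] := cube_root n.+1.
have QW : (Q <= W)%N.
  rewrite leqNgt; apply/negP => WQ.
  have QE : E <= Q%:R by apply: le_trans (ltW W2) _; rewrite natr1 ler_nat.
  have Q3 : Q%:R * Q%:R * Q%:R <= nn by rewrite -!natrM ler_nat; move: Q1; rewrite !expnS expn0 muln1 mulnA.
  have q1 : 100 * 100 <= Q%:R :> R by lra.
  have q2 : 100 * 100 * (100 * 100) <= Q%:R * Q%:R :> R by apply: ler_pM => //; rewrite mulr_ge0.
  have q0 : 0 <= Q%:R :> R by rewrite ler0n.
  by have := ler_wpM2r q0 q2; move: Q3 QE q1; rewrite nE; move: (Q%:R * Q%:R * Q%:R) => y; lra.
have Q_leW : Q%:R <= W%:R :> R by rewrite ler_nat.
have aQ : (a + Q <= n.+1)%N by rewrite -(ler_nat R) natrD -/nn nE; lra.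
have aW : (40 * (a + W) <= n.+1.*2.+1)%N.
  apply: (@leq_trans n.+1); last by apply: leqW; rewrite -addnn leq_addr.
  by rewrite -(ler_nat R) natrM natrD -/nn nE; lra.
have W0 : (0 < W)%N by rewrite -(ltr_nat R); lra.
have Wn : (W <= n.+1)%N by rewrite -(ler_nat R) -/nn nE; lra.
have la' : (rl m a)%:R <= nn / (10 * 100) by rewrite mulrC -eE.
have nB' : 100 * 100 * 100 * 100 * 10 <= nn by rewrite -BE.
have gK := gain_columns nuH nB' aW la'.
set K : R := (degm (mid m a W))%:R in gK.
have Kg : 2 / 3 * K <= g.
  have K0 : 0 <= K by rewrite ler0n.
  apply: (@le_trans _ _ (7 / 10 * K)); first by lra.
  have -> : 7 / 10 * K = nn / 2 * (7 / 5 * K / nn) by field; rewrite gt_eqF.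
  apply: ler_wpM2l; first by rewrite divr_ge0// ltW.
  by rewrite lerNr -ler_expR lnK// posrE lap_gt0.
have lW : ln nn - ln W%:R <= - ln (e / 2).
  have : ln (e / 2 * nn) <= ln W%:R.
    rewrite ler_ln ?posrE ?ltr0n// ?mulr_gt0 ?divr_gt0//.
    by rewrite mulrAC -/E ler_pdivrMr//; lra.
  by rewrite lnM ?posrE ?divr_gt0//; lra.
exists (a + Q)%N; apply: (fin _ K) => //.
apply: le_trans (logdim_narrow aQ QW Q1 Q2 lan W0 Wn) _; rewrite -/nn -/Gm -/K.
have h1 : 2 * nn * a%:R <= 2 / g1 * Gm by move: aG; rewrite -mulrA => h; rewrite -[leRHS]mulrA ler_pM2l.
have h2 : (6 + ln nn - ln W%:R) * (2 * Gm) <= (6 - ln (e / 2)) * 2 * Gm.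
  by rewrite -[leRHS]mulrA; apply: ler_wpM2r; [rewrite mulr_ge0|lra].
rewrite cE; have p1 : 0 <= 2 * B / g0 * Gm by exact: mulr_ge0.
have p2 : 0 <= (3 - ln e) * 2 * Gm by exact: mulr_ge0.
move: h1 h2 p1 p2 nG.
by move: (2 * B / g0 * Gm) (2 / g1 * Gm) (g0^-1 * Gm) ((6 - ln (e / 2)) * 2 * Gm) ((3 - ln e) * 2 * Gm) (2 * nn * a%:R) ((6 + ln nn - ln W%:R) * (2 * Gm)) (2 / 3 * ln nn * K); clear; move=> *; lra.
Qed.

End star.

(** * Mixing in L2 *)

Section sum_over_weights.
Context {R : realType} {n : nat}.
Local Notation nn := (n.+1%:R : R).
Implicit Types m : 'I_n.+1 -> nat.

(** Concavity trades the factor [1 / n] inside the logarithm for a factor [n] outside, which makes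
    the sum over weights converge uniformly in [n]. *)
Lemma Gam_ge_rows m : \sum_(i < n.+1) ln (1 + (rl m i)%:R) <= nn * Gam m.
Proof.
have n0 : 0 < nn by rewrite ltr0n.
rewrite /Gam big_distrr /=; apply: ler_sum => i _; set l := (rl m i)%:R.
have v0 : 0 <= nn^-1 by rewrite invr_ge0 ltW.
have v1 : nn^-1 <= 1 by rewrite invf_le1// ler1n.
have := ln_concave v0 v1 (ler0n R (rl m i)); rewrite ler_pdivrMl// -/l.
by rewrite /rlR -/l mulrC [_^-1 * l]mulrC mulrC.
Qed.

Lemma rl_ge m (i : 'I_n.+1) : (m i <= rl m i)%N.
Proof. by rewrite /rl (bigD1 i)//= ltnSn muln1 leq_addr. Qed.

Lemma sum_inv_squares K : \sum_(q < K.+1) (1 + q%:R)^-2 <= 2 - K.+1%:R^-1 :> R.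
Proof.
elim: K => [|K IH]; first by rewrite big_ord1 /= addr0 expr1n invr1; lra.
rewrite big_ord_recr /=; apply: le_trans (lerD IH (lexx _)) _.
have E : 1 + K.+1%:R = K.+2%:R :> R by rewrite addrC natr1.
rewrite E; have k0 : 0 < K.+1%:R :> R by rewrite ltr0n.
have k1 : 0 < K.+2%:R :> R by rewrite ltr0n.
have : (K.+2%:R ^+ 2)^-1 <= K.+1%:R^-1 - K.+2%:R^-1 :> R.
  have -> : K.+1%:R^-1 - K.+2%:R^-1 = (K.+1%:R * K.+2%:R)^-1 :> R.
    by rewrite -E; move: k0; move: (K.+1%:R : R) => x x0; field; rewrite !gt_eqF//; lra.
  rewrite lef_pV2 ?posrE ?mulr_gt0 ?exprn_gt0// expr2 ler_pM2r// -E; lra.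
by move=> h; apply: le_trans (lerD (lexx _) h) _; rewrite addrA subrK.
Qed.

Lemma weight_factor (alpha : R) (l q : nat) : 4 <= alpha -> (0 < l)%N -> (q <= l)%N ->
  expR (- (alpha * ln (1 + l%:R))) <= expR (- (alpha / 2 * ln 2)) * (1 + q%:R)^-2.
Proof.
move=> a4 l0 ql; have q0 : 0 < 1 + q%:R :> R by rewrite ltr_pwDl.
have -> : (1 + q%:R)^-2 = expR (- (2 * ln (1 + q%:R))) :> R by rewrite expRN expRM_natl lnK.
rewrite -expRD ler_expR.
have l2 : ln 2 <= ln (1 + l%:R) :> R.
  by rewrite ler_ln ?posrE ?ltr_pwDl// -natr1 lerD2l ler1n.
have lq : ln (1 + q%:R) <= ln (1 + l%:R) :> R by rewrite ler_ln ?posrE ?ltr_pwDl// lerD2l ler_nat.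
have lq0 : 0 <= ln (1 + q%:R) :> R by exact: ln_sum1_ge0.
by move: l2 lq lq0; move: (ln 2 : R) (ln (1 + l%:R)) (ln (1 + q%:R)) => x y z; nra.
Qed.

(** Group the weights by the largest index [H] with a nonzero entry. All rows up to [H] are then
    nonempty, each leaves a factor [c (1 + q)^-2] with [q] the entry, and the sum over the entries
    is at most [(2 c)^(H + 1)], geometric in [H]. *)
Lemma sum_weights K (alpha : R) : 4 <= alpha ->
  \sum_(a : {ffun 'I_n.+1 -> 'I_K.+1} | weights_upto a) expR (- (alpha * (nn * Gam (toN a)))) <=
  4 * expR (- (alpha / 2 * ln 2)).
Proof.
move=> a4; set c := expR (- (alpha / 2 * ln 2)); have c0 : 0 < c by exact: expR_gt0.
have cs : c <= 4^-1.
  rewrite /c expRN lef_pV2 ?posrE ?expR_gt0//.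
  apply: (@le_trans _ _ (expR (2 * ln 2))); last by rewrite ler_expR ler_wpM2r ?ln_ge0//; lra.
  by rewrite expRM_natl lnK ?posrE// expr2; lra.
pose w (H i : 'I_n.+1) (q : 'I_K.+1) : R := if (i <= H)%N then c * (1 + q%:R)^-2 else (q == ord0)%:R.
have w0 H i q : 0 <= w H i q.
  by rewrite /w; case: ifP => // _; rewrite mulr_ge0 ?(ltW c0)// invr_ge0 exprn_ge0// addr_ge0.
have key a : weights_upto a -> expR (- (alpha * (nn * Gam (toN a)))) <= \sum_H \prod_i w H i (a i).
  case/andP => _ /existsP[i0 ai0].
  pose H := [arg max_(i > i0 | a i != ord0) (i : nat)].
  have [aH Hmax] : a H != ord0 /\ forall i, a i != ord0 -> (i <= H)%N by rewrite /H; case: arg_maxnP.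
  rewrite (bigD1 H)//= -[leLHS]addr0; apply: lerD; last first.
    by apply: sumr_ge0 => j _; apply: prodr_ge0.
  apply: (@le_trans _ _ (expR (\sum_(i < n.+1) - (alpha * ln (1 + (rl (toN a) i)%:R))))).
    rewrite ler_expR sumrN lerN2 -big_distrr /=; apply: ler_wpM2l; first lra.
    exact: Gam_ge_rows.
  rewrite expR_sum; apply: ler_prod => i _; rewrite expR_ge0 /w; case: leqP => iH /=.
    apply: weight_factor => //; last exact: (rl_ge (toN a)).
    apply: leq_trans (rl_mono _ iH); apply: leq_trans (rl_ge (toN a) H).
    by rewrite lt0n; apply: contraNN aH => /eqP h; apply/eqP/val_inj.
  have -> : a i = ord0 by apply/eqP; apply: contraTT iH => /Hmax; rewrite -leqNgt.
  rewrite eqxx -[leRHS]expR0 ler_expR oppr_le0 mulr_ge0//; first lra.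
  exact: ln_sum1_ge0.
apply: (@le_trans _ _ (\sum_(a : {ffun 'I_n.+1 -> 'I_K.+1}) \sum_H \prod_i w H i (a i))).
  rewrite [leRHS](bigID (fun a => weights_upto a)) /= -[leLHS]addr0; apply: lerD.
    by apply: ler_sum => a; exact: key.
  by apply: sumr_ge0 => a _; apply: sumr_ge0 => H _; apply: prodr_ge0.
rewrite exchange_big /=; pose rho := 2 * c.
have step (H : 'I_n.+1) : \sum_(a : {ffun 'I_n.+1 -> 'I_K.+1}) \prod_i w H i (a i) <= rho ^+ H.+1.
  rewrite -(bigA_distr_bigA (w H)).
  apply: (@le_trans _ _ (\prod_(i < n.+1) (if (i <= H)%N then rho else 1))).
    apply: ler_prod => i _; rewrite sumr_ge0//= /w; case: leqP => iH.
      rewrite -big_distrr /= /rho mulrC ler_pM2r//.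
      apply: le_trans (sum_inv_squares K) _; have : 0 <= K.+1%:R^-1 :> R by rewrite invr_ge0.
      by move: (K.+1%:R^-1 : R) => x; lra.
    by rewrite (bigD1 ord0)//= big1 ?addr0// => q /negbTE ->.
  rewrite -big_mkcond prodr_const le_eqVlt; apply/orP; left; apply/eqP; congr (_ ^+ _).
  transitivity (\sum_(i < n.+1 | (i < H.+1)%N) 1)%N; first by rewrite sum1_card.
  by rewrite -(big_ord_widen n.+1 (fun=> 1%N) (ltn_ord H)) sum1_card card_ord.
apply: (@le_trans _ _ (\sum_(H < n.+1) rho ^+ H.+1)); first by apply: ler_sum => H _.
have r0 : 0 <= rho by rewrite mulr_ge0// ltW.
have r1 : rho <= 2^-1 by rewrite /rho; lra.
suff geo k : \sum_(H < k) rho ^+ H.+1 <= 2 * rho - 2 * rho ^+ k.+1.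
  by apply: le_trans (geo _) _; have := exprn_ge0 n.+2 r0; rewrite /rho; lra.
elim: k => [|k IH]; first by rewrite big_ord0 expr1 subrr.
rewrite big_ord_recr /=; apply: le_trans (lerD IH (lexx _)) _.
have := exprn_ge0 k.+1 r0; rewrite [rho ^+ k.+2]exprS; move: (rho ^+ k.+1) => x; nra.
Qed.

End sum_over_weights.

Section mixing.
Context {R : realType}.
Local Notation G n := (SO R n.+1.*2.+1).

(** Twice the log degree bound in [star] and the squared eigenvalues from [phi_le] are both
    proportional to [- ln (lap nu m)]. The balance is [- (x - C)] times [nn * - ln (lap nu m)], and
    [gain_lower] makes the sum over weights converge. *)
Lemma mixing_bound : exists eta C : R, 0 < eta /\
  forall n (nu : probability (G n) R) K (f : G n -> R) (ts : seq R), is_haar nu -> rpol K f -> rclass f ->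
  let x := 2 * (\sum_(t <- ts) sin (t / 2) ^+ 2) / n.+1%:R - ln n.+1%:R in
  4 <= eta * (x - C) ->
  (opl nu [seq rot12 n.+1 t | t <- ts] f 1%g - Ex nu f) ^+ 2 <=
  4 * expR (- (eta * (x - C) / 2 * ln 2)) * Ex nu (fun g => f g ^+ 2).
Proof.
have [eta eta0 Heta] := gain_lower (R := R); have [C C0 HC] := star (R := R).
exists eta, C; split => // n nu K f ts nuH pf cf x xC.
set nn : R := n.+1%:R in x xC *; have n0 : 0 < nn by rewrite ltr0n.
pose D (m : 'I_n.+1 -> nat) : R := expR ((ln nn + C) * (nn * - ln (lap nu m))).
have dimD (m : 'I_n.+1 -> nat) : (exists i, m i <> 0%N) ->
    exists (J : finType) (B : J -> G n -> R), [/\ birep B, jspan B (phi nu m) & #|J|%:R <= D m].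
  move=> m0; have [T HT] := HC n nu m nuH m0.
  have [J [B [bB jB cJ]]] := phi_logdim m T nuH; exists J, B; split => //.
  case: (posnP #|J|) => [->|J0]; first exact: expR_ge0.
  rewrite -[leLHS]lnK ?posrE ?ltr0n// ler_expR cJ.
  by move: HT; rewrite -/nn => /(ler_wpM2l (ler0n R 2)) /le_trans; apply; rewrite le_eqVlt; apply/orP; left; apply/eqP; field.
apply: le_trans (spectral_bound nuH dimD _ pf cf) _.
apply: ler_wpM2r; first by apply: Ex_ge0 => g; exact: sqr_ge0.
apply: le_trans (@sum_weights R n K _ xC); apply: ler_sum => a /andP[_ /existsP[i ai]].
set m := toN a; have m0 : exists i, m i <> 0.
  by exists i => h; move/eqP: ai; apply; exact: val_inj.
set b := - ln (lap nu m); set s := \sum_(t <- ts) sin (t / 2) ^+ 2 in x xC *.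
have lb : eta * Gam m <= b.
  have := Heta n nu m nuH m0; rewrite -[leLHS](lnK (x := lap nu m)) ?posrE ?lap_gt0// ler_expR /b; lra.
have P : \prod_(h <- [seq rot12 n.+1 t | t <- ts]) phi nu m h ^+ 2 <= expR (- (2 * s * b)).
  rewrite big_map (_ : - (2 * s * b) = \sum_(t <- ts) - (2 * sin (t / 2) ^+ 2 * b)); last first.
    by rewrite sumrN -big_distrl -big_distrr.
  rewrite expR_sum; apply: ler_prod => t _; rewrite sqr_ge0 /= -real_normK ?num_real//.
  have := phi_le nu m t; rewrite -/(lap nu m) => h.
  apply: (@le_trans _ _ (expR (sin (t / 2) ^+ 2 * ln (lap nu m)) ^+ 2)).
    by rewrite ler_pXn2r ?nnegrE ?expR_ge0.
  by rewrite -expRM_natl ler_expR /b; lra.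
apply: (@le_trans _ _ (D m * expR (- (2 * s * b)))); first by apply: ler_wpM2l => //; exact: expR_ge0.
rewrite /D -/b -expRD ler_expR.
have -> : (ln nn + C) * (nn * b) + - (2 * s * b) = - ((x - C) * (nn * b)).
  by rewrite /x; field; rewrite gt_eqF.
rewrite lerN2; have xC0 : 0 <= x - C.
  by rewrite -(pmulr_rge0 _ eta0); apply: le_trans xC.
have := ler_wpM2l xC0 (ler_wpM2l (ltW n0) lb); apply: le_trans.
by rewrite le_eqVlt; apply/orP; left; apply/eqP; ring.
Qed.

End mixing.

(** Measurability of a partial expectation when the parameter space carries no measure: a Dirac mass
    serves for Fubini, and the empty space is treated apart. *)
Lemma bm_Ex_param (R : realType) d1 d2 (T1 : measurableType d1) (T2 : measurableType d2)
  (Q : probability T2 R) (F : T1 * T2 -> R) : bm F -> bm (fun x => Ex Q (fun y => F (x, y))).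
Proof.
move=> bF; have [[x0 _]|no] := pselect (exists x : T1, True).
  exact: (bm_Ex1 (\d_x0 : probability T1 R) Q bF).
have no' (x : T1) : False by apply: no; exists x.
split; last by exists 0 => x; case: (no' x).
by move=> _ B _; rewrite (_ : _ `&` _ = set0)//; apply/seteqP; split => x; case: (no' x).
Qed.

(** * Total variation upper bound *)

Section convolution.
Context {R : realType} {n : nat} (nu : probability (SO R n.*2.+1) R) (nuH : is_haar nu).
Local Notation G := (SO R n.*2.+1).
Implicit Types (f : G -> R) (h : G).

(* The law of [U h U^-1] being invariant under conjugation, [kop] and [cop] agree on class functions. *)
Definition kop h f : G -> R := fun X => Ex nu (fun U : G => f (U * h * U^-1 * X)%g).

Definition kopl (hs : seq G) f := foldr kop f hs.

Lemma measurable_conj d (T : measurableType d) (F H : T -> G) :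
  measurable_fun setT F -> measurable_fun setT H -> measurable_fun setT (fun t => (F t * H t * (F t)^-1)%g).
Proof. by move=> mF mH; apply: measurable_mul; [exact: measurable_mul|exact: measurable_inv]. Qed.

Lemma bm_kop_arg h f X : bm f -> bm (fun U : G => f (U * h * U^-1 * X)%g).
Proof.
move=> bf; apply: (bm_comp bf); apply: measurable_mul; last exact: measurable_cst.
by apply: measurable_conj; [exact: measurable_id|exact: measurable_cst].
Qed.

Lemma bm_kop_joint d (T : measurableType d) (F : T * G -> R) (H : T -> G) : bm F -> measurable_fun setT H ->
  bm (fun p : T * G => kop (H p.1) (fun g => F (p.1, g)) p.2).
Proof.
move=> bF mH; apply: (bm_Ex_param nu (F := fun q : (T * G) * G => F (q.1.1, q.2 * H q.1.1 * q.2^-1 * q.1.2)%g)).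
have m11 : measurable_fun setT (fun q : (T * G) * G => q.1.1).
  by apply: (measurableT_comp (f := fst)); [exact: measurable_fst|exact: measurable_fst].
have m12 : measurable_fun setT (fun q : (T * G) * G => q.1.2).
  by apply: (measurableT_comp (f := snd)); [exact: measurable_snd|exact: measurable_fst].
apply: (bm_comp bF); apply/measurable_fun_pairP; split => //=.
apply: measurable_mul => //; apply: measurable_conj; first exact: measurable_snd.
exact: (measurableT_comp mH).
Qed.

Lemma bm_kop h f : bm f -> bm (kop h f).
Proof.
move=> bf; have b1 : bm (fun p : unit * G => f p.2) by apply: (bm_comp bf); exact: measurable_snd.
exact: (bm_pair1 tt (bm_kop_joint b1 (measurable_cst h))).
Qed.

Lemma bm_kopl hs f : bm f -> bm (kopl hs f).
Proof. by move=> bf; elim: hs => //= h hs; exact: bm_kop. Qed.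

Lemma kop_lin h f f' a : bm f -> bm f' -> kop h (fun g => f g + a * f' g) = fun g => kop h f g + a * kop h f' g.
Proof. by move=> bf bf'; apply/funext => g; rewrite /kop Ex_lin//; exact: bm_kop_arg. Qed.

Lemma kopl_lin hs f f' a : bm f -> bm f' ->
  kopl hs (fun g => f g + a * f' g) = fun g => kopl hs f g + a * kopl hs f' g.
Proof. by move=> bf bf'; elim: hs => //= h hs ->; apply: kop_lin; exact: bm_kopl. Qed.

Lemma kopl_cst hs a : kopl hs (fun=> a) = fun=> a.
Proof. by elim: hs => //= h hs ->; apply/funext => g; rewrite /kop Ex_cst. Qed.

Lemma kopl_ge0 hs f : (forall g, 0 <= f g) -> forall X, 0 <= kopl hs f X.
Proof. by move=> f0; elim: hs => //= h hs IH X; apply: Ex_ge0. Qed.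

Lemma kopl_bound hs f (M : R) : bm f -> (forall g, `|f g| <= M) -> forall X, `|kopl hs f X| <= M.
Proof.
move=> bf fM; elim: hs => //= h hs IH X; apply: le_trans (Ex_norm nu (bm_kop_arg h X (bm_kopl hs bf))) _.
rewrite -[leRHS](Ex_cst nu); apply: Ex_le; [apply: bm_norm; exact: bm_kop_arg (bm_kopl hs bf)|exact: bm_cst|].
by move=> U; exact: IH.
Qed.

Lemma kopl_cvg hs (F : nat -> G -> R) f (M : R) : (forall k, bm (F k)) -> (forall k g, `|F k g| <= M) ->
  (forall g, F k g @[k --> \oo] --> f g) -> forall X, kopl hs (F k) X @[k --> \oo] --> kopl hs f X.
Proof.
move=> bF FM Ff; elim: hs => //= h hs IH X.
have [|||_] := @Ex_cvg _ _ R nu (fun k (U : G) => kopl hs (F k) (U * h * U^-1 * X)%g) (fun U => kopl hs f (U * h * U^-1 * X)%g) M.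
- by move=> k; have [] := bm_kop_arg h X (bm_kopl hs (bF k)).
- by move=> k U; exact: kopl_bound.
- by move=> U; exact: IH.
by [].
Qed.

Lemma kopl_Ex_joint d (T : measurableType d) (P : probability T R) (F : T * G -> R) hs : bm F ->
  bm (fun p : T * G => kopl hs (fun g => F (p.1, g)) p.2) /\
  forall X, kopl hs (fun g => Ex P (fun t => F (t, g))) X = Ex P (fun t => kopl hs (fun g => F (t, g)) X).
Proof.
move=> bF; elim: hs => [|h hs [bIH IH]] /=.
  by split=> //; rewrite (_ : (fun p => _) = F)//; apply/funext => -[].
split.
  rewrite (_ : (fun p => _) = fun p : T * G => kop h (fun g => (fun q : T * G => kopl hs (fun g => F (q.1, g)) q.2) (p.1, g)) p.2)//.
  exact: (bm_kop_joint bIH (measurable_cst h)).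
move=> X; rewrite /kop (_ : (fun U => kopl hs _ _) = fun U => Ex P (fun t => kopl hs (fun g => F (t, g)) (U * h * U^-1 * X)%g)); last first.
  by apply/funext => U; exact: IH.
have b2 : bm (fun p : G * T => kopl hs (fun g => F (p.2, g)) (p.1 * h * p.1^-1 * X)%g).
  apply: (bm_comp (F := fun p : G * T => (p.2, p.1 * h * p.1^-1 * X)%g) bIH).
  apply/measurable_fun_pairP; split => /=; first exact: measurable_snd.
  apply: measurable_mul; last exact: measurable_cst.
  by apply: measurable_conj; [exact: measurable_fst|exact: measurable_cst].
exact: (Ex_swap nu P b2).
Qed.

Definition conjf (V : G) f : G -> R := fun g => f (V * g * V^-1)%g.

Lemma kopl_conj hs V f : bm f -> kopl hs (conjf V f) = conjf V (kopl hs f).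
Proof.
move=> bf; elim: hs => //= h hs ->; apply/funext => X; rewrite /kop /conjf.
rewrite -(Ex_mull nuH V (bm_kop_arg h (V * X * V^-1)%g (bm_kopl hs bf))).
congr Ex; apply/funext => U; congr (kopl hs f).
by rewrite !invgM !mulgA mulgKV.
Qed.

(** Averaging over conjugations changes neither the value of the walk at the identity nor the Haar
    mean, and reduces arbitrary test functions to class functions. *)
Definition cav f : G -> R := fun g => Ex nu (fun V => conjf V f g).

Lemma bm_cav_arg f : bm f -> bm (fun p : G * G => conjf p.1 f p.2).
Proof. by move=> bf; apply: (bm_comp bf); apply: measurable_conj; [exact: measurable_fst|exact: measurable_snd]. Qed.

Lemma kopl_cav hs f : bm f -> kopl hs (cav f) 1%g = kopl hs f 1%g.
Proof.
move=> bf; have [_ ->] := kopl_Ex_joint nu hs (bm_cav_arg bf).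
rewrite (_ : (fun V => _) = fun=> kopl hs f 1%g) ?Ex_cst//.
by apply/funext => V; rewrite /= (kopl_conj hs V bf) /conjf mulg1 mulgV.
Qed.

Lemma Ex_cav f : bm f -> Ex nu (cav f) = Ex nu f.
Proof.
move=> bf; have := Ex_swap nu nu (bm_cav_arg bf) => /= E.
rewrite /cav -E (_ : (fun V => _) = fun=> Ex nu f) ?Ex_cst//; apply/funext => V.
have bV : bm (fun g => f (V * g)%g).
  by apply: (bm_comp bf); apply: measurable_mul; [exact: measurable_cst|exact: measurable_id].
rewrite /conjf -[RHS](Ex_mull nuH V bf) -[RHS](Ex_mulr nuH V^-1%g bV).
by congr Ex; apply/funext => g; rewrite mulgA.
Qed.

Lemma bm_cav f : bm f -> bm (cav f).
Proof. by move=> bf; exact: (bm_Ex2 nu nu (bm_cav_arg bf)). Qed.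

Lemma cav_class f : bm f -> rclass (cav f).
Proof.
move=> bf g V; rewrite /cav.
have bc : bm (fun U => conjf U f g) by exact: (bm_pair2 g (bm_cav_arg bf)).
rewrite -[RHS](Ex_mulr nuH V bc); congr Ex; apply/funext => U; rewrite /conjf; congr f.
by rewrite invgM !mulgA.
Qed.

Lemma cav_rpol k f : rpol k f -> rpol k (cav f).
Proof.
move=> pf; have bf := rpol_bm pf.
have := @pol_conj_avg R _ nu k _ pf; rewrite /rpol; congr pol; apply/funext => g.
by rewrite Ec_real//; exact: (bm_pair2 g (bm_cav_arg bf)).
Qed.

Lemma cav_square f : bm f -> Ex nu (fun g => cav f g ^+ 2) <= Ex nu (fun g => f g ^+ 2).
Proof.
move=> bf; rewrite -[leRHS](Ex_cav (bmX 2 bf)); apply: Ex_le.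
- by apply: bmX; exact: bm_cav.
- by apply: bm_cav; exact: bmX.
move=> g; have := @Ex_sqr_le _ _ R nu (fun V => conjf V f g) (fun=> 1) (bm_pair2 g (bm_cav_arg bf)) (bm_cst 1).
rewrite (_ : (fun V => _ * 1) = fun V => conjf V f g); last by apply/funext => V; rewrite mulr1.
by rewrite (_ : (fun=> 1 ^+ 2) = fun=> 1 : R) ?Ex_cst ?mulr1//; apply/funext => V; rewrite expr1n.
Qed.

Lemma kopl_class hs f : bm f -> rclass f -> kopl hs f = opl nu hs f /\ rclass (kopl hs f).
Proof.
move=> bf cf; elim: hs => //= h hs [IH cIH].
have E : kop h (kopl hs f) = cop nu h (kopl hs f).
  apply/funext => X; rewrite /kop /cop; congr Ex; apply/funext => U.
  by rewrite -(cIH (_ * X)%g X) !mulgA mulgK.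
rewrite E; split; first by rewrite IH.
by apply: cop_class => //; exact: bm_kopl.
Qed.

End convolution.

Lemma bernoulli_ge (R : realDomainType) (x : R) k : 0 <= 1 + x -> 1 + k%:R * x <= (1 + x) ^+ k.
Proof.
move=> x1; elim: k => [|k IH]; first by rewrite mul0r addr0 expr0.
rewrite exprS; apply: le_trans (ler_wpM2l x1 IH).
by have := mulr_ge0 (ler0n R k) (sqr_ge0 x); rewrite -natr1; move: (k%:R) => y; nra.
Qed.

Lemma cvg_natr_geometric (R : realType) (a : R) : 0 <= a -> a < 1 -> k%:R * a ^+ k @[k --> \oo] --> (0 : R).
Proof.
move=> a0 a1; pose p := (1 + a) / 2.
have p0 : 0 < p by rewrite /p; lra.
have p1 : p < 1 by rewrite /p; lra.
have ap : a <= p ^+ 2 by have := sqr_ge0 (1 - a); rewrite /p; nra.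
pose C := p / (1 - p).
have kC k : k%:R * p ^+ k <= C.
  have h := @bernoulli_ge R (p^-1 - 1) k.
  have := h _; rewrite addrC subrK invr_ge0 ltW// => /(_ isT) {}h.
  have pk : 0 < p ^+ k by rewrite exprn_gt0.
  have := ler_wpM2r (ltW pk) h; rewrite exprVn mulVf ?gt_eqF// => h2.
  rewrite /C ler_pdivlMr ?subr_gt0//.
  have E : p * (p^-1 - 1) = 1 - p by field; rewrite gt_eqF.
  have : k%:R * p ^+ k * (p * (p^-1 - 1)) <= p.
    have := ler_wpM2l (ltW p0) h2; move: pk p0; move: (p ^+ k) (p^-1) (k%:R) => y z w; nra.
  by rewrite E.
apply: (squeeze_cvgr (f := fun=> 0) (h := fun k => C * p ^+ k)); last first.
- by rewrite -[X in _ --> X](mulr0 C); apply: cvgM; [exact: cvg_cst|apply: cvg_expr; rewrite ger0_norm// ltW].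
- exact: cvg_cst.
apply: nearW => k; rewrite mulr_ge0 ?ler0n ?exprn_ge0//=.
apply: (@le_trans _ _ (k%:R * (p ^+ 2) ^+ k)).
  by apply: ler_wpM2l => //; apply: lerXn2r => //; rewrite nnegrE// sqr_ge0.
rewrite -exprM mulnC mulnS muln1 exprD mulrA; apply: ler_wpM2r => //.
by rewrite exprn_ge0// ltW.
Qed.

(** Polynomials in [u] converging pointwise to the indicator of [u < 1/2]. Expanding, the decisive
    quantity is [k (2 u)^k]; the factor [k] in the exponent makes the limit 0 at [u = 1/2] as
    well. *)
Lemma cvg_step (R : realType) (u : R) : 0 <= u -> u <= 1 ->
  (1 - u ^+ k) ^+ (k * 2 ^ k) @[k --> \oo] --> ((u < 1 / 2)%R%:R : R).
Proof.
move=> u0 u1; have uk k : 0 <= 1 - u ^+ k by rewrite subr_ge0 exprn_ile1.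
case: ltP => hu.
  apply: (squeeze_cvgr (f := fun k => 1 - k%:R * (2 * u) ^+ k) (h := fun=> 1)).
  - apply: nearW => k; apply/andP; split; last by apply: exprn_ile1 => //; rewrite gerBl exprn_ge0.
    have := @bernoulli_ge R (- u ^+ k) (k * 2 ^ k) (uk k).
    by rewrite mulrN natrM natrX -mulrA -exprMn.
  - rewrite -[X in _ --> X](subr0 1); apply: cvgB; first exact: cvg_cst.
    by apply: cvg_natr_geometric; lra.
  - exact: cvg_cst.
apply: (squeeze_cvgr (f := fun=> 0) (h := fun k => expR (-1) ^+ k)).
- apply: nearW => k; rewrite exprn_ge0//=.
  apply: (@le_trans _ _ (expR (- u ^+ k) ^+ (k * 2 ^ k))).
    by apply: lerXn2r; rewrite ?nnegrE ?expR_ge0//; exact: expR_ge1Dx.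
  rewrite -!expRM_natr ler_expR mulNr mulN1r lerN2 natrM mulrC -mulrA -[leLHS]mulr1.
  apply: ler_wpM2l => //; rewrite natrX -exprMn; apply: exprn_ege1; lra.
- exact: cvg_cst.
- by apply: cvg_expr; rewrite ger0_norm ?expR_ge0// -expR0 ltr_expR; lra.
Qed.

(** * Borel sets as mean square limits of polynomials *)

Section polynomial_approximation.
Context {R : realType} {N : nat}.
Local Notation G := (SO R N).
Implicit Types f g : G -> R.
Variable I : (G -> R) -> R.
Hypothesis I_lin : forall f g a, bm f -> bm g -> I (fun x => f x + a * g x) = I f + a * I g.
Hypothesis I_ge0 : forall f, (forall x, 0 <= f x) -> 0 <= I f.
Hypothesis I_cvg : forall (F : nat -> G -> R) f (M : R), (forall k, bm (F k)) -> (forall k x, `|F k x| <= M) ->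
  (forall x, F k x @[k --> \oo] --> f x) -> I (F k) @[k --> \oo] --> I f.

(** Approximation in mean square for an abstract positive functional [I] that is continuous under
    bounded pointwise limits; it will be the sum of the walk and the Haar expectation. *)
Definition appr f := bm f /\ forall e : R, 0 < e -> exists (k : nat) (psi : G -> R),
  rpol k psi /\ I (fun x => (f x - psi x) ^+ 2) <= e.

Lemma I_le f g : bm f -> bm g -> (forall x, f x <= g x) -> I f <= I g.
Proof.
move=> bf bg fg; have := I_lin (-1) bg bf; rewrite mulN1r => E.
by rewrite -subr_ge0 -E; apply: I_ge0 => x; rewrite mulN1r subr_ge0.
Qed.

Lemma I0 : I (fun=> 0) = 0.
Proof. by have := @I_lin (fun=> 0) (fun=> 0) 1 (bm_cst 0) (bm_cst 0); under eq_fun do rewrite mulr0 addr0; lra. Qed.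

Lemma I_Z a f : bm f -> I (fun x => a * f x) = a * I f.
Proof.
move=> bf; have := @I_lin (fun=> 0) f a (bm_cst 0) bf; rewrite I0 add0r => <-.
by congr I; apply/funext => x; rewrite add0r.
Qed.

Lemma rpolD k f g : rpol k f -> rpol k g -> rpol k (fun x => f x + g x).
Proof. by move=> pf pg; rewrite /rpol; under eq_fun do rewrite rmorphD; exact: polD. Qed.

Lemma rpolM k l f g : rpol k f -> rpol l g -> rpol (k + l) (fun x => f x * g x).
Proof. by move=> pf pg; rewrite /rpol; under eq_fun do rewrite rmorphM; exact: polM. Qed.

Lemma rpol_cst k (c : R) : rpol k (fun _ : G => c).
Proof. exact: pol_cst. Qed.

Lemma rpol_entry i j : rpol 1 (fun g : G => SO_mx g i j).
Proof. exact: pol_entry. Qed.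

Lemma rpol_le k l f : (k <= l)%N -> rpol k f -> rpol l f.
Proof. exact: pol_le. Qed.

Lemma appr_rpol k f : rpol k f -> appr f.
Proof.
move=> pf; split; first exact: rpol_bm pf.
move=> e e0; exists k, f; split => //.
by rewrite (_ : (fun x => _) = fun=> 0) ?I0 ?ltW//; apply/funext => x; rewrite subrr expr0n.
Qed.

Lemma bmZ (a : R) f : bm f -> bm (fun x => a * f x).
Proof. by move=> bf; apply: bmM => //; exact: bm_cst. Qed.

Lemma appr_lin a f g : appr f -> appr g -> appr (fun x => f x + a * g x).
Proof.
move=> [bf af] [bg ag]; split; first by apply: bmD => //; exact: bmZ.
move=> e e0; have e4 : 0 < e / 4 by rewrite divr_gt0.
have c0 : 0 < 4 * (a ^+ 2 + 1) by rewrite mulr_gt0// ltr_wpDl// sqr_ge0.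
have e5 : 0 < e / (4 * (a ^+ 2 + 1)) by rewrite divr_gt0.
have [k [p [pp hp]]] := af _ e4; have [l [q [pq hq]]] := ag _ e5.
exists (k + l)%N, (fun x => p x + a * q x); split.
  apply: rpolD; first exact: rpol_le (leq_addr _ _) pp.
  have := rpolM (rpol_cst 0 a) (rpol_le (leq_addl k l) pq).
  by rewrite add0n.
have bp := rpol_bm pp; have bq := rpol_bm pq.
have b1 : bm (fun x => (f x - p x) ^+ 2) by apply: bmX; exact: bmB.
have b2 : bm (fun x => (g x - q x) ^+ 2) by apply: bmX; exact: bmB.
have bb : bm (fun x => (f x + a * g x - (p x + a * q x)) ^+ 2).
  by apply: bmX; apply: bmB; apply: bmD => //; exact: bmZ.
apply: (@le_trans _ _ (I (fun x => 2 * (f x - p x) ^+ 2 + 2 * a ^+ 2 * (g x - q x) ^+ 2))).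
  apply: I_le => //; first by apply: bmD; exact: bmZ.
  move=> x; have := sqr_ge0 ((f x - p x) - a * (g x - q x)).
  by move: (f x) (g x) (p x) (q x) => u v w z; rewrite -subr_ge0 => h; rewrite -subr_ge0; apply: le_trans h _;
     rewrite le_eqVlt; apply/orP; left; apply/eqP; ring.
rewrite I_lin//; last exact: bmZ.
rewrite I_Z//; have a2 : 0 <= a ^+ 2 by exact: sqr_ge0.
have a1 : 0 < a ^+ 2 + 1 by rewrite ltr_wpDl.
have h3 : 2 * a ^+ 2 * I (fun x => (g x - q x) ^+ 2) <= e / 2.
  apply: (@le_trans _ _ (2 * a ^+ 2 * (e / (4 * (a ^+ 2 + 1))))); first by apply: ler_wpM2l => //; rewrite mulr_ge0.
  have -> : 2 * a ^+ 2 * (e / (4 * (a ^+ 2 + 1))) = (e / 2) * (a ^+ 2 / (a ^+ 2 + 1)) by field; rewrite gt_eqF.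
  rewrite -[leRHS]mulr1; apply: ler_wpM2l; first by rewrite divr_ge0// ltW.
  by rewrite ler_pdivrMr// mul1r; lra.
by move: hp h3; lra.
Qed.

Lemma appr_cst c : appr (fun=> c).
Proof. exact: (appr_rpol (rpol_cst 0 c)). Qed.

Lemma appr_mul f g : appr f -> appr g -> appr (fun x => f x * g x).
Proof.
move=> [bf af] [bg ag]; split; first exact: bmM.
have sq (h : G -> R) : bm h -> exists2 M : R, 0 < M & forall x, h x ^+ 2 <= M.
  move=> [_ [M hM]]; exists (M ^+ 2 + 1); first by rewrite ltr_wpDl// sqr_ge0.
  move=> x; have M0 : 0 <= M by apply: le_trans (hM x).
  apply: (@le_trans _ _ (M ^+ 2)); last by rewrite lerDl.
  by rewrite -real_normK ?num_real// ler_pXn2r ?nnegrE.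
move=> e e0; have [Mf Mf0 hf] := sq _ bf.
have e1 : 0 < e / 4 / Mf by rewrite !divr_gt0.
have [l [q [pq hq]]] := ag _ e1; have bq := rpol_bm pq.
have [Mq Mq0 hMq] := sq _ bq.
have e2 : 0 < e / 4 / Mq by rewrite !divr_gt0.
have [k [p [pp hp]]] := af _ e2; have bp := rpol_bm pp.
exists (k + l)%N, (fun x => p x * q x); split; first exact: rpolM.
have b1 : bm (fun x => (f x - p x) ^+ 2) by apply: bmX; exact: bmB.
have b2 : bm (fun x => (g x - q x) ^+ 2) by apply: bmX; exact: bmB.
apply: (@le_trans _ _ (I (fun x => 2 * Mf * (g x - q x) ^+ 2 + 2 * Mq * (f x - p x) ^+ 2))).
  apply: I_le; first by apply: bmX; apply: bmB; exact: bmM.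
    by apply: bmD; exact: bmZ.
  move=> x; have h1 := ler_wpM2r (sqr_ge0 (g x - q x)) (hf x).
  have h2 := ler_wpM2r (sqr_ge0 (f x - p x)) (hMq x).
  have h3 := sqr_ge0 (f x * (g x - q x) - q x * (f x - p x)).
  move: h1 h2 h3; move: (f x) (g x) (p x) (q x) => u v w z; nra.
rewrite I_lin//; last exact: bmZ.
rewrite I_Z//; have h1 : 2 * Mf * I (fun x => (g x - q x) ^+ 2) <= e / 2.
  have := ler_wpM2l (ltW (mulr_gt0 (ltr0n R 2) Mf0)) hq.
  by have -> : 2 * Mf * (e / 4 / Mf) = e / 2 by field; rewrite gt_eqF.
have h2 : 2 * Mq * I (fun x => (f x - p x) ^+ 2) <= e / 2.
  have := ler_wpM2l (ltW (mulr_gt0 (ltr0n R 2) Mq0)) hp.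
  by have -> : 2 * Mq * (e / 4 / Mq) = e / 2 by field; rewrite gt_eqF.
by rewrite [leRHS](splitr e); exact: lerD.
Qed.

Lemma appr_exp f k : appr f -> appr (fun x => f x ^+ k).
Proof.
move=> af; elim: k => [|k IH]; first by under eq_fun do rewrite expr0; exact: appr_cst.
by under eq_fun do rewrite exprS; exact: appr_mul.
Qed.

Lemma appr_lim (F : nat -> G -> R) f (M : R) : (forall k, appr (F k)) -> (forall k x, `|F k x| <= M) ->
  (forall x, F k x @[k --> \oo] --> f x) -> appr f.
Proof.
move=> aF FM Ff; have bF k : bm (F k) by have [] := aF k.
have mf : measurable_fun setT f.
  have mF k : measurable_fun setT (F k) by have [] := bF k.
  by apply: (measurable_fun_cvg (h := F)) => // x _; exact: Ff.
have fM x : `|f x| <= M.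
  have Fx := cvg_norm (Ff x); rewrite -(cvg_lim _ (Fx _))//.
  by apply: limr_le; [apply/cvg_ex; exists (`|f x|); exact: Fx|apply: nearW => k; exact: FM].
have bf : bm f by split => //; exists M.
split => // e e0; pose D k x := (f x - F k x) ^+ 2.
have bD k : bm (D k) by apply: bmX; exact: bmB.
have D0 : I (D k) @[k --> \oo] --> 0.
  rewrite -I0; apply: (I_cvg (M := (M + M) ^+ 2)) => // [k x|x].
    rewrite /D ger0_norm ?sqr_ge0// -real_normK ?num_real// ler_pXn2r ?nnegrE ?addr_ge0//; try exact: le_trans (fM x).
    by apply: le_trans (ler_normB _ _) _; apply: lerD.
  rewrite -[X in _ --> X](_ : (f x - f x) ^+ 2 = 0); last by rewrite subrr expr0n.
  by rewrite expr2; apply: cvgM; apply: cvgB => //; exact: cvg_cst.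
have e4 : 0 < e / 4 by rewrite divr_gt0.
have [k hk] : exists k, I (D k) <= e / 4.
  move/cvgrPdist_lt: D0 => /(_ _ e4)[k _ /(_ k (leqnn k))]; rewrite sub0r normrN => h; exists k.
  by apply: le_trans (ltW h); exact: ler_norm.
have [_ /(_ _ e4)[l [p [pp hp]]]] := aF k; have bp := rpol_bm pp.
exists l, p; split => //.
have b2 : bm (fun x => (F k x - p x) ^+ 2) by apply: bmX; exact: bmB.
apply: (@le_trans _ _ (I (fun x => 2 * D k x + 2 * (F k x - p x) ^+ 2))).
  apply: I_le; first by apply: bmX; exact: bmB.
    by apply: bmD; exact: bmZ.
  by move=> x; rewrite /D; have := sqr_ge0 ((f x - F k x) - (F k x - p x)); move: (f x) (F k x) (p x) => u v w; nra.
rewrite I_lin//; last exact: bmZ.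
by rewrite I_Z//; lra.
Qed.

(** An affine image [u] of [f] takes values in [0, 1] and is below 1/2 exactly where [f < a]; then
    [cvg_step] applies. *)
Lemma appr_indic_lt f a : appr f -> appr (\1_[set x | f x < a]).
Proof.
move=> af; have [[_ [M fM]] _] := af.
pose L := 2 * (M + `|a| + 1); pose u x := 1 / 2 - a / L + L^-1 * f x.
have M0 : 0 <= M by apply: le_trans (fM 1%g).
have L0 : 0 < L by rewrite /L; have := normr_ge0 a; lra.
have u01 x : 0 <= u x <= 1.
  have E : u x = (L / 2 - a + f x) / L by rewrite /u; field; rewrite gt_eqF.
  have := fM x; have := lexx `|a|; rewrite !ler_norml => /andP[a1 a2] /andP[f1 f2].
  rewrite E divr_ge0 ?ler_pdivrMr ?mul1r//=; last by exact: ltW.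
    by rewrite /L; lra.
  by rewrite /L; lra.
have au : appr u by apply: appr_lin => //; exact: appr_cst.
have aF k : appr (fun x => (1 - u x ^+ k) ^+ (k * 2 ^ k)).
  apply: appr_exp; rewrite (_ : (fun x => _) = fun x => 1 + (-1) * u x ^+ k); last first.
    by apply/funext => x; rewrite mulN1r.
  by apply: appr_lin; [exact: appr_cst|exact: appr_exp].
apply: (@appr_lim _ _ 1 aF) => [k x|x].
  have /andP[u0 u1] := u01 x.
  by rewrite ger0_norm ?exprn_ge0 ?exprn_ile1 ?subr_ge0 ?gerBl ?exprn_ge0 ?exprn_ile1.
have /andP[u0 u1] := u01 x; rewrite indicE (_ : (x \in _) = (u x < 1 / 2)).
  exact: cvg_step.
have E : 1 / 2 - u x = (a - f x) / L by rewrite /u; field; rewrite gt_eqF.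
rewrite -[RHS]subr_gt0 E pmulr_lgt0 ?invr_gt0// subr_gt0.
by apply/idP/idP => [/set_mem|h]; [|exact/mem_set].
Qed.

Definition appr_set (B : set G) := appr (\1_B).

Lemma indic_val (B : set G) x : (\1_B x : R) = 0 \/ (\1_B x : R) = 1.
Proof. by rewrite indicE; case: (_ \in _); [right|left]. Qed.

Lemma appr_set_sigma_algebra : sigma_algebra setT appr_set.
Proof.
have aC B : appr_set B -> appr_set (~` B).
  move=> aB; rewrite /appr_set (_ : \1_(~` B) = fun x => 1 + (-1) * \1_B x); last first.
    by apply/funext => x; rewrite !indicE in_setC; case: (_ \in _) => /=; rewrite ?mulr1 ?mulr0 ?subrr ?addr0.
  by apply: appr_lin => //; exact: appr_cst.
have aI B C : appr_set B -> appr_set C -> appr_set (B `&` C).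
  by move=> aB aC'; rewrite /appr_set indicI; exact: appr_mul.
have a0 : appr_set set0 by rewrite /appr_set indic0; exact: appr_cst.
split => // [B aB|A aA]; first by rewrite setTD; exact: aC.
have aU n : appr_set (\big[setU/set0]_(i < n) A i).
  elim: n => [|n IH]; first by rewrite big_ord0.
  by rewrite big_ord_recr /= -[X in appr_set X]setCK setCU; apply/aC/aI; exact: aC.
apply: (@appr_lim (fun n => \1_(\big[setU/set0]_(i < n) A i)) _ 1) => // [k x|x].
  by case: (indic_val (\big[setU/set0]_(i < k) A i) x) => ->; rewrite ?normr0 ?normr1.
have [[k _ Akx]|no] := pselect ((\bigcup_k A k) x).
  apply: cvg_near_cst; near=> n; rewrite !indicE !mem_set//; first by exists k.
  rewrite -bigcup_mkord; exists k => //=; near: n; exact: nbhs_infty_gt.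
apply: cvg_near_cst; apply: nearW => n; rewrite !indicE !memNset//.
by rewrite -bigcup_mkord => -[i _ Ai]; apply: no; exists i.
Unshelve. all: by end_near. Qed.

(** Approximable sets form a sigma-algebra containing the half-spaces of matrix entries, so by
    [measurable_SO] the identity map from it to the Borel structure is measurable. *)
Lemma appr_measurable (B : set G) : measurable B -> appr_set B.
Proof.
move=> mB; pose T := g_sigma_algebraType appr_set.
have sE := sigma_algebra_id appr_set_sigma_algebra.
have mS (C : set T) : measurable C = appr_set C by rewrite /measurable /= sE.
have mF : measurable_fun setT (fun t : T => (t : G)).
  apply: measurable_SO => i j; apply: (measurability _ (RGenInftyO.measurableE R)).
  move=> _ [_ [a ->] <-]; rewrite setTI mS.
  rewrite (_ : _ @^-1` _ = [set x : G | SO_mx x i j < a]); first exact: appr_indic_lt (appr_rpol (rpol_entry i j)).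
  by apply/seteqP; split => x /=; rewrite in_itv.
by have := mF measurableT B mB; rewrite setTI mS.
Qed.

End polynomial_approximation.

Lemma sqr_functional_le d (T : measurableType d) (R : realType) (J : (T -> R) -> R) (h : T -> R) :
  (forall f g a, bm f -> bm g -> J (fun x => f x + a * g x) = J f + a * J g) ->
  (forall f, (forall x, 0 <= f x) -> 0 <= J f) -> J (fun=> 1) = 1 -> bm h -> J h ^+ 2 <= J (fun x => h x ^+ 2).
Proof.
move=> J_lin J_ge0 J1 bh; have := J_ge0 (fun x => (h x - J h) ^+ 2) (fun x => sqr_ge0 _).
have -> : (fun x => (h x - J h) ^+ 2) = fun x => (h x ^+ 2 + (- 2 * J h) * h x) + J h ^+ 2 * 1.
  by apply/funext => x; ring.
have b1 := bm_cst (1 : R).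
have b2 := bmX 2 bh.
have b3 : bm (fun x => (- 2 * J h) * h x) by apply: bmM => //; exact: bm_cst.
by rewrite J_lin//; [rewrite J_lin// J1; move: (J h) => y; nra|exact: bmD].
Qed.

Section approximated_mixing.
Context {R : realType} {n : nat} (nu : probability (SO R n.+1.*2.+1) R) (nuH : is_haar nu).
Local Notation G := (SO R n.+1.*2.+1).

(** One polynomial has to approximate the indicator under the law of the walk and under Haar measure
    simultaneously, hence the functional [I]. It is then averaged over conjugations so that the L2
    bound applies. *)
Lemma mixing_indic (ts : seq R) (B : set G) (b : R) : measurable B -> 0 <= b ->
  (forall K (f : G -> R), rpol K f -> rclass f ->
    (opl nu [seq rot12 n.+1 t | t <- ts] f 1%g - Ex nu f) ^+ 2 <= b ^+ 2 * Ex nu (fun g => f g ^+ 2)) ->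
  kopl nu [seq rot12 n.+1 t | t <- ts] (\1_B) 1%g - Ex nu (\1_B) <= b.
Proof.
move=> mB b0 mix; set hs := [seq rot12 n.+1 t | t <- ts] in mix *.
have b1 : bm (\1_B : G -> R) by exact: bm_indic.
pose I (f : G -> R) := kopl nu hs f 1%g + Ex nu f.
have K_lin (f g : G -> R) a : bm f -> bm g ->
    kopl nu hs (fun x => f x + a * g x) 1%g = kopl nu hs f 1%g + a * kopl nu hs g 1%g.
  by move=> bf bg; rewrite kopl_lin.
have E_lin (f g : G -> R) a : bm f -> bm g -> Ex nu (fun x => f x + a * g x) = Ex nu f + a * Ex nu g.
  by move=> bf bg; rewrite Ex_lin.
have K_ge0 (f : G -> R) : (forall x, 0 <= f x) -> 0 <= kopl nu hs f 1%g by move=> f0; exact: kopl_ge0.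
have E_ge0 (f : G -> R) : (forall x, 0 <= f x) -> 0 <= Ex nu f by exact: Ex_ge0.
have [_ apprB] : appr I (\1_B).
  apply: (@appr_measurable _ _ I) => // [f g a bf bg|f f0|F f M bF FM Ff].
  - by rewrite /I K_lin// E_lin//; ring.
  - by rewrite /I addr_ge0// ?K_ge0 ?E_ge0.
  - apply: cvgD; first exact: kopl_cvg FM Ff _.
    by have [|||_] := @Ex_cvg _ _ R nu F f M => // k; have [] := bF k.
apply/ler_addgt0Pr => e e0; pose s := e / (b + 2).
have b20 : 0 < b + 2 by lra.
have s0 : 0 < s by rewrite divr_gt0.
have [k [p [pp Ip]]] := apprB _ (exprn_gt0 2 s0).
have bp := rpol_bm pp.
pose h x := \1_B x - p x.
have bh : bm h by exact: bmB.
have bh2 : bm (fun x => h x ^+ 2) by exact: bmX.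
have Kh0 : 0 <= kopl nu hs (fun x => h x ^+ 2) 1%g by apply: K_ge0 => x; exact: sqr_ge0.
have Eh0 : 0 <= Ex nu (fun x => h x ^+ 2) by apply: E_ge0 => x; exact: sqr_ge0.
have Ih : kopl nu hs (fun x => h x ^+ 2) 1%g + Ex nu (fun x => h x ^+ 2) <= s ^+ 2 by exact: Ip.
have Kh : kopl nu hs h 1%g <= s.
  have := @sqr_functional_le _ _ R (fun f => kopl nu hs f 1%g) h K_lin K_ge0 _ bh; rewrite kopl_cst => /(_ erefl) hK.
  apply: le_trans (ler_norm _) _; rewrite -(@ler_pXn2r _ 2)// ?nnegrE ?(ltW s0)// real_normK ?num_real//.
  by apply: le_trans hK _; lra.
have Eh : - s <= Ex nu h.
  have := @sqr_functional_le _ _ R (Ex nu) h E_lin E_ge0 _ bh; rewrite Ex_cst => /(_ erefl) hE.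
  rewrite lerNl; apply: le_trans (ler_norm _) _; rewrite normrN -(@ler_pXn2r _ 2)// ?nnegrE ?(ltW s0)// real_normK ?num_real//.
  by apply: le_trans hE _; lra.
have hE : Ex nu h = Ex nu (\1_B) - Ex nu p by rewrite /h ExB.
have hK : kopl nu hs h 1%g = kopl nu hs (\1_B) 1%g - kopl nu hs p 1%g.
  by rewrite -mulN1r -K_lin//; congr (kopl nu hs _ _); apply/funext => x; rewrite /h mulN1r.
have p2 : Ex nu (fun g => p g ^+ 2) <= (1 + s) ^+ 2.
  have bZ (c : R) (f : G -> R) : bm f -> bm (fun x => c * f x) by move=> bf; apply: bmM => //; exact: bm_cst.
  apply: (@le_trans _ _ (Ex nu (fun x => (1 + s) * 1 + (1 + s^-1) * h x ^+ 2))).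
    apply: Ex_le; [exact: bmX|by apply: bmD; [exact: bm_cst|exact: bZ]|].
    move=> x; have -> : p x = \1_B x - h x by rewrite /h; ring.
    have q1 : \1_B x ^+ 2 <= 1 :> R by case: (indic_val (R := R) B x) => ->; rewrite ?expr1n ?expr0n.
    have q2 := ler_wpM2l (ltW s0) q1.
    have q3 : 0 <= s^-1 * (s * \1_B x + h x) ^+ 2 by rewrite mulr_ge0 ?sqr_ge0// invr_ge0 ltW.
    have q4 : s^-1 * (s * \1_B x + h x) ^+ 2 = s * \1_B x ^+ 2 + 2 * \1_B x * h x + s^-1 * h x ^+ 2.
      by field; rewrite gt_eqF.
    have q5 : (1 + s) * \1_B x ^+ 2 <= (1 + s) * 1 by apply: ler_wpM2l => //; lra.
    rewrite -subr_ge0; apply: le_trans (addr_ge0 q3 (_ : 0 <= (1 + s) * 1 - (1 + s) * \1_B x ^+ 2)) _; first by rewrite subr_ge0.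
    by rewrite q4 le_eqVlt; apply/orP; left; apply/eqP; ring.
  rewrite E_lin; [|exact: bm_cst|exact: bh2].
  rewrite Ex_cst; have : (1 + s^-1) * Ex nu (fun x => h x ^+ 2) <= (1 + s^-1) * s ^+ 2.
    by apply: ler_wpM2l; [rewrite addr_ge0 ?invr_ge0 ?ltW|lra].
  have -> : (1 + s^-1) * s ^+ 2 = s ^+ 2 + s by field; rewrite gt_eqF.
  nra.
have bc := bm_cav nu bp.
have [opE _] := kopl_class nuH hs bc (cav_class nuH bp).
have := mix _ _ (cav_rpol nu pp) (cav_class nuH bp); rewrite -opE (kopl_cav nuH)// (Ex_cav nuH)// => main.
have {main} : kopl nu hs p 1%g - Ex nu p <= b * (1 + s).
  have bs0 : 0 <= b * (1 + s) by rewrite mulr_ge0//; lra.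
  apply: le_trans (ler_norm _) _; rewrite -(@ler_pXn2r _ 2)// ?nnegrE// real_normK ?num_real//.
  apply: le_trans main _; rewrite exprMn; apply: ler_wpM2l; first exact: sqr_ge0.
  exact: le_trans (cav_square nuH bp) p2.
have es : e = s * (b + 2) by rewrite /s mulfVK ?gt_eqF.
by rewrite hE in Eh; rewrite hK in Kh; rewrite es; lra.
Qed.

End approximated_mixing.

(** The rate [lam] stays free below [lam0], so that it can later be taken small enough to integrate
    over the angles. When the L2 bound does not apply the right side is at least 1. *)
Lemma mixing_sets (R : realType) : exists lam0 C : R, 0 < lam0 /\
  forall n (nu : probability (SO R n.+1.*2.+1) R) (B : set (SO R n.+1.*2.+1)) (ts : seq R) (lam : R),
  is_haar nu -> measurable B -> 0 < lam -> lam <= lam0 ->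
  kopl nu [seq rot12 n.+1 t | t <- ts] (\1_B) 1%g - Ex nu (\1_B) <=
    2 * expR (- (lam * (2 * (\sum_(t <- ts) sin (t / 2) ^+ 2) / n.+1%:R - ln n.+1%:R - C))).
Proof.
have [eta [C [eta0 mix]]] := @mixing_bound R.
have l20 : 0 < ln 2 :> R by rewrite ln_gt0//; lra.
exists (eta / 4 * ln 2), C; split; first by rewrite mulr_gt0// divr_gt0.
move=> n nu B ts lam nuH mB lam0 lamle.
set x := 2 * _ / _ - _; set y := x - C.
have b1 : bm (\1_B : SO R n.+1.*2.+1 -> R) by exact: bm_indic.
have [y4|y4] := leP 4 (eta * y).
  have y0 : 0 <= y by rewrite -(pmulr_rge0 _ eta0); lra.
  apply: mixing_indic => // K f pf cf.
  apply: le_trans (mix n nu K f ts nuH pf cf y4) _; apply: ler_wpM2r; first by apply: Ex_ge0 => g; exact: sqr_ge0.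
  rewrite exprMn -expRM_natr -natrX ler_pM2l ?ltr0n// ler_expR -/x -/y.
  have := ler_wpM2r y0 lamle; lra.
have : kopl nu [seq rot12 n.+1 t | t <- ts] (\1_B) 1%g <= 1.
  apply: le_trans (ler_norm _) _; apply: kopl_bound => // g.
  by case: (indic_val (R := R) B g) => ->; rewrite ?normr0 ?normr1.
have : 0 <= Ex nu (\1_B) by apply: Ex_ge0 => g; case: (indic_val (R := R) B g) => ->.
suff : 1 / 2 <= expR (- (lam * y)) by lra.
have -> : 1 / 2 = expR (- ln 2) :> R by rewrite expRN lnK ?posrE ?ltr0n// div1r.
rewrite ler_expR lerN2; have [y0|y0] := leP 0 y; last by apply: le_trans (ltW l20); rewrite pmulr_rle0// ltW.
apply: le_trans (ler_wpM2r y0 lamle) _; have := ler_wpM2r (ltW l20) (ltW y4); lra.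
Qed.

(** * The walk as an average over angles *)

Section kac_walk_step.
Context {R : realType} {n : nat} (nu : probability (SO R n.+1.*2.+1) R) (nuH : is_haar nu).
Context (xi : probability (measurableTypeR R) R).
Hypothesis xi_supp : xi `[0, pi]%classic = 1%E.
Local Notation G := (SO R n.+1.*2.+1).
Local Notation T := (measurableTypeR R).

Lemma Ex_supp (f : T -> R) : bm f -> (\int[xi]_(t in `[0%R, pi]) (f t)%:E)%E = (Ex xi f)%:E.
Proof.
move=> bf; rewrite -(Ex_EFin xi bf).
have mN : measurable (~` `[0, pi]%classic : set T) by exact: measurableC.
rewrite (@negligible_integral _ T R xi setT (~` `[0, pi]%classic))//; last 2 first.
- exact: bm_integrable.
- by apply: etrans (probability_setC xi (measurable_itv `[0, pi])) _; rewrite xi_supp subee.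
by rewrite setTD setCK.
Qed.

Lemma measurable_rot12 : measurable_fun setT (fun t : T => rot12 n.+1 t).
Proof.
have mc : measurable_fun setT (@cos R) by apply: continuous_measurable_fun; exact: continuous_cos.
have ms : measurable_fun setT (@sin R) by apply: continuous_measurable_fun; exact: continuous_sin.
apply: measurable_SO => i j.
rewrite (_ : (fun t => _) = fun t => rot12_mx n.*2.+1 t i j)//.
case: (split_ordP (i : 'I_(2 + n.*2.+1))) => a ->; case: (split_ordP (j : 'I_(2 + n.*2.+1))) => b ->.
- under eq_fun do rewrite /rot12_mx block_mxEul mxE.
  case: (a == b); first exact: mc.
  by case: (a < b)%N; [exact: measurable_funN|exact: ms].
- by under eq_fun do rewrite /rot12_mx block_mxEur mxE; exact: measurable_cst.
- by under eq_fun do rewrite /rot12_mx block_mxEdl mxE; exact: measurable_cst.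
- by under eq_fun do rewrite /rot12_mx block_mxEdr mxE; exact: measurable_cst.
Qed.

Definition pk (f : G -> R) : G -> R := fun X => Ex xi (fun t : T => kop nu (rot12 n.+1 t) f X).

Lemma bm_pk_arg (f : G -> R) : bm f -> bm (fun p : T * G => kop nu (rot12 n.+1 p.1) f p.2).
Proof.
move=> bf; apply: (bm_kop_joint nu (F := fun p : T * G => f p.2)); last exact: measurable_rot12.
by apply: (bm_comp bf); exact: measurable_snd.
Qed.

Lemma bm_pk (f : G -> R) : bm f -> bm (pk f).
Proof. by move=> bf; exact: (bm_Ex2 xi nu (bm_pk_arg bf)). Qed.

Lemma bm_iter_pk t (f : G -> R) : bm f -> bm (iter t pk f).
Proof. by move=> bf; elim: t => //= t; exact: bm_pk. Qed.

Lemma kac_kernelE (f : G -> R) : bm f -> kac_kernel nu xi (EFin \o f) = EFin \o pk f.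
Proof.
move=> bf; apply/funext => X; rewrite /kac_kernel /= /pk -Ex_supp; last exact: (bm_pair2 X (bm_pk_arg bf)).
by apply: eq_integral => t _; rewrite -Ex_EFin//; exact: bm_kop_arg.
Qed.

Lemma kac_lawE t (B : set G) : measurable B -> kac_law nu xi t B = (iter t pk (\1_B) 1%g)%:E.
Proof.
move=> mB; have bB : bm (\1_B : G -> R) by exact: bm_indic.
rewrite /kac_law; suff -> : iter t (kac_kernel nu xi) (EFin \o \1_B) = EFin \o iter t pk (\1_B) by [].
by elim: t => //= t ->; rewrite kac_kernelE//; exact: bm_iter_pk.
Qed.

Definition halfsin2 (t : T) : R := sin (t / 2) ^+ 2.

Lemma halfsin2_01 t : 0 <= halfsin2 t <= 1.
Proof. by rewrite /halfsin2 sqr_ge0/=; have := sin2cos2 (t / 2); have := sqr_ge0 (cos (t / 2)); lra. Qed.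

Lemma bm_halfsin2 : bm halfsin2.
Proof.
apply: bmX; split; last by exists 1 => t; rewrite ler_norml sin_geN1 sin_le1.
apply: measurableT_comp; first by apply: continuous_measurable_fun; exact: continuous_sin.
exact: measurable_funM.
Qed.

Lemma xi_sigma2E : xi_sigma2 xi = Ex xi halfsin2.
Proof. by rewrite /xi_sigma2 /Rintegral Ex_supp//; exact: bm_halfsin2. Qed.

Lemma bm_exp_halfsin2 u : 0 <= u -> bm (fun t => expR (- (u * halfsin2 t))).
Proof.
move=> u0; split.
  apply: (measurableT_comp (f := @expR R)); first exact: measurable_expR.
  by have [+ _] := bmN (bmM (bm_cst u) bm_halfsin2).
exists 1 => t; rewrite ger0_norm ?expR_ge0// -expR0 ler_expR oppr_le0 mulr_ge0//.
by have /andP[] := halfsin2_01 t.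
Qed.

(** Uses [exp (- x) <= 1 - x + x^2] together with [halfsin2 t ^ 2 <= halfsin2 t], so that only the
    mean [xi_sigma2 xi] appears. *)
Lemma halfsin2_laplace u : 0 <= u ->
  Ex xi (fun t => expR (- (u * halfsin2 t))) <= expR (- (u * xi_sigma2 xi * (1 - u))).
Proof.
move=> u0; have bs := bm_halfsin2.
have bZ (c : R) : bm (fun t => c * halfsin2 t) by apply: bmM => //; exact: bm_cst.
apply: (@le_trans _ _ (Ex xi (fun t => 1 + (- (u * (1 - u))) * halfsin2 t))).
  apply: Ex_le; [exact: bm_exp_halfsin2|by apply: bmD; [exact: bm_cst|exact: bZ]|].
  move=> t; have /andP[s0 s1] := halfsin2_01 t.
  apply: le_trans (expR_quad_le (mulr_ge0 u0 s0)) _.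
  have := mulr_ge0 (sqr_ge0 u) (mulr_ge0 s0 (_ : 0 <= 1 - halfsin2 t)); rewrite subr_ge0 => /(_ s1).
  move: (halfsin2 t) => s; nra.
rewrite (Ex_lin xi _ (bm_cst 1) bs) Ex_cst -xi_sigma2E.
by rewrite mulNr mulrAC; exact: expR_ge1Dx.
Qed.

(** Stated inside with a list [ts] of angles already fixed; each step of the walk appends one angle
    and integrates it, which produces one factor of the Laplace transform. *)
Lemma walk_bound (B : set G) (D u : R) t : measurable B -> 0 <= D -> 0 <= u ->
  (forall ts : seq R, kopl nu [seq rot12 n.+1 s | s <- ts] (\1_B) 1%g - Ex nu (\1_B) <=
     D * expR (- (u * \sum_(s <- ts) halfsin2 s))) ->
  iter t pk (\1_B) 1%g - Ex nu (\1_B) <= D * Ex xi (fun s => expR (- (u * halfsin2 s))) ^+ t.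
Proof.
move=> mB D0 u0 H; set q := Ex xi _.
have bB : bm (\1_B : G -> R) by exact: bm_indic.
have be := bm_exp_halfsin2 u0.
have main (ts : seq R) : kopl nu [seq rot12 n.+1 s | s <- ts] (iter t pk (\1_B)) 1%g - Ex nu (\1_B) <=
     D * expR (- (u * \sum_(s <- ts) halfsin2 s)) * q ^+ t.
  elim: t ts => [|t IH] ts; first by rewrite expr0 mulr1; exact: H.
  set hs := [seq _ | _ <- ts]; set g := iter t pk (\1_B).
  have bg : bm g by exact: bm_iter_pk.
  have [bj ->] := kopl_Ex_joint nu xi hs (bm_pk_arg bg).
  have bk : bm (fun s : T => kopl nu hs (fun X => kop nu (rot12 n.+1 s) g X) 1%g) by exact: (bm_pair2 (F := fun p : T * G => kopl nu hs (fun X => kop nu (rot12 n.+1 p.1) g X) p.2) 1%g bj).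
  rewrite -[X in _ - X](Ex_cst xi) -ExB//; last exact: bm_cst.
  have -> : D * expR (- (u * \sum_(s <- ts) halfsin2 s)) * q ^+ t.+1 =
      Ex xi (fun s => (D * expR (- (u * \sum_(s <- ts) halfsin2 s)) * q ^+ t) * expR (- (u * halfsin2 s))).
    by rewrite ExZ// exprSr mulrA.
  apply: Ex_le; [by apply: bmB => //; exact: bm_cst|by apply: bmM => //; exact: bm_cst|].
  move=> s; have := IH (rcons ts s).
  rewrite map_rcons {1}/kopl foldr_rcons -/(kopl nu hs _) big_rcons /= mulrDr opprD expRD.
  by move=> h; apply: le_trans h _; rewrite le_eqVlt; apply/orP; left; apply/eqP; ring.
by have := main [::]; rewrite big_nil mulr0 oppr0 expR0 mulr1.
Qed.

End kac_walk_step.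

Lemma kac_upper (R : realType) : exists lam C : R, 0 < lam /\
  forall n (nu : probability (SO R n.+1.*2.+1) R) (xi : probability (measurableTypeR R) R)
    (B : set (SO R n.+1.*2.+1)) (c : R) t,
  is_haar nu -> xi `[0, pi]%classic = 1%E -> 0 < xi_sigma2 xi -> measurable B -> 0 <= c ->
  t%:R = n.+1%:R * (ln n.+1%:R + c) / (2 * xi_sigma2 xi) ->
  iter t (pk nu xi) (\1_B) 1%g - Ex nu (\1_B) <= 2 * expR (C - lam * c).
Proof.
have [lam0 [C [lam00 mix]]] := @mixing_sets R.
pose lam := Num.min lam0 (1 / 4).
have lampos : 0 < lam by rewrite lt_min lam00; lra.
have lam4 : lam <= 1 / 4 by rewrite ge_min lexx orbT.
exists (lam / 2), (lam * C + 2 * lam ^+ 2); split; first by rewrite divr_gt0.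
move=> n nu xi B c t nuH xi_supp; set mu := xi_sigma2 xi => mu0 mB c0 tE.
set N : R := n.+1%:R in tE *.
have N1 : 1 <= N by rewrite ler1n.
have N0 : 0 < N by exact: lt_le_trans N1.
(* The exponent of [mixing_sets] split into the part linear in the sines and the rest. *)
pose u := 2 * lam / N; pose D := 2 * expR (lam * (ln N + C)).
have u0 : 0 <= u by rewrite divr_ge0// ?mulr_ge0// ltW.
apply: (@le_trans _ _ (D * Ex xi (fun s => expR (- (u * halfsin2 s))) ^+ t)).
  apply: walk_bound => // [|ts]; first by rewrite mulr_ge0 ?expR_ge0.
  apply: le_trans (mix n nu B ts lam nuH mB lampos _) _; first by rewrite ge_min lexx.
  rewrite /D -[leRHS]mulrA -expRD ler_pM2l// ler_expR le_eqVlt; apply/orP; left; apply/eqP.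
  by rewrite /u -/N /halfsin2; field; rewrite gt_eqF.
have q0 : 0 <= Ex xi (fun s => expR (- (u * halfsin2 s))) by apply: Ex_ge0 => s; exact: expR_ge0.
apply: (@le_trans _ _ (D * expR (- (u * mu * (1 - u))) ^+ t)).
  apply: ler_wpM2l; first by rewrite mulr_ge0 ?expR_ge0.
  by apply: lerXn2r; rewrite ?nnegrE ?expR_ge0//; exact: halfsin2_laplace.
rewrite /D -mulrA -expRM_natr -expRD ler_pM2l// ler_expR tE.
have -> : - (u * mu * (1 - u)) * (N * (ln N + c) / (2 * mu)) = - (lam * (ln N + c)) * (1 - 2 * lam / N).
  by rewrite /u; field; rewrite !gt_eqF.
have lnN : ln N <= N by apply: le_trans (ln_le_subr1 N0) _; lra.
have h1 : ln N / N <= 1 by rewrite ler_pdivrMr// mul1r.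
have h2 : 0 <= N^-1 <= 1 by rewrite invr_ge0 ltW//= invf_le1.
have -> : lam * (ln N + C) + - (lam * (ln N + c)) * (1 - 2 * lam / N) =
  lam * C + 2 * lam ^+ 2 * (ln N / N) + 2 * lam ^+ 2 * c * N^-1 - lam * c by ring.
have h3 := ler_wpM2l (mulr_ge0 (ler0n R 2) (sqr_ge0 lam)) h1.
(* The second order error of the Laplace transform is proportional to [c]; [lam <= 1/4] keeps it
   below half of the gain, so the final rate is [lam / 2]. *)
have h4 : 2 * lam ^+ 2 * c * N^-1 <= lam * c / 2.
  have /andP[_ i1] := h2; have lc : 0 <= lam * c by rewrite mulr_ge0// ltW.
  have := ler_wpM2l (mulr_ge0 (mulr_ge0 (ler0n R 2) (sqr_ge0 lam)) c0) i1.
  have := ler_wpM2l lc lam4; clear; move: (N^-1) => y h5 h6; rewrite mulr1 in h6; apply: le_trans h6 _; nra.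
move: h3 h4; move: (N^-1) (ln N) => y z; move: (z * y) => w; move: (2 * lam ^+ 2) => v; clear; lra.
Qed.

Lemma mxtrace_gram_ge0 (R : realDomainType) p q (C : 'M[R]_(p, q)) : 0 <= \tr (C^T *m C).
Proof. by apply: sumr_ge0 => i _; rewrite mxE; apply: sumr_ge0 => j _; rewrite mxE -expr2 sqr_ge0. Qed.

(** * Trace lower bound *)

Section trace_moments.
Context {R : realType} {n : nat} (nu : probability (SO R n.+1.*2.+1) R) (nuH : is_haar nu).
Local Notation N := n.+1.*2.+1.
Local Notation NN := (N%:R : R).
Local Notation G := (SO R N).

Definition c0 : 'I_N := @lshift 2 n.*2.+1 ord0.
Definition c1 : 'I_N := @lshift 2 n.*2.+1 (lift ord0 ord0).
Definition tr0 (X : G) : R := \tr (SO_mx X).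

Lemma bm_tr0 : bm tr0.
Proof. by apply: bm_sum => i _; exact: bm_entry. Qed.

Lemma SO_mulVmx (U : G) : (SO_mx U)^T *m SO_mx U = 1%:M.
Proof. by case: U => U /= /andP[/eqP h _]; exact: mulmx1C. Qed.

Lemma SO_mulmxV (U : G) : SO_mx U *m (SO_mx U)^T = 1%:M.
Proof. by case: U => U /= /andP[/eqP h _]. Qed.

Lemma trace_conj (U X : G) t : tr0 (U * rot12 n.+1 t * U^-1 * X)%g =
  tr0 X + (cos t - 1) * (qf (fun=> SO_mx X) c0 c0 U + qf (fun=> SO_mx X) c1 c1 U) +
  sin t * (qf (fun=> SO_mx X) c0 c1 U - qf (fun=> SO_mx X) c1 c0 U).
Proof.
have E : tr0 (U * rot12 n.+1 t * U^-1 * X)%g = \tr (rot12_mx n.*2.+1 t *m ((SO_mx U)^T *m SO_mx X *m SO_mx U)).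
  rewrite /tr0 (_ : SO_mx _ = SO_mx U *m (rot12_mx n.*2.+1 t *m ((SO_mx U)^T *m SO_mx X))).
    by rewrite mxtrace_mulC -!mulmxA.
  by rewrite !mulmxA.
have TX : tr0 X = \tr ((SO_mx U)^T *m SO_mx X *m SO_mx U).
  by rewrite /tr0 mxtrace_mulC mulmxA SO_mulmxV mul1mx.
rewrite {}E {}TX /qf; move: ((SO_mx U)^T *m SO_mx X *m SO_mx U) => Y.
have -> : Y c0 c0 = ulsubmx (Y : 'M[R]_(2 + n.*2.+1)) ord0 ord0 by rewrite !mxE.
have -> : Y c1 c1 = ulsubmx (Y : 'M[R]_(2 + n.*2.+1)) (lift ord0 ord0) (lift ord0 ord0) by rewrite !mxE.
have -> : Y c0 c1 = ulsubmx (Y : 'M[R]_(2 + n.*2.+1)) ord0 (lift ord0 ord0) by rewrite !mxE.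
have -> : Y c1 c0 = ulsubmx (Y : 'M[R]_(2 + n.*2.+1)) (lift ord0 ord0) ord0 by rewrite !mxE.
have S1 k (r : 'M[R]_2) (Z : 'M[R]_(2 + k)) : \tr (block_mx r 0 0 1%:M *m Z) = \tr (r *m ulsubmx Z) + \tr (drsubmx Z).
  by rewrite -{1}(submxK Z) mulmx_block mxtrace_block !mul0mx addr0 add0r mul1mx.
have S2 k (Z : 'M[R]_(2 + k)) : \tr Z = \tr (ulsubmx Z) + \tr (drsubmx Z) by rewrite -{1}(submxK Z) mxtrace_block.
rewrite (S1 n.*2.+1 (rot2 t) Y) (S2 n.*2.+1 Y).
move: (ulsubmx _) (\tr (drsubmx _)) => A z; rewrite /mxtrace !big_ord_recl !big_ord0 !mxE !big_ord_recl !big_ord0 !mxE /=.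
ring.
Qed.

Definition symm (X : G) : 'M[R]_N := 2^-1 *: (SO_mx X + (SO_mx X)^T).
Definition anti (X : G) : 'M[R]_N := SO_mx X - (SO_mx X)^T.

Lemma symm_tr X : (symm X)^T = symm X.
Proof. by rewrite /symm linearZ /= linearD /= trmxK addrC. Qed.

Lemma anti_tr X : (anti X)^T = - anti X.
Proof. by rewrite /anti linearB /= trmxK opprB. Qed.

Lemma tr_symm X : \tr (symm X) = tr0 X.
Proof. by rewrite /symm mxtraceZ mxtraceD mxtrace_tr /tr0; field. Qed.

Lemma qf_tr (A : 'M[R]_N) b c U : qf (fun=> A) b c U = qf (fun=> A^T) c b U.
Proof.
have E : ((SO_mx U)^T *m A *m SO_mx U)^T = (SO_mx U)^T *m A^T *m SO_mx U by rewrite !trmx_mul trmxK mulmxA.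
by rewrite /qf -E [RHS]mxE.
Qed.

Lemma qf_symm X b U : qf (fun=> SO_mx X) b b U = qf (fun=> symm X) b b U.
Proof.
have -> : qf (fun=> symm X) b b U = 2^-1 * (qf (fun=> SO_mx X) b b U + qf (fun=> (SO_mx X)^T) b b U).
  by rewrite /qf /symm -scalemxAr -scalemxAl mulmxDr mulmxDl !mxE.
by rewrite -qf_tr; field.
Qed.

Lemma qf_anti X U : qf (fun=> SO_mx X) c0 c1 U - qf (fun=> SO_mx X) c1 c0 U = qf (fun=> anti X) c0 c1 U.
Proof. by rewrite [qf _ c1 c0 U]qf_tr /qf /anti mulmxBr mulmxBl [in RHS]mxE [X in _ = _ + X]mxE. Qed.

Lemma trace_squares X : [/\ \tr (symm X *m symm X) <= NN & \tr ((anti X)^T *m anti X) <= 4 * NN].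
Proof.
have t1 : \tr (SO_mx X *m (SO_mx X)^T) = NN by rewrite SO_mulmxV mxtrace1.
have t2 : \tr ((SO_mx X)^T *m SO_mx X) = NN by rewrite SO_mulVmx mxtrace1.
have t3 : \tr ((SO_mx X)^T *m (SO_mx X)^T) = \tr (SO_mx X *m SO_mx X) by rewrite -trmx_mul mxtrace_tr.
have a : \tr ((anti X)^T *m anti X) = 2 * NN - 2 * \tr (SO_mx X *m SO_mx X).
  have tB (A B : 'M[R]_N) : \tr (A - B) = \tr A - \tr B by rewrite raddfB.
  have tN (A : 'M[R]_N) : \tr (- A) = - \tr A by rewrite raddfN.
  rewrite anti_tr /anti mulNmx tN mulmxBr tB !mulmxBl !tB t1 t2 t3.
  by move: (\tr _) => y; ring.
have b : \tr (symm X *m symm X) = 2^-1 * (NN + \tr (SO_mx X *m SO_mx X)).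
  rewrite /symm -scalemxAr -scalemxAl mulmxDr !mulmxDl !mxtraceZ !mxtraceD t1 t2 t3.
  by move: (\tr _) => y; field.
have := mxtrace_gram_ge0 (anti X); have := mxtrace_gram_ge0 (symm X); rewrite symm_tr a b; lra.
Qed.

(** Stein's identity with [W] the identity function. *)
Lemma qf_square_mean (c : 'I_N) (A : 'M[R]_N) : A^T = A ->
  NN * (NN + 2) * Ex nu (fun U => qf (fun=> A) c c U ^+ 2) = (\tr A) ^+ 2 + 2 * \tr (A *m A).
Proof.
move=> sA; have bZ : bm (qf (fun=> A) c c) by apply: bm_qf; exact: bmx_cst.
have bZZ : bm (qf (fun=> A *m A) c c) by apply: bm_qf; exact: bmx_cst.
have fixc : fixed_by_rotations c pred0 (fun=> A) by [].
have := @qf_identity _ _ nu nuH c pred0 (fun=> A) (fun=> A) (fun z => z) (fun=> 1)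
  isT (bmx_cst _) (bmx_cst _) fixc fixc (fun=> sA) (fun=> sA) (fun _ _ _ (h : pred0 _) => match notF h with end)
  (fun z => is_derive_id z 1) bZ (bm_cst 1).
rewrite card0 subn0 (_ : (fun U => _) = fun U => (\tr A * qf (fun=> A) c c U + 2 * qf (fun=> A *m A) c c U) - (NN + 2) * qf (fun=> A) c c U ^+ 2); last first.
  by apply/funext => U; ring.
have bZ2 := bmX 2 bZ.
have bC (k : R) (f : G -> R) : bm f -> bm (fun x => k * f x) by move=> bf; apply: bmM => //; exact: bm_cst.
rewrite ExB ?ExD ?ExZ//; [|exact: bC|exact: bC|by apply: bmD; exact: bC|exact: bC].
have m1 := proj_mean nuH c sA.
have m2 : NN * Ex nu (qf (fun=> A *m A) c c) = \tr (A *m A) by apply: proj_mean => //; rewrite trmx_mul sA.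
move=> h; rewrite -m2 -mulrA.
have -> : (NN + 2) * Ex nu (fun U => qf (fun=> A) c c U ^+ 2) = \tr A * Ex nu (qf (fun=> A) c c) + 2 * Ex nu (qf (fun=> A *m A) c c) by lra.
by rewrite mulrDr mulrCA m1; ring.
Qed.

(** Given column 0, the vector [v = anti X * col c0] is fixed and, by antisymmetry, orthogonal to
    that column. Stein's identity with the rank one matrix [v v^T] over the other columns yields
    [|v|^2 / (NN - 1)] for the squared component along column 1. *)
Lemma anti_square_mean X : NN * (NN - 1) * Ex nu (fun U => qf (fun=> anti X) c0 c1 U ^+ 2) = \tr ((anti X)^T *m anti X).
Proof.
set B := anti X; pose v (U : G) : 'cV[R]_N := B *m col c0 (SO_mx U).
have c10 : ~~ pred1 c0 c1 by [].
have bv p : bm (fun U => v U p 0).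
  rewrite (_ : (fun U => _) = fun U => \sum_(j < N) B p j * SO_mx U j c0); last first.
    by apply/funext => U; rewrite /v mxE; apply: eq_bigr => j _; rewrite [col _ _ _ _]mxE.
  by apply: bm_sum => j _; apply: bmM; [exact: bm_cst|exact: bm_entry].
have bB : bmx (fun U => v U *m (v U)^T).
  move=> p q; rewrite (_ : (fun U => _) = fun U => v U p 0 * v U q 0); first exact: bmM.
  by apply/funext => U; rewrite mxE big_ord1 [_^T _ _]mxE.
have fB : fixed_by_rotations c1 (pred1 c0) (fun U => v U *m (v U)^T).
  move=> j aj Kj U s; suff -> : v (U * prot aj s)%g = v U by [].
  congr (B *m _); apply/colP => i; rewrite [LHS]mxE [RHS]mxE.
  by apply: prot_entry_o => //; rewrite eq_sym.
have qv b U : ((SO_mx U)^T *m v U) b 0 = qf (fun=> B) b c0 U.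
  by rewrite /v mulmxA /qf !mxE; apply: eq_bigr => j _; rewrite [col _ _ _ _]mxE.
have qvv b c U : qf (fun U => v U *m (v U)^T) b c U = qf (fun=> B) b c0 U * qf (fun=> B) c c0 U.
  rewrite /qf mulmxA -mulmxA (_ : (v U)^T *m SO_mx U = ((SO_mx U)^T *m v U)^T); last by rewrite [RHS]trmx_mul trmxK.
  by rewrite mxE big_ord1 [_^T _ _]mxE !qv.
have q00 U : qf (fun=> B) c0 c0 U = 0.
  have := qf_tr B c0 c0 U; rewrite anti_tr /qf mulmxN mulNmx [X in _ = X]mxE => h.
  by move: h; move: (_ c0 c0) => y; lra.
have q01 U : qf (fun=> B) c1 c0 U = - qf (fun=> B) c0 c1 U.
  by rewrite qf_tr anti_tr /qf mulmxN mulNmx mxE.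
have b0 : bmx (fun=> 0 : 'M[R]_N) by move=> p q; exact: bm_cst.
have bd : bm (qf (fun=> B) c0 c1) by apply: bm_qf; exact: bmx_cst.
have := @qf_identity _ _ nu nuH c1 (pred1 c0) (fun=> 0) (fun U => v U *m (v U)^T) (fun=> 1) (fun=> 0)
  c10 b0 bB (fun _ _ _ _ _ => erefl) fB (fun=> trmx0 _ _ _) _ _ (fun z => is_derive_cst (1 : R) z 1) (bm_cst 1) (bm_cst 0).
have -> : (fun U => (\tr (v U *m (v U)^T) - (N - #|pred1 c0|)%:R * qf (fun U0 => v U0 *m (v U0)^T) c1 c1 U) * 1 +
   2 * 0 * (qf (fun U0 => v U0 *m (v U0)^T *m 0) c1 c1 U - qf (fun U0 => v U0 *m (v U0)^T) c1 c1 U * qf (fun=> 0) c1 c1 U)) =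
   fun U => qf (fun=> B^T *m B) c0 c0 U - (NN - 1) * qf (fun=> B) c0 c1 U ^+ 2.
  apply/funext => U; rewrite qvv q01 card1 natrB//.
  have -> : \tr (v U *m (v U)^T) = qf (fun=> B^T *m B) c0 c0 U.
    have Q (A : 'M[R]_N) : qf (fun=> A) c0 c0 U = ((col c0 (SO_mx U))^T *m A *m col c0 (SO_mx U)) 0 0.
      by rewrite /qf tr_col -row_mul [LHS]mxE [RHS]mxE; apply: eq_bigr => p _; congr (_ * _); rewrite [RHS]mxE.
    by rewrite mxtrace_mulC /mxtrace big_ord1 Q /v trmx_mul !mulmxA.
  by ring.
move=> h0; have sq : bm (fun U => qf (fun=> B) c0 c1 U ^+ 2) by exact: bmX.
have bq : bm (qf (fun=> B^T *m B) c0 c0) by apply: bm_qf; exact: bmx_cst.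
have {}h0 : Ex nu (fun U => qf (fun=> B^T *m B) c0 c0 U - (NN - 1) * qf (fun=> B) c0 c1 U ^+ 2) = 0.
  apply: h0; first by move=> U; rewrite [LHS]trmx_mul trmxK.
  by move=> U j c /eqP ->; rewrite qvv q00 mul0r.
move: h0; rewrite ExB ?ExZ//; last by apply: bmM => //; exact: bm_cst.
move=> h; have m : NN * Ex nu (qf (fun=> B^T *m B) c0 c0) = \tr (B^T *m B).
  by apply: proj_mean => //; rewrite trmx_mul trmxK.
by rewrite -m -mulrA; congr (_ * _); apply/esym/eqP; rewrite -subr_eq0 h.
Qed.

End trace_moments.

Section trace_walk.
Context {R : realType} {n : nat} (nu : probability (SO R n.+1.*2.+1) R) (nuH : is_haar nu).
Local Notation N := n.+1.*2.+1.
Local Notation NN := (N%:R : R).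
Local Notation G := (SO R N).

Lemma dim_ge3 : 3 <= NN.
Proof. by rewrite ler_nat. Qed.

(** Rotating by pi in the plane of column 1 and a third column changes the sign of column 1 and
    preserves Haar measure. *)
Lemma anti_mean X : Ex nu (qf (fun=> anti X) c0 c1) = 0.
Proof.
pose c2 : 'I_N := @rshift 2 n.*2.+1 ord0.
have c12 : c1 != c2 by [].
set B := anti X; have bd : bm (qf (fun=> B) c0 c1) by apply: bm_qf; exact: bmx_cst.
have E := Ex_mulr nuH (prot c12 pi) bd.
suff F : (fun g => qf (fun=> B) c0 c1 (g * prot c12 pi)%g) = fun g => -1 * qf (fun=> B) c0 c1 g.
  by move: E; rewrite F ExZ//; lra.
apply/funext => U; rewrite !qfE mulr_sumr; apply: eq_bigr => p _; rewrite mulr_sumr; apply: eq_bigr => q _.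
have -> : SO_mx (U * prot c12 pi)%g p c0 = SO_mx U p c0 by exact: prot_entry_o.
have -> : SO_mx (U * prot c12 pi)%g q c1 = - SO_mx U q c1.
  by apply: etrans (prot_entry_a (SO_mx U) pi q c12) _; rewrite cospi sinpi mul0r addr0 mulN1r.
by ring.
Qed.

(** The trace of [symm X] compressed to the random plane, centred: together with the antisymmetric
    term it is the noise in one step of the trace. *)
Definition pvar X (U : G) := qf (fun=> symm X) c0 c0 U + qf (fun=> symm X) c1 c1 U - 2 * tr0 X / NN.

Lemma bm_qf_cst (A : 'M[R]_N) b c : bm (qf (fun=> A) b c : G -> R).
Proof. by apply: bm_qf; exact: bmx_cst. Qed.

Lemma bm_pvar X : bm (pvar X).
Proof. by apply: bmB; [apply: bmD; exact: bm_qf_cst|exact: bm_cst]. Qed.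

Lemma pvar_mean X : Ex nu (pvar X) = 0.
Proof.
have N0 : NN != 0 by rewrite pnatr_eq0.
have m c : Ex nu (qf (fun=> symm X) c c) = tr0 X / NN.
  apply/eqP; rewrite eq_sym -subr_eq0 -(mulrI_eq0 _ (mulfI N0)); apply/eqP.
  by rewrite mulrBr (proj_mean nuH c (symm_tr X)) tr_symm; field.
rewrite /pvar ExB; [|by apply: bmD; exact: bm_qf_cst|exact: bm_cst].
rewrite ExD ?Ex_cst ?m; [by field|exact: bm_qf_cst|exact: bm_qf_cst].
Qed.

Lemma pvar_square X : Ex nu (fun U => pvar X U ^+ 2) <= 8 / NN.
Proof.
have N3 := dim_ge3; have N0 : 0 < NN by lra.
pose z c (U : G) := qf (fun=> symm X) c c U - tr0 X / NN.
have bz c : bm (z c) by apply: bmB; [exact: bm_qf_cst|exact: bm_cst].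
have bz2 c : bm (fun U => z c U ^+ 2) by apply: bmX.
have bC (k : R) (f : G -> R) : bm f -> bm (fun x => k * f x) by move=> bf; apply: bmM => //; exact: bm_cst.
have zv c : Ex nu (fun U => z c U ^+ 2) <= 2 / NN.
  have bq := bm_qf_cst (symm X) c c; have bq2 := bmX 2 bq.
  have s2 := qf_square_mean nuH c (symm_tr X); have m := proj_mean nuH c (symm_tr X).
  have [tA _] := trace_squares X; rewrite tr_symm in s2 m.
  have -> : (fun U => z c U ^+ 2) = fun U => (qf (fun=> symm X) c c U ^+ 2 + (- 2 * (tr0 X / NN)) * qf (fun=> symm X) c c U) + (tr0 X / NN) ^+ 2.
    by apply/funext => U; rewrite /z; ring.
  rewrite ExD; [|by apply: bmD => //; exact: bC|exact: bm_cst].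
  rewrite ExD; [|exact: bq2|exact: bC].
  rewrite ExZ// Ex_cst.
  have -> : Ex nu (qf (fun=> symm X) c c) = tr0 X / NN by rewrite -m; field; rewrite gt_eqF.
  have -> : Ex nu (fun x => qf (fun=> symm X) c c x ^+ 2) = (tr0 X ^+ 2 + 2 * \tr (symm X *m symm X)) / (NN * (NN + 2)).
    by rewrite -s2; field; rewrite !gt_eqF// ltr_wpDl// ltW.
  have -> : (tr0 X ^+ 2 + 2 * \tr (symm X *m symm X)) / (NN * (NN + 2)) + - 2 * (tr0 X / NN) * (tr0 X / NN) + (tr0 X / NN) ^+ 2 =
     (2 * NN * \tr (symm X *m symm X) - 2 * tr0 X ^+ 2) / (NN ^+ 2 * (NN + 2)).
    by field; rewrite !gt_eqF// ltr_wpDl// ltW.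
  rewrite ler_pdivrMr; last by rewrite mulr_gt0 ?exprn_gt0//; lra.
  have -> : 2 / NN * (NN ^+ 2 * (NN + 2)) = 2 * NN * (NN + 2) by field; rewrite gt_eqF.
  have h1 := ler_wpM2l (ltW N0) tA; have h2 := sqr_ge0 (tr0 X).
  move: h1 h2 N0; move: (NN) (tr0 X ^+ 2) (\tr _) => x y w; clear; nra.
apply: (@le_trans _ _ (Ex nu (fun U => 2 * z c0 U ^+ 2 + 2 * z c1 U ^+ 2))).
  apply: Ex_le; [by apply: bmX; exact: bm_pvar|by apply: bmD; exact: bC|].
  move=> U; have -> : pvar X U = z c0 U + z c1 U by rewrite /pvar /z; field; rewrite gt_eqF.
  have := sqr_ge0 (z c0 U - z c1 U); move: (z c0 U) (z c1 U) => x y; clear; nra.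
rewrite ExD ?ExZ//; [|exact: bC|exact: bC].
have := zv c0; have := zv c1; move: (NN^-1) => y; lra.
Qed.

Lemma anti_square X : Ex nu (fun U => qf (fun=> anti X) c0 c1 U ^+ 2) <= 6 / NN.
Proof.
have N3 := dim_ge3; have N0 : 0 < NN by lra. have N1 : 0 < NN - 1 by lra.
have [_ tA] := trace_squares X; rewrite -(anti_square_mean nuH) in tA.
set v := Ex nu _ in tA *; rewrite ler_pdivlMr//.
have : (NN - 1) * v <= 4 by rewrite -(ler_pM2l N0); move: tA; clear; lra.
have v0 : 0 <= v by apply: Ex_ge0 => U; exact: sqr_ge0.
clear tA; move: N3 v0; move: (NN) v => x v; clear; nra.
Qed.

Lemma trace_conjE (X U : G) t : tr0 (U * rot12 n.+1 t * U^-1 * X)%g =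
  (1 - 4 * halfsin2 t / NN) * tr0 X + ((- 2 * halfsin2 t) * pvar X U + sin t * qf (fun=> anti X) c0 c1 U).
Proof.
rewrite trace_conj !qf_symm qf_anti /pvar.
have -> : cos t - 1 = - 2 * halfsin2 t.
  rewrite {1}(splitr t) cosD -!expr2 /halfsin2; have := sin2cos2 (t / 2); lra.
by have : NN != 0; [rewrite pnatr_eq0|move: (NN) => x x0; field].
Qed.

Lemma bm_noise (a b : R) X : bm (fun U => a * pvar X U + b * qf (fun=> anti X) c0 c1 U).
Proof. by apply: bmD; apply: bmM; rewrite ?bm_cst//; [exact: bm_cst|exact: bm_pvar|exact: bm_cst|exact: bm_qf_cst]. Qed.

Lemma kop_trace t X : kop nu (rot12 n.+1 t) tr0 X = (1 - 4 * halfsin2 t / NN) * tr0 X.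
Proof.
rewrite /kop; under eq_fun do rewrite trace_conjE.
rewrite ExD ?Ex_cst; [|exact: bm_cst|exact: bm_noise].
have bC (k : R) (f : G -> R) : bm f -> bm (fun x => k * f x) by move=> bf; apply: bmM => //; exact: bm_cst.
have bp := bm_pvar X; have bq := bm_qf_cst (anti X) c0 c1.
by rewrite ExD ?ExZ ?pvar_mean ?anti_mean ?mulr0 ?addr0//; exact: bC.
Qed.

Lemma sin_sq_half t : sin t ^+ 2 <= 4 * halfsin2 t :> R.
Proof.
have -> : sin t = 2 * (sin (t / 2) * cos (t / 2)).
  by rewrite [in LHS](splitr t) sinD; ring.
rewrite /halfsin2; have := sin2cos2 (t / 2); have := sqr_ge0 (sin (t / 2)).
have := sqr_ge0 (sin (t / 2)); rewrite exprMn exprMn.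
move: (sin _ ^+ 2) (cos _ ^+ 2) => x y; clear; nra.
Qed.

(** The noise has mean zero, so only its variance is added: with [s = halfsin2 t], at most
    [8 s * 8 / NN] from [pvar] and [2 * 4 s * 6 / NN] from the antisymmetric part, in total
    [112 s / NN]. *)
Lemma kop_trace_square t X : kop nu (rot12 n.+1 t) (fun g => tr0 g ^+ 2) X <=
  (1 - 4 * halfsin2 t / NN) ^+ 2 * tr0 X ^+ 2 + 112 * halfsin2 t / NN.
Proof.
have N3 := dim_ge3; have N0 : 0 < NN by lra.
rewrite /kop; set s := halfsin2 t; set a := (1 - 4 * s / NN) * tr0 X.
have /andP[s0 s1] := halfsin2_01 t; rewrite -/s in s0 s1.
pose w U := (- 2 * s) * pvar X U + sin t * qf (fun=> anti X) c0 c1 U.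
have bp := bm_pvar X; have bq := bm_qf_cst (anti X) c0 c1.
have bp2 := bmX 2 bp; have bq2 := bmX 2 bq.
have bw : bm w by exact: bm_noise.
have bC (k : R) (f : G -> R) : bm f -> bm (fun x => k * f x) by move=> bf; apply: bmM => //; exact: bm_cst.
rewrite -exprMn -/a.
apply: (@le_trans _ _ (Ex nu (fun U => (a ^+ 2 + (2 * a) * w U) + ((8 * s ^+ 2) * pvar X U ^+ 2 + (2 * sin t ^+ 2) * qf (fun=> anti X) c0 c1 U ^+ 2)))).
  apply: Ex_le.
  - by apply: bmX; apply: bm_kop_arg; exact: bm_tr0.
  - by apply: bmD; apply: bmD; [exact: bm_cst|exact: bC|exact: bC|exact: bC].
  move=> U; rewrite trace_conjE -/s -/a -/(w U).
  have : w U ^+ 2 <= (8 * s ^+ 2) * pvar X U ^+ 2 + (2 * sin t ^+ 2) * qf (fun=> anti X) c0 c1 U ^+ 2.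
    rewrite /w; have := sqr_ge0 ((- 2 * s) * pvar X U - sin t * qf (fun=> anti X) c0 c1 U).
    move: (pvar X U) (sin t) (qf _ _ _ _) => x y z; clear; move=> h; rewrite -subr_ge0; apply: le_trans h _.
    by rewrite le_eqVlt; apply/orP; left; apply/eqP; ring.
  move: (w U) => x; move: (_ + _ * _ ^+ 2) => y h.
  have -> : (a + x) ^+ 2 = a ^+ 2 + 2 * a * x + x ^+ 2 by ring.
  by rewrite lerD2l.
rewrite ExD; [|by apply: bmD; [exact: bm_cst|exact: bC]|by apply: bmD; exact: bC].
rewrite ExD; [|exact: bm_cst|exact: bC].
rewrite [in X in _ + X]ExD; [|exact: bC|exact: bC].
rewrite Ex_cst !ExZ//.
have -> : Ex nu w = 0.
  rewrite /w ExD; [|exact: bC|exact: bC].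
  by rewrite !ExZ// pvar_mean anti_mean !mulr0 addr0.
rewrite mulr0 addr0 lerD2l.
have h1 : 8 * s ^+ 2 * Ex nu (fun U => pvar X U ^+ 2) <= 8 * s * (8 / NN).
  apply: ler_pM; [by rewrite mulr_ge0// sqr_ge0|by apply: Ex_ge0 => U; exact: sqr_ge0| |exact: pvar_square].
  by rewrite ler_pM2l// expr2 -[leRHS]mulr1 ler_wpM2l.
have h2 : 2 * sin t ^+ 2 * Ex nu (fun U => qf (fun=> anti X) c0 c1 U ^+ 2) <= 2 * (4 * s) * (6 / NN).
  apply: ler_pM; [by rewrite mulr_ge0// sqr_ge0|by apply: Ex_ge0 => U; exact: sqr_ge0| |exact: anti_square].
  by rewrite ler_pM2l//; exact: sin_sq_half.
apply: le_trans (lerD h1 h2) _; rewrite le_eqVlt; apply/orP; left; apply/eqP; ring.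
Qed.

End trace_walk.

Section trace_chebyshev.
Context {R : realType} {n : nat} (nu : probability (SO R n.+1.*2.+1) R) (nuH : is_haar nu).
Context (xi : probability (measurableTypeR R) R).
Hypothesis xi_supp : xi `[0, pi]%classic = 1%E.
Local Notation N := n.+1.*2.+1.
Local Notation NN := (N%:R : R).
Local Notation G := (SO R N).
Local Notation mu := (xi_sigma2 xi).
Hypothesis mu0 : 0 < mu.

Lemma xi_sigma2_le1 : mu <= 1.
Proof.
rewrite (xi_sigma2E xi_supp) -[leRHS](Ex_cst xi); apply: Ex_le; [exact: bm_halfsin2|exact: bm_cst|].
by move=> t; have /andP[] := halfsin2_01 t.
Qed.

Lemma bm_pk_fiber (f : G -> R) X : bm f -> bm (fun t : measurableTypeR R => kop nu (rot12 n.+1 t) f X).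
Proof. by move=> bf; exact: (bm_pair2 X (bm_pk_arg nu bf)). Qed.

Lemma pk_lin (f g : G -> R) a : bm f -> bm g -> pk nu xi (fun x => f x + a * g x) = fun x => pk nu xi f x + a * pk nu xi g x.
Proof.
move=> bf bg; apply/funext => X; rewrite /pk -Ex_lin; [|exact: bm_pk_fiber|exact: bm_pk_fiber].
by congr Ex; apply/funext => t; rewrite kop_lin.
Qed.

Lemma pk_ge0 (f : G -> R) : (forall x, 0 <= f x) -> forall x, 0 <= pk nu xi f x.
Proof. by move=> f0 x; apply: Ex_ge0 => t; apply: Ex_ge0. Qed.

Lemma pk_cst c : pk nu xi (fun=> c) = fun=> c.
Proof. by apply/funext => X; rewrite /pk /kop; under eq_fun do rewrite Ex_cst; rewrite Ex_cst. Qed.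

Lemma pk_le (f g : G -> R) : bm f -> bm g -> (forall x, f x <= g x) -> forall x, pk nu xi f x <= pk nu xi g x.
Proof.
move=> bf bg fg x; rewrite -subr_ge0; have := @pk_ge0 (fun x => g x + (-1) * f x) _ x.
by rewrite pk_lin// mulN1r; apply => y; rewrite mulN1r subr_ge0.
Qed.

Lemma iter_pk_lin t (f g : G -> R) a : bm f -> bm g ->
  iter t (pk nu xi) (fun x => f x + a * g x) = fun x => iter t (pk nu xi) f x + a * iter t (pk nu xi) g x.
Proof. by move=> bf bg; elim: t => //= t ->; rewrite pk_lin//; exact: bm_iter_pk. Qed.

Lemma iter_pk_cst t c : iter t (pk nu xi) (fun=> c) = fun=> c.
Proof. by elim: t => //= t ->; exact: pk_cst. Qed.

Lemma iter_pk_le t (f g : G -> R) : bm f -> bm g -> (forall x, f x <= g x) ->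
  forall x, iter t (pk nu xi) f x <= iter t (pk nu xi) g x.
Proof. by move=> bf bg fg; elim: t => //= t IH; apply: pk_le => //; exact: bm_iter_pk. Qed.

Let bC (k : R) (f : G -> R) : bm f -> bm (fun x => k * f x).
Proof. by move=> bf; apply: bmM => //; exact: bm_cst. Qed.

Let bt : bm (tr0 : G -> R) := bm_tr0.
Let bt2 : bm (fun x : G => tr0 x ^+ 2) := bmX 2 bt.
Let bs := @bm_halfsin2 R.

Lemma pk_trace X : pk nu xi tr0 X = (1 - 4 * mu / NN) * tr0 X.
Proof.
rewrite /pk; under eq_fun do rewrite kop_trace//.
rewrite (_ : (fun t => _) = fun t => tr0 X + (- (4 * tr0 X / NN)) * halfsin2 t); last first.
  by apply/funext => t; ring.
by rewrite (Ex_lin xi _ (bm_cst _) bs) Ex_cst -(xi_sigma2E xi_supp); ring.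
Qed.

Lemma iter_pk_trace t X : iter t (pk nu xi) tr0 X = (1 - 4 * mu / NN) ^+ t * tr0 X.
Proof.
elim: t X => [|t IH] X; first by rewrite expr0 mul1r.
rewrite /= (_ : iter t (pk nu xi) tr0 = fun x => 0 + (1 - 4 * mu / NN) ^+ t * tr0 x); last first.
  by apply/funext => x; rewrite add0r.
by rewrite pk_lin ?pk_cst ?add0r ?pk_trace ?mulrA ?exprSr//; exact: bm_cst.
Qed.

(* Bounds the mean over [xi] of (1 - 4 sin(t/2)^2 / N)^2, since sin(t/2)^4 <= sin(t/2)^2. *)
Definition rho2 : R := 1 - 8 * mu / NN + 16 * mu / NN ^+ 2.

(** The constant 42 is the value at which the inequality becomes an equality for [NN = 3], the
    smallest dimension; it makes 42 a stationary level for the second moment of the trace. *)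
Lemma rho2_gap : 0 <= rho2 /\ 112 * mu / NN <= 42 * (1 - rho2).
Proof.
have N3 := @dim_ge3 R n; have N0 : 0 < NN by lra.
have m1 := xi_sigma2_le1.
rewrite /rho2; have -> : 1 - 8 * mu / NN + 16 * mu / NN ^+ 2 = ((NN - 4) ^+ 2 * mu + NN ^+ 2 * (1 - mu)) / NN ^+ 2.
  by field; rewrite gt_eqF.
split.
  apply: divr_ge0; last exact: sqr_ge0.
  by apply: addr_ge0; apply: mulr_ge0; [exact: sqr_ge0|exact: ltW|exact: sqr_ge0|rewrite subr_ge0].
have -> : 42 * (1 - ((NN - 4) ^+ 2 * mu + NN ^+ 2 * (1 - mu)) / NN ^+ 2) = 112 * mu / NN + 224 * mu * (NN - 3) / NN ^+ 2.
  by field; rewrite gt_eqF.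
rewrite lerDl; apply: divr_ge0; last exact: sqr_ge0.
by apply: mulr_ge0; [rewrite mulr_ge0// ltW|rewrite subr_ge0].
Qed.

Lemma pk_trace_square X : pk nu xi (fun x => tr0 x ^+ 2) X <= rho2 * tr0 X ^+ 2 + 42 * (1 - rho2).
Proof.
have N3 := @dim_ge3 R n; have N0 : 0 < NN by lra.
set T2 := tr0 X ^+ 2; have T20 : 0 <= T2 by exact: sqr_ge0.
pose a := (16 / NN ^+ 2 - 8 / NN) * T2 + 112 / NN.
apply: (@le_trans _ _ (Ex xi (fun t => T2 + a * halfsin2 t))).
  apply: Ex_le; [exact: bm_pk_fiber|by apply: bmD; [exact: bm_cst|apply: bmM => //; exact: bm_cst]|].
  move=> t; apply: le_trans (kop_trace_square nuH t X) _; rewrite -/T2 /a.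
  have /andP[s0 s1] := halfsin2_01 t; move: (halfsin2 t) s0 s1 => s s0 s1.
  have h : 0 <= 16 / NN ^+ 2 * T2 * (s * (1 - s)).
    apply: mulr_ge0; first by apply: mulr_ge0 => //; apply: divr_ge0 => //; exact: sqr_ge0.
    by apply: mulr_ge0 => //; rewrite subr_ge0.
  rewrite -subr_ge0; apply: le_trans h _; rewrite le_eqVlt; apply/orP; left; apply/eqP.
  by field; rewrite gt_eqF.
rewrite (Ex_lin xi _ (bm_cst _) bs) Ex_cst -(xi_sigma2E xi_supp).
have [_ g] := rho2_gap; apply: le_trans (lerD (lexx _) g).
by rewrite le_eqVlt /a /rho2; apply/orP; left; apply/eqP; field; rewrite gt_eqF.
Qed.

Lemma iter_pk_trace_square t X : iter t (pk nu xi) (fun x => tr0 x ^+ 2) X <= rho2 ^+ t * tr0 X ^+ 2 + 42 * (1 - rho2 ^+ t).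
Proof.
have [r0 _] := rho2_gap.
elim: t X => [|t IH] X /=; first by rewrite expr0; lra.
apply: le_trans (pk_le (bm_iter_pk nu xi t bt2) _ IH X) _.
  by apply: bmD; [exact: bC|exact: bm_cst].
rewrite (_ : (fun x => _) = fun x => 42 * (1 - rho2 ^+ t) + rho2 ^+ t * tr0 x ^+ 2); last by apply/funext => x; rewrite addrC.
rewrite pk_lin// ?pk_cst; last exact: bm_cst.
apply: le_trans (lerD (lexx _) (ler_wpM2l (exprn_ge0 t r0) (pk_trace_square X))) _.
by rewrite (exprS rho2 t) le_eqVlt; apply/orP; left; apply/eqP; ring.
Qed.

Lemma Ex_kop h (f : G -> R) : bm f -> Ex nu (kop nu h f) = Ex nu f.
Proof.
move=> bf; have b2 : bm (fun p : G * G => f (p.1 * h * p.1^-1 * p.2)%g).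
  apply: (bm_comp bf); apply: measurable_mul; last exact: measurable_snd.
  by apply: measurable_conj; [exact: measurable_fst|exact: measurable_cst].
have := Ex_swap nu nu b2 => /= E; rewrite /kop -E (_ : (fun U => _) = fun=> Ex nu f) ?Ex_cst//.
by apply/funext => U; exact: (Ex_mull nuH _ bf).
Qed.

(** Haar measure is stationary, so one step with angle pi, where the contraction is strongest, gives
    [(8 - 16 / NN) v <= 112], and [NN >= 3] turns this into 42. *)
Lemma haar_trace_square : Ex nu (fun x => tr0 x ^+ 2) <= 42.
Proof.
have N3 := @dim_ge3 R n; have N0 : 0 < NN by lra.
have := Ex_kop (rot12 n.+1 pi) bt2; set v := Ex nu (fun x => tr0 x ^+ 2) => E.
have : v <= (1 - 4 / NN) ^+ 2 * v + 112 / NN.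
  rewrite -{1}E addrC -[X in X + _](Ex_cst nu) /v -ExZ// -ExD; [|exact: bm_cst|exact: bC].
  apply: Ex_le; [exact: bm_kop|by apply: bmD; [exact: bm_cst|exact: bC]|].
  move=> X; have := kop_trace_square nuH pi X.
  by rewrite /halfsin2 sin_pihalf expr1n !mulr1 addrC.
have v0 : 0 <= v by apply: Ex_ge0 => x; exact: sqr_ge0.
have -> : (1 - 4 / NN) ^+ 2 * v + 112 / NN = v + (112 - (8 - 16 / NN) * v) / NN by field; rewrite gt_eqF.
rewrite lerDl pmulr_lge0 ?invr_gt0// => h.
have i3 : NN^-1 <= 3^-1 by rewrite lef_pV2 ?posrE.
have := ler_wpM2r v0 i3; clear E; move: h v0; move: (NN^-1) v => y w; lra.
Qed.

(** Chebyshev's inequality for the event that the trace exceeds half its mean [M] under the walk: a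
    deviation of [M / 2] is needed to leave it under the walk, and a trace of size [M / 2] to enter
    it under Haar measure. *)
Lemma trace_test t : 0 < 1 - 4 * mu / NN -> let r := (1 - 4 * mu / NN) ^+ t in
  exists2 B : set G, measurable B & 1 - 4 * (rho2 ^+ t / r ^+ 2 - 1) - 336 / (NN * r) ^+ 2 <=
    iter t (pk nu xi) (\1_B) 1%g - Ex nu (\1_B).
Proof.
move=> r0' r; have r0 : 0 < r by exact: exprn_gt0.
have N3 := @dim_ge3 R n; have N0 : 0 < NN by lra.
set M := NN * r; have M0 : 0 < M by rewrite mulr_gt0.
pose B : set G := [set x | M / 2 <= tr0 x].
have mB : measurable B.
  have [mt _] := bt; have := mt measurableT `[M / 2, +oo[%classic (measurable_itv _); rewrite setTI.
  by congr measurable; apply/seteqP; split => x /=; rewrite in_itv /= andbT.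
have bB : bm (\1_B : G -> R) by exact: bm_indic.
pose k := 4 / M ^+ 2; have k0 : 0 < k by rewrite divr_gt0 ?exprn_gt0.
have kM : k * M ^+ 2 = 4 by rewrite /k mulfVK// gt_eqF ?exprn_gt0.
exists B => //.
(* The quadratic [1 - 4 (tr - M)^2 / M^2], arranged as a linear combination to which the walk can be
   applied. *)
have lowB x : (1 - k * M ^+ 2) + (-k) * (tr0 x ^+ 2 + (- 2 * M) * tr0 x) <= \1_B x.
  have -> : (1 - k * M ^+ 2) + (-k) * (tr0 x ^+ 2 + (- 2 * M) * tr0 x) = 1 - k * (tr0 x - M) ^+ 2 by ring.
  rewrite indicE; have [xB|xB] := pselect (B x); first by rewrite mem_set// gerBl mulr_ge0 ?sqr_ge0// ltW.
  rewrite memNset// subr_le0 -[leLHS](mulfV (lt0r_neq0 k0)) ler_pM2l//.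
  have xM : tr0 x < M / 2 by rewrite ltNge; apply/negP.
  have -> : k^-1 = (M / 2) ^+ 2 by rewrite /k; field; rewrite gt_eqF.
  have h : 0 <= (M / 2 - tr0 x) * (3 * (M / 2) - tr0 x) by rewrite mulr_ge0//; lra.
  by rewrite -subr_ge0; apply: le_trans h _; rewrite le_eqVlt; apply/orP; left; apply/eqP; field.
have upB x : \1_B x <= k * tr0 x ^+ 2.
  rewrite indicE; have [xB|xB] := pselect (B x); last by rewrite memNset// mulr_ge0 ?sqr_ge0// ltW.
  rewrite mem_set// -[leLHS](mulfV (lt0r_neq0 k0)) ler_pM2l//.
  have -> : k^-1 = (M / 2) ^+ 2 by rewrite /k; field; rewrite gt_eqF.
  by rewrite ler_pXn2r// nnegrE; [rewrite divr_ge0// ltW|apply: le_trans xB; rewrite divr_ge0// ltW].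
have b1 : bm (fun x : G => tr0 x ^+ 2 + (- 2 * M) * tr0 x) by apply: bmD => //; exact: bC.
have J := iter_pk_le t _ bB lowB 1%g.
have {J} := J (bmD (bm_cst _) (bC _ b1)); rewrite iter_pk_lin//; last exact: bm_cst.
rewrite iter_pk_lin// iter_pk_cst iter_pk_trace -/r.
have T1 : tr0 (1%g : G) = NN by rewrite /tr0 mxtrace1.
have := iter_pk_trace_square t 1%g; rewrite T1.
have E : Ex nu (\1_B) <= k * Ex nu (fun x => tr0 x ^+ 2) by rewrite -ExZ//; apply: Ex_le => //; exact: bC.
have E2 := ler_wpM2l (ltW k0) haar_trace_square.
have [rr _] := rho2_gap; have rt := exprn_ge0 t rr.
set Q := rho2 ^+ t in rt *; set I2 := iter t _ _ _ => hI hB.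
have hI2 : k * I2 <= k * (Q * NN ^+ 2 + 42).
  by apply: ler_wpM2l; [exact: ltW|apply: le_trans hI _; lra].
have e1 : k * (Q * NN ^+ 2 + 42) = 4 * (Q / r ^+ 2) + 168 / M ^+ 2.
  by rewrite /k /M; field; rewrite !gt_eqF.
have e2 : 336 / M ^+ 2 = 168 / M ^+ 2 + k * 42 by rewrite /k; field; rewrite gt_eqF.
rewrite e1 in hI2; rewrite e2.
have e3 : - k * (I2 + - 2 * M * (r * NN)) = - (k * I2) + 2 * (k * M ^+ 2) by rewrite /M; ring.
rewrite e3 kM in hB; move: hB hI2 E E2; move: (168 / _) (Q / _) (k * I2) => x y z; lra.
Qed.

End trace_chebyshev.

Lemma expR_le_lin (R : realType) (x : R) : 0 <= x -> x <= 1 / 2 -> expR x <= 1 + 2 * x.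
Proof.
move=> x0 x1; have h := expR_ge1Dx (- x); have e0 := expR_gt0 x.
have := ler_wpM2r (ltW e0) h; rewrite expRN mulVf ?gt_eqF// => h2.
have : (1 - x) * expR x <= (1 - x) * (1 + 2 * x).
  by apply: le_trans h2 _; nra.
by rewrite ler_pM2l//; lra.
Qed.

(** From [ln x <= 2 sqrt x] and [x >= exp (- c)]; in [kac_lower] it converts [ln n / n] into a bound
    by [exp (c / 2)]. *)
Lemma ln_div_le (R : realType) (x c : R) : 0 < x -> - c <= ln x -> ln x / x <= 2 * expR (c / 2).
Proof.
move=> x0 cx; set h := expR (ln x / 2).
have h0 : 0 < h by exact: expR_gt0.
have hx : h ^+ 2 = x by rewrite /h -expRM_natr mulfVK ?pnatr_eq0// lnK.
have lh : ln x <= 2 * h by have := expR_ge1Dx (ln x / 2); rewrite -/h; lra.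
have hg : h^-1 <= expR (c / 2) by rewrite /h -expRN ler_expR; lra.
apply: (@le_trans _ _ (2 * h^-1)); last by rewrite ler_pM2l.
rewrite ler_pdivrMr// -{2}hx; have -> : 2 * h^-1 * h ^+ 2 = 2 * h by field; rewrite gt_eqF.
by [].
Qed.

(** For negative [c] the mean of the trace is still of order [exp (- c)], while its relative
    variance is of order [ln n / n], hence of order [exp (c / 2)], because [t >= 0] forces
    [n >= exp (- c)]. *)
Lemma kac_lower (R : realType) : exists2 K : R, 0 < K &
  forall n (nu : probability (SO R n.+1.*2.+1) R) (xi : probability (measurableTypeR R) R) (c : R) t,
  is_haar nu -> xi `[0, pi]%classic = 1%E -> 0 < xi_sigma2 xi -> c < 0 ->
  t%:R = n.+1%:R * (ln n.+1%:R + c) / (2 * xi_sigma2 xi) ->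
  exists2 B : set (SO R n.+1.*2.+1), measurable B &
    1 - K * expR (c / 2) <= iter t (pk nu xi) (\1_B) 1%g - Ex nu (\1_B).
Proof.
(* The 84 is [336 / 4] and the 8 is twice the 4 lost in [rlow]. The 128 covers the [4 * 16] from the
   variance and, when the claim is not trivial, gives [g < 1/128], hence a large dimension. *)
pose K : R := 128 + 84 * expR 8; have K0 : 0 < K by rewrite addr_gt0// mulr_gt0 ?expR_gt0.
exists K => // n nu xi c t nuH xi_supp; set mu := xi_sigma2 xi => mu0 c0 tE.
set g := expR (c / 2); have g0 : 0 < g by exact: expR_gt0.
have [trivial|Kg] := leP 1 (K * g).
  exists set0 => //; have -> : \1_(set0 : set (SO R n.+1.*2.+1)) = (fun=> 0 : R) by exact: indic0.
  by rewrite iter_pk_cst Ex_cst; lra.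
have g128 : 128 * g < 1.
  by apply: le_lt_trans Kg; rewrite ler_pM2r// lerDl mulr_ge0// expR_ge0.
have m1 : mu <= 1 by exact: xi_sigma2_le1.
set nn : R := n.+1%:R in tE *; have nn1 : 1 <= nn by rewrite ler1n.
have nn0 : 0 < nn by exact: lt_le_trans nn1.
set y := ln nn + c in tE.
have y0 : 0 <= y.
  have := ler0n R t; rewrite tE pmulr_lge0 ?invr_gt0 ?mulr_gt0//.
  by rewrite pmulr_rge0.
have cl : - c <= ln nn by rewrite /y in y0; lra.
have nng : 1 <= nn * g ^+ 2.
  rewrite -(@lnK _ nn) ?posrE// /g -expRM_natr -expRD -expR0 ler_expR mulfVK ?pnatr_eq0//; lra.
have nn10 : 10 <= nn.
  rewrite leNgt; apply/negP => n10; have := ler_wpM2r (sqr_ge0 g) (ltW n10).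
  have : g ^+ 2 <= 1 / 128 * (1 / 128) by rewrite expr2; apply: ler_pM; lra.
  lra.
have NE : (n.+1.*2.+1)%:R = 2 * nn + 1 :> R by rewrite -addn1 natrD -mul2n natrM.
set N : R := (n.+1.*2.+1)%:R in NE *; have N0 : 0 < N by lra.
have lnn : ln nn <= nn by have := ln_le_subr1 nn0; lra.
pose a := 4 * mu / N.
have a0 : 0 <= a by rewrite divr_ge0 ?mulr_ge0// ltW.
have a4 : a <= 4 / N by rewrite ler_pM2r ?invr_gt0//; lra.
have a5 : a <= 1 / 5 by apply: le_trans a4 _; rewrite ler_pdivrMr//; lra.
have rb : 0 < 1 - a by lra.
have [B mB hB] := @trace_test R n nu nuH xi xi_supp mu0 t rb.
exists B => //; apply: le_trans hB; rewrite -/mu -/N -/a; set r := (1 - a) ^+ t.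
have r0 : 0 < r by exact: exprn_gt0.
have ay : a * y <= 2.
  apply: (@le_trans _ _ (4 / N * nn)); first by apply: ler_pM => //; rewrite /y; lra.
  by rewrite mulrAC ler_pdivrMr//; lra.
have ta : a * t%:R <= y.
  have -> : a * t%:R = y * (2 * nn / N) by rewrite tE /a; field; rewrite !gt_eqF.
  by rewrite -[leRHS]mulr1 ler_wpM2l// ler_pdivrMr// mul1r; lra.
have rlow : expR (- (y + 4)) <= r.
  apply: (@le_trans _ _ (expR (- (a + 2 * a ^+ 2)) ^+ t)).
    rewrite -expRM_natr ler_expR mulNr lerN2.
    have -> : (a + 2 * a ^+ 2) * t%:R = a * t%:R + 2 * a * (a * t%:R) by ring.
    have := ler_wpM2l (mulr_ge0 (ler0n R 2) a0) ta; move: ta ay; move: (a * t%:R) => z; lra.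
  apply: lerXn2r; rewrite ?nnegrE ?expR_ge0 ?(ltW rb)//.
  apply: le_trans (expR_quad_le _) _; first by rewrite addr_ge0// mulr_ge0// sqr_ge0.
  have : 0 <= a ^+ 2 * (1 - 4 * a - 4 * a ^+ 2) by apply: mulr_ge0; [exact: sqr_ge0|nra].
  move=> h; rewrite -subr_ge0; apply: le_trans h _; rewrite le_eqVlt; apply/orP; left; apply/eqP; ring.
have Mlow : 2 * expR (- (c + 4)) <= N * r.
  apply: (@le_trans _ _ (N * expR (- (y + 4)))); last by rewrite ler_pM2l.
  have -> : expR (- (y + 4)) = nn^-1 * expR (- (c + 4)).
    by rewrite -{1}(@lnK _ nn) ?posrE// -expRN -expRD; congr expR; rewrite /y; ring.
  by rewrite mulrA ler_pM2r ?expR_gt0// ler_pdivlMr//; lra.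
have h336 : 336 / (N * r) ^+ 2 <= 84 * expR 8 * g.
  apply: (@le_trans _ _ (336 / (2 * expR (- (c + 4))) ^+ 2)).
    apply: ler_wpM2l; first exact: ler0n.
    have e0 : 0 < 2 * expR (- (c + 4)) by rewrite mulr_gt0// expR_gt0.
    rewrite lef_pV2; last 2 first.
    - by rewrite posrE exprn_gt0// mulr_gt0.
    - by rewrite posrE exprn_gt0.
    by apply: lerXn2r => //; rewrite nnegrE; [exact: ltW|rewrite ltW// mulr_gt0].
  have -> : 336 / (2 * expR (- (c + 4))) ^+ 2 = 84 * (expR (- (c + 4)) ^- 2) by field; rewrite gt_eqF ?expR_gt0.
  rewrite -expRM_natr -expRN -mulrA ler_pM2l// -expRD ler_expR; lra.
have hQ : @rho2 R n xi ^+ t / r ^+ 2 - 1 <= 16 * g.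
  have -> : @rho2 R n xi ^+ t / r ^+ 2 = (@rho2 R n xi / (1 - a) ^+ 2) ^+ t by rewrite /r [RHS]exprMn exprVn -!exprM mulnC.
  have [rho0 _] := @rho2_gap R n xi xi_supp mu0.
  (* Per step the second moment outgrows the squared mean by a relative [O(mu / N^2)]; over [t]
     steps this sums to a multiple of [ln n / n]. *)
  have q1 : @rho2 R n xi / (1 - a) ^+ 2 <= expR (25 * mu / N ^+ 2).
    apply: le_trans (expR_ge1Dx _); rewrite ler_pdivrMr ?exprn_gt0//.
    have E : @rho2 R n xi = (1 - a) ^+ 2 + 16 * mu / N ^+ 2 - a ^+ 2.
      by rewrite /rho2 -/mu -/N /a; field; rewrite gt_eqF.
    have h : 16 * mu / N ^+ 2 <= 25 * mu / N ^+ 2 * (1 - a) ^+ 2.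
      have w0 : 0 <= mu / N ^+ 2 by apply: divr_ge0; [exact: ltW|exact: sqr_ge0].
      have b : 16 <= 25 * (1 - a) ^+ 2 by have := sqr_ge0 (1 - a - 4 / 5); nra.
      have -> : 16 * mu / N ^+ 2 = mu / N ^+ 2 * 16 by ring.
      have -> : 25 * mu / N ^+ 2 * (1 - a) ^+ 2 = mu / N ^+ 2 * (25 * (1 - a) ^+ 2) by ring.
      exact: ler_wpM2l.
    rewrite E [leRHS]mulrDl mul1r lerBlDr -[leRHS]addrA lerD2l; apply: le_trans h _.
    by rewrite lerDl sqr_ge0.
  have q2 : (@rho2 R n xi / (1 - a) ^+ 2) ^+ t <= expR (8 * g).
    apply: (@le_trans _ _ (expR (25 * mu / N ^+ 2) ^+ t)).
      by apply: lerXn2r; rewrite ?nnegrE ?expR_ge0// divr_ge0// sqr_ge0.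
    rewrite -expRM_natr ler_expR tE.
    have -> : 25 * mu / N ^+ 2 * (nn * y / (2 * mu)) = y / nn * (25 / 2 * nn ^+ 2 / N ^+ 2) by field; rewrite !gt_eqF.
    have n4 : 25 / 2 * nn ^+ 2 / N ^+ 2 <= 4.
      rewrite ler_pdivrMr ?exprn_gt0// NE; have := sqr_ge0 nn; nra.
    have yn : 0 <= y / nn by rewrite divr_ge0// ltW.
    apply: le_trans (ler_wpM2l yn n4) _.
    have := ln_div_le nn0 cl; rewrite -/g.
    have : y / nn <= ln nn / nn by rewrite ler_pM2r ?invr_gt0// /y; lra.
    by move: (y / nn) (ln nn / nn) => z w; lra.
  have := @expR_le_lin R (8 * g); move: q2; move: (_ ^+ t) => q q2 h; have := h _ _; lra.
rewrite /K; move: h336 hQ g0; move: (336 / _) (_ / _ - 1) => x z; lra.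
Qed.

(** A zero mean of [sin (t / 2)^2] forces it to vanish almost everywhere, and on [0, pi] it vanishes
    at 0 only. *)
Lemma xi_sigma2_gt0 (R : realType) (xi : probability (measurableTypeR R) R) :
  xi `[0, pi]%classic = 1%E ->
  (~ forall A : set (measurableTypeR R), measurable A -> xi A = \d_(0 : measurableTypeR R) A) -> 0 < xi_sigma2 xi.
Proof.
move=> xi_supp notdirac; have sE := xi_sigma2E xi_supp; have bs := @bm_halfsin2 R.
have s0 : 0 <= xi_sigma2 xi by rewrite sE; apply: Ex_ge0 => t; have /andP[] := halfsin2_01 t.
rewrite lt_neqAle s0 andbT eq_sym; apply/negP => /eqP mu0; apply: notdirac.
pose D : set (measurableTypeR R) := `[0, pi]%classic.
have mD : measurable D by exact: measurable_itv.
have mf : measurable_fun D (fun t => (halfsin2 t)%:E).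
  by apply/measurable_EFinP; case: bs => ms _; exact: measurable_funS ms.
have int0 : (\int[xi]_(t in D) `|(halfsin2 t)%:E| = 0)%E.
  rewrite (eq_integral (fun t => (halfsin2 t)%:E)); first by rewrite (Ex_supp xi_supp bs) -sE mu0.
  by move=> t _; rewrite /= ger0_norm//; have /andP[] := halfsin2_01 t.
have [N [mN N0 DN]] := (ae_eq_integral_abs xi mD mf).1 int0.
have Dc : xi (~` D) = 0%E by apply: etrans (probability_setC xi mD) _; rewrite xi_supp subee.
pose Z := ~` D `|` N.
have mZ : measurable Z by apply: measurableU => //; exact: measurableC.
have Z0 : xi Z = 0%E by rewrite measureU0//; exact: measurableC.
have offZ t : ~ Z t -> t = 0.
  move=> nZ; have [Dt|/(@or_introl _ (N t))//] := pselect (D t).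
  have nN : ~ N t by move=> Nt; apply: nZ; right.
  have h : halfsin2 t = 0.
    apply/eqP/negPn/negP => /eqP ht; apply: nN; apply: DN => /= /(_ Dt) [] //.
  move: Dt; rewrite /D /= in_itv /= => /andP[t0 tp].
  apply/eqP; rewrite eq_le t0 andbT leNgt; apply/negP => tpos.
  have : 0 < sin (t / 2) by apply: sin_gt0_pi; have := pi_gt0 R; lra.
  by move/eqP: h; rewrite /halfsin2 sqrf_eq0 => /eqP ->; rewrite ltxx.
have small (A : set (measurableTypeR R)) : measurable A -> ~ A 0 -> xi A = 0%E.
  move=> mA nA; apply: (subset_measure0 mA mZ _ Z0) => t At.
  by apply: contrapT => /offZ t0; apply: nA; rewrite -t0.
move=> A mA; rewrite diracE; have [A0|nA0] := pselect (A 0); last by rewrite memNset//; exact: small.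
rewrite mem_set//=; have mAc : measurable (~` A) by exact: measurableC.
have := probability_setC xi mAc; rewrite setCK (small _ mAc); first by rewrite sube0.
by move=> /(_ A0).
Qed.

Section total_variation.
Context {R : realType} {n : nat} (nu : probability (SO R n.+1.*2.+1) R).
Context (xi : probability (measurableTypeR R) R).
Hypothesis xi_supp : xi `[0, pi]%classic = 1%E.
Local Notation G := (SO R n.+1.*2.+1).
Let d t (B : set G) : R := iter t (pk nu xi) (\1_B) 1%g - Ex nu (\1_B).

Lemma walk_gap0 t : d t set0 = 0.
Proof.
by rewrite /d; have -> : \1_(set0 : set G) = (fun=> 0 : R) by [exact: indic0]; rewrite iter_pk_cst Ex_cst subrr.
Qed.

Lemma walk_gap_le1 t B : measurable B -> d t B <= 1.
Proof.
move=> mB; have bB : bm (\1_B : G -> R) by exact: bm_indic.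
have : 0 <= Ex nu (\1_B) by apply: Ex_ge0 => g; case: (indic_val (R := R) B g) => ->.
have : iter t (pk nu xi) (\1_B) 1%g <= iter t (pk nu xi) (fun=> 1) 1%g.
  by apply: (iter_pk_le nu xi t bB (bm_cst 1)) => g; case: (indic_val (R := R) B g) => ->.
by rewrite iter_pk_cst /d; lra.
Qed.

Lemma tv_between t (lo hi : R) : (exists2 B, measurable B & lo <= d t B) ->
  (forall B, measurable B -> d t B <= hi) ->
  exists2 r : R, tv_distance (kac_law nu xi t) nu = r%:E & lo <= r <= hi.
Proof.
move=> [B0 mB0 hB0] up; rewrite /tv_distance; set S := [set _ | _ in _].
have E B : measurable B -> (kac_law nu xi t B - nu B = (d t B)%:E)%E.
  move=> mB; rewrite kac_lawE// /d Ex_indic// EFinB fineK//; exact: fin_num_measure.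
have h1 : (ereal_sup S <= hi%:E)%E by apply: ge_ereal_sup => _ [B mB <-]; rewrite E// lee_fin up.
have h2 : (lo%:E <= ereal_sup S)%E.
  by apply: le_ereal_sup_tmp; exists (d t B0)%:E; rewrite ?lee_fin//; exists B0 => //; exact: E.
move: h1 h2; case: (ereal_sup S) => [r| |]//; rewrite !lee_fin => rh lr.
by exists r => //; rewrite lr rh.
Qed.

End total_variation.

Lemma min1_expR_cvg (R : realType) (T : Type) (F : set_system T) (FF : Filter F) (A : R) (g f : T -> R) :
  0 < A -> (forall b : R, \forall c \near F, g c <= b) ->
  (\forall c \near F, f c = Num.min 1 (A * expR (g c))) -> f c @[c --> F] --> (0 : R).
Proof.
move=> A0 gF fE; apply/cvgrPdist_le => e e0; near=> c.
have -> : f c = Num.min 1 (A * expR (g c)) by near: c.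
have m0 : 0 <= Num.min 1 (A * expR (g c)) by rewrite le_min ler01 mulr_ge0 ?expR_ge0// ltW.
rewrite sub0r normrN ger0_norm// ge_min; apply/orP; right.
rewrite -ler_pdivlMl// -[leRHS](@lnK _ (A^-1 * e)) ?posrE ?mulr_gt0 ?invr_gt0// ler_expR.
near: c; exact: gF.
Unshelve. all: by end_near. Qed.

Theorem theorem1p1 (R : realType) (xi : probability (measurableTypeR R) R)
  (xi_supp : xi `[0, pi]%classic = 1%E)
  (xi_neq_delta0 : ~ forall A : set (measurableTypeR R),
     measurable A -> xi A = \d_(0 : measurableTypeR R) A) :
  exists f : R -> R,
    [/\ forall c, 0 <= f c <= 1,
        f c @[c --> +oo] --> 0,
        f c @[c --> -oo] --> 0 &
        forall (n : nat) (nu : probability (SO R n.*2.+1) R) (c : R) (t : nat),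
          (1 <= n)%N -> is_haar nu ->
          t%:R = n%:R * (ln n%:R + c) / (2 * xi_sigma2 xi) ->
          (`| tv_distance (kac_law nu xi t) nu - (c < 0)%R%:R%:E |
            <= (f c)%:E)%E].
Proof.
have mu0 := xi_sigma2_gt0 xi_supp xi_neq_delta0.
have [lam [C [lam0 upper]]] := @kac_upper R.
have [K K0 lower] := @kac_lower R.
(* The cap at 1 is harmless because a total variation distance lies between 0 and 1; it also covers
   the range of [c] near 0, where the exponential bounds exceed 1. *)
pose f c := Num.min 1 (if 0 <= c then 2 * expR (C - lam * c) else K * expR (c / 2)).
exists f; split.
- move=> c; rewrite /f ge_min lexx le_min ler01 /= andbT.
  by case: ifP => _; rewrite mulr_ge0 ?expR_ge0// ltW.
- apply: (@min1_expR_cvg R R _ _ 2 (fun c => C - lam * c)) => // [b|].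
    exists ((C - b) / lam); split; first exact: num_real.
    by move=> c; rewrite ltr_pdivrMr// => h; rewrite mulrC; lra.
  exists 0; split; first exact: num_real.
  by move=> c c0; rewrite /f ltW.
- apply: (@min1_expR_cvg R R _ _ K (fun c => c / 2)) => // [b|].
    exists (2 * b); split; first exact: num_real.
    by move=> c h; lra.
  exists 0; split; first exact: num_real.
  by move=> c c0; rewrite /f leNgt c0.
case=> // n nu c t _ nuH tE; rewrite /f.
have [c0|c0] := leP 0 c.
  have [r -> /andP[r0 rf]] : exists2 r : R, tv_distance (kac_law nu xi t) nu = r%:E & 0 <= r <= f c.
    apply: tv_between => //; first by exists set0 => //; rewrite walk_gap0.
    move=> B mB; rewrite /f c0 le_min walk_gap_le1//=.
    exact: upper tE.
  by rewrite sube0 /= lee_fin ger0_norm//; rewrite /f c0 in rf.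
have [r -> /andP[r0 rf]] : exists2 r : R, tv_distance (kac_law nu xi t) nu = r%:E & 1 - f c <= r <= 1.
  apply: tv_between => //; last by move=> B mB; exact: walk_gap_le1.
  rewrite /f leNgt c0 /=; have [h|h] := leP 1 (K * expR (c / 2)).
    by exists set0 => //; rewrite walk_gap0 subrr.
  exact: lower tE.
rewrite -EFinB /= lee_fin ler0_norm; last by lra.
by move: r0; rewrite /f (leNgt 0 c) c0 /=; lra.
Qed.
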